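(* Let Assumption 1 (stated in the context) hold, fix $(t,x)\in[0,T]\times\mathbb{R}^n$, and let $\alpha^b\in C_b^{\mathrm{UniLip}}([0,T]\times\mathbb{R}^n)$ be a policy valued in $A$. Let $\alpha^0\in C_b^{\mathrm{UniLip}}([0,T]\times\mathbb{R}^n)$ be a policy valued in $A$, and let $\{\alpha^n\}_{n\in\mathbb{N}}$ be the sequence of policies in which, for each $n\ge1$, $\alpha^n$ is the output of the off-policy subroutine (defined in the context) with input $\alpha^{n-1}$, $\alpha^b$ and $(t,x)$. Then $\alpha^n$ is admissible for every $n\ge0$, and the cost sequence $\{v^{\alpha^n}(t,x)\}_{n\in\mathbb{N}}$ is monotonically decreasing to $v^*(t,x)$. Moreover, there exist a constant $C=C(t,x)$ depending on $(t,x)$ and a constant $q\in(0,1)$ independent of $(t,x)$ such that $$|v^{\alpha^n}(t,x)-v^*(t,x)|\le C(t,x)\,q^n\qquad\text{for any }n\ge0.$$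
   Context: Setting. Fix a horizon $T<\infty$, dimensions $n,m,d$, a set $A\subset\mathbb{R}^m$ with $0\in A$, and measurable functions $b:[0,T]\times\mathbb{R}^n\times\mathbb{R}^m\to\mathbb{R}^n$, $\sigma:[0,T]\times\mathbb{R}^n\to\mathbb{R}^{n\times d}$, $f:[0,T]\times\mathbb{R}^n\times\mathbb{R}^m\to\mathbb{R}$, $g:\mathbb{R}^n\to\mathbb{R}$. For $(t,x)\in[0,T]\times\mathbb{R}^n$, work on a complete probability space $(\Omega,\mathcal{F},\mathbb{P})$ carrying a $d$-dimensional Brownian motion $(W_s)_{t\le s\le T}$ with $W_t=0$, equipped with its natural filtration $(\mathcal{F}_s)_{t\le s\le T}$ augmented by $\mathbb{P}$-null sets. ''Adapted'' means progressively measurable. $\mathbb{S}^2$ is the set of adapted $Y$ with $\mathbb{E}[\sup_{t\le s\le T}|Y_s|^2]<\infty$; $\mathbb{H}^2$ is the set of adapted $Z$ with $\mathbb{E}\int_t^T\|Z_s\|^2ds<\infty$. A policy is a measurable map $\alpha:[0,T]\times\mathbb{R}^n\to\mathbb{R}^m$. For $F(t,x,a)$ write $F^a(t,x)=F(t,x,a)$ and $F^\alpha(t,x)=F(t,x,\alpha(t,x))$. $X^{\alpha,t,x}$ (or $X^\alpha$) is the solution of $X_s=x+\int_t^s b^\alpha(\tau,X_\tau)d\tau+\int_t^s\sigma(\tau,X_\tau)dW_\tau$, $s\in[t,T]$. A policy is admissible if it is valued in $A$ and this SDE has a unique solution; $\mathcal{A}$ is the set of admissible policies. Value function: $v^\alpha(t,x)=\mathbb{E}[\int_t^T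 f^\alpha(s,X_s^{\alpha,t,x})ds+g(X_T^{\alpha,t,x})]$; optimal value function: $v^*(t,x)=\inf_{\alpha\in\mathcal{A}}v^\alpha(t,x)$. Generator: $\mathscr{L}^\alpha v=\partial_t v+\langle b^\alpha,\partial_x v\rangle+\frac12\mathrm{tr}\{\sigma\sigma^\intercal\partial_{xx}v\}$ (and $\mathscr{L}^a$ with $b^a$ in place of $b^\alpha$). Structure of the drift: $b(t,x,a)=\bar b(t,x)+\sigma(t,x)\hat b(t,x,a)$ for all $(t,x,a)\in[0,T]\times\mathbb{R}^n\times A$. A measurable minimizing function $\mu:[0,T]\times\mathbb{R}^n\times\mathbb{R}^d\to A$ is given with $\mu(t,x,z)\in\operatorname{arginf}_{a\in A}\{\langle\hat b^a(t,x),z\rangle+f^a(t,x)\}$ for all $(t,x,z)$. Function classes: a continuous $\phi(t,x,y)$ on $E^1\times E^2\times E^3$ (nonempty subsets of Euclidean spaces) is in $C^{\mathrm{UniLip}}$ if for some constant $L$, $\|\phi(t,x,y)-\phi(t,x',y')\|\le L\|x-x'\|+L\|y-y'\|$ for all $t,x,x',y,y'$; it is in $C_b^{\mathrm{UniLip}}$ if moreover $\|\phi(t,0,0)\|\le L$ for all $t$. Functions of fewer variables are in these classes if their trivial extensions are. $C^{1,2}$: continuously differentiable once in $t$ and twice in $x$. Assumption 1. (1) $\bar b,\hat b,\sigma,f,g\in C^{\mathrm{UniLip}}([0,T]\times\mathbb{R}^n\times A)$ and $\mu\in C^{\mathrm{UniLip}}([0,T]\times\mathbb{R}^n\times\mathbb{R}^d)$.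 (2) There is a constant $L$ with $\|\bar b(t,0)\|+\|\mu(t,0,0)\|+|f(t,0,0)|\le L$ for all $t\in[0,T]$ and $\|\hat b(t,x,a)\|+\|\sigma(t,x)\|\le L$ for all $(t,x,a)\in[0,T]\times\mathbb{R}^n\times A$. (3) For every $A$-valued $\alpha\in C_b^{\mathrm{UniLip}}([0,T]\times\mathbb{R}^n)$, the linear Cauchy problem $0=\mathscr{L}^\alpha w+f^\alpha$ on $[0,T)\times\mathbb{R}^n$, $w(T,\cdot)=g$, has a solution $w^\alpha\in C^{1,2}([0,T]\times\mathbb{R}^n)$ with $\partial_x w^\alpha\in C_b^{\mathrm{UniLip}}$; and the HJB equation $0=\inf_{a\in A}\{\mathscr{L}^a v^*+f^a\}$ on $[0,T)\times\mathbb{R}^n$, $v^*(T,\cdot)=g$, has such a smooth solution $v^*$ too (identified with the optimal value function). Off-policy subroutine (input: policies $\alpha,\alpha^b$ and $(t,x)$): let $X^b=X^{\alpha^b,t,x}$; let $(Y^{\alpha,b},Z^{\alpha,b})\in\mathbb{S}^2\times\mathbb{H}^2$ be the adapted solution of $Y_s=g(X^b_T)+\int_s^T f^\alpha(\tau,X^b_\tau)d\tau+\int_s^T\langle\hat b^\alpha(\tau,X^b_\tau)-\hat b^{\alpha^b}(\tau,X^b_\tau),Z_\tau\rangle d\tau-\int_s^T\langle Z_\tau,dW_\tau\rangle$; let $z^\alpha$ be an optimal solution of $\min_{z\in C_b^{\mathrm{UniLip}}}\mathbb{E}\int_t^T\|z(s,X^b_s)-Z^{\alpha,b}_s\|^2ds$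 (minimum over functions $z:[0,T]\times\mathbb{R}^n\to\mathbb{R}^d$ in $C_b^{\mathrm{UniLip}}$); output $\alpha'(s,y)=\mu(s,y,z^\alpha(s,y))$. *)

(* Defs.v *)
From HB Require Import structures.
From mathcomp Require Import all_boot all_order all_algebra.
From mathcomp Require Import all_classical all_reals all_analysis.

Set Implicit Arguments.
Unset Strict Implicit.
Unset Printing Implicit Defensive.

Import Order.TTheory GRing.Theory Num.Theory.
Import numFieldNormedType.Exports.

Local Open Scope classical_set_scope.
Local Open Scope ring_scope.

(* Vectors of R^k are columns.  Time-dependent data are total functions of the
   time variable, and are only constrained on [0, T]. *)

Section Euclidean.
Context {R : realType}.

(* Euclidean norm on columns, Frobenius norm on matrices (the library norm on
   matrices is the sup norm). *)
Definition enorm p q (M : 'M[R]_(p, q)) : R :=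
  Num.sqrt (\sum_(i < p) \sum_(j < q) M i j ^+ 2).

Definition dot p (u v : 'cV[R]_p) : R := \sum_(i < p) u i 0 * v i 0.

Definition borel_fun (S U : topologicalType) (D : set S) (h : S -> U) : Prop :=
  forall O : set U, open O -> (<<s [set V : set S | open V] >>) (D `&` h @^-1` O).

Definition continuous3 n k p q (I : set R) (E : set 'cV[R]_n) (F : set 'cV[R]_k)
    (phi : R -> 'cV[R]_n -> 'cV[R]_k -> 'M[R]_(p, q)) : Prop :=
  {within [set w : R * 'cV[R]_n * 'cV[R]_k | [/\ I w.1.1, E w.1.2 & F w.2]],
    continuous (fun w => phi w.1.1 w.1.2 w.2)}.

Definition lip_bound n k p q (I : set R) (E : set 'cV[R]_n) (F : set 'cV[R]_k)
    (phi : R -> 'cV[R]_n -> 'cV[R]_k -> 'M[R]_(p, q)) (L : R) : Prop :=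
  forall t x x' y y', I t -> E x -> E x' -> F y -> F y' ->
    enorm (phi t x y - phi t x' y') <= L * enorm (x - x') + L * enorm (y - y').

Definition UniLip n k p q (I : set R) (E : set 'cV[R]_n) (F : set 'cV[R]_k)
    (phi : R -> 'cV[R]_n -> 'cV[R]_k -> 'M[R]_(p, q)) : Prop :=
  continuous3 I E F phi /\ exists L, lip_bound I E F phi L.

Definition UniLipb n k p q (I : set R) (E : set 'cV[R]_n) (F : set 'cV[R]_k)
    (phi : R -> 'cV[R]_n -> 'cV[R]_k -> 'M[R]_(p, q)) : Prop :=
  continuous3 I E F phi /\ exists L, lip_bound I E F phi L /\
    forall t, I t -> enorm (phi t 0 0) <= L.

(* Functions of (t, x) belong to the class when their trivial extension to a
   dummy third variable does. *)
Definition UniLipb2 n p q (I : set R) (E : set 'cV[R]_n)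
    (phi : R -> 'cV[R]_n -> 'M[R]_(p, q)) : Prop :=
  UniLipb I E [set: 'cV[R]_1] (fun t x _ => phi t x).

(* [C12 T v vt vx vxx]: v is of class C^{1,2} on [0, T] x R^n, with time
   derivative vt (one-sided at 0 and T), gradient vx and Hessian vxx. *)
Definition C12 n (T : R) (v vt : R -> 'cV[R]_n -> R) (vx : R -> 'cV[R]_n -> 'cV[R]_n)
    (vxx : R -> 'cV[R]_n -> 'M[R]_n) : Prop :=
  let D := [set w : R * 'cV[R]_n | 0 <= w.1 <= T] in
  [/\ {within D, continuous (fun w => v w.1 w.2)} /\
      {within D, continuous (fun w => vt w.1 w.2)},
      {within D, continuous (fun w => vx w.1 w.2)} /\
      {within D, continuous (fun w => vxx w.1 w.2)},
      forall t x, 0 <= t <= T ->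
        (fun s => (s - t)^-1 * (v s x - v t x))
          @ within [set s | 0 <= s <= T /\ s != t] (nbhs t) --> vt t x,
      forall t x i, 0 <= t <= T ->
        is_derive x (delta_mx i 0 : 'cV[R]_n) (v t) (vx t x i 0)
    & forall t x i j, 0 <= t <= T ->
        is_derive x (delta_mx j 0 : 'cV[R]_n) (fun y => vx t y i 0) (vxx t x i j)].

End Euclidean.

Section Stochastic.
Context {R : realType}.

Record stoch_base (d : nat) := StochBase {
  disp : measure_display;
  Omega : measurableType disp;
  Pr : probability Omega R;
  W : R -> Omega -> 'cV[R]_d }.

Section Base.
Context {d : nat} (B : stoch_base d) (t T : R).
Local Notation leb := (@lebesgue_measure R).

(* Natural filtration of (W_r)_{r >= t} at time s, augmented by the null
   sets. *)
Definition filtration (s : R) : set (set (Omega B)) :=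
  <<s [set E | (exists r i U, [/\ t <= r <= s, measurable (U : set R)
                   & E = [set w | U (@W d B r w i 0)]])
               \/ (Pr B).-negligible E] >>.

(* The increment over [r, s] is independent of the past and has law
   N(0, (s - r) I_d). *)
Definition brownian : Prop :=
  [/\ measure_is_complete (Pr B),
      (forall s i, t <= s <= T -> measurable_fun setT (fun w => @W d B s w i 0)),
      (forall w : Omega B, W t w = 0 :> 'cV[R]_d),
      (forall w, {within `[t, T], continuous (fun s => @W d B s w)})
    & forall r s (E : set (Omega B)) (U : 'I_d -> set R),
        t <= r -> r < s -> s <= T -> filtration r E ->
        (forall i, measurable (U i)) ->
        (Pr B (E `&` [set w | forall i, U i ((W s w - W r w) i 0)%R]) =
         Pr B E * \prod_(i < d) normal_prob 0 (Num.sqrt (s - r)) (U i))%E].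

Definition progressive (Y : R -> Omega B -> R) : Prop :=
  forall s (U : set R), t <= s <= T -> measurable U ->
    (<<s [set Q : set (R * Omega B) | exists I E,
            [/\ measurable (I : set R), filtration s E & Q = I `*` E] ] >>)
      [set z | t <= z.1 <= s /\ U (Y z.1 z.2)].

Definition S2 (Y : R -> Omega B -> R) : Prop :=
  progressive Y /\
  (\int[Pr B]_w ereal_sup [set (`|Y s w| ^+ 2)%:E | s in `[t, T]%classic] < +oo)%E.

Definition H2 k (Z : R -> Omega B -> 'cV[R]_k) : Prop :=
  (forall i, progressive (fun s w => Z s w i 0)) /\
  (\int[Pr B]_w \int[leb]_(s in `[t, T]) (enorm (Z s w) ^+ 2)%:E < +oo)%E.

(* Simple process: \sum_(j < steps) coef j * 1_(knot j, knot (j+1)]. *)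
Record simple_process := SimpleProcess {
  steps : nat;
  knot : nat -> R;
  coef : nat -> Omega B -> 'cV[R]_d }.

Definition simple_wf (H : simple_process) : Prop :=
  forall j, (j < steps H)%N ->
    [/\ t <= knot H j, knot H j <= knot H j.+1, knot H j.+1 <= T,
        exists K, forall w, enorm (coef H j w) <= K
      & forall i (U : set R), measurable U ->
          filtration (knot H j) [set w | U (coef H j w i 0)]].

Definition simple_val (H : simple_process) (s : R) (w : Omega B) : 'cV[R]_d :=
  \sum_(j < steps H) (knot H j < s <= knot H j.+1)%R%:R *: coef H j w.

Definition simple_int (H : simple_process) (s : R) (w : Omega B) : R :=
  \sum_(j < steps H) dot (coef H j w)
     (W (Num.min (knot H j.+1) s) w - W (Num.min (knot H j) s) w).

(* [ito Z M]: Z is in H^2 and M is (a version, with a.s. continuous paths, of)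
   the Ito integral s |-> \int_t^s <Z, dW>, obtained as the L^2 limit of the
   integrals of simple processes approximating Z in H^2.  This determines M up
   to indistinguishability. *)
Definition ito (Z : R -> Omega B -> 'cV[R]_d) (M : R -> Omega B -> R) : Prop :=
  [/\ H2 Z, progressive M,
      {ae Pr B, forall w, {within `[t, T], continuous (fun s => M s w)}}
    & exists H : nat -> simple_process,
      [/\ forall k, simple_wf (H k),
          ((fun k => \int[Pr B]_w \int[leb]_(s in `[t, T])
               (enorm (simple_val (H k) s w - Z s w) ^+ 2)%:E)%E @ \oo --> 0%E)
        & forall s, t <= s <= T ->
          ((fun k => \int[Pr B]_w
               ((simple_int (H k) s w - M s w) ^+ 2)%:E)%E @ \oo --> 0%E)]].

End Base.
End Stochastic.

Section Control.
Context {R : realType} {n m d : nat}.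

(* [bb] and [bh] are the components of the drift: b = bb + sigma bh. *)
Record problem := Problem {
  horizon : R;
  actions : set 'cV[R]_m;
  b : R -> 'cV[R]_n -> 'cV[R]_m -> 'cV[R]_n;
  sigma : R -> 'cV[R]_n -> 'M[R]_(n, d);
  f : R -> 'cV[R]_n -> 'cV[R]_m -> R;
  g : 'cV[R]_n -> R;
  bb : R -> 'cV[R]_n -> 'cV[R]_n;
  bh : R -> 'cV[R]_n -> 'cV[R]_m -> 'cV[R]_d;
  mu : R -> 'cV[R]_n -> 'cV[R]_d -> 'cV[R]_m }.

Definition policy := R -> 'cV[R]_n -> 'cV[R]_m.

Variable p : problem.
Local Notation leb := (@lebesgue_measure R).
Local Notation base := (@stoch_base R d).
Local Notation A := (actions p).
Local Notation T := (horizon p).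
Local Notation I := [set t : R | 0 <= t <= T].

Definition standing : Prop :=
  let D3 k := [set w : R * 'cV[R]_n * 'cV[R]_k | 0 <= w.1.1 <= T] in
  0 < T /\ A 0 /\
  [/\ borel_fun (D3 m) (fun w => b p w.1.1 w.1.2 w.2),
      borel_fun [set w : R * 'cV[R]_n | 0 <= w.1 <= T] (fun w => sigma p w.1 w.2),
      borel_fun (D3 m) (fun w => f p w.1.1 w.1.2 w.2 : R),
      borel_fun setT (g p)
    & borel_fun (D3 d) (fun w => mu p w.1.1 w.1.2 w.2)] /\
  (forall t x a, 0 <= t <= T -> A a ->
     b p t x a = bb p t x + sigma p t x *m bh p t x a) /\
  (forall t x z, 0 <= t <= T ->
     A (mu p t x z) /\
     forall a, A a -> dot (bh p t x (mu p t x z)) z + f p t x (mu p t x z)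
                      <= dot (bh p t x a) z + f p t x a).

Definition A_valued (alpha : policy) : Prop :=
  forall t x, 0 <= t <= T -> A (alpha t x).

Definition CbUniLip k (phi : R -> 'cV[R]_n -> 'cV[R]_k) : Prop :=
  UniLipb2 I setT phi.

(* Value at (t, x) of the generator with control value a, applied to a function
   with time derivative vt, gradient vx and Hessian vxx. *)
Definition generator (vt : R -> 'cV[R]_n -> R) (vx : R -> 'cV[R]_n -> 'cV[R]_n)
    (vxx : R -> 'cV[R]_n -> 'M[R]_n) (a : 'cV[R]_m) (t : R) (x : 'cV[R]_n) : R :=
  vt t x + dot (b p t x a) (vx t x) +
  2^-1 * \tr (sigma p t x *m (sigma p t x)^T *m vxx t x).

Definition smooth_cauchy_sol (alpha : policy) (w : R -> 'cV[R]_n -> R) : Prop :=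
  exists wt wx wxx,
    [/\ C12 T w wt wx wxx, CbUniLip wx,
        forall t x, 0 <= t < T ->
          0 = generator wt wx wxx (alpha t x) t x + f p t x (alpha t x)
      & forall x, w T x = g p x].

Definition smooth_hjb_sol (v : R -> 'cV[R]_n -> R) : Prop :=
  exists vt vx vxx,
    [/\ C12 T v vt vx vxx, CbUniLip vx,
        forall t x, 0 <= t < T ->
          0%E = ereal_inf [set (generator vt vx vxx a t x + f p t x a)%:E | a in A]
      & forall x, v T x = g p x].

(* The scalar functions f and g are viewed as 1 x 1 matrices.  The argument
   [vopt] is the optimal value function, with which the solution of the HJB
   equation is identified. *)
Definition assumption1 (vopt : R -> 'cV[R]_n -> \bar R) : Prop :=
  [/\ [/\ UniLip I setT A (fun t x _ => bb p t x),
          UniLip I setT A (bh p),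
          UniLip I setT A (fun t x _ => sigma p t x)
        & UniLip I setT setT (mu p)] /\
      UniLip I setT A (fun t x a => (f p t x a)%:M : 'M[R]_1) /\
      UniLip I setT A (fun _ x _ => (g p x)%:M : 'M[R]_1),
      exists L, forall t, 0 <= t <= T ->
        enorm (bb p t 0) + enorm (mu p t 0 0) + `|f p t 0 0| <= L /\
        forall x a, A a -> enorm (bh p t x a) + enorm (sigma p t x) <= L,
      forall alpha, CbUniLip alpha -> A_valued alpha ->
        exists w, smooth_cauchy_sol alpha w
    & exists v, smooth_hjb_sol v /\
        forall t x, 0 <= t <= T -> (v t x)%:E = vopt t x].

(* Under [assumption1] the integrand sigma(s, X_s) is bounded, so that the
   square-integrable Ito integral suffices. *)
Definition sde_sol (B : base) (alpha : policy) (t : R) (x : 'cV[R]_n)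
    (X : R -> Omega B -> 'cV[R]_n) : Prop :=
  let drift i w s := b p s (X s w) (alpha s (X s w)) i 0 in
  (forall i, progressive t T (fun s w => X s w i 0)) /\
  exists M : R -> Omega B -> 'cV[R]_n,
    (forall i, ito t T (fun s w => (row i (sigma p s (X s w)))^T)
                       (fun s w => M s w i 0)) /\
    {ae Pr B, forall w i,
       leb.-integrable `[t, T] (EFin \o drift i w) /\
       forall s, t <= s <= T ->
         X s w i 0 = x i 0 + \int[leb]_(r in `[t, s]) drift i w r + M s w i 0}.

(* B t x is the space and Brownian motion used for the starting point (t, x).
   Uniqueness is up to indistinguishability. *)
Definition admissible (B : R -> 'cV[R]_n -> base) (alpha : policy) : Prop :=
  [/\ borel_fun [set w : R * 'cV[R]_n | 0 <= w.1 <= T] (fun w => alpha w.1 w.2),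
      A_valued alpha
    & forall t x, 0 <= t <= T ->
        (exists X, sde_sol (B := B t x) alpha t x X) /\
        (forall X X', sde_sol (B := B t x) alpha t x X -> sde_sol alpha t x X' ->
           {ae Pr (B t x), forall w s, t <= s <= T -> X s w = X' s w})].

(* X^{alpha,t,x}: an arbitrary solution (unique when alpha is admissible). *)
Definition state (B : base) (alpha : policy) (t : R) (x : 'cV[R]_n) :
    R -> Omega B -> 'cV[R]_n :=
  xget (fun _ _ => 0) [set X | sde_sol alpha t x X].

(* Extended-real valued: the running cost of a general admissible policy need
   not be integrable. *)
Definition value (B : base) (alpha : policy) (t : R) (x : 'cV[R]_n) : \bar R :=
  let X := state (B := B) alpha t x in
  (\int[Pr B]_w (\int[leb]_(s in `[t, T]) (f p s (X s w) (alpha s (X s w)))%:E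
                 + (g p (X T w))%:E))%E.

Definition vstar (B : R -> 'cV[R]_n -> base) (t : R) (x : 'cV[R]_n) : \bar R :=
  ereal_inf [set value (B t x) alpha t x | alpha in admissible B].

Definition offpolicy_bsde (B : base) (alpha alphab : policy) (t : R) (x : 'cV[R]_n)
    (Y : R -> Omega B -> R) (Z : R -> Omega B -> 'cV[R]_d) : Prop :=
  let X := state (B := B) alphab t x in
  let cost w s := f p s (X s w) (alpha s (X s w)) in
  let corr w s := dot (bh p s (X s w) (alpha s (X s w))
                       - bh p s (X s w) (alphab s (X s w))) (Z s w) in
  [/\ S2 t T Y, H2 t T Z
    & exists M, ito t T Z M /\
      {ae Pr B, forall w,
         [/\ leb.-integrable `[t, T] (EFin \o cost w),
             leb.-integrable `[t, T] (EFin \o corr w)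
           & forall s, t <= s <= T ->
               Y s w = g p (X T w) + \int[leb]_(r in `[s, T]) cost w r
                       + \int[leb]_(r in `[s, T]) corr w r - (M T w - M s w)]}].

Definition sq_error (B : base) (alphab : policy) (t : R) (x : 'cV[R]_n)
    (Z : R -> Omega B -> 'cV[R]_d) (z : R -> 'cV[R]_n -> 'cV[R]_d) : \bar R :=
  (\int[Pr B]_w \int[leb]_(s in `[t, T])
     (enorm (z s (state (B := B) alphab t x s w) - Z s w) ^+ 2)%:E)%E.

(* [offpolicy_output B alpha alphab t x alpha']: alpha' is an output of the
   off-policy subroutine (the minimizer z need not be unique as a function). *)
Definition offpolicy_output (B : base) (alpha alphab : policy) (t : R) (x : 'cV[R]_n)
    (alpha' : policy) : Prop :=
  exists (Y : R -> Omega B -> R) (Z : R -> Omega B -> 'cV[R]_d)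
         (z : R -> 'cV[R]_n -> 'cV[R]_d),
    [/\ offpolicy_bsde alpha alphab t x Y Z,
        CbUniLip z,
        forall z', CbUniLip z' -> (sq_error alphab t x Z z <= sq_error alphab t x Z z')%E
      & forall s y, 0 <= s <= T -> alpha' s y = mu p s y (z s y)].

End Control.

Arguments problem : clear implicits.
Arguments policy : clear implicits.
Arguments stoch_base : clear implicits.

(* Main.v *)
(** By Ito's formula, w^alpha along X = X^{alpha^b} solves the BSDE of the
    subroutine with Z = sigma^T dw^alpha/dx, so the regression recovers the exact
    gradient a.e. along X.  Each difference of values is then again the solution
    of a linear BSDE, and the minimality of mu at the two gradients bounds its
    driver by the previous gradient error against v*.  The energy estimate for
    the squared difference, on N + 1 equal time pieces with weights 2^i (the
    integral S_k of the squared gradient error being weighted in the same way),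
    gives
      (v^{k+1} - v* )^2 + 7/8 S_{k+1} <= 1/8 S_k,
    so that q = 1/2 works at every (t, x); only N depends on the constants.
    Monotonicity holds because the improved policy has the same cost at (t, x)
    as the policy greedy for the exact gradient, to which Feynman-Kac applies.

    The Ito integral is handled through the relation [isint], the L^2 closure of
    the integrals of elementary integrands, and the stochastic differential
    equation is solved by Picard iteration. *)

Require Import Defs.
From mathcomp Require Import all_boot all_order all_algebra.
From mathcomp Require Import all_classical all_reals all_analysis.
From mathcomp Require Import measurable_realfun ring lra zify.
Import Order.TTheory GRing.Theory Num.Theory.
Import numFieldNormedType.Exports.
Local Open Scope classical_set_scope.
Local Open Scope ring_scope.
Set Implicit Arguments.
Unset Strict Implicit.
Unset Printing Implicit Defensive.

Local Notation mT := measurableT.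
Local Notation leb := (@lebesgue_measure _).
Local Notation "'I[' a , b ] f" := (Rintegral leb `[a, b]%classic f) (at level 10, a, b, f at next level).

(** The gradient of a Cauchy solution is only assumed to have linear growth, while the regression
    ranges over Lipschitz functions, and sigma^T dw is a Lipschitz product once dw is bounded. For
    an admissible policy that bound is probabilistic: w is the expected cost, hence Lipschitz by
    stability of the equation in its initial point. For v* no bound is derived, so the policy greedy
    for v* is only known to be continuous. It never drives an equation: v* is compared with the
    other values along the behaviour process, the mismatch of drifts going into the driver. The
    weights 2^i pay for the 2 in (a - b)^2 <= 2 a^2 + 2 b^2, spent once per time piece. N enters the
    weights and C but not the ratio: 7/8 S' <= 1/8 S gives S' <= S/4, and the values converge like
    the square root of S. All data are constrained only at times in [0, T]; composing with a clamp
    of time makes them total continuous functions with global bounds. Processes are likewise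
    modified on null sets until all paths are continuous, which the augmented filtration permits. *)

Lemma cvgMl0 (R : realType) (c : R) (u : nat -> R) : u @ \oo --> 0 -> (fun k => c * u k) @ \oo --> 0.
Proof. by move=> cu; rewrite -[X in _ --> X](mulr0 c); apply: cvgM => //; exact: cvg_cst. Qed.

Lemma cvg_sumF (R : realType) (U : Type) (F : set_system U) (FF : Filter F) (I : Type) (s : seq I)
    (f : I -> U -> R) (a : I -> R) :
  (forall i, f i @ F --> a i) -> (fun x => \sum_(i <- s) f i x) @ F --> \sum_(i <- s) a i.
Proof.
move=> h; elim: s => [|i s IH].
  by under eq_fun do rewrite big_nil; rewrite big_nil; exact: cvg_cst.
by under eq_fun do rewrite big_cons; rewrite big_cons; exact: cvgD.
Qed.

Lemma cvg_sum0 (R : realType) (I : Type) (s : seq I) (F : I -> nat -> R) :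
  (forall i, F i @ \oo --> 0) -> (fun k => \sum_(i <- s) F i k) @ \oo --> 0.
Proof.
move=> cF; have e : \sum_(i <- s) 0 = 0 :> R by rewrite big1.
by rewrite -[X in _ --> X]e; exact: cvg_sumF.
Qed.

Lemma cvg_subseq (phi : nat -> nat) : (forall q, (q <= phi q)%N) -> phi @ \oo --> \oo.
Proof. by move=> h; apply/cvgnyPge => q; exists q => // z /= qz; exact: leq_trans (h z). Qed.

Lemma cvg0_lt (R : realType) (u : nat -> R) e : u @ \oo --> 0 -> 0 < e -> \forall k \near \oo, `|u k| < e.
Proof. by move=> /cvgrPdist_lt h /h; apply: filterS => k; rewrite sub0r normrN. Qed.

Lemma cvg0_le (R : realType) (u : nat -> R) e : u @ \oo --> 0 -> 0 < e -> \forall k \near \oo, `|u k| <= e.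
Proof. by move=> cu /(cvg0_lt cu); apply: filterS => k; exact: ltW. Qed.

Lemma cvg_eq (T : topologicalType) (u v : nat -> T) (l : T) : (forall k, u k = v k) -> u @ \oo --> l -> v @ \oo --> l.
Proof. by move=> /funext ->. Qed.

Lemma ler_eq disp (T : porderType disp) (x y : T) : x = y -> (x <= y)%O. Proof. by move->. Qed.

(** * Square-integrable functions *)

Section SquareIntegrable.
Context d (T : measurableType d) (R : realType).
Variables (mu : {measure set T -> \bar R}) (D : set T).
Hypothesis mD : measurable D.
Implicit Types (f g h : T -> R).

Definition itg f := mu.-integrable D (EFin \o f).
Definition L2 f := measurable_fun D f /\ itg (fun x => f x ^+ 2).
Local Notation "'E[' f ]" := (Rintegral mu D f).

Lemma itg_meas f : itg f -> measurable_fun D f.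
Proof. by move/measurable_int/measurable_EFinP. Qed.

Lemma itg_le f g : measurable_fun D f -> itg g ->
  (forall x, D x -> `|f x| <= g x) -> itg f.
Proof.
move=> mf ig fg; apply: (le_integrable mD _ _ ig) => /=.
  exact/measurable_EFinP.
by move=> x Dx; rewrite lee_fin (le_trans (fg _ Dx))// ler_norm.
Qed.

Lemma itg_sqr_le f g : measurable_fun D f -> itg g -> (forall x, D x -> f x ^+ 2 <= g x) ->
  itg (fun x => f x ^+ 2).
Proof.
move=> mf ig h; apply: (itg_le _ ig) => [|x Dx]; first exact: measurable_funX.
by rewrite ger0_norm ?sqr_ge0 // h.
Qed.

Lemma itgD f g : itg f -> itg g -> itg (fun x => f x + g x).
Proof. by move=> h1 h2; exact: (integrableD mD h1 h2). Qed.
Lemma itgB f g : itg f -> itg g -> itg (fun x => f x - g x).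
Proof. by move=> h1 h2; exact: (integrableB mD h1 h2). Qed.
Lemma itgZ c f : itg f -> itg (fun x => c * f x).
Proof. by move=> h; exact: (integrableZl mD c h). Qed.
Lemma itgN f : itg f -> itg (fun x => - f x).
Proof. by move=> h; exact: (integrableN h). Qed.
Lemma itg_abs f : itg f -> itg (fun x => `|f x|).
Proof. by move=> h; exact: (integrable_abse h). Qed.
Lemma itg_eq f g : (forall x, D x -> f x = g x) -> itg f -> itg g.
Proof.
by move=> fg; apply: eq_integrable => // x /set_mem Dx /=; rewrite fg.
Qed.
Lemma itg0 : itg (fun=> 0).
Proof. exact: integrable0. Qed.
Lemma itg_sum I (s : seq I) (F : I -> T -> R) :
  (forall i, itg (F i)) -> itg (fun x => \sum_(i <- s) F i x).
Proof.
move=> H; elim: s => [|i s IH].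
  by apply: itg_eq itg0 => x _; rewrite big_nil.
by apply: itg_eq (itgD (H i) IH) => x _; rewrite big_cons.
Qed.

Lemma ED f g : itg f -> itg g -> E[fun x => f x + g x] = E[f] + E[g].
Proof. exact: RintegralD. Qed.
Lemma EB f g : itg f -> itg g -> E[fun x => f x - g x] = E[f] - E[g].
Proof. exact: RintegralB. Qed.
Lemma EZ c f : itg f -> E[fun x => c * f x] = c * E[f].
Proof. exact: RintegralZl. Qed.
Lemma EN f : itg f -> E[fun x => - f x] = - E[f].
Proof.
move=> i; rewrite -mulN1r -EZ//; congr Rintegral; apply/funext => x.
by rewrite mulN1r.
Qed.
Lemma E0 : E[fun=> 0] = 0.
Proof. by rewrite /Rintegral integral0. Qed.
Lemma E_eq f g : (forall x, D x -> f x = g x) -> E[f] = E[g].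
Proof. by move=> fg; apply: eq_Rintegral => x /set_mem; exact: fg. Qed.
Lemma E_sum I (s : seq I) (F : I -> T -> R) :
  (forall i, itg (F i)) ->
  E[fun x => \sum_(i <- s) F i x] = \sum_(i <- s) E[F i].
Proof.
move=> H; elim: s => [|i s IH].
  by rewrite big_nil -[RHS]E0; apply: E_eq => x _; rewrite big_nil.
rewrite big_cons -IH -ED //; last exact: itg_sum.
by apply: E_eq => x _; rewrite big_cons.
Qed.
Lemma E_le f g : itg f -> itg g -> (forall x, D x -> f x <= g x) ->
  E[f] <= E[g].
Proof. exact: le_Rintegral. Qed.
Lemma E_ge0 f : (forall x, D x -> 0 <= f x) -> 0 <= E[f].
Proof. exact: Rintegral_ge0. Qed.
Lemma E_abs f : itg f -> `|E[f]| <= E[fun x => `|f x|].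
Proof. exact: le_normr_Rintegral. Qed.

Lemma EFin_E f : itg f -> (\int[mu]_(x in D) (f x)%:E)%E = E[f]%:E.
Proof. by move=> i; rewrite /Rintegral fineK //; exact: integrable_fin_num. Qed.

Lemma itg_ge0P f : measurable_fun D f -> (forall x, D x -> 0 <= f x) ->
  (\int[mu]_(x in D) (f x)%:E < +oo)%E -> itg f.
Proof.
move=> mf f0 h; apply/integrableP; split; first exact/measurable_EFinP.
rewrite (eq_integral (fun x => (f x)%:E)) // => x /set_mem Dx.
by rewrite /= ger0_norm ?f0.
Qed.

Lemma itg_leE f c : measurable_fun D f -> (forall x, D x -> 0 <= f x) ->
  (\int[mu]_(x in D) (f x)%:E <= c%:E)%E -> itg f /\ E[f] <= c.
Proof.
move=> mf f0 h; have i : itg f by apply: itg_ge0P => //; rewrite (le_lt_trans h) ?ltry.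
by split=> //; rewrite -lee_fin -EFin_E.
Qed.

Lemma itg_ae f g : measurable_fun D f -> measurable_fun D g ->
  {ae mu, forall x, D x -> f x = g x} -> itg f -> itg g /\ E[f] = E[g].
Proof.
move=> mf mg fg i.
have fg' : ae_eq mu D (fun x => (f x)%:E) (fun x => (g x)%:E).
  by apply: filterS fg => x + Dx => /(_ Dx) ->.
split; last first.
  rewrite /Rintegral; congr fine; apply: ae_eq_integral => //; exact/measurable_EFinP.
apply/integrableP; split; first exact/measurable_EFinP.
have /integrableP[_] := i.
congr (_ < _)%E; apply: ge0_ae_eq_integral => //.
- by apply/measurableT_comp => //; apply/measurable_EFinP.
- by apply/measurableT_comp => //; apply/measurable_EFinP.
by apply: filterS fg => x + Dx => /(_ Dx) /= ->.
Qed.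

Lemma E_eq0 f : itg f -> (forall x, D x -> 0 <= f x) -> E[f] = 0 ->
  {ae mu, forall x, D x -> f x = 0}.
Proof.
move=> i f0 Ef.
have mf : measurable_fun D (EFin \o f) by exact: measurable_int i.
have /(ae_eq_integral_abs mu mD mf) : (\int[mu]_(x in D) `|(EFin \o f) x| = 0)%E.
  rewrite (eq_integral (fun x => (f x)%:E)) ?EFin_E ?Ef// => x /set_mem Dx /=.
  by rewrite ger0_norm ?f0.
by apply: filterS => x + Dx => /(_ Dx) /= [].
Qed.

Lemma L2_meas f : L2 f -> measurable_fun D f. Proof. by case. Qed.
Lemma L2_sq f : L2 f -> itg (fun x => f x ^+ 2). Proof. by case. Qed.

Lemma L2_le f g : measurable_fun D f -> L2 g ->
  (forall x, D x -> `|f x| <= `|g x|) -> L2 f.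
Proof.
move=> mf [mg ig] fg; split => //; apply: (itg_le _ ig).
  exact: measurable_funX.
move=> x Dx; rewrite normrX -[leRHS]real_normK ?num_real//.
by rewrite ler_pXn2r ?nnegrE ?fg.
Qed.

Lemma L2_eq f g : (forall x, D x -> f x = g x) -> L2 f -> L2 g.
Proof.
move=> fg [mf i]; split; last by apply: itg_eq i => x Dx; rewrite fg.
by apply: eq_measurable_fun mf => x /set_mem; exact: fg.
Qed.

Lemma itgM f g : L2 f -> L2 g -> itg (fun x => f x * g x).
Proof.
move=> [mf f2] [mg g2]; apply: (itg_le _ (itgD f2 g2)).
  exact: measurable_funM.
move=> x _; rewrite normrM -(real_normK (num_real (f x))).
rewrite -(real_normK (num_real (g x))).
have : 0 <= (`|f x| - `|g x|) ^+ 2 by exact: sqr_ge0.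
have : 0 <= `|f x| * `|g x| by rewrite mulr_ge0.
nra.
Qed.

Lemma L2Z c f : L2 f -> L2 (fun x => c * f x).
Proof.
move=> [mf f2]; split; first exact: measurable_funM.
by apply: itg_eq (itgZ (c ^+ 2) f2) => x _; rewrite exprMn.
Qed.

Lemma L2N f : L2 f -> L2 (fun x => - f x).
Proof. by move=> /(L2Z (-1)); apply: L2_eq => x _; rewrite mulN1r. Qed.

Lemma L2D f g : L2 f -> L2 g -> L2 (fun x => f x + g x).
Proof.
move=> Lf Lg; split; first by apply: measurable_funD; [case: Lf|case: Lg].
apply: itg_eq (itgD (itgD (L2_sq Lf) (itgZ 2 (itgM Lf Lg))) (L2_sq Lg)) => x _.
by ring.
Qed.

Lemma L2B f g : L2 f -> L2 g -> L2 (fun x => f x - g x).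
Proof. by move=> Lf /L2N Lg; exact: L2D Lf Lg. Qed.

Lemma L2_0 : L2 (fun=> 0).
Proof.
split; first exact: measurable_cst.
by apply: itg_eq itg0 => x _; rewrite expr0n.
Qed.

Lemma L2_abs f : L2 f -> L2 (fun x => `|f x|).
Proof.
move=> Lf; apply: L2_le (Lf) _; first by apply: measurableT_comp => //; case: Lf.
by move=> x _; rewrite normr_id.
Qed.

Definition nrm f := Num.sqrt E[fun x => f x ^+ 2].

Lemma nrm_ge0 f : 0 <= nrm f. Proof. exact: sqrtr_ge0. Qed.

Lemma nrm_sq f : nrm f ^+ 2 = E[fun x => f x ^+ 2].
Proof. by rewrite sqr_sqrtr // E_ge0 // => x _; exact: sqr_ge0. Qed.

Lemma nrm_eq f g : (forall x, D x -> f x = g x) -> nrm f = nrm g.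
Proof. by move=> fg; congr Num.sqrt; apply: E_eq => x Dx; rewrite fg. Qed.

(** E[(f - c g)^2] is a nonnegative quadratic in c; at c = |f|/|g| this is the claim. If one of the
    norms vanishes, another value of c contradicts the sign as soon as E[f g] > 0. *)
Lemma E_CS f g : L2 f -> L2 g -> E[fun x => f x * g x] <= nrm f * nrm g.
Proof.
move=> Lf Lg; have iff := L2_sq Lf; have igg := L2_sq Lg.
have ifg := itgM Lf Lg.
have H c : 0 <= nrm f ^+ 2 - 2 * c * E[fun x => f x * g x] + c ^+ 2 * nrm g ^+ 2.
  rewrite !nrm_sq -!EZ // -EB //; last exact: itgZ.
  rewrite -ED //; [|by apply: itgB => //; exact: itgZ|exact: itgZ].
  by apply: E_ge0 => x _; apply: le_trans (sqr_ge0 (f x - c * g x)) _; lra.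
have [g0|g0] := eqVneq (nrm g) 0.
  rewrite g0 mulr0; rewrite leNgt; apply/negP => e0.
  (* This value of [c] makes the quadratic equal to -1. *)
  have := H ((nrm f ^+ 2 + 1) / (2 * E[fun x => f x * g x])).
  rewrite g0 expr0n /= mulr0 addr0.
  have -> : 2 * ((nrm f ^+ 2 + 1) / (2 * E[fun x => f x * g x])) *
     E[fun x => f x * g x] = nrm f ^+ 2 + 1.
    by field; rewrite gt_eqF.
  lra.
have gp : 0 < nrm g by rewrite lt_neqAle eq_sym g0 nrm_ge0.
have := H (nrm f / nrm g).
have -> : nrm f ^+ 2 - 2 * (nrm f / nrm g) * E[fun x => f x * g x] +
   (nrm f / nrm g) ^+ 2 * nrm g ^+ 2
   = 2 * (nrm f / nrm g) * (nrm f * nrm g - E[fun x => f x * g x]).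
  by field.
have [f0|f0] := eqVneq (nrm f) 0.
  move=> _; rewrite f0 mul0r leNgt; apply/negP => e0.
  have := H (E[fun x => f x * g x] / nrm g ^+ 2).
  rewrite f0 expr0n /= add0r.
  have -> : - (2 * (E[fun x => f x * g x] / nrm g ^+ 2) * E[fun x => f x * g x]) +
    (E[fun x => f x * g x] / nrm g ^+ 2) ^+ 2 * nrm g ^+ 2 =
    - (E[fun x => f x * g x] / nrm g) ^+ 2 by field.
  by rewrite oppr_ge0 leNgt exprn_gt0 // divr_gt0.
have fp : 0 < nrm f by rewrite lt_neqAle eq_sym f0 nrm_ge0.
by rewrite pmulr_rge0 ?subr_ge0 // mulr_gt0 // divr_gt0.
Qed.

Lemma nrmZ c f : L2 f -> nrm (fun x => c * f x) = `|c| * nrm f.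
Proof.
move=> Lf; rewrite /nrm -sqrtr_sqr -sqrtrM ?sqr_ge0 // -EZ; last exact: L2_sq.
by congr Num.sqrt; apply: E_eq => x _; rewrite exprMn.
Qed.

Lemma nrmN f : nrm (fun x => - f x) = nrm f.
Proof. by congr Num.sqrt; apply: E_eq => x _; rewrite sqrrN. Qed.

Lemma nrm_abs f : nrm (fun x => `|f x|) = nrm f.
Proof. by congr Num.sqrt; apply: E_eq => x _; rewrite real_normK ?num_real. Qed.

Lemma E_CSabs f g : L2 f -> L2 g -> E[fun x => `|f x * g x|] <= nrm f * nrm g.
Proof.
move=> /L2_abs Lf /L2_abs Lg; have := E_CS Lf Lg; rewrite !nrm_abs.
by under eq_Rintegral do rewrite -normrM.
Qed.

Lemma nrmD f g : L2 f -> L2 g -> nrm (fun x => f x + g x) <= nrm f + nrm g.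
Proof.
move=> Lf Lg; rewrite -(@ler_pXn2r _ 2) ?nnegrE ?addr_ge0 ?nrm_ge0 //.
rewrite sqrrD !nrm_sq.
rewrite (_ : E[fun x => (f x + g x) ^+ 2] =
  E[fun x => f x ^+ 2] + 2 * E[fun x => f x * g x] + E[fun x => g x ^+ 2]).
  by have := E_CS Lf Lg; lra.
have iff := L2_sq Lf; have igg := L2_sq Lg; have ifg := itgZ 2 (itgM Lf Lg).
rewrite -EZ ?itgM // -!ED //; last exact: itgD.
by apply: E_eq => x _; ring.
Qed.

Lemma nrmB f g : L2 f -> L2 g -> nrm (fun x => f x - g x) <= nrm f + nrm g.
Proof. by move=> Lf Lg; rewrite -[nrm g]nrmN; apply: nrmD => //; exact: L2N. Qed.

Lemma nrm_le f g : L2 f -> L2 g -> (forall x, D x -> `|f x| <= `|g x|) ->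
  nrm f <= nrm g.
Proof.
move=> Lf Lg fg; rewrite ler_wsqrtr //; apply: E_le => [||x Dx]; try exact: L2_sq.
rewrite -[leLHS]real_normK ?num_real// -[leRHS]real_normK ?num_real//.
by rewrite ler_pXn2r ?nnegrE ?fg.
Qed.

Lemma nrm_eq0 f : L2 f -> nrm f = 0 -> {ae mu, forall x, D x -> f x = 0}.
Proof.
move=> Lf f0; have : E[fun x => f x ^+ 2] = 0 by rewrite -nrm_sq f0 expr0n.
move/(E_eq0 (L2_sq Lf)) => /(_ (fun x _ => sqr_ge0 (f x))).
by apply: filterS => x + Dx => /(_ Dx) /eqP; rewrite sqrf_eq0 => /eqP.
Qed.

Lemma L2_ae f g : measurable_fun D g ->
  {ae mu, forall x, D x -> f x = g x} -> L2 f -> L2 g /\ nrm f = nrm g.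
Proof.
move=> mg fg [mf i].
have fg2 : {ae mu, forall x, D x -> f x ^+ 2 = g x ^+ 2}.
  by apply: filterS fg => x + Dx => /(_ Dx) ->.
have [i2 e2] := itg_ae (measurable_funX 2 mf) (measurable_funX 2 mg) fg2 i.
by split; [split|rewrite /nrm e2].
Qed.

Definition L2cv (F : nat -> T -> R) f :=
  [/\ forall k, L2 (F k), L2 f & (fun k => nrm (fun x => F k x - f x)) @ \oo --> 0].

Lemma L2cvD F f G g : L2cv F f -> L2cv G g ->
  L2cv (fun k x => F k x + G k x) (fun x => f x + g x).
Proof.
move=> [LF Lf Ff] [LG Lg Gg]; split => [k||]; try exact: L2D.
have h : (fun k => nrm (fun x => F k x - f x) + nrm (fun x => G k x - g x)) @ \oo --> 0.
  by rewrite -[X in _ --> X]addr0; exact: cvgD.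
apply: squeeze_cvgr _ (@cvg_cst _ 0 _ _ _) h.
apply: nearW => k; rewrite nrm_ge0 /=.
apply: le_trans (nrmD (L2B (LF k) Lf) (L2B (LG k) Lg)).
by rewrite le_eqVlt (nrm_eq (g := fun x => F k x - f x + (G k x - g x))) ?eqxx // => x _; ring.
Qed.

Lemma L2cvZ c F f : L2cv F f -> L2cv (fun k x => c * F k x) (fun x => c * f x).
Proof.
move=> [LF Lf Ff]; split => [k||]; try exact: L2Z.
have h : (fun k => `|c| * nrm (fun x => F k x - f x)) @ \oo --> 0.
  by rewrite -[X in _ --> X](mulr0 `|c|); exact: cvgM (cvg_cst _) Ff.
apply: cvg_trans h; apply: near_eq_cvg; apply: nearW => k.
rewrite -nrmZ; last exact: L2B.
by apply: nrm_eq => x _; ring.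
Qed.

Lemma L2cv_ip F f G g : L2cv F f -> L2cv G g ->
  (fun k => E[fun x => F k x * G k x]) @ \oo --> E[fun x => f x * g x].
Proof.
move=> [LF Lf Ff] [LG Lg Gg].
pose a k := nrm (fun x => F k x - f x); pose b k := nrm (fun x => G k x - g x).
have h : (fun k => a k * b k + a k * nrm g + nrm f * b k) @ \oo --> 0.
  have -> : 0 = 0 * 0 + 0 * nrm g + nrm f * 0 :> R by ring.
  apply: cvgD; [apply: cvgD|]; apply: cvgM => //; exact: cvg_cst.
apply/cvgrPdist_le => e e0.
have /cvgrPdist_le/(_ _ e0) := h.
apply: filterS => k; rewrite sub0r normrN => /(le_trans (ler_norm _)) he.
apply: le_trans he.
have LFf : L2 (fun x => F k x - f x) by exact: L2B.
have LGg : L2 (fun x => G k x - g x) by exact: L2B.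
rewrite distrC -EB ?itgM //.
rewrite (E_eq (g := fun x => (F k x - f x) * (G k x - g x) +
   (F k x - f x) * g x + f x * (G k x - g x))); last by move=> x _; ring.
rewrite !ED ?itgM //; last by apply: itgD; apply: itgM.
apply: le_trans (ler_normD _ _) _; apply: lerD; last first.
  apply: le_trans (E_abs (itgM Lf LGg)) _; exact: E_CSabs.
apply: le_trans (ler_normD _ _) _; apply: lerD.
  apply: le_trans (E_abs (itgM LFf LGg)) _; exact: E_CSabs.
apply: le_trans (E_abs (itgM LFf Lg)) _; exact: E_CSabs.
Qed.

Lemma L2cv_cst f : L2 f -> L2cv (fun=> f) f.
Proof.
move=> Lf; split => //; apply: cvg_near_cst; apply: nearW => k.
rewrite /nrm -[RHS]sqrtr0; congr Num.sqrt; rewrite -[RHS]E0.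
by apply: E_eq => x _; rewrite subrr expr0n.
Qed.

Lemma cvge_EFin (u : nat -> R) (l : R) : u @ \oo --> l ->
  (fun n => (u n)%:E) @ \oo --> l%:E.
Proof. by move=> h; apply/fine_cvgP; split => //; exact: nearW. Qed.

Lemma dct0 (F : nat -> T -> R) g : (forall k, measurable_fun D (F k)) ->
  itg g -> (forall k x, D x -> `|F k x| <= g x) ->
  {ae mu, forall x, D x -> F ^~ x @ \oo --> 0} ->
  (fun k => E[fun x => `|F k x|]) @ \oo --> 0.
Proof.
move=> mF ig Fg F0.
have mFE k : measurable_fun D (EFin \o F k) by apply/measurable_EFinP.
have [] := @dominated_convergence _ _ _ mu D mD (fun k => EFin \o F k) (cst 0%E)
   (EFin \o g) mFE (measurable_cst _) _ ig _.
- by apply: filterS F0 => x + Dx => /(_ Dx); exact: cvge_EFin.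
- by apply: aeW => x k Dx; rewrite lee_fin Fg.
move=> _ /= + _ => h.
apply: fine_cvg.
apply: cvg_trans h; apply: near_eq_cvg; apply: nearW => k /=.
have iF : itg (F k) by apply: itg_le (ig) (Fg k).
by apply: eq_integral => x _; rewrite subr0.
Qed.

Lemma dct (F : nat -> T -> R) f g : (forall k, measurable_fun D (F k)) ->
  measurable_fun D f -> itg g -> (forall k x, D x -> `|F k x| <= g x) ->
  {ae mu, forall x, D x -> F ^~ x @ \oo --> f x} ->
  itg f /\ (fun k => E[F k]) @ \oo --> E[f].
Proof.
move=> mF mf ig Fg F0.
have mFE k : measurable_fun D (EFin \o F k) by apply/measurable_EFinP.
have [] := @dominated_convergence _ _ _ mu D mD (fun k => EFin \o F k) (EFin \o f)
   (EFin \o g) mFE _ _ ig _.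
- exact/measurable_EFinP.
- by apply: filterS F0 => x + Dx => /(_ Dx); exact: cvge_EFin.
- by apply: aeW => x k Dx; rewrite lee_fin Fg.
move=> i _ h; split => //.
by apply: fine_cvg; rewrite -EFin_E //.
Qed.

(** Applied to the differences F_j - F_k with k fixed, this turns an L2 Cauchy bound together with
    almost sure convergence into an L2 estimate for the almost sure limit. The bound may hold for
    large indices alone, since a lower limit ignores initial terms. *)
Lemma L2_fatou (F : nat -> T -> R) f K : (forall k, L2 (F k)) ->
  measurable_fun D f -> (\forall k \near \oo, nrm (F k) <= K) ->
  {ae mu, forall x, D x -> F ^~ x @ \oo --> f x} -> L2 f /\ nrm f <= K.
Proof.
move=> LF mf FK Ff.
have K0 : 0 <= K.
  by have [N _ /(_ N (leqnn N))] := FK; apply: le_trans (nrm_ge0 _).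
have h : (\int[mu]_(x in D) (f x ^+ 2)%:E <= (K ^+ 2)%:E)%E.
  have -> : (\int[mu]_(x in D) (f x ^+ 2)%:E =
     \int[mu]_(x in D) limn_einf (fun k => (F k x ^+ 2)%:E))%E.
    apply: ae_eq_integral => //.
    - by apply/measurable_EFinP; exact: measurable_funX.
    (* Measurability of the lower limit is read off from the upper limit of the negated sequence. *)
    - rewrite (_ : (fun x => _) = fun x => (- limn_esup (fun k => - (F k x ^+ 2)%:E))%E); last first.
        apply/funext => x; rewrite -limn_einfN; congr limn_einf; apply/funext => k.
        by rewrite /= opprK.
      apply: measurableT_comp => //; apply: measurable_fun_limn_esup => k.
      apply: measurableT_comp => //; apply/measurable_EFinP.
      by apply: measurable_funX; case: (LF k).
    apply: filterS Ff => x + Dx => /(_ Dx) h.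
    apply/esym; rewrite is_cvg_limn_einfE.
      apply/cvg_lim => //; apply: cvge_EFin; exact: cvgM.
    by apply/cvg_ex; exists (f x ^+ 2)%:E; apply: cvge_EFin; exact: cvgM.
  apply: le_trans (fatou mu mD _ _) _.
  - by move=> k; apply/measurable_EFinP; apply: measurable_funX; case: (LF k).
  - by move=> k x _; rewrite lee_fin sqr_ge0.
  have [N _ HN] := FK.
  rewrite limn_einf_lim; apply: lime_le; first exact: is_cvg_einfs.
  exists N => // k /= Nk; apply: ereal_inf_le.
  exists (\int[mu]_(x in D) (F k x ^+ 2)%:E)%E; first by exists k => /=.
  rewrite EFin_E; last exact: L2_sq.
  by rewrite lee_fin -nrm_sq ler_pXn2r ?nnegrE ?nrm_ge0 // HN.
have [i e] : itg (fun x => f x ^+ 2) /\ E[fun x => f x ^+ 2] <= K ^+ 2.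
  apply: itg_leE => //; first exact: measurable_funX.
  by move=> x _; exact: sqr_ge0.
split; first by split.
by rewrite -(@ler_pXn2r _ 2) ?nnegrE ?nrm_ge0 // nrm_sq.
Qed.

(** The series of the [F k] has a finite integral, so it converges almost everywhere and its terms
    tend to 0: Borel-Cantelli for functions instead of events. *)
Lemma fast_ae (F : nat -> T -> R) : (forall k, itg (F k)) ->
  (forall k x, D x -> 0 <= F k x) -> (forall k, E[F k] <= 2^-1 ^+ k) ->
  {ae mu, forall x, D x -> F ^~ x @ \oo --> 0}.
Proof.
move=> iF F0 FE.
have mF k : measurable_fun D (EFin \o F k) by exact: measurable_int (iF k).
have h : (\int[mu]_(x in D) \sum_(0 <= k <oo) (F k x)%:E < +oo)%E.
  rewrite (integral_nneseries mu mD mF); last by move=> k x Dx; rewrite lee_fin F0.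
  apply: (@le_lt_trans _ _ (\sum_(0 <= k <oo) (2^-1 ^+ k)%:E)%E).
    apply: lee_nneseries => [k _ _|k _].
      by apply: integral_ge0 => x Dx; rewrite lee_fin F0.
    by rewrite EFin_E // lee_fin.
  rewrite (_ : (\sum_(0 <= k <oo) _)%E = 2%:E) ?ltry //; apply/cvg_lim => //.
  have := @cvg_geometric_series R 1 2^-1.
  rewrite ger0_norm // invf_lt1 // ltr1n => /(_ erefl).
  rewrite (_ : 1 / (1 - 2^-1) = 2 :> R); last by field.
  move/cvge_EFin; apply: cvg_eq => n /=.
  by rewrite /eseries /series /= sumEFin; congr EFin; apply: eq_bigr => i _; rewrite mul1r.
have ih : mu.-integrable D (fun x => \sum_(0 <= k <oo) (F k x)%:E)%E.
  apply/integrableP; split.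
    have h0 k x : D x -> true -> (0 <= (F k x)%:E)%E by move=> Dx _; rewrite lee_fin F0.
    exact: (ge0_emeasurable_sum h0 (fun k _ => mF k)).
  rewrite (eq_integral (fun x => \sum_(0 <= k <oo) (F k x)%:E)%E) // => x /set_mem Dx.
  by rewrite gee0_abs // nneseries_ge0 // => k _ _; rewrite lee_fin F0.
have := integrable_ae mD ih; apply: filterS => x + Dx => /(_ Dx) fin.
apply: cvg_series_cvg_0; apply: nondecreasing_is_cvgn.
  apply/nondecreasing_seqP => n; rewrite /series /= big_nat_recr //= lerDl.
  exact: F0.
exists (fine (\sum_(0 <= k <oo) (F k x)%:E)%E) => _ [n _ <-].
rewrite -lee_fin fineK // /series /= -sumEFin.
by apply: nneseries_lim_ge => k _; rewrite lee_fin F0.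
Qed.

End SquareIntegrable.

Import HBNNSimple.

(** * Laws, independence and Gaussian moments *)

Section LawExtension.
Context d1 d2 (X1 : measurableType d1) (X2 : measurableType d2) (R : realType).
Variables (m1 : {measure set X1 -> \bar R}) (m2 : {measure set X2 -> \bar R}).
Variables (k1 : X1 -> R) (k2 : X2 -> R) (Y1 : X1 -> R) (Y2 : X2 -> R).
Hypotheses (mk1 : measurable_fun setT k1) (mk2 : measurable_fun setT k2).
Hypotheses (mY1 : measurable_fun setT Y1) (mY2 : measurable_fun setT Y2).
Hypotheses (k10 : forall x, 0 <= k1 x) (k20 : forall x, 0 <= k2 x).

Variable phi : R -> R.
Hypotheses (mphi : measurable_fun setT phi) (phi0 : forall x, 0 <= phi x).

(** Monotone convergence, from indicators through simple functions to a nonnegative measurable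
    [phi]. The weights [k1] and [k2] allow an expectation of a product to be extended one factor at
    a time, and also accommodate a density. *)
Lemma law_ext : (forall V : set R, measurable V ->
    \int[m1]_x (k1 x * \1_V (Y1 x))%:E = \int[m2]_x (k2 x * \1_V (Y2 x))%:E)%E ->
  (\int[m1]_x (k1 x * phi (Y1 x))%:E = \int[m2]_x (k2 x * phi (Y2 x))%:E)%E.
Proof.
move=> H.
have mE : measurable_fun setT (EFin \o phi) by exact/measurable_EFinP.
pose g n : {nnsfun R >-> R} := nnsfun_approx mT mE n.
have gcv x : (fun n => (g n : R -> R) x) @ \oo --> phi x.
  have f0 y : setT y -> (0 <= (EFin \o phi) y)%E by move=> _; rewrite lee_fin.
  by have /fine_cvg := cvg_nnsfun_approx mT mE f0 (I : setT x).
have gnd x : nondecreasing_seq (fun n => (g n : R -> R) x).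
  by move=> a b ab; exact/lefP/(nd_nnsfun_approx mT mE ab).
have key d (X : measurableType d) (m : {measure set X -> \bar R}) (k Y : X -> R) :
    measurable_fun setT k -> measurable_fun setT Y -> (forall x, 0 <= k x) ->
    ((fun n => \int[m]_x (k x * (g n : R -> R) (Y x))%:E) @ \oo -->
      \int[m]_x (k x * phi (Y x))%:E)%E.
  move=> mk mY k0.
  rewrite [X in _ --> X](_ : _ = \int[m]_x limn (fun n => (k x * (g n : R -> R) (Y x))%:E))%E; last first.
    apply: eq_integral => x _; apply/esym/cvg_lim => //; apply: cvge_EFin.
    by apply: cvgM; [exact: cvg_cst|exact: gcv].
  apply: cvg_monotone_convergence => //.
  - move=> n; apply/measurable_EFinP; apply: measurable_funM => //.
    exact: measurableT_comp.
  - by move=> n x _; rewrite lee_fin mulr_ge0.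
  - by move=> x _ a b ab; rewrite lee_fin ler_wpM2l // gnd.
pose s n := finmap.enum_fset (fset_set (range (g n : R -> R))).
(* The levels of [g n] are nonnegative, so the absolute value changes nothing; it makes every term
   nonnegative by its form, as the additivity of nonnegative integrals asks for each index. *)
have key2 d (X : measurableType d) (m : {measure set X -> \bar R}) (k Y : X -> R) n :
    measurable_fun setT k -> measurable_fun setT Y -> (forall x, 0 <= k x) ->
    (\int[m]_x (k x * (g n : R -> R) (Y x))%:E =
      \sum_(y <- s n) `|y|%:E * \int[m]_x (k x * \1_((g n : R -> R) @^-1` [set y]) (Y x))%:E)%E.
  move=> mk mY k0.
  have mi y : measurable_fun setT (fun x => k x * \1_((g n : R -> R) @^-1` [set y]) (Y x)).
    by apply: measurable_funM => //; exact: measurableT_comp.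
  rewrite (eq_integral (fun x => \sum_(y <- s n)
     (`|y| * (k x * \1_((g n : R -> R) @^-1` [set y]) (Y x)))%:E)%E); last first.
    move=> x _; rewrite [in LHS](fimfunE (g n)) fsbig_finite //= sumEFin; congr EFin.
    rewrite mulr_sumr; apply: eq_big_seq => y.
    rewrite in_fset_set // => /set_mem [z _ <-].
    by rewrite ger0_norm // mulrCA.
  rewrite ge0_integral_sum //; last first.
    by move=> y x _; rewrite lee_fin mulr_ge0 // mulr_ge0.
    by move=> y; apply/measurable_EFinP; exact: measurable_funM.
  apply: eq_bigr => y _.
  rewrite -ge0_integralZl //=; first exact/measurable_EFinP.
  by move=> x _; rewrite lee_fin mulr_ge0.
have := key _ _ m1 _ _ mk1 mY1 k10.
rewrite (_ : (fun n => _) = (fun n => \int[m2]_x (k2 x * (g n : R -> R) (Y2 x))%:E)%E); last first.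
  apply/funext => n; rewrite !key2 //; apply: eq_bigr => y _; congr (_ * _)%E.
  exact: H.
by move=> h; apply: cvg_unique h (key _ _ m2 _ _ mk2 mY2 k20).
Qed.

End LawExtension.

(** * Product formula for expectations, from independence on rectangles *)

Section Independence.
Context d (T : measurableType d) (R : realType) (P : probability T R).
Local Notation "'E[' f ]" := (Rintegral P setT f).
Local Notation itgP := (itg P setT).
Variables (G : set (set T)) (Y1 Y2 : T -> R).
Variables (N1 N2 : probability (measurableTypeR R) R).
Hypothesis mG : forall A, G A -> measurable A.
Hypotheses (mY1 : measurable_fun setT Y1) (mY2 : measurable_fun setT Y2).
Hypothesis ind : forall A (U V : set R), G A -> measurable U -> measurable V ->
  (P (A `&` (Y1 @^-1` U `&` Y2 @^-1` V)) = P A * (N1 U * N2 V))%E.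

Definition gmeas (f : T -> R) := forall U : set R, measurable U -> G (f @^-1` U).

Lemma gmeas_measurable f : gmeas f -> measurable_fun setT f.
Proof. by move=> h _ U mU; rewrite setTI; apply: mG; exact: h. Qed.

Let integral_indicP d' (T' : measurableType d') (m : {measure set T' -> \bar R})
  (A : set T') : measurable A ->
  (\int[m]_x (\1_A x : R)%:E = m A)%E.
Proof. by move=> mA; rewrite integral_indic // setIT. Qed.

Let cst_scale d' (T' : measurableType d') (m : {measure set T' -> \bar R}) (c : R) (f : T' -> R) :
  measurable_fun setT f -> (forall x, 0 <= f x) -> 0 <= c -> itg m setT f ->
  (\int[m]_x (c * f x)%:E = (c * Rintegral m setT f)%:E)%E.
Proof.
by move=> mf f0 c0 i; rewrite (EFin_E mT) ?EZ //; apply: itgZ.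
Qed.

(** [law_ext] is used three times: it frees [xi] while the two other factors are indicators, then
    [phi], then [psi]. In each use the second measure is the one on which the freed factor is to be
    integrated. *)
Lemma ind_ge0 xi (phi psi : R -> R) : gmeas xi -> (forall x, 0 <= xi x) -> itgP xi ->
  measurable_fun setT phi -> (forall x, 0 <= phi x) -> itg N1 setT phi ->
  measurable_fun setT psi -> (forall x, 0 <= psi x) -> itg N2 setT psi ->
  (\int[P]_w (xi w * phi (Y1 w) * psi (Y2 w))%:E =
   (E[xi] * Rintegral N1 setT phi * Rintegral N2 setT psi)%:E)%E.
Proof.
move=> gxi xi0 ixi mphi phi0 iphi mpsi psi0 ipsi.
have mxi := gmeas_measurable gxi.
have mi1 (U : set R) : measurable U -> measurable (Y1 @^-1` U).
  by move=> mU; rewrite -[X in measurable X]setTI; exact: mY1.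
have mi2 (U : set R) : measurable U -> measurable (Y2 @^-1` U).
  by move=> mU; rewrite -[X in measurable X]setTI; exact: mY2.
pose n1 U := fine (N1 U); pose n2 U := fine (N2 U).
have n10 U : 0 <= n1 U by rewrite fine_ge0.
have n20 U : 0 <= n2 U by rewrite fine_ge0.
have c0 : 0 <= E[xi] by apply: E_ge0 => x _; exact: xi0.
have fN (N : probability (measurableTypeR R) R) (V : set R) : measurable V -> (N V = (fine (N V))%:E)%E.
  by move=> mV; rewrite fineK // fin_num_measure.
have fP A : measurable A -> (P A = (fine (P A))%:E)%E.
  by move=> mV; rewrite fineK // fin_num_measure.
have s1 (U V : set R) : measurable U -> measurable V ->
  (\int[P]_w (xi w * \1_U (Y1 w) * \1_V (Y2 w))%:E = (E[xi] * n1 U * n2 V)%:E)%E.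
  move=> mU mV; pose B := Y1 @^-1` U `&` Y2 @^-1` V.
  have mB : measurable B by apply: measurableI; [exact: mi1|exact: mi2].
  (* [law_ext] wants a function nonnegative on the whole line, hence the positive part, which is the
     identity on the values of [xi]. *)
  have -> : (\int[P]_w (xi w * \1_U (Y1 w) * \1_V (Y2 w))%:E =
     \int[P]_w (\1_B w * Num.max (xi w) 0)%:E)%E.
    apply: eq_integral => w _; congr EFin.
    by rewrite /B indicI /= -mulrA mulrC max_l.
  rewrite (@law_ext _ _ _ _ _ P P _ (fun=> n1 U * n2 V) _ xi _ _ _ _ _ _ (fun x => Num.max x 0)).
  - rewrite (eq_integral (fun w => (n1 U * n2 V * xi w)%:E)); last first.
      by move=> w _; rewrite max_l.
    rewrite cst_scale //; last exact: mulr_ge0.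
    by congr EFin; ring.
  - exact: measurable_indic.
  - exact: measurable_cst.
  - exact: mxi.
  - exact: mxi.
  - by [].
  - by move=> w; exact: mulr_ge0.
  - exact: measurable_maxr.
  - by move=> x; rewrite le_max lexx orbT.
  - move=> W mW; have mA : G (xi @^-1` W) by exact: gxi.
    rewrite (eq_integral (fun x => (\1_(xi @^-1` W `&` B) x)%:E)); last first.
      by move=> w _; rewrite indicI /= mulrC.
    rewrite integral_indicP; last by apply: measurableI => //; exact: mG.
    transitivity (P (xi @^-1` W) * (N1 U * N2 V))%E; first exact: ind.
    rewrite (fN N1) // (fN N2) // (fP _ (mG mA)).
    rewrite (eq_integral (fun w => (n1 U * n2 V * \1_(xi @^-1` W) w)%:E)) //.
    rewrite cst_scale //.
    + by rewrite /Rintegral (integral_indicP _ (mG mA)) !EFinM muleC.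
    + by apply: measurable_indic; exact: mG.
    + exact: mulr_ge0.
    + apply: itg_ge0P => //; first by apply: measurable_indic; exact: mG.
      rewrite (integral_indicP _ (mG mA)).
      by have := ltry (fine (P (xi @^-1` W))); rewrite -(fP _ (mG mA)).
have s2 (V : set R) : measurable V ->
  (\int[P]_w (xi w * phi (Y1 w) * \1_V (Y2 w))%:E =
     (E[xi] * n2 V * Rintegral N1 setT phi)%:E)%E.
  move=> mV.
  rewrite (eq_integral (fun w => (xi w * \1_V (Y2 w) * phi (Y1 w))%:E)); last first.
    by move=> w _; congr EFin; ring.
  rewrite (@law_ext _ _ _ _ _ P N1 _ (fun=> E[xi] * n2 V) _ id _ _ _ _ _ _ phi) //.
  - by rewrite cst_scale // mulr_ge0.
  - apply: measurable_funM => //; apply: measurableT_comp => //; exact: measurable_indic.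
  - by move=> w; rewrite mulr_ge0.
  - by move=> w; rewrite mulr_ge0.
  - move=> U mU; rewrite (eq_integral (fun w => (xi w * \1_U (Y1 w) * \1_V (Y2 w))%:E)); last first.
      by move=> w _; congr EFin; ring.
    rewrite s1 // cst_scale //; last 2 first.
    + exact: mulr_ge0.
    + apply: itg_ge0P => //; rewrite integral_indicP //.
      by have := ltry (fine (N1 U)); rewrite -(fN N1).
    + by rewrite /Rintegral integral_indicP // -/(n1 U); congr EFin; ring.
rewrite (@law_ext _ _ _ _ _ P N2 _ (fun=> E[xi] * Rintegral N1 setT phi) _ id _ _ _ _ _ _ psi) //.
- rewrite cst_scale //; apply: mulr_ge0 => //; exact: E_ge0.
- apply: measurable_funM => //; exact: measurableT_comp.
- by move=> w; rewrite mulr_ge0.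
- by move=> w; apply: mulr_ge0 => //; exact: E_ge0.
- move=> V mV; rewrite s2 // cst_scale //; last 2 first.
  + by apply: mulr_ge0 => //; exact: E_ge0.
  + apply: itg_ge0P => //; rewrite integral_indicP //.
    by have := ltry (fine (N2 V)); rewrite -(fN N2).
  + by rewrite /Rintegral integral_indicP // -/(n2 V); congr EFin; ring.
Qed.

Let ind_ge0' xi (phi psi : R -> R) : gmeas xi -> (forall x, 0 <= xi x) -> itgP xi ->
  (forall x, 0 <= phi x) -> itg N1 setT phi ->
  (forall x, 0 <= psi x) -> itg N2 setT psi ->
  itgP (fun w => xi w * phi (Y1 w) * psi (Y2 w)) /\
  E[fun w => xi w * phi (Y1 w) * psi (Y2 w)] =
   E[xi] * Rintegral N1 setT phi * Rintegral N2 setT psi.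
Proof.
move=> gxi xi0 ixi phi0 iphi psi0 ipsi.
have mphi := itg_meas iphi; have mpsi := itg_meas ipsi.
have h := ind_ge0 gxi xi0 ixi mphi phi0 iphi mpsi psi0 ipsi.
split; last by rewrite /Rintegral h.
apply: itg_ge0P => //.
- apply: measurable_funM; last exact: measurableT_comp.
  by apply: measurable_funM; [exact: gmeas_measurable|exact: measurableT_comp].
- by move=> w _; rewrite !mulr_ge0.
- by rewrite h ltry.
Qed.

Let pos (x : R) := Num.max x 0.
Let neg (x : R) := Num.max (- x) 0.
Let posneg x : x = pos x - neg x.
Proof. by rewrite /pos /neg; case: (leP x 0) => h; case: (leP (-x) 0) => h'; lra. Qed.
Let pos0 x : 0 <= pos x. Proof. by rewrite /pos le_max lexx orbT. Qed.
Let neg0 x : 0 <= neg x. Proof. by rewrite /neg le_max lexx orbT. Qed.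
Let pos_le x : `|pos x| <= `|x|.
Proof. by rewrite ger0_norm // /pos ge_max normr_ge0 ler_norm. Qed.
Let neg_le x : `|neg x| <= `|x|.
Proof. by rewrite ger0_norm // /neg ge_max normr_ge0 -normrN ler_norm. Qed.
Let mpos : measurable_fun setT pos.
Proof. exact: measurable_maxr. Qed.
Let mneg : measurable_fun setT neg.
Proof. by apply: measurable_maxr => //; exact: measurableT_comp. Qed.

Let itg_pos d' (T' : measurableType d') (m : {measure set T' -> \bar R}) (f : T' -> R) :
  itg m setT f -> itg m setT (pos \o f) /\ itg m setT (neg \o f).
Proof.
move=> i; have mf := itg_meas i; split; apply: (itg_le _ _ (itg_abs i)) => //.
- exact: measurableT_comp.
- by move=> x _; exact: pos_le.
- exact: measurableT_comp.
- by move=> x _; exact: neg_le.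
Qed.

Let gcomp (h : R -> R) xi : measurable_fun setT h -> gmeas xi -> gmeas (h \o xi).
Proof.
move=> mh gx U mU; rewrite comp_preimage; apply: gx.
by rewrite -[X in measurable X]setTI; exact: mh.
Qed.

(** Positive and negative parts are split off one factor at a time, [psi] first and [xi] last;
    composing [xi] with a Borel map keeps it measurable for [G]. *)
Lemma ind_int xi (phi psi : R -> R) : gmeas xi -> itgP xi ->
  itg N1 setT phi -> itg N2 setT psi ->
  itgP (fun w => xi w * phi (Y1 w) * psi (Y2 w)) /\
  E[fun w => xi w * phi (Y1 w) * psi (Y2 w)] =
   E[xi] * Rintegral N1 setT phi * Rintegral N2 setT psi.
Proof.
move=> gxi ixi iphi ipsi.
have split_pn d' (T' : measurableType d') (m : {measure set T' -> \bar R}) (f : T' -> R) :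
    itg m setT f -> Rintegral m setT f = Rintegral m setT (pos \o f) - Rintegral m setT (neg \o f).
  move=> i; have [ip ine] := itg_pos i.
  by rewrite -(EB mT) //; apply: E_eq => x _; exact: posneg.
have comb (F F1 F2 : T -> R) a a1 a2 : (forall w, F w = F1 w - F2 w) -> a = a1 - a2 ->
    itgP F1 /\ E[F1] = a1 -> itgP F2 /\ E[F2] = a2 -> itgP F /\ E[F] = a.
  move=> FE -> [i1 <-] [i2 <-]; split; last first.
    by rewrite -(EB mT) //; apply: E_eq => w _.
  by apply: (itg_eq mT) (itgB mT i1 i2) => w _; rewrite FE.
have [xp xn] := itg_pos ixi; have [pp pn] := itg_pos iphi; have [qp qn] := itg_pos ipsi.
have st1 (f : T -> R) (q : R -> R) : gmeas f -> (forall x, 0 <= f x) -> itgP f ->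
   (forall x, 0 <= q x) -> itg N1 setT q ->
   itgP (fun w => f w * q (Y1 w) * psi (Y2 w)) /\
   E[fun w => f w * q (Y1 w) * psi (Y2 w)] = E[f] * Rintegral N1 setT q * Rintegral N2 setT psi.
  move=> gf f0 jf q0 jq.
  apply: (comb _ _ _ _ _ _ _ _ (ind_ge0' gf f0 jf q0 jq _ qp) (ind_ge0' gf f0 jf q0 jq _ qn)) => /=.
  - by move=> w; rewrite {1}(posneg (psi _)) mulrBr.
  - by rewrite (split_pn _ _ _ _ ipsi) mulrBr.
  - by move=> x; exact: pos0.
  - by move=> x; exact: neg0.
have st2 (f : T -> R) : gmeas f -> (forall x, 0 <= f x) -> itgP f ->
   itgP (fun w => f w * phi (Y1 w) * psi (Y2 w)) /\
   E[fun w => f w * phi (Y1 w) * psi (Y2 w)] = E[f] * Rintegral N1 setT phi * Rintegral N2 setT psi.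
  move=> gf f0 jf.
  apply: (comb _ _ _ _ _ _ _ _ (st1 _ _ gf f0 jf _ pp) (st1 _ _ gf f0 jf _ pn)) => /=.
  - by move=> w; rewrite {1}(posneg (phi _)) mulrBr mulrBl.
  - by rewrite (split_pn _ _ _ _ iphi) mulrBr mulrBl.
  - by move=> x; exact: pos0.
  - by move=> x; exact: neg0.
apply: (comb _ _ _ _ _ _ _ _ (st2 _ (gcomp mpos gxi) _ xp) (st2 _ (gcomp mneg gxi) _ xn)) => /=.
- by move=> w; rewrite {1}(posneg (xi _)) !mulrBl.
- by rewrite (split_pn _ _ _ _ ixi) !mulrBl.
- by move=> x; exact: pos0.
- by move=> x; exact: neg0.
Qed.

End Independence.

(** * Moments of the centred normal law *)

Section GaussianMoments.
Context (R : realType) (s : R).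
Hypothesis s0 : 0 < s.
Local Notation p := (normal_pdf 0 s).

Lemma normal_intE (phi : R -> R) : measurable_fun setT phi -> (forall x, 0 <= phi x) ->
  (\int[normal_prob 0 s]_x (phi x)%:E = \int[leb]_x (p x * phi x)%:E)%E.
Proof.
move=> mphi phi0.
have -> : (\int[normal_prob 0 s]_x (phi x)%:E = \int[normal_prob 0 s]_x (1 * phi x)%:E)%E.
  by apply: eq_integral => x _; rewrite mul1r.
apply: (@law_ext _ _ _ _ _ (normal_prob 0 s) leb (fun=> 1) p id id _ _ _ _ _ _ phi) => //.
- exact: measurable_normal_pdf.
- by move=> x; exact: normal_pdf_ge0.
- move=> V mV; have -> : (\int[normal_prob 0 s]_x (1 * \1_V x)%:E = \int[normal_prob 0 s]_x (\1_V x)%:E)%E.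
    by apply: eq_integral => x _; rewrite mul1r.
  rewrite integral_indic // setIT /normal_prob /=.
  rewrite [LHS]integral_mkcond; congr integral; apply/funext => x.
  by rewrite patchE indicE; case: (x \in V); rewrite ?mulr1 ?mulr0.
Qed.

Lemma normal_itg (phi : R -> R) : itg leb setT (fun x => p x * phi x) ->
  measurable_fun setT phi ->
  itg (normal_prob 0 s) setT phi /\
  Rintegral (normal_prob 0 s) setT phi = \int[leb]_x (p x * phi x).
Proof.
move=> i mphi.
have p0 x : 0 <= p x by exact: normal_pdf_ge0.
have key (h : R -> R) : measurable_fun setT h -> (forall x, 0 <= h x <= `|phi x|) ->
   itg (normal_prob 0 s) setT h /\
   Rintegral (normal_prob 0 s) setT h = \int[leb]_x (p x * h x) /\
   itg leb setT (fun x => p x * h x).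
  move=> mh h0.
  have ih : itg leb setT (fun x => p x * h x).
    apply: (itg_le _ _ (itg_abs i)) => //.
      by apply: measurable_funM => //; exact: measurable_normal_pdf.
    move=> x _; rewrite !normrM ler_wpM2l // ger0_norm; by case/andP: (h0 x).
  have e : (\int[normal_prob 0 s]_x (h x)%:E = (\int[leb]_x (p x * h x))%:E)%E.
    rewrite normal_intE // ?(EFin_E mT) //.
    by move=> x; case/andP: (h0 x).
  split; last by split => //; rewrite /Rintegral e.
  by apply: itg_ge0P => //; [move=> x _; case/andP: (h0 x)|rewrite e ltry].
have [] := key (fun x => Num.max (phi x) 0).
- exact: measurable_maxr.
- by move=> x; rewrite le_max lexx orbT /= ge_max ler_norm normr_ge0.
move=> i1 [e1 j1].
have [] := key (fun x => Num.max (- phi x) 0).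
- by apply: measurable_maxr => //; exact: measurableT_comp.
- by move=> x; rewrite le_max lexx orbT /= ge_max -normrN ler_norm normr_ge0.
move=> i2 [e2 j2].
have E x : phi x = Num.max (phi x) 0 - Num.max (- phi x) 0.
  by case: (leP (phi x) 0) => h; case: (leP (- phi x) 0) => h'; lra.
split; first by apply: (itg_eq mT) (itgB mT i1 i2) => x _; rewrite -E.
have -> : \int[normal_prob 0 s]_x phi x =
    \int[normal_prob 0 s]_x (Num.max (phi x) 0 - Num.max (- phi x) 0) by apply: E_eq.
rewrite (EB mT) // e1 e2 -(EB mT) //.
by apply: E_eq => x _; rewrite -mulrBr -E.
Qed.

Local Notation gbound := (normal_pdf 0 (2 * s)).

(** The quotient of the densities with deviations s and 2s is a constant times exp(-u), where u = 3
    x^2 / (8 s^2). The polynomial is absorbed by 1 <= exp u and u^2 <= 4 exp u, with x^4 = (8 s^2 /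
    3)^2 u^2; this gives the constant and an integrable majorant for all moments up to order 4. *)
Lemma pdf_bound : exists C, forall x, p x * (1 + x ^+ 4) <= C * gbound x.
Proof.
have s20 : 2 * s != 0 by rewrite mulf_neq0 ?gt_eqF.
have sn0 : s != 0 by rewrite gt_eqF.
pose A := normal_peak s / normal_peak (2 * s).
exists (A * (1 + 4 * (8 * s ^+ 2 / 3) ^+ 2)) => x.
rewrite !normal_pdfE // /normal_fun !subr0.
pose u := 3 * x ^+ 2 / (8 * s ^+ 2).
have u0 : 0 <= u by rewrite /u divr_ge0 // mulr_ge0 // sqr_ge0.
have -> : - x ^+ 2 / (s ^+ 2 *+ 2) = - x ^+ 2 / ((2 * s) ^+ 2 *+ 2) - u.
  by rewrite /u; field.
rewrite expRD.
have pk : 0 < normal_peak (2 * s) by exact: normal_peak_gt0.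
have -> : A * (1 + 4 * (8 * s ^+ 2 / 3) ^+ 2) * (normal_peak (2 * s) *
   expR (- x ^+ 2 / ((2 * s) ^+ 2 *+ 2))) = normal_peak s *
   expR (- x ^+ 2 / ((2 * s) ^+ 2 *+ 2)) * (1 + 4 * (8 * s ^+ 2 / 3) ^+ 2).
  by rewrite /A; field; rewrite gt_eqF.
rewrite !mulrA -!mulrA; do 2 (rewrite ler_wpM2l ?normal_peak_ge0 ?expR_ge0 //).
rewrite expRN.
have -> : x ^+ 4 = (8 * s ^+ 2 / 3) ^+ 2 * u ^+ 2 by rewrite /u; field.
have e1 : 1 + u <= expR u by exact: expR_ge1Dx.
(* From (1 + u/2)^2 <= exp u. *)
have e2 : u ^+ 2 <= 4 * expR u.
  have h : 1 + u / 2 <= expR (u / 2) by exact: expR_ge1Dx.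
  have -> : expR u = expR (u / 2) ^+ 2.
    by rewrite -expRM_natl; congr expR; field.
  have : (1 + u/2) ^+ 2 <= expR (u / 2) ^+ 2.
    by rewrite ler_pXn2r ?nnegrE ?expR_ge0 //; nra.
  nra.
rewrite mulrC ler_pdivrMr ?expR_gt0 //.
have : 0 <= (8 * s ^+ 2 / 3) ^+ 2 by exact: sqr_ge0.
nra.
Qed.

Lemma pdf_itg (k : nat) : (k <= 4)%N -> itg leb setT (fun x => p x * x ^+ k).
Proof.
move=> k4; have [C hC] := pdf_bound.
have ig : itg leb setT (fun x => C * gbound x).
  by apply: itgZ => //; exact: integrable_normal_pdf.
apply: (itg_le _ _ ig) => //.
  apply: measurable_funM; [exact: measurable_normal_pdf|exact: measurable_funX].
move=> x _; apply: le_trans (hC x); rewrite normrM ger0_norm ?normal_pdf_ge0 //.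
rewrite ler_wpM2l ?normal_pdf_ge0 // normrX.
have [x1|x1] := leP `|x| 1.
  apply: (@le_trans _ _ 1); first by rewrite exprn_ile1.
  by rewrite lerDl -[x ^+ 4]/(x ^+ (2 * 2)%N) exprM sqr_ge0.
apply: (@le_trans _ _ (`|x| ^+ 4)); first by rewrite ler_weXn2l // ltW.
by rewrite -normrX ger0_norm ?lerDr // -[x ^+ 4]/(x ^+ (2 * 2)%N) exprM sqr_ge0.
Qed.

(** The fundamental theorem of calculus on [-n, n] and dominated convergence. As [f] is integrable,
    symmetric intervals suffice, and [F] is only looked at along the integers. *)
Lemma total_derivative (F f : R -> R) : (forall x, is_derive x (1:R) F (f x)) ->
  continuous f -> itg leb setT f ->
  (fun n : nat => F n%:R) @ \oo --> 0 -> (fun n : nat => F (- n%:R)) @ \oo --> 0 ->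
  \int[leb]_x f x = 0.
Proof.
move=> dF cf i F1 F2.
have mf := itg_meas i.
have mI n : measurable (`[- n%:R, n%:R]%classic : set R) by [].
have [] := @dct _ _ _ leb setT mT
   (fun n => f \_ `[- n%:R, n%:R]) f (fun x => `|f x|) _ mf (itg_abs i).
- by move=> n; apply/measurable_restrict => //; exact: measurable_funS mf.
- by move=> n x _; rewrite patchE; case: ifP => // _; rewrite normr0.
- apply: aeW => x _; apply: cvg_near_cst.
  have [N hN] : exists N : nat, `|x| <= N%:R.
    by exists (Num.bound `|x|); rewrite ltW // archi_boundP.
  exists N => // n /= Nn; rewrite patchE mem_set //= in_itv /= -ler_norml.
  by rewrite (le_trans hN) // ler_nat.
move=> _ h.
have h2 : (fun n : nat => F n%:R - F (- n%:R)) @ \oo --> 0.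
  by rewrite -[X in _ --> X](subr0 0); exact: cvgB.
apply: cvg_unique h _ => //.
apply: cvg_trans h2; apply: near_eq_cvg; exists 1%N => // n /= n1.
rewrite -Rintegral_mkcond /Rintegral.
rewrite (@continuous_FTC2 _ f F) //.
- by rewrite (@lt_trans _ _ 0) ?oppr_lt0 ?ltr0n.
- by apply: continuous_subspaceT => x; exact: cf.
- split.
  + by move=> x _; apply: ex_derive; exact: dF.
  + apply: cvg_at_right_filter; apply: differentiable_continuous.
    by apply/derivable1_diffP; apply: ex_derive; exact: dF.
  + apply: cvg_at_left_filter; apply: differentiable_continuous.
    by apply/derivable1_diffP; apply: ex_derive; exact: dF.
- by move=> x _; rewrite derive1E; exact: derive_val.
Qed.

Let dpdf x : is_derive x (1:R) p (- (x / s ^+ 2) * p x).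
Proof.
have sn0 : s != 0 by rewrite gt_eqF.
set c := - (s ^+ 2 *+ 2)^-1.
have pE : p = fun y => normal_peak s * expR (c * y ^+ 2).
  by apply/funext => y; rewrite normal_pdfE // /normal_fun subr0 /c !mulNr [_ * y ^+ 2]mulrC.
have dg : is_derive x (1:R) (fun y : R => c * y ^+ 2) (c * (2 * x)).
  apply: is_derive_eq; rewrite /GRing.scale /= ?mulr0 ?addr0 ?add0r; ring.
have dE := @is_derive1_comp _ expR (fun y : R => c * y ^+ 2) x _ _ (is_derive_expR _) dg.
rewrite pE; apply: (is_derive_eq (is_deriveZ (normal_peak s) dE)); rewrite /GRing.scale /=.
by rewrite /c; field.
Qed.

(** The density satisfies p' = -(x / s^2) p. Integrating this derivative over the line relates the
    moments of orders k - 1 and k + 1. *)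
Let dmoment k x : is_derive x (1:R) (fun x : R => x ^+ k * p x)
   (k%:R * (p x * x ^+ k.-1) - (p x * x ^+ k.+1) / s ^+ 2).
Proof.
have sn0 : s != 0 by rewrite gt_eqF.
have dX : is_derive x (1:R) (fun y : R => y ^+ k) (k%:R * x ^+ k.-1).
  have -> : (fun y : R => y ^+ k) = (id : R -> R) ^+ k.
    by apply/funext => y; rewrite exprfctE.
  by apply: is_derive_eq; rewrite /GRing.scale /= mulr1.
apply: (is_derive_eq (@is_deriveM _ _ _ _ _ _ _ _ dX (dpdf x))); rewrite /GRing.scale /=.
by rewrite (exprS x); field.
Qed.

(** The recursion for k = 0, 1, 3 gives the moments 0, s^2 and 3 s^4 of orders 1, 2, 4. The fourth
    one controls the variance of squared Brownian increments. *)
Lemma normal_moments :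
  [/\ itg (normal_prob 0 s) setT id /\ Rintegral (normal_prob 0 s) setT id = 0,
     itg (normal_prob 0 s) setT (fun x => x ^+ 2) /\
       Rintegral (normal_prob 0 s) setT (fun x => x ^+ 2) = s ^+ 2
   & itg (normal_prob 0 s) setT (fun x => x ^+ 4) /\
       Rintegral (normal_prob 0 s) setT (fun x => x ^+ 4) = 3 * s ^+ 4].
Proof.
have sn0 : s != 0 by rewrite gt_eqF.
have [C hC] := pdf_bound.
have Cg x : C * gbound x <= `|C| * normal_peak (2 * s).
  apply: (@le_trans _ _ (`|C| * gbound x)).
    by rewrite ler_wpM2r ?normal_pdf_ge0 // ler_norm.
  by rewrite ler_wpM2l // normal_pdf_ub // mulf_neq0.
set K := `|C| * normal_peak (2 * s) in Cg.
have bnd k x : (k <= 3)%N -> 0 < `|x| -> `|x ^+ k * p x| <= K / `|x|.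
  move=> k3 x0; rewrite ler_pdivlMr // -normrM.
  have -> : x ^+ k * p x * x = p x * x ^+ k.+1 by rewrite exprS; ring.
  apply: le_trans (Cg x); apply: le_trans (hC x).
  rewrite normrM ger0_norm ?normal_pdf_ge0 // ler_wpM2l ?normal_pdf_ge0 // normrX.
  have x4 : 0 <= x ^+ 4 by rewrite -[x ^+ 4]/(x ^+ (2 * 2)%N) exprM sqr_ge0.
  have [x1|x1] := leP `|x| 1.
    by apply: (@le_trans _ _ 1); [rewrite exprn_ile1|rewrite lerDl].
  apply: (@le_trans _ _ (`|x| ^+ 4)); first by rewrite ler_weXn2l // ltW.
  by rewrite -normrX ger0_norm ?lerDr.
have lim0 (y : nat -> R) k : (k <= 3)%N -> (forall n, `|y n| = n%:R) ->
    (fun n => y n ^+ k * p (y n)) @ \oo --> 0.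
  move=> k3 hy; apply/cvgr0Pnorm_le => e e0.
  have K0 : 0 <= K by rewrite mulr_ge0 ?normal_peak_ge0.
  exists (Num.bound (K / e)).+1 => // n /= hn.
  have n0 : 0 < (n%:R : R) by rewrite ltr0n (leq_ltn_trans _ hn).
  apply: (le_trans (bnd _ _ k3 _)); rewrite hy // ler_pdivrMr // mulrC -ler_pdivrMr //.
  by rewrite (le_trans (ltW (archi_boundP _))) ?divr_ge0 ?ler_nat ?(ltW e0) // ltnW.
have ab1 n : `|n%:R| = n%:R :> R by rewrite ger0_norm.
have ab2 n : `|- n%:R| = n%:R :> R by rewrite normrN ger0_norm.
have cpx k : continuous (fun x : R => p x * x ^+ k).
  move=> x; apply: cvgM; first exact: continuous_normal_pdf.
  exact: exprn_continuous.
(* For k = 0 the predecessor is again 0, but the factor [k%:R] removes that term. *)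
have rec k : (k <= 3)%N -> k%:R * (\int[leb]_x (p x * x ^+ k.-1)) =
    (\int[leb]_x (p x * x ^+ k.+1)) / s ^+ 2.
  move=> k2.
  have i1 : itg leb setT (fun x => p x * x ^+ k.-1) by apply: pdf_itg; lia.
  have i2 : itg leb setT (fun x => p x * x ^+ k.+1) by apply: pdf_itg; lia.
  have := total_derivative (dmoment k) _ _ (lim0 _ _ _ ab1) (lim0 _ _ _ ab2).
  have -> : (\int[leb]_x (k%:R * (p x * x ^+ k.-1) - (p x * x ^+ k.+1) / s ^+ 2)) =
     \int[leb]_x (k%:R * (p x * x ^+ k.-1) - (s ^+ 2)^-1 * (p x * x ^+ k.+1)).
    by apply: E_eq => x _; rewrite [_ / _]mulrC.
  rewrite (EB mT) ?itgZ // !(EZ mT) // => h.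
  apply/eqP; rewrite -subr_eq0 [_ / _]mulrC h //.
  - move=> x; apply: cvgB; apply: cvgM; try exact: cpx; exact: cvg_cst.
  - apply: (itg_eq mT) (itgB mT (itgZ mT _ i1) (itgZ mT (s ^+ 2)^-1 i2)) => x _.
    by rewrite [(s ^+ 2)^-1 * _]mulrC.
have m0 : \int[leb]_x (p x * x ^+ 0) = 1.
  rewrite /Rintegral; have -> : (\int[leb]_x (p x * x ^+ 0)%:E = \int[leb]_x (p x)%:E)%E.
    by apply: eq_integral => x _; rewrite expr0 mulr1.
  by rewrite integral_normal_pdf.
have m2 : \int[leb]_x (p x * x ^+ 2) = s ^+ 2.
  have := rec 1 isT; rewrite m0 mulr1 => /(congr1 (fun z => z * s ^+ 2)).
  by rewrite mul1r divfK // expf_neq0.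
have m4 : \int[leb]_x (p x * x ^+ 4) = 3 * s ^+ 4.
  have := rec 3 isT; rewrite m2 => /(congr1 (fun z => z * s ^+ 2)).
  rewrite divfK ?expf_neq0 // => <-; ring.
have m1 : \int[leb]_x (p x * x ^+ 1) = 0.
  have := rec 0 isT; rewrite mul0r => /esym/eqP.
  by rewrite mulf_eq0 invr_eq0 expf_eq0 /= (negbTE sn0) orbF => /eqP.
split.
- have [|i e] := @normal_itg id _ (@measurable_id _ _ _).
    by apply: (itg_eq mT) (pdf_itg (k := 1) isT) => x _.
  split => //; rewrite e -[RHS]m1; apply: E_eq => x _; by rewrite expr1.
- have [|i e] := @normal_itg (fun x => x ^+ 2) _ (@measurable_funX _ _ _ _ _ _ (@measurable_id _ _ _)).
    exact: pdf_itg.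
  by split => //; rewrite e m2.
- have [|i e] := @normal_itg (fun x => x ^+ 4) _ (@measurable_funX _ _ _ _ _ _ (@measurable_id _ _ _)).
    exact: pdf_itg.
  by split => //; rewrite e m4.
Qed.

End GaussianMoments.

Definition gaussian (R : realType) (s : R) : probability (measurableTypeR R) R :=
  [the probability _ R of normal_prob 0 s].

Lemma gaussian_moments (R : realType) (s : R) : 0 < s ->
  [/\ itg (gaussian s) setT id /\ Rintegral (gaussian s) setT id = 0,
     itg (gaussian s) setT (fun x => x ^+ 2) /\
       Rintegral (gaussian s) setT (fun x => x ^+ 2) = s ^+ 2
   & itg (gaussian s) setT (fun x => x ^+ 4) /\
       Rintegral (gaussian s) setT (fun x => x ^+ 4) = 3 * s ^+ 4].
Proof. exact: normal_moments. Qed.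

(** * Measurability by rounding to grids *)

Section CountableValued.
Context d (T : measurableType d) (R : realType) (C : countType) (D : set T).

Lemma measurable_countable_bigcup (F : C -> set T) :
  (forall c, measurable (F c)) -> measurable (\bigcup_c F c).
Proof.
move=> mF; have -> : \bigcup_c F c = \bigcup_k (if unpickle k is Some c then F c else set0).
  apply/seteqP; split => [x [c _ Fc]|x [k _]]; first by exists (pickle c) => //; rewrite pickleK.
  by case: unpickle => // c Fc; exists c.
by apply: bigcupT_measurable => k; case: unpickle.
Qed.

(** The codomain [C] of [kappa] carries no measurable structure; only the fibres of [kappa] are
    asked to be measurable, and preimages are countable unions of them. *)
Lemma measurable_fun_countable (kappa : T -> C) (g : C -> R) :
  (forall c, measurable (D `&` kappa @^-1` [set c])) -> measurable_fun D (g \o kappa).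
Proof.
move=> mk _ U mU.
have -> : D `&` (g \o kappa) @^-1` U =
    \bigcup_c (if `[< U (g c) >] then D `&` kappa @^-1` [set c] else set0).
  apply/seteqP; split => [x [Dx Ux]|x [c _]].
    by exists (kappa x) => //; rewrite asboolT.
  by case: asboolP => // Uc [Dx /= kx]; split => //=; rewrite kx.
by apply: measurable_countable_bigcup => c; case: ifP.
Qed.

End CountableValued.

Section GridFloor.
Context (R : realType).

Definition gfl (N : nat) (x : R) : R := (Num.floor (N.+1%:R * x))%:~R / N.+1%:R.

Lemma gfl_le N x : gfl N x <= x.
Proof. by rewrite ler_pdivrMr ?ltr0n // mulrC floor_le. Qed.

Lemma gfl_gt N x : x - N.+1%:R^-1 < gfl N x.
Proof.
rewrite ltr_pdivlMr ?ltr0n // mulrBl mulVf ?pnatr_eq0 // mulrC ltrBlDr.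
by have := floorD1_gt (N.+1%:R * x); rewrite intrD.
Qed.

Lemma gfl_cvg x : gfl ^~ x @ \oo --> x.
Proof.
have h : (fun N : nat => x - N.+1%:R^-1) @ \oo --> x.
  rewrite -[X in _ --> X]subr0; apply: cvgB; first exact: cvg_cst.
  exact: cvg_harmonic.
apply: squeeze_cvgr _ h (cvg_cst x).
by apply: nearW => N; rewrite gfl_le ltW // gfl_gt.
Qed.

Lemma measurable_floor_fiber N (k : int) :
  measurable [set x : R | Num.floor (N.+1%:R * x) = k].
Proof.
have -> : [set x : R | Num.floor (N.+1%:R * x) = k] = `[k%:~R / N.+1%:R, (k + 1)%:~R / N.+1%:R[%classic.
  apply/seteqP; split => x /=; rewrite in_itv /= ler_pdivrMr ?ltr_pdivlMr ?ltr0n //.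
    by move=> <-; rewrite [x * _]mulrC floor_le floorD1_gt.
  by rewrite [x * _]mulrC; exact: floor_def.
exact: measurable_itv.
Qed.

End GridFloor.

Section ContinuousComposition.
Context d (T : measurableType d) (R : realType) (n : nat) (D : set T).
Hypothesis mD : measurable D.

Lemma cvg_col (U : Type) (G : set_system U) (FG : Filter G) (V : 'cV[R]_n) (F : U -> 'cV[R]_n) :
  (forall i, (fun k => F k i 0) @ G --> V i 0) -> F @ G --> V.
Proof.
move=> H; apply/cvg_ballP => e e0.
have h : \forall k \near G, forall i : 'I_n, `|V i 0 - F k i 0| < e.
  apply: filter_forall => i; have /cvgrPdist_lt := H i; exact.
by apply: filterS h => k h; split => // i j; rewrite ord1; exact: h.
Qed.

Lemma measurable_continuous_comp (F : R * 'cV[R]_n -> R) (tau : T -> R) (X : T -> 'cV[R]_n) :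
  continuous F -> measurable_fun D tau -> (forall i, measurable_fun D (fun w => X w i 0)) ->
  measurable_fun D (fun w => F (tau w, X w)).
Proof.
move=> cF mt mX.
pose kap N w : int * {ffun 'I_n -> int} := (Num.floor (N.+1%:R * tau w),
   [ffun i => Num.floor (N.+1%:R * X w i 0)]).
pose g N (c : int * {ffun 'I_n -> int}) : R :=
  F (c.1%:~R / N.+1%:R, \col_i ((c.2 i)%:~R / N.+1%:R)).
apply: (@measurable_fun_cvg _ _ _ D (fun N => g N \o kap N)).
  move=> N; apply: measurable_fun_countable => -[a b].
  have -> : D `&` kap N @^-1` [set (a, b)] =
     (D `&` tau @^-1` [set x | Num.floor (N.+1%:R * x) = a]) `&`
     \bigcap_(i : 'I_n) (D `&` (fun w => X w i 0) @^-1` [set x | Num.floor (N.+1%:R * x) = b i]).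
    apply/seteqP; split => w.
      move=> [Dw [<- <-]]; split => // i _; split => //=; by rewrite ffunE.
    move=> [[Dw ta] Hb]; split => //; rewrite /= /kap ta; congr (_, _).
    by apply/ffunP => i; rewrite ffunE; have [_] := Hb i I.
  apply: measurableI; first exact: (mt mD _ (measurable_floor_fiber _ _)).
  apply: fin_bigcap_measurable => // i _.
  exact: (mX i mD _ (measurable_floor_fiber _ _)).
move=> w Dw.
have h : (fun N => (gfl N (tau w), \col_i gfl N (X w i 0))) @ \oo --> (tau w, X w).
  apply: (@cvg_pair _ _ _ _ (nbhs (tau w)) (nbhs (X w))); first exact: gfl_cvg.
  by apply: cvg_col => i; under eq_fun do rewrite mxE; exact: gfl_cvg.
have := cvg_comp _ _ h (cF (tau w, X w)).
apply: cvg_eq => N.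
rewrite /g /kap /= /gfl; congr (F (_, _)); apply/colP => i; by rewrite !mxE ffunE.
Qed.

End ContinuousComposition.

Section Clamp.
Context (R : realType).

(** Retraction of the line onto [a, b]. Composing with it turns a function continuous within the
    segment into one continuous on the whole line, so that end points need no separate treatment. *)
Definition clp (a b x : R) : R := Num.max a (Num.min x b).

Lemma clp_in a b x : a <= b -> a <= clp a b x <= b.
Proof. by move=> ab; rewrite /clp le_max lexx /= ge_max ab ge_min lexx orbT. Qed.

Lemma clp_id a b x : a <= x <= b -> clp a b x = x.
Proof. by move=> /andP[ax xb]; rewrite /clp (min_l xb) (max_r ax). Qed.

Lemma clp_continuous a b : continuous (clp a b).
Proof.
move=> x; apply: (@continuous_max _ R (fun=> a) (fun y => Num.min y b) x).
  exact: cvg_cst.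
by apply: (@continuous_min _ R id (fun=> b) x); [exact: cvg_id|exact: cvg_cst].
Qed.

Lemma within_continuous_comp (S U V : topologicalType) (D : set U) (F : U -> V) (rho : S -> U) :
  {within D, continuous F} -> continuous rho -> (forall x, D (rho x)) ->
  continuous (F \o rho).
Proof.
move=> /subspace_continuousP cF cr Dr x.
have := cF _ (Dr x) => h A nA.
have /= := h _ nA; rewrite /within /= => h2.
have := cr x _ h2; rewrite !nbhs_simpl /=.
by apply: filterS => y; apply.
Qed.

Lemma within_clp (V : topologicalType) a b (f : R -> V) : a <= b ->
  {within `[a, b], continuous f} -> continuous (f \o clp a b).
Proof.
move=> ab cf; apply: (within_continuous_comp cf); first exact: clp_continuous.
by move=> x; rewrite /= in_itv /=; exact: clp_in.
Qed.

End Clamp.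

(** * Brownian filtration and elementary integrals *)

Section Filtration.
Context (R : realType) (d : nat) (B : stoch_base R d) (t T : R).
Hypothesis HB : brownian B t T.
Local Notation P := (Pr B).
Local Notation lm := (leb \x P)%E.
Local Notation "'E[' f ]" := (Rintegral P setT f).

Definition fgen (s : R) : set (set (Omega B)) :=
  [set E | (exists r i U, [/\ t <= r <= s, measurable (U : set R)
                   & E = [set w | U (@W R d B r w i 0)]])
               \/ P.-negligible E].

Lemma filtrationE s : @filtration R d B t s = <<s fgen s >>.
Proof. by []. Qed.

(** Measurability for the generated sigma-algebra in the general sense, so that sums, products and
    limits of adapted variables follow from the general lemmas; [fmeasP] translates to the set-based
    form in which independence is stated. *)
Definition fmeas (s : R) (f : Omega B -> R) :=
  @measurable_fun _ _ (g_sigma_algebraType (fgen s)) R setT f.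

Lemma fmeasP s f : fmeas s f <-> gmeas (@filtration R d B t s) f.
Proof.
split=> [h U mU|h _ U mU]; last by rewrite setTI; exact: h.
by rewrite -[X in filtration _ _ X]setTI; exact: (h mT).
Qed.

(** Completeness of the base is what makes the negligible generators measurable. *)
Lemma filtration_measurable s E : t <= s <= T -> @filtration R d B t s E -> measurable E.
Proof.
move=> /andP[ts sT]; apply: (smallest_sub (@sigma_algebra_measurable _ (Omega B))).
case: HB => cP mW _ _ _ A [[r [i [U [/andP[tr rs] mU ->]]]]|/cP //].
have := @mW r i; rewrite tr (le_trans rs sT) => /(_ isT) h.
by rewrite -[X in measurable X]setTI; exact: h.
Qed.

Lemma filtration_mono r s : r <= s -> @filtration R d B t r `<=` @filtration R d B t s.
Proof.
move=> rs; rewrite !filtrationE; apply: sub_sigma_algebra2 => A [[q [i [U [/andP[tq qr] mU ->]]]]|nA]; last by right.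
by left; exists q, i, U; rewrite tq (le_trans qr rs).
Qed.

Lemma fmeas_mono r s f : r <= s -> fmeas r f -> fmeas s f.
Proof.
by move=> rs /fmeasP h; apply/fmeasP => U mU; exact: filtration_mono rs _ (h _ mU).
Qed.

Lemma fmeas_measurable s f : t <= s <= T -> fmeas s f -> measurable_fun setT f.
Proof.
move=> st /fmeasP h; apply: (gmeas_measurable _ h) => A.
exact: filtration_measurable.
Qed.

Lemma fmeas_W r s i : t <= r <= s -> fmeas s (fun w => @W R d B r w i 0).
Proof.
move=> trs; apply/fmeasP => U mU; apply: sub_gen_smallest; left.
by exists r, i, U.
Qed.

Lemma filtration_negligible s E : P.-negligible E -> @filtration R d B t s E.
Proof. by move=> nE; apply: sub_gen_smallest; right. Qed.

(** The two variables differ on a negligible set, and the augmentation puts every negligible set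
    into each sigma-algebra of the filtration. This is what allows paths to be repaired on null sets
    later. *)
Lemma fmeas_ae s f g : fmeas s f -> {ae P, forall w, f w = g w} -> fmeas s g.
Proof.
move=> /fmeasP mf fg; apply/fmeasP => U mU.
pose N := [set w | f w <> g w].
have nN : P.-negligible N by apply: negligibleS fg => w /= h1 h2; exact: h1.
have sA := smallest_sigma_algebra setT (fgen s).
have mN : @filtration R d B t s N by exact: filtration_negligible.
have mD A C : @filtration R d B t s A -> @filtration R d B t s C -> @filtration R d B t s (A `\` C).
  by move=> mA mC; exact: (@measurableD _ (g_sigma_algebraType (fgen s))).
have mUn A C : @filtration R d B t s A -> @filtration R d B t s C -> @filtration R d B t s (A `|` C).
  by move=> mA mC; exact: (@measurableU _ (g_sigma_algebraType (fgen s))).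
have -> : g @^-1` U = (f @^-1` U `\` N) `|` (N `&` g @^-1` U).
  apply/seteqP; split=> [w /= gU|w /=].
    have [E|E] := pselect (N w); [by right|left; split => //].
    by have -> : f w = g w by apply: contrapT.
  by case=> [[fU nN']|[_ gU]] //; have <- : f w = g w by apply: contrapT.
apply: mUn; first by apply: mD => //; exact: mf.
by apply: filtration_negligible; apply: negligibleS nN => w [].
Qed.

Definition dW r s (i : 'I_d) (w : Omega B) : R := @W R d B s w i 0 - @W R d B r w i 0.

Lemma dWxx r i : dW r r i = fun=> 0.
Proof. by apply/funext => w; rewrite /dW subrr. Qed.

Lemma fmeas_dW r s q i : t <= r <= q -> t <= s <= q -> fmeas q (dW r s i).
Proof. by move=> h1 h2; apply: measurable_funB; exact: fmeas_W. Qed.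

Lemma meas_dW r s i : t <= r <= T -> t <= s <= T -> measurable_fun setT (dW r s i).
Proof. by case: HB => _ mW _ _ _ h1 h2; apply: measurable_funB; exact: mW. Qed.

Section Increment.
Variables (r s : R).
Hypotheses (tr : t <= r) (rs : r <= s) (sT : s <= T).
Let h := s - r.

Let ind2 (lt_rs : r < s) i j : i != j -> forall A (U V : set R),
  @filtration R d B t r A -> measurable U -> measurable V ->
  (P (A `&` (dW r s i @^-1` U `&` dW r s j @^-1` V)) =
   P A * (gaussian (Num.sqrt h) U * gaussian (Num.sqrt h) V))%E.
Proof.
move=> ij A U V mA mU mV; case: HB => _ _ _ _ /(_ r s A
  (fun k => if k == i then U else if k == j then V else setT) tr lt_rs sT mA) H.
have mk k : measurable (if k == i then U else if k == j then V else setT).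
  by case: ifP => // _; case: ifP.
have := H mk; rewrite (bigD1 i) //= eqxx (bigD1 j) ?[j == i]eq_sym ?(negbTE ij) ?eqxx //=.
  rewrite big1 ?mule1 => [<-|k /andP[/negbTE -> /negbTE ->]]; last exact: probability_setT.
  congr (P (A `&` _)); apply/seteqP; split => w /=.
    move=> [Ui Vj] k; case: eqP => [->|_]; first by rewrite !mxE.
    by case: eqP => [->|//]; rewrite !mxE.
  move=> Hk; split; first by have := Hk i; rewrite eqxx !mxE.
  by have := Hk j; rewrite eq_sym (negbTE ij) eqxx !mxE.
Qed.

(** A constant second variable, whose law is the Dirac mass at 0, lets the two-factor independence
    lemma serve for a single increment too. *)
Let zf (w : Omega B) : R := 0.
Let o : measurableTypeR R := (0 : R).

Let ind1 (lt_rs : r < s) i : forall A (U V : set R),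
  @filtration R d B t r A -> measurable U -> measurable V ->
  (P (A `&` (dW r s i @^-1` U `&` zf @^-1` V)) =
   P A * (gaussian (Num.sqrt h) U * (\d_o V)))%E.
Proof.
move=> A U V mA mU mV; case: HB => _ _ _ _ /(_ r s A
  (fun k => if k == i then U else setT) tr lt_rs sT mA) H.
have mk k : measurable (if k == i then U else setT) by case: ifP.
have := H mk; rewrite (bigD1 i) //= eqxx big1 ?mule1 => [|k /negbTE ->]; last exact: probability_setT.
have [V0|V0] := boolP (0 \in V).
  rewrite diracE V0 mule1 => <-; congr (P (A `&` _)); apply/seteqP; split => w /=.
    by move=> [Ui _] k; case: eqP => [->|//]; rewrite !mxE.
  by move=> Hk; split; [have := Hk i; rewrite eqxx !mxE|exact: set_mem].
move=> _; rewrite diracE (negbTE V0) !mule0.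
rewrite (_ : A `&` _ = set0) ?measure0 // -subset0 => w /= [_ [_ V0']].
by move/negP: V0; apply; exact: mem_set.
Qed.

Variable xi : Omega B -> R.
Hypotheses (mxi : fmeas r xi) (ixi : itg P setT xi).

Let sh : 0 < h -> Num.sqrt h ^+ 2 = h. Proof. by move=> h0; rewrite sqr_sqrtr // ltW. Qed.

Let sq0 (lt_rs : r < s) : 0 < Num.sqrt h. Proof. by rewrite sqrtr_gt0 subr_gt0. Qed.

Let mF A : @filtration R d B t r A -> measurable A.
Proof. by apply: filtration_measurable; rewrite tr (le_trans rs). Qed.

Let itgcst (N : probability (measurableTypeR R) R) : itg N setT (fun=> 1) /\ Rintegral N setT (fun=> 1) = 1.
Proof.
split; first exact: finite_measure_integrable_cst.
rewrite /Rintegral integral_cst // mul1e; exact: (congr1 fine (probability_setT N)).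
Qed.

Let single (lt_rs : r < s) i (phi : R -> R) : itg (gaussian (Num.sqrt h)) setT phi ->
  itg P setT (fun w => xi w * phi (dW r s i w)) /\
  E[fun w => xi w * phi (dW r s i w)] = E[xi] * Rintegral (gaussian (Num.sqrt h)) setT phi.
Proof.
move=> iphi.
have tsT : t <= r <= T by rewrite tr (le_trans rs).
have tsT' : t <= s <= T by rewrite sT (le_trans tr).
have := @ind_int _ _ _ P (@filtration R d B t r) (dW r s i) zf
  (gaussian (Num.sqrt h)) \d_o mF (meas_dW i tsT tsT') (measurable_cst _)
  (ind1 lt_rs i) xi phi (fun=> 1).
have [i1 e1] := itgcst \d_o.
move=> /(_ ((fmeasP _ _).1 mxi) ixi iphi i1) [ii ee].
split; first by apply: (itg_eq mT) ii => w _; rewrite mulr1.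
move: ee; rewrite e1 mulr1 => <-; by apply: E_eq => w _; rewrite mulr1.
Qed.

Lemma dW_mean i : itg P setT (fun w => xi w * dW r s i w) /\ E[fun w => xi w * dW r s i w] = 0.
Proof.
(* The law of increments is given for r < s only, a normal law wanting a positive deviation; for r =
   s everything vanishes. *)
have [lt_rs|ge] := ltP r s; last first.
  have -> : s = r by apply/eqP; rewrite eq_le ge.
  rewrite dWxx; split; first by apply: (itg_eq mT) (itg0 _ _) => w _; rewrite mulr0.
  by rewrite -[RHS](E0 P setT); apply: E_eq => w _; rewrite mulr0.
have [[i1 e1] _ _] := gaussian_moments (sq0 lt_rs).
by have [? ->] := single lt_rs i i1; rewrite e1 mulr0.
Qed.

Lemma dW_cov i j : itg P setT (fun w => xi w * (dW r s i w * dW r s j w)) /\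
  E[fun w => xi w * (dW r s i w * dW r s j w)] = (i == j)%:R * h * E[xi].
Proof.
have [lt_rs|ge] := ltP r s; last first.
  rewrite /h; have -> : s = r by apply/eqP; rewrite eq_le ge.
  rewrite !dWxx; split.
    by apply: (itg_eq mT) (itg0 _ _) => w _; rewrite !mulr0.
  by rewrite subrr [in RHS]mulr0 mul0r -[RHS](E0 P setT); apply: E_eq => w _; rewrite !mulr0.
have h0 : 0 < h by rewrite subr_gt0.
have [[i1 e1] [i2 e2] _] := gaussian_moments (sq0 lt_rs).
have [->|ij] := eqVneq i j.
  have [ii ee] := single lt_rs j i2.
  rewrite mul1r; move: ee; rewrite e2 sh // [E[xi] * _]mulrC => ee; split => //.
have tsT : t <= r <= T by rewrite tr (le_trans rs).
have tsT' : t <= s <= T by rewrite sT (le_trans tr).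
have := @ind_int _ _ _ P (@filtration R d B t r) (dW r s i) (dW r s j)
  (gaussian (Num.sqrt h)) (gaussian (Num.sqrt h)) mF (meas_dW i tsT tsT')
  (meas_dW j tsT tsT') (ind2 lt_rs ij) xi id id.
move=> /(_ ((fmeasP _ _).1 mxi) ixi i1 i1) [ii ee].
split; first by apply: (itg_eq mT) ii => w _; rewrite mulrA.
rewrite !mul0r -[RHS](mulr0 (E[xi] * 0)) -{1}e1 -e1 -ee.
by apply: E_eq => w _; rewrite mulrA.
Qed.

(** The centred product has second moment h^2 for distinct coordinates and 3 h^2 - 2 h^2 + h^2 = 2
    h^2 for equal ones, by the fourth Gaussian moment. Terms of order h^2 sum to order h over a
    grid, which is the source of the quadratic variation. *)
Lemma dW_quartic i j :
  itg P setT (fun w => xi w * (dW r s i w * dW r s j w - (i == j)%:R * h) ^+ 2) /\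
  E[fun w => xi w * (dW r s i w * dW r s j w - (i == j)%:R * h) ^+ 2] =
    (1 + (i == j)%:R) * h ^+ 2 * E[xi].
Proof.
have [lt_rs|ge] := ltP r s; last first.
  rewrite /h; have -> : s = r by apply/eqP; rewrite eq_le ge.
  have z w : xi w * (dW r r i w * dW r r j w - (i == j)%:R * (r - r)) ^+ 2 = 0.
    by rewrite !dWxx subrr !mulr0 subrr expr0n mulr0.
  split; first by apply: (itg_eq mT) (itg0 _ _) => w _; rewrite z.
  by rewrite [in RHS]subrr expr0n [in RHS]mulr0 mul0r -[RHS](E0 P setT); apply: E_eq => w _; rewrite z.
have h0 : 0 < h by rewrite subr_gt0.
have [[i1 e1] [i2 e2] [i4 e4]] := gaussian_moments (sq0 lt_rs).
have s4 : Num.sqrt h ^+ 4 = h ^+ 2.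
  by rewrite -[_ ^+ 4]/(Num.sqrt h ^+ (2 * 2)%N) exprM sh.
have [ij|ij] := eqVneq i j.
  rewrite {i}ij; have [ii2 ee2] := single lt_rs j i2; have [ii4 ee4] := single lt_rs j i4.
  have iA := itgB mT ii4 (itgZ mT (2 * h) ii2).
  have iB := itgD mT iA (itgZ mT (h ^+ 2) ixi).
  have eq w : xi w * dW r s j w ^+ 4 - 2 * h * (xi w * dW r s j w ^+ 2) + h ^+ 2 * xi w =
     xi w * (dW r s j w * dW r s j w - 1 * h) ^+ 2 by ring.
  split; first by apply: (itg_eq mT) iB => w _; rewrite -eq.
  transitivity (E[fun w => xi w * dW r s j w ^+ 4 - 2 * h * (xi w * dW r s j w ^+ 2) + h ^+ 2 * xi w]).
    by apply: E_eq => w _; rewrite eq.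
  rewrite (ED mT iA (itgZ mT (h ^+ 2) ixi)).
  rewrite (EB mT ii4 (itgZ mT (2 * h) ii2)).
  rewrite (EZ mT _ ii2) (EZ mT _ ixi) ee2 ee4 e2 e4 s4 sh //.
  have -> : true%:R = 1 :> R by [].
  ring.
have tsT : t <= r <= T by rewrite tr (le_trans rs).
have tsT' : t <= s <= T by rewrite sT (le_trans tr).
have := @ind_int _ _ _ P (@filtration R d B t r) (dW r s i) (dW r s j)
  (gaussian (Num.sqrt h)) (gaussian (Num.sqrt h)) mF (meas_dW i tsT tsT')
  (meas_dW j tsT tsT') (ind2 lt_rs ij) xi (fun x => x ^+ 2) (fun x => x ^+ 2).
move=> /(_ ((fmeasP _ _).1 mxi) ixi i2 i2) [ii ee].
have eq w : xi w * dW r s i w ^+ 2 * dW r s j w ^+ 2 =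
   xi w * (dW r s i w * dW r s j w - 0 * h) ^+ 2 by ring.
split; first by apply: (itg_eq mT) ii => w _; rewrite eq.
transitivity (E[fun w => xi w * dW r s i w ^+ 2 * dW r s j w ^+ 2]).
  by apply: E_eq => w _; rewrite eq.
by rewrite ee e2 sh // addr0 mul1r -mulrA mulrC.
Qed.

End Increment.

(** Left-open in time, so that the bands over consecutive grid cells are disjoint and match the
    left-open cells of simple processes. *)
Definition band (r s : R) : set (R * Omega B) := `]r, s]%classic `*` setT.

Lemma measurable_band r s : measurable (band r s : set (measurableTypeR R * Omega B)).
Proof. exact: measurableX. Qed.

Lemma band_tonelli r s (f : R * Omega B -> R) :
  measurable_fun (band r s : set (measurableTypeR R * Omega B)) f ->
  (forall z, band r s z -> 0 <= f z) ->
  (\int[lm]_(z in band r s) (f z)%:E = \int[leb]_(x in `]r, s]) \int[P]_w (f (x, w))%:E /\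
   \int[lm]_(z in band r s) (f z)%:E = \int[P]_w \int[leb]_(x in `]r, s]) (f (x, w))%:E)%E.
Proof.
move=> mf f0.
have mD := measurable_band r s.
have mg : measurable_fun setT ((EFin \o f) \_ (band r s) : measurableTypeR R * Omega B -> \bar R).
  apply/measurable_restrict => //; rewrite setIidr //; exact/measurable_EFinP.
have g0 z : (0 <= ((EFin \o f) \_ (band r s)) z)%E.
  by rewrite patchE; case: ifPn => // /set_mem/f0; rewrite lee_fin.
split; rewrite integral_mkcond.
  rewrite (fubini_tonelli1 _ mg g0) [RHS]integral_mkcond.
  apply: eq_integral => x _; rewrite /fubini_F patchE.
  case: ifPn => [/set_mem xrs|xrs].
    by apply: eq_integral => w _; rewrite patchE mem_set.
  rewrite -[RHS](integral0 P setT); apply: eq_integral => w _; rewrite patchE memNset //.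
  by case=> /= h _; move/negP: xrs; apply; exact: mem_set.
rewrite (fubini_tonelli2 _ mg g0).
apply: eq_integral => w _; rewrite /fubini_G [RHS]integral_mkcond.
apply: eq_integral => x _; rewrite !patchE.
case: ifPn => [/set_mem [xrs _]|xrs]; first by rewrite mem_set.
by rewrite memNset // => h; move/negP: xrs; apply; exact: mem_set.
Qed.

Lemma band_prod r s a b (h : Omega B -> R) : r <= a -> a <= b -> b <= s ->
  itg P setT h ->
  let f := (fun z : R * Omega B => \1_(`]a, b]%classic) z.1 * h z.2) in
  itg lm (band r s) f /\ Rintegral lm (band r s) f = (b - a) * E[h].
Proof.
move=> ra ab bs ih f.
have mh := itg_meas ih.
have mf (k : Omega B -> R) : measurable_fun setT k ->
    measurable_fun (band r s : set (measurableTypeR R * Omega B))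
     (fun z : R * Omega B => \1_(`]a, b]%classic) z.1 * k z.2).
  move=> mk; apply: measurable_funTS; apply: measurable_funM.
    apply: measurableT_comp; last exact: measurable_fst.
    exact: measurable_indic.
  by apply: measurableT_comp => //; exact: measurable_snd.
have ge k : itg P setT k -> (forall w, 0 <= k w) ->
    let f := (fun z : R * Omega B => \1_(`]a, b]%classic) z.1 * k z.2) in
    itg lm (band r s) f /\ Rintegral lm (band r s) f = (b - a) * E[k].
  move=> ik k0 g.
  have mg := mf _ (itg_meas ik).
  have g0 z : 0 <= g z by rewrite mulr_ge0.
  have e : (\int[lm]_(z in band r s) (g z)%:E = ((b - a) * E[k])%:E)%E.
    have [-> _] := band_tonelli mg (fun z _ => g0 z).
    under eq_integral => x _ do
      rewrite (EFin_E mT (itgZ mT (\1_(`]a, b]%classic) x) ik))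
        (EZ mT _ ik) mulrC EFinM.
    rewrite ge0_integralZl //.
    - rewrite integral_indic // setIidl; last first.
        by move=> x /=; rewrite !in_itv /= => /andP[/(le_lt_trans ra) -> /le_trans ->].
      have L : leb `]a, b]%classic = (b - a)%:E.
        by rewrite lebesgue_measure_itv /= lte_fin; case: ltgtP ab => // -> _; rewrite subrr.
      transitivity ((E[k])%:E * leb `]a, b]%classic)%E => //.
      by rewrite L -EFinM mulrC.
    - by apply/measurable_EFinP; exact: measurable_indic.
    - by rewrite lee_fin; apply: E_ge0 => w _.
  split; last by rewrite /Rintegral e.
  by apply: itg_ge0P => //; rewrite e ltry.
pose hp w := Num.max (h w) 0; pose hn w := Num.max (- h w) 0.
have Eh w : h w = hp w - hn w.
  by rewrite /hp /hn; case: (leP (h w) 0) => k1; case: (leP (- h w) 0) => k2; lra.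
have hp0 w : 0 <= hp w by rewrite /hp le_max lexx orbT.
have hn0 w : 0 <= hn w by rewrite /hn le_max lexx orbT.
have ip : itg P setT hp.
  apply: (itg_le mT _ (itg_abs ih)) => [|w _]; first exact: measurable_maxr.
  by rewrite ger0_norm // /hp ge_max normr_ge0 ler_norm.
have iN : itg P setT hn.
  apply: (itg_le mT _ (itg_abs ih)) => [|w _].
    by apply: measurable_maxr => //; exact: measurableT_comp.
  by rewrite ger0_norm // /hn ge_max normr_ge0 -normrN ler_norm.
have [i1 e1] := ge _ ip hp0; have [i2 e2] := ge _ iN hn0.
have mD := measurable_band r s.
split.
  by apply: (itg_eq mD) (itgB mD i1 i2) => z _; rewrite /f Eh mulrBr.
transitivity ((b - a) * E[hp] - (b - a) * E[hn]).
  by rewrite -e1 -e2 -(EB mD) //; apply: E_eq => z _; rewrite /f Eh mulrBr.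
by rewrite -mulrBr -(EB mT) //; congr (_ * _); apply: E_eq => w _; rewrite -Eh.
Qed.

Definition L2F (r : R) f := fmeas r f /\ L2 P setT f.

(** In contrast to [simple_process], an integrand is a list of separate pieces: intervals may
    overlap, each piece drives a single Brownian coordinate, and coefficients are square integrable.
    Sums are then concatenations, and bilinear identities reduce to pairs of pieces. *)
Record elem := Elem { ea : R; eb : R; ei : 'I_d; ec : Omega B -> R }.

Definition elem_wf (r s : R) (e : elem) :=
  [/\ r <= ea e, ea e <= eb e, eb e <= s & L2F (ea e) (ec e)].

Definition elem_val (e : elem) (i : 'I_d) (z : R * Omega B) : R :=
  (i == ei e)%:R * (\1_(`]ea e, eb e]%classic) z.1 * ec e z.2).

Definition elem_int (e : elem) (w : Omega B) : R :=
  ec e w * dW (ea e) (eb e) (ei e) w.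

Definition vals (l : seq elem) i z := \sum_(e <- l) elem_val e i z.
Definition ints (l : seq elem) w := \sum_(e <- l) elem_int e w.

Section Interval.
Variables (r s : R).
Hypotheses (tr : t <= r) (sT : s <= T).

Let fM a f g : fmeas a f -> fmeas a g -> fmeas a (fun w => f w * g w).
Proof. exact: measurable_funM. Qed.

Lemma elem_int_L2 e : elem_wf r s e -> L2 P setT (elem_int e).
Proof.
move=> [ra ab bs [mc lc]].
have ta := le_trans tr ra; have bT := le_trans bs sT.
have [i1 _] := dW_cov ta ab bT (fM mc mc) (itgM mT lc lc) (ei e) (ei e).
split; last by apply: (itg_eq mT) i1 => w _; rewrite /elem_int; ring.
apply: measurable_funM; first exact: L2_meas lc.
by apply: meas_dW; rewrite ?ta ?(le_trans ab) ?(le_trans ta).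
Qed.

Lemma elem_mean e xi : elem_wf r s e -> L2F r xi -> E[fun w => xi w * elem_int e w] = 0.
Proof.
move=> [ra ab bs [mc lc]] [mx lx].
have ta := le_trans tr ra; have bT := le_trans bs sT.
have [_ <-] := dW_mean ta ab bT (fM (fmeas_mono ra mx) mc) (itgM mT lx lc) (ei e).
by apply: E_eq => w _; rewrite /elem_int mulrA.
Qed.

Definition overlap e e' : R := Num.max 0 (Num.min (eb e) (eb e') - Num.max (ea e) (ea e')).

(** By symmetry [e] starts first. If it ends before [e'] starts, the later increment is centred
    given the past. Otherwise both are cut at [ea e'] and at the earlier end: the common part
    contributes its covariance, and every other product either contains an increment lying after all
    its other factors or vanishes. *)
Lemma elem_int_ip e e' : elem_wf r s e -> elem_wf r s e' ->
  E[fun w => elem_int e w * elem_int e' w] =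
  (ei e == ei e')%:R * overlap e e' * E[fun w => ec e w * ec e' w].
Proof.
wlog aa : e e' / ea e <= ea e'.
  move=> H we we'; have [aa|/ltW aa] := leP (ea e) (ea e'); first exact: H.
  transitivity (E[fun w => elem_int e' w * elem_int e w]).
    by apply: E_eq => w _; rewrite mulrC.
  rewrite H // eq_sym /overlap minC [Num.max (ea e') _]maxC; congr (_ * _).
  by apply: E_eq => w _; rewrite mulrC.
move=> we we'; have [ra ab bs [mc lc]] := we; have [ra' ab' bs' [mc' lc']] := we'.
have ta := le_trans tr ra; have bT := le_trans bs sT.
have ta' := le_trans tr ra'; have bT' := le_trans bs' sT.
have Le := elem_int_L2 we; have Le' := elem_int_L2 we'.
have [ba|ab2] := leP (eb e) (ea e').
  have mx : fmeas (ea e') (elem_int e).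
    apply: fM; first exact: fmeas_mono mc.
    by apply: fmeas_dW; rewrite ?ta ?(le_trans ta) //= (le_trans ab).
  have -> : overlap e e' = 0.
    by rewrite /overlap (max_r aa) (min_l (le_trans ba ab')) max_l // subr_le0.
  rewrite mulr0 mul0r.
  have [_ <-] := dW_mean ta' ab' bT' (fM mx mc') (itgM mT Le lc') (ei e').
  by apply: E_eq => w _; rewrite mulrA.
pose m := Num.min (eb e) (eb e').
have am : ea e' <= m by rewrite le_min (ltW ab2).
have mb : m <= eb e by rewrite ge_min lexx.
have mb' : m <= eb e' by rewrite ge_min lexx orbT.
have tm := le_trans ta' am; have mT0 := le_trans mb bT.
pose u w := ec e w * ec e' w.
have mu_ : fmeas (ea e') u by apply: fM => //; exact: fmeas_mono mc.
have iu : itg P setT u by exact: itgM.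
(* split [ea e, eb e] at [ea e'] and [m], and [ea e', eb e'] at [m] *)
have E1 w : elem_int e w * elem_int e' w =
   ec e w * dW (ea e) (ea e') (ei e) w * ec e' w * dW (ea e') (eb e') (ei e') w +
   (u w * (dW (ea e') m (ei e) w * dW (ea e') m (ei e') w) +
   (u w * dW (ea e') m (ei e) w * dW m (eb e') (ei e') w +
   (u w * dW (ea e') m (ei e') w * dW m (eb e) (ei e) w +
    u w * dW m (eb e) (ei e) w * dW m (eb e') (ei e') w))).
  by rewrite /elem_int /u /dW; ring.
have wA : elem_wf r s (Elem (ea e) (ea e') (ei e) (ec e)).
  by split => //=; exact: le_trans ab' bs'.
have LA := elem_int_L2 wA.
have mA : fmeas (ea e') (fun w => ec e w * dW (ea e) (ea e') (ei e) w).
  apply: fM; first exact: fmeas_mono mc.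
  by apply: fmeas_dW; rewrite ?ta ?lexx ?ta'.
have [iA eA] := dW_mean ta' ab' bT' (fM mA mc') (itgM mT LA lc') (ei e').
have [iB eB] := dW_cov ta' am mT0 mu_ iu (ei e) (ei e').
have iC0 i : itg P setT (fun w => u w * dW (ea e') m i w) /\ fmeas m (fun w => u w * dW (ea e') m i w).
  split; first by have [] := dW_mean ta' am mT0 mu_ iu i.
  apply: fM; first exact: fmeas_mono mu_.
  by apply: fmeas_dW; rewrite ?ta' ?tm ?lexx.
have [iC eC] := dW_mean tm mb' bT' (iC0 (ei e)).2 (iC0 (ei e)).1 (ei e').
have [iD eD] := dW_mean tm mb bT (iC0 (ei e')).2 (iC0 (ei e')).1 (ei e).
(* one of the two leftover increments vanishes *)
have [iF eF] : itg P setT (fun w => u w * dW m (eb e) (ei e) w * dW m (eb e') (ei e') w) /\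
   E[fun w => u w * dW m (eb e) (ei e) w * dW m (eb e') (ei e') w] = 0.
  have z : (forall w, u w * dW m (eb e) (ei e) w * dW m (eb e') (ei e') w = 0).
    move=> w; rewrite /m; case: (leP (eb e) (eb e')) => _; rewrite dWxx ?mulr0 //.
    by rewrite mul0r.
  split; first by apply: (itg_eq mT) (itg0 _ _) => w _; rewrite z.
  by rewrite -[RHS](E0 P setT); apply: E_eq => w _; rewrite z.
have iDF := itgD mT iD iF.
have iCDF := itgD mT iC iDF.
have iBCDF := itgD mT iB iCDF.
under eq_Rintegral do rewrite E1.
rewrite (ED mT iA iBCDF) (ED mT iB iCDF) (ED mT iC iDF).
rewrite (ED mT iD iF) eA eB eC eD eF add0r !addr0.
congr (_ * _ * _); rewrite /overlap (max_r aa) max_r // subr_ge0 //.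
Qed.

Lemma elem_val_ip e e' i : elem_wf r s e -> elem_wf r s e' ->
  itg lm (band r s) (fun z => elem_val e i z * elem_val e' i z) /\
  Rintegral lm (band r s) (fun z => elem_val e i z * elem_val e' i z) =
  (i == ei e)%:R * ((i == ei e')%:R * (overlap e e' * E[fun w => ec e w * ec e' w])).
Proof.
move=> we we'; have [ra ab bs [mc lc]] := we; have [ra' ab' bs' [mc' lc']] := we'.
have mD := measurable_band r s.
(* The outer maximum makes ]A, C] empty when the supports are disjoint, so that [band_prod] covers
   both cases. *)
pose A := Num.max (ea e) (ea e'); pose C := Num.max A (Num.min (eb e) (eb e')).
have iu := itgM mT lc lc'.
have h1 : r <= A by rewrite le_max ra.
have h2 : A <= C by rewrite le_max lexx.
have h3 : C <= s.
  by rewrite /C /A !ge_max ge_min bs (le_trans ab bs) (le_trans ab' bs').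
have [iP eP] := band_prod h1 h2 h3 iu.
have EE z : elem_val e i z * elem_val e' i z = (i == ei e)%:R * ((i == ei e')%:R *
   (\1_(`]A, C]%classic) z.1 * (ec e z.2 * ec e' z.2))).
  rewrite /elem_val; have -> : \1_(`]A, C]%classic) z.1 =
     \1_(`]ea e, eb e]%classic) z.1 * \1_(`]ea e', eb e']%classic) z.1 :> R.
    rewrite !indicE -natrM mulnb; congr (_%:R); congr nat_of_bool.
    apply/idP/idP.
      move/set_mem; rewrite /= in_itv /= /C le_max => /andP[h /orP[|]].
        by move/(lt_le_trans h); rewrite ltxx.
      move: h; rewrite /A gt_max => /andP[h h']; rewrite le_min => /andP[k k'].
      by rewrite !mem_set //= in_itv /= ?h ?h' ?k ?k'.
    move=> /andP[/set_mem + /set_mem]; rewrite /= !in_itv /= => /andP[h k] /andP[h' k'].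
    by apply/mem_set; rewrite /= in_itv /= /A /C gt_max h h' le_max le_min k k' orbT.
  ring.
have iQ := itgZ mD (i == ei e)%:R (itgZ mD (i == ei e')%:R iP).
split; first by apply: (itg_eq mD) iQ => z _; rewrite EE.
under eq_Rintegral do rewrite EE.
rewrite (EZ mD) ?(itgZ mD) // (EZ mD) // eP.
congr (_ * (_ * (_ * _))); rewrite /overlap -/A /C.
by case: (leP A (Num.min (eb e) (eb e'))) => h; [rewrite max_r // subr_ge0|rewrite subrr max_l // subr_le0 ltW].
Qed.

Lemma elem_val_L2 e i : elem_wf r s e -> L2 lm (band r s) (elem_val e i).
Proof.
move=> we; have [ra ab bs [mc lc]] := we.
have [h _] := elem_val_ip i we we.
split; last by apply: (itg_eq (measurable_band r s)) h => z _; rewrite expr2.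
apply: measurable_funTS; apply: measurable_funM; first exact: measurable_cst.
apply: measurable_funM.
  apply: measurableT_comp; last exact: measurable_fst.
  exact: measurable_indic.
by apply: measurableT_comp; [exact: L2_meas lc|exact: measurable_snd].
Qed.

Lemma ints_L2 l : List.Forall (elem_wf r s) l -> L2 P setT (ints l).
Proof.
elim: l => [|e l IH] H.
  by apply: (L2_eq mT) (L2_0 _ mT) => w _; rewrite /ints big_nil.
have [we wl] := (List.Forall_inv H, List.Forall_inv_tail H).
apply: (L2_eq mT) (L2D mT (elem_int_L2 we) (IH wl)) => w _.
by rewrite /ints big_cons.
Qed.

Lemma vals_L2 l i : List.Forall (elem_wf r s) l -> L2 lm (band r s) (vals l i).
Proof.
have mD := measurable_band r s.
elim: l => [|e l IH] H.
  by apply: (L2_eq mD) (L2_0 _ mD) => w _; rewrite /vals big_nil.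
have [we wl] := (List.Forall_inv H, List.Forall_inv_tail H).
apply: (L2_eq mD) (L2D mD (elem_val_L2 i we) (IH wl)) => w _.
by rewrite /vals big_cons.
Qed.

Lemma ints_mean l xi : List.Forall (elem_wf r s) l -> L2F r xi ->
  E[fun w => xi w * ints l w] = 0.
Proof.
move=> + Lx; elim: l => [|e l IH] H.
  by rewrite -[RHS](E0 P setT); apply: E_eq => w _; rewrite /ints big_nil mulr0.
have [we wl] := (List.Forall_inv H, List.Forall_inv_tail H).
transitivity (E[fun w => xi w * elem_int e w + xi w * ints l w]).
  by apply: E_eq => w _; rewrite /ints big_cons mulrDr.
rewrite (ED mT) ?elem_mean ?IH ?addr0 //; apply: itgM => //.
- by case: Lx.
- exact: elem_int_L2.
- by case: Lx.
- exact: ints_L2.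
Qed.

Lemma elem_isometry e e' : elem_wf r s e -> elem_wf r s e' ->
  E[fun w => elem_int e w * elem_int e' w] =
  \sum_i Rintegral lm (band r s) (fun z => elem_val e i z * elem_val e' i z).
Proof.
move=> we we'; rewrite elem_int_ip // (bigD1 (ei e)) //= big1 ?addr0.
  have [_ ->] := elem_val_ip (ei e) we we'.
  by rewrite eqxx mul1r mulrA.
move=> i /negbTE ie; have [_ ->] := elem_val_ip i we we'.
by rewrite ie mul0r.
Qed.

Lemma ints_isometry l l' : List.Forall (elem_wf r s) l -> List.Forall (elem_wf r s) l' ->
  E[fun w => ints l w * ints l' w] =
  \sum_i Rintegral lm (band r s) (fun z => vals l i z * vals l' i z).
Proof.
have mD := measurable_band r s.
move=> + Hl'; elim: l => [|e l IH] H.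
  rewrite big1 => [|i _].
    by rewrite -[RHS](E0 P setT); apply: E_eq => w _; rewrite /ints big_nil mul0r.
  by rewrite -[RHS](E0 lm (band r s)); apply: E_eq => w _; rewrite /vals big_nil mul0r.
have [we wl] := (List.Forall_inv H, List.Forall_inv_tail H).
have Le := elem_int_L2 we; have LI := ints_L2 wl; have LI' := ints_L2 Hl'.
transitivity (E[fun w => elem_int e w * ints l' w + ints l w * ints l' w]).
  by apply: E_eq => w _; rewrite /ints big_cons mulrDl.
rewrite (ED mT (itgM mT Le LI') (itgM mT LI LI')) (IH wl).
have -> : E[fun w => elem_int e w * ints l' w] =
    \sum_i Rintegral lm (band r s) (fun z => elem_val e i z * vals l' i z).
  elim: l' Hl' {LI' IH} => [|e' l' IH'] H'.
    rewrite big1 => [|i _].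
      by rewrite -[RHS](E0 P setT); apply: E_eq => w _; rewrite /ints big_nil mulr0.
    by rewrite -[RHS](E0 lm (band r s)); apply: E_eq => w _; rewrite /vals big_nil mulr0.
  have [we' wl'] := (List.Forall_inv H', List.Forall_inv_tail H').
  have Le' := elem_int_L2 we'; have LI' := ints_L2 wl'.
  transitivity (E[fun w => elem_int e w * elem_int e' w + elem_int e w * ints l' w]).
    by apply: E_eq => w _; rewrite /ints big_cons mulrDr.
  rewrite (ED mT (itgM mT Le Le') (itgM mT Le LI')) (IH' wl').
  rewrite elem_isometry // -big_split; apply: eq_bigr => i _ /=.
  rewrite -(ED mD (itgM mD (elem_val_L2 i we) (elem_val_L2 i we'))
    (itgM mD (elem_val_L2 i we) (vals_L2 i wl'))).
  by apply: E_eq => z _; rewrite /vals big_cons mulrDr.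
rewrite -big_split; apply: eq_bigr => i _ /=.
rewrite -(ED mD (itgM mD (elem_val_L2 i we) (vals_L2 i Hl'))
    (itgM mD (vals_L2 i wl) (vals_L2 i Hl'))).
by apply: E_eq => z _; rewrite /vals big_cons mulrDl.
Qed.

(* [isint Z xi]: the random variable xi is the Ito integral of Z over ]r, s] *)
Definition isint (Z : 'I_d -> R * Omega B -> R) (xi : Omega B -> R) :=
  exists l : nat -> seq elem,
    [/\ forall k, List.Forall (elem_wf r s) (l k),
       forall i, L2cv lm (band r s) (fun k => vals (l k) i) (Z i)
     & L2cv P setT (fun k => ints (l k)) xi].

Lemma isint_L2 Z xi : isint Z xi -> L2 P setT xi /\ forall i, L2 lm (band r s) (Z i).
Proof. by move=> [l [_ hZ [_ Lx _]]]; split => // i; case: (hZ i). Qed.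

Lemma isint_isometry Z xi Z' xi' : isint Z xi -> isint Z' xi' ->
  E[fun w => xi w * xi' w] =
  \sum_i Rintegral lm (band r s) (fun z => Z i z * Z' i z).
Proof.
move=> [l [wl cZ cx]] [l' [wl' cZ' cx']].
have := L2cv_ip mT cx cx'.
have -> : (fun k => E[fun w => ints (l k) w * ints (l' k) w]) =
   (fun k => \sum_i Rintegral lm (band r s) (fun z => vals (l k) i z * vals (l' k) i z)).
  by apply/funext => k; exact: ints_isometry.
move=> h; apply: cvg_unique h _ => //.
apply: cvg_sumF => i; exact: (L2cv_ip (measurable_band r s) (cZ i) (cZ' i)).
Qed.

(** The martingale property in the form used throughout: a square integrable factor known at the
    initial time takes the place of conditional expectation. *)
Lemma isint_mean Z xi eta : isint Z xi -> L2F r eta -> E[fun w => eta w * xi w] = 0.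
Proof.
move=> [l [wl cZ cx]] Le.
have := L2cv_ip mT (L2cv_cst Le.2) cx.
have -> : (fun k => E[fun w => eta w * ints (l k) w]) = (fun=> 0).
  by apply/funext => k; exact: ints_mean.
by move=> h; apply: cvg_unique h _ => //; exact: cvg_cst.
Qed.

Lemma isintD Z xi Z' xi' : isint Z xi -> isint Z' xi' ->
  isint (fun i z => Z i z + Z' i z) (fun w => xi w + xi' w).
Proof.
move=> [l [wl cZ cx]] [l' [wl' cZ' cx']].
exists (fun k => l k ++ l' k); split => [k|i|].
- by apply/List.Forall_app.
- have -> : (fun k => vals (l k ++ l' k) i) = (fun k z => vals (l k) i z + vals (l' k) i z).
    by apply/funext => k; apply/funext => z; rewrite /vals big_cat.
  exact: (L2cvD (measurable_band r s)).
- have -> : (fun k => ints (l k ++ l' k)) = (fun k z => ints (l k) z + ints (l' k) z).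
    by apply/funext => k; apply/funext => z; rewrite /ints big_cat.
  exact: (L2cvD mT).
Qed.

Lemma isintN Z xi : isint Z xi -> isint (fun i z => - Z i z) (fun w => - xi w).
Proof.
move=> [l [wl cZ cx]].
pose neg e := Elem (ea e) (eb e) (ei e) (fun w => -1 * ec e w).
exists (fun k => map neg (l k)); split => [k|i|].
- elim: (wl k) => [|e l' [ra ab bs [mc lc]] _ IH]; constructor => //.
  split => //=; split; last exact: (L2Z mT).
  by apply: measurable_funM => //; exact: measurable_cst.
- have -> : (fun k => vals (map neg (l k)) i) = (fun k z => -1 * vals (l k) i z).
    apply/funext => k; apply/funext => z; rewrite /vals big_map mulr_sumr.
    by apply: eq_bigr => e _; rewrite /elem_val /=; ring.
  have -> : (fun z => - Z i z) = (fun z => -1 * Z i z) by apply/funext => z; rewrite mulN1r.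
  exact: (L2cvZ (measurable_band r s)).
- have -> : (fun k => ints (map neg (l k))) = (fun k z => -1 * ints (l k) z).
    apply/funext => k; apply/funext => z; rewrite /ints big_map mulr_sumr.
    by apply: eq_bigr => e _; rewrite /elem_int /=; ring.
  have -> : (fun z => - xi z) = (fun z => -1 * xi z) by apply/funext => z; rewrite mulN1r.
  exact: (L2cvZ mT).
Qed.

Lemma isint_norm Z xi : isint Z xi ->
  E[fun w => xi w ^+ 2] = \sum_i Rintegral lm (band r s) (fun z => Z i z ^+ 2).
Proof.
move=> h; rewrite (_ : E[_] = E[fun w => xi w * xi w]); last exact: E_eq.
by rewrite (isint_isometry h h); apply: eq_bigr => i _; exact: E_eq.
Qed.

Lemma isint_ae Z xi Z' xi' : isint Z xi ->
  measurable_fun setT xi' -> {ae P, forall w, xi w = xi' w} ->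
  (forall i, measurable_fun (band r s : set (measurableTypeR R * Omega B)) (Z' i)) ->
  (forall i, {ae lm, forall z, band r s z -> Z i z = Z' i z}) ->
  isint Z' xi'.
Proof.
have mD := measurable_band r s.
move=> [l [wl cZ cx]] mx xx mZ ZZ.
have tr_cv d' (X : measurableType d') (m : {measure set X -> \bar R}) (D : set X) (F : nat -> X -> R) f g :
    measurable D -> measurable_fun D g -> {ae m, forall x, D x -> f x = g x} ->
    L2cv m D F f -> L2cv m D F g.
  move=> mD' mg fg [LF Lf cv].
  have [Lg _] := L2_ae mD' mg fg Lf.
  split => //; apply: cvg_trans cv; apply: near_eq_cvg; apply: nearW => k.
  have mFg : measurable_fun D (fun x => F k x - g x).
    by apply: measurable_funB => //; case: (LF k).
  have [] // := L2_ae mD' mFg _ (L2B mD' (LF k) Lf).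
  by apply: filterS fg => x + Dx => /(_ Dx) ->.
exists l; split => // [i|]; first exact: tr_cv (cZ i).
by apply: (tr_cv _ _ _ _ _ _ _ mT mx _ cx); apply: filterS xx => w ->.
Qed.

End Interval.

(** * Progressive measurability *)

Definition rgen (s : R) : set (set (R * Omega B)) :=
  [set Q : set (R * Omega B) | exists I E,
     [/\ measurable (I : set R), @filtration R d B t s E & Q = I `*` E] ].

Let K s := g_sigma_algebraType (rgen s).

(** The subsets of the product whose section at time [s] lies in the filtration form a
    sigma-algebra, and it contains the generating rectangles. *)
Lemma progressive_fmeas (Y : R -> Omega B -> R) s : t <= s <= T ->
  progressive t T Y -> fmeas s (Y s).
Proof.
move=> /[dup] st /andP[ts sT] pY; apply/fmeasP => U mU.
pose H : set (set (R * Omega B)) := [set A | @filtration R d B t s [set w | A (s, w)]].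
have := pY s U st mU.
have sub : <<s rgen s >> `<=` H.
  apply: smallest_sub.
    split.
    - rewrite /H /=; exact: (@measurable0 _ (g_sigma_algebraType (@fgen s))).
    - move=> A hA; rewrite /H /= (_ : [set w | _] = ~` [set w | A (s, w)]); last first.
        by apply/seteqP; split => w /=; [case|split].
      exact: (@measurableC _ (g_sigma_algebraType (@fgen s))).
    - move=> F hF; rewrite /H /=.
      exact: (@bigcupT_measurable _ (g_sigma_algebraType (@fgen s)) (fun k => [set w | F k (s, w)])).
  move=> _ [I [E [mI mE ->]]]; rewrite /H /=.
  have [Is|Is] := pselect (I s).
    rewrite (_ : [set w | _] = E) //; apply/seteqP; split => w /=; first by case.
    by split.
  rewrite (_ : [set w | _] = set0); first exact: (@measurable0 _ (g_sigma_algebraType (@fgen s))).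
  by rewrite -subset0 => w /= [].
move=> /sub; rewrite /H /=; congr (@filtration R d B t s _).
by apply/seteqP; split => w /=; [case|rewrite ts lexx].
Qed.

Lemma progressive_measurable (Y : R -> Omega B -> R) (D : set (R * Omega B)) :
  progressive t T Y -> t <= T ->
  measurable (D : set (measurableTypeR R * Omega B)) ->
  (forall z, D z -> t <= z.1 <= T) ->
  measurable_fun (D : set (measurableTypeR R * Omega B)) (fun z => Y z.1 z.2).
Proof.
move=> pY tT mD DT _ U mU.
have tTT : t <= T <= T by rewrite tT lexx.
pose H : set (set (R * Omega B)) := [set A | measurable (A : set (measurableTypeR R * Omega B))].
have sub : <<s rgen T >> `<=` H.
  apply: smallest_sub; first exact: sigma_algebra_measurable.
  move=> _ [I [E [mI mE ->]]]; rewrite /H /=; apply: measurableX => //.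
  exact: (filtration_measurable tTT).
rewrite (_ : D `&` _ = D `&` [set z | t <= z.1 <= T /\ U (Y z.1 z.2)]).
  by apply: measurableI => //; exact: sub (pY T U tTT mU).
by apply/seteqP; split => z /= [Dz h]; split => //; [split => //; exact: DT|case: h].
Qed.

(** Time is rounded down to a grid, though not below [t]. A time rounded down from [t, s] is at most
    [s], so the sampled value is known at [s]; continuity of the paths gives the limit. *)
Lemma continuous_adapted_progressive (Y : R -> Omega B -> R) :
  (forall s, t <= s <= T -> fmeas s (Y s)) ->
  (forall w, {within `[t, T], continuous (fun s => Y s w)}) ->
  progressive t T Y.
Proof.
move=> aY cY s U /[dup] st /andP[ts sT] mU.
pose Dm : set (K s) := [set z | t <= z.1 <= s].
have rectK I E : measurable (I : set R) -> @filtration R d B t s E -> measurable (I `*` E : set (K s)).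
  by move=> mI mE; apply: sub_sigma_algebra; exists I, E.
have FT : @filtration R d B t s setT by exact: (@mT _ (g_sigma_algebraType (@fgen s))).
have mDm : measurable Dm.
  rewrite (_ : Dm = `[t, s]%classic `*` setT); first exact: rectK.
  by apply/seteqP; split => z /=; rewrite /Dm /= in_itv //= => -[].
have key : measurable_fun Dm (fun z : K s => Y z.1 z.2).
  pose gam N (r : R) := Num.max t (gfl N r).
  apply: (@measurable_fun_cvg _ _ _ Dm (fun N (z : K s) => Y (gam N z.1) z.2)).
    move=> N _ V mV.
    pose gk (k : int) : R := Num.max t (k%:~R / N.+1%:R).
    (* Cells whose rounded time exceeds [s] do not meet the domain. They are sent to the empty set,
       because the value of [Y] there need not be known at [s]. *)
    have -> : Dm `&` (fun z : K s => Y (gam N z.1) z.2) @^-1` V =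
       \bigcup_(k : int) (if gk k <= s then
         ((`[t, s]%classic `&` [set x | Num.floor (N.+1%:R * x) = k]) `*` (Y (gk k) @^-1` V))
         else set0).
      apply/seteqP; split => [[r w] [/= trs VY]|[r w] [k _]].
        exists (Num.floor (N.+1%:R * r)) => //=.
        have -> : gk (Num.floor (N.+1%:R * r)) = gam N r by [].
        rewrite ifT; first by split => //=; rewrite in_itv.
        by rewrite /gam ge_max ts (le_trans (gfl_le _ _)) //; case/andP: trs.
      case: ifP => // ks [[/= + kr] VY]; rewrite in_itv /= => trs; split => //=.
      by rewrite /gam /gfl kr.
    apply: measurable_countable_bigcup => k; case: ifP => // ks.
    apply: rectK; first by apply: measurableI => //; exact: measurable_floor_fiber.
    have tk : t <= gk k <= T by rewrite le_max lexx (le_trans ks).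
    by apply: (filtration_mono ks); have /fmeasP := aY _ tk; apply.
  move=> [r w] /= /andP[tr rs].
  have tT := le_trans ts sT.
  have rT : t <= r <= T by rewrite tr (le_trans rs).
  have h : gam ^~ r @ \oo --> r.
    have hc : continuous (fun x : R => Num.max t x).
      by move=> x; apply: (@continuous_max _ R (fun=> t) id x); [exact: cvg_cst|exact: cvg_id].
    by have := cvg_comp _ _ (@gfl_cvg R r) (hc r); rewrite (max_r tr); exact.
  have cYc : continuous ((Y ^~ w) \o clp t T) by exact: within_clp.
  have := cvg_comp _ _ h (cYc r).
  rewrite /= clp_id //; apply: cvg_eq => N /=.
  rewrite clp_id // /gam le_max lexx /= ge_max tT (le_trans (gfl_le _ _)) //.
  exact: le_trans sT.
have := key mDm U mU.
rewrite (_ : Dm `&` _ = [set z | t <= z.1 <= s /\ U (Y z.1 z.2)]) //.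
Qed.

End Filtration.

Local Notation mband f r s := (measurable_fun (@band _ _ _ r s : set (measurableTypeR _ * Omega _)) f).

Lemma within_clp_inv (R : realType) (V : topologicalType) a b (f : R -> V) : a <= b ->
  continuous (f \o clp a b) -> {within `[a, b], continuous f}.
Proof.
move=> ab cf; apply: (@subspace_eq_continuous _ _ _ (f \o clp a b)).
  by move=> x /set_mem /=; rewrite in_itv /= => xab; rewrite clp_id.
exact: continuous_subspaceT.
Qed.

Lemma cvg_sqrt0 (R : realType) (u : nat -> R) : u @ \oo --> 0 -> (fun k => Num.sqrt (u k)) @ \oo --> 0.
Proof. by move=> cu; have := cvg_comp _ _ cu (@sqrt_continuous R 0); rewrite sqrtr0. Qed.

Lemma clp_mono (R : realType) (a b x y : R) : x <= y -> clp a b x <= clp a b y.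
Proof. by move=> xy; rewrite /clp ge_max !le_max lexx /= le_min !ge_min xy lexx !orbT. Qed.

Lemma L2_sub d (T : measurableType d) (R : realType) (m : {measure set T -> \bar R}) (D E : set T)
    (f : T -> R) : measurable D -> measurable E -> E `<=` D -> L2 m D f ->
  L2 m E f /\ nrm m E f <= nrm m D f.
Proof.
move=> mD mE ED [mf lf]; have lE : itg m E (fun x => f x ^+ 2) by exact: integrableS lf.
have mfE : measurable_fun E f by exact: measurable_funS mf.
split=> //; apply: ler_wsqrtr; rewrite -lee_fin -!EFin_E //.
apply: ge0_subset_integral => // [|x _]; last by rewrite lee_fin sqr_ge0.
exact/measurable_EFinP/itg_meas/lf.
Qed.

Lemma enorm_sqr (R : realType) k (v : 'cV[R]_k) : enorm v ^+ 2 = \sum_i v i 0 ^+ 2.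
Proof.
rewrite sqr_sqrtr; last by apply: sumr_ge0 => i _; apply: sumr_ge0 => j _; rewrite sqr_ge0.
by apply: eq_bigr => i _; rewrite big_ord1.
Qed.

Lemma enorm_ge0 (R : realType) p q (v : 'M[R]_(p, q)) : 0 <= enorm v.
Proof. exact: sqrtr_ge0. Qed.

Lemma enorm_coord (R : realType) p q (v : 'M[R]_(p, q)) i j : `|v i j| <= enorm v.
Proof.
rewrite -sqrtr_sqr; apply: ler_wsqrtr; rewrite (bigD1 i) //= (bigD1 j) //= -addrA lerDl.
apply: addr_ge0; first by apply: sumr_ge0 => k _; rewrite sqr_ge0.
by apply: sumr_ge0 => k _; apply: sumr_ge0 => l _; rewrite sqr_ge0.
Qed.

Section Bands.
Context (R : realType) (d : nat) (B : stoch_base R d).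
Local Notation P := (Pr B).
Local Notation lm := (leb \x P)%E.
Local Notation band := (@band R d B).
Local Notation mbd r s := (@measurable_band R d B r s).

Lemma band_sub r s r' s' : r' <= r -> s <= s' -> band r s `<=` band r' s'.
Proof.
move=> rr ss z [/= + _]; rewrite in_itv /= => /andP[h1 h2]; split => //=.
by rewrite in_itv /= (le_lt_trans rr h1) (le_trans h2).
Qed.

Lemma band_slice r s (f : R * Omega B -> R) w : mband f r s ->
  measurable_fun (`]r, s]%classic : set (measurableTypeR R)) (fun x => f (x, w)).
Proof.
move=> mf.
have sub : [set (x, w) | x in `]r, s]%classic] `<=` band r s by move=> _ [x xrs <-].
apply: (@measurable_comp _ _ _ (measurableTypeR R) (measurableTypeR R * Omega B)%type R
  (band r s) f _ (fun x => (x, w)) (mbd r s) sub mf).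
exact: measurable_funTS (pair2_measurable w).
Qed.

(** The norms of H^2 are stated over closed time intervals; the left end point is Lebesgue null,
    which reconciles them with half-open bands. *)
Lemma band_closed r s (f : R * Omega B -> R) : mband f r s ->
  (forall z, band r s z -> 0 <= f z) ->
  (\int[P]_w \int[leb]_(x in `[r, s]) (f (x, w))%:E = \int[lm]_(z in band r s) (f z)%:E)%E.
Proof.
move=> mf f0; rewrite (band_tonelli mf f0).2; apply: eq_integral => w _.
by rewrite -integral_itv_obnd_cbnd //; apply/measurable_EFinP; exact: band_slice.
Qed.

Lemma L2_band_sub r s r' s' f : r' <= r -> s <= s' -> L2 lm (band r' s') f ->
  L2 lm (band r s) f /\ nrm lm (band r s) f <= nrm lm (band r' s') f.
Proof.
by move=> rr ss; apply: L2_sub (mbd r' s') (mbd r s) (band_sub rr ss).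
Qed.

Lemma band_enorm k r s (f : R -> Omega B -> 'cV[R]_k) :
  (forall i, L2 lm (band r s) (fun z => f z.1 z.2 i 0)) ->
  (\int[P]_w \int[leb]_(x in `[r, s]) (enorm (f x w) ^+ 2)%:E =
   (\sum_i nrm lm (band r s) (fun z => f z.1 z.2 i 0) ^+ 2)%:E)%E.
Proof.
move=> Lf; have mb := mbd r s.
have ie : itg lm (band r s) (fun z => \sum_i f z.1 z.2 i 0 ^+ 2).
  by apply: (itg_sum mb) => i; exact: (Lf i).2.
transitivity (\int[P]_w \int[leb]_(x in `[r, s]) (\sum_i f x w i 0 ^+ 2)%:E)%E.
  by apply: eq_integral => w _; apply: eq_integral => x _; rewrite enorm_sqr.
rewrite (@band_closed _ _ (fun z => \sum_i f z.1 z.2 i 0 ^+ 2)).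
- rewrite (EFin_E mb ie) (E_sum mb) => [|i]; last exact: (Lf i).2.
  by congr (_%:E); apply: eq_bigr => i _; rewrite nrm_sq.
- exact: itg_meas ie.
- by move=> z _; apply: sumr_ge0 => i _; rewrite sqr_ge0.
Qed.

Lemma band_enorm_fin k r s (f : R -> Omega B -> 'cV[R]_k) :
  (forall i, mband (fun z => f z.1 z.2 i 0) r s) ->
  (\int[P]_w \int[leb]_(x in `[r, s]) (enorm (f x w) ^+ 2)%:E < +oo)%E ->
  forall i, L2 lm (band r s) (fun z => f z.1 z.2 i 0).
Proof.
move=> mf fin i; have mb := mbd r s; split => //.
apply: itg_ge0P; [exact: measurable_funX|by move=> *; rewrite sqr_ge0|].
have me : mband (fun z => enorm (f z.1 z.2) ^+ 2) r s.
  rewrite (_ : (fun z => _) = fun z => \sum_i f z.1 z.2 i 0 ^+ 2); last first.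
    by apply/funext => z; rewrite enorm_sqr.
  by apply: measurable_sum => j; exact: measurable_funX.
apply: le_lt_trans fin; rewrite (@band_closed _ _ (fun z => enorm (f z.1 z.2) ^+ 2)) //; last first.
  by move=> *; rewrite sqr_ge0.
apply: ge0_le_integral => //.
- by move=> *; rewrite lee_fin sqr_ge0.
- by apply/measurable_EFinP; exact: measurable_funX.
- exact/measurable_EFinP.
- by move=> z _; rewrite lee_fin enorm_sqr (bigD1 i) //= lerDl sumr_ge0 // => j _; rewrite sqr_ge0.
Qed.

End Bands.

(** * Grids, interval integrals and Taylor expansion *)

Section Grid.
Context (R : realType).

Definition grid (r s : R) (N j : nat) : R := r + (s - r) * j%:R / N.+1%:R.

Lemma grid0 r s N : grid r s N 0 = r.
Proof. by rewrite /grid mulr0 mul0r addr0. Qed.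

Lemma grid_last r s N : grid r s N N.+1 = s.
Proof. by rewrite /grid mulfK ?pnatr_eq0 // addrC subrK. Qed.

Lemma grid_step r s N j : grid r s N j.+1 - grid r s N j = (s - r) / N.+1%:R.
Proof. by rewrite /grid -natr1; ring. Qed.

Lemma mesh_sum (r s : R) N : \sum_(j < N.+1) (s - r) / N.+1%:R = s - r.
Proof. by rewrite sumr_const card_ord -[LHS]mulr_natl mulrC divfK. Qed.

Lemma mesh_cvg (r s : R) : (fun N : nat => (s - r) / N.+1%:R) @ \oo --> 0.
Proof. exact: cvgMl0 (cvg_harmonic). Qed.

Lemma grid_le r s N i j : r <= s -> (i <= j)%N -> grid r s N i <= grid r s N j.
Proof.
by move=> rs ij; rewrite /grid lerD2l ler_wpM2r ?invr_ge0 // ler_wpM2l ?subr_ge0 // ler_nat.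
Qed.

Lemma grid_in r s N j : r <= s -> (j <= N.+1)%N -> r <= grid r s N j <= s.
Proof.
move=> rs jN; have := grid_le N rs (leq0n j); have := grid_le N rs jN.
by rewrite grid0 grid_last => -> ->.
Qed.

(** The indicator of a cell is a difference of two threshold indicators, so the sum telescopes. *)
Lemma grid_sum1 r s N x : r <= s -> r < x <= s ->
  \sum_(j < N.+1) (grid r s N j < x <= grid r s N j.+1)%R%:R = 1 :> R.
Proof.
move=> rs /andP[rx xs].
rewrite -(big_mkord xpredT (fun j => (grid r s N j < x <= grid r s N j.+1)%R%:R)).
rewrite (eq_bigr (fun j => - (grid r s N j.+1 < x)%R%:R - - (grid r s N j < x)%R%:R)) => [|j _].
  by rewrite telescope_sumr // grid0 grid_last rx ltNge xs opprK oppr0 add0r.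
have := grid_le N rs (leqnSn j); case: (ltP (grid r s N j) x); case: (leP x (grid r s N j.+1)) => /=; lra.
Qed.

(** The value of a step function at [x] is a convex combination of the [a j], with weight 1 on the
    cell of [x]; so it inherits any bound valid on that cell. *)
Lemma grid_avg r s N x (a : nat -> R) (b e : R) : r <= s -> r < x <= s ->
  (forall j, (j < N.+1)%N -> grid r s N j < x <= grid r s N j.+1 -> `|a j - b| <= e) ->
  `|\sum_(j < N.+1) (grid r s N j < x <= grid r s N j.+1)%R%:R * a j - b| <= e.
Proof.
move=> rs xs h; set c := fun j : nat => (grid r s N j < x <= grid r s N j.+1)%R%:R : R.
have s1 : \sum_(j < N.+1) c j = 1 by exact: grid_sum1.
have -> : \sum_(j < N.+1) c j * a j - b = \sum_(j < N.+1) c j * (a j - b).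
  under [RHS]eq_bigr do rewrite mulrBr.
  by rewrite sumrB -mulr_suml s1 mul1r.
apply: le_trans (ler_norm_sum _ _ _) _.
rewrite -[leRHS]mul1r -s1 mulr_suml; apply: ler_sum => j _.
rewrite normrM /c; have := h j (ltn_ord j).
by case: (_ < _ <= _) => hj; rewrite ?normr1 ?mul1r ?normr0 ?mul0r //; exact: hj.
Qed.

Lemma fast_subsequence (u : nat -> R) (q : R) : u @ \oo --> 0 -> 0 < q ->
  exists phi : nat -> nat, forall k, (k <= phi k)%N /\ `|u (phi k)| <= q ^+ k.
Proof.
move=> u0 q0.
have /choice[phi h] k : exists n, (k <= n)%N /\ `|u n| <= q ^+ k.
  have /cvgrPdist_le /(_ (q ^+ k)) := u0.
  rewrite exprn_gt0 // => /(_ isT) [n _ hn]; exists (maxn k n); split; first exact: leq_maxl.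
  by have := hn (maxn k n) (leq_maxr _ _); rewrite /= sub0r normrN.
by exists phi.
Qed.

Lemma geo_cvg (u : nat -> R) (l c : R) m : (forall k, (m <= k)%N -> `|u k - l| <= c * 2^-1 ^+ k) ->
  u @ \oo --> l.
Proof.
move=> h; apply/cvgrPdist_lt => e e0.
have hc : (fun n => c * 2^-1 ^+ n) @ \oo --> 0.
  apply: cvgMl0.
  by apply: cvg_expr; rewrite ger0_norm // invf_lt1 // ltr1n.
have /cvgrPdist_lt /(_ e e0) [j _ hj] := hc.
exists (maxn m j) => // k /= jk; rewrite distrC.
apply: le_lt_trans (h k _) _; first exact: leq_trans (leq_maxl _ _) jk.
apply: le_lt_trans (ler_norm _) _; have := hj k (leq_trans (leq_maxr _ _) jk).
by rewrite /= sub0r normrN.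
Qed.

End Grid.

Section IntervalIntegrals.
Context (R : realType).
Implicit Types (a b c r s x y : R) (f g : R -> R).
Local Notation J a b f := (itg leb `[a, b]%classic f).

Lemma mcci (a b : R) : measurable (`[a, b]%classic : set (measurableTypeR R)).
Proof. exact: measurable_itv. Qed.

Lemma ci_cont a b f : {within `[a, b], continuous f} -> J a b f.
Proof. by move=> cf; apply: continuous_compact_integrable => //; exact: segment_compact. Qed.

Lemma ci_continuous a b (f : R -> R) : continuous f -> J a b f.
Proof. by move=> cf; apply: ci_cont; exact: continuous_subspaceT. Qed.

Lemma ci_sub a b a' b' f : a' <= a -> b <= b' -> J a' b' f -> J a b f.
Proof.
move=> aa bb; apply: integrableS => //.
by apply: subset_itv; rewrite bnd_simp.
Qed.

Lemma ci_eq a b (f g : R -> R) : (forall x, a <= x <= b -> f x = g x) -> I[a, b] f = I[a, b] g.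
Proof. by move=> h; apply: E_eq => x /=; rewrite in_itv /=; exact: h. Qed.

Lemma ci_le a b (f g : R -> R) : J a b f -> J a b g ->
  (forall x, a <= x <= b -> f x <= g x) -> I[a, b] f <= I[a, b] g.
Proof. by move=> Jf Jg h; apply: (E_le (mcci a b)) => // x /=; rewrite in_itv /=; exact: h. Qed.

Lemma ci_ge0 a b (f : R -> R) : (forall x, a <= x <= b -> 0 <= f x) -> 0 <= I[a, b] f.
Proof. by move=> h; apply: E_ge0 => x /=; rewrite in_itv /=; exact: h. Qed.

Lemma ci_same a f : I[a, a] f = 0.
Proof. by rewrite set_itv1 Rintegral_set1. Qed.

Lemma ci_split a b c f : a <= b -> b <= c -> J a c f -> I[a, c] f = I[a, b] f + I[b, c] f.
Proof.
move=> ab bc Jf.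
have Jb : leb.-integrable `]b, c]%classic (EFin \o f).
  by apply: integrableS Jf => //; apply: subset_itv; rewrite bnd_simp.
have := @Rintegral_itvB R f (BLeft a) (BRight c) b Jf.
by rewrite (Rintegral_itv_obnd_cbnd Jb) => <-; rewrite ?bnd_simp //; ring.
Qed.

Lemma ci_cst a b (c : R) : a <= b -> J a b (fun=> c) /\ I[a, b] (fun=> c) = c * (b - a).
Proof.
move=> ab; split; first by apply: ci_continuous => x; exact: cvg_cst.
rewrite Rintegral_cst; last exact: mcci.
congr (_ * _); transitivity (fine (if (a < b) then (b%:E - a%:E)%E else 0%E)).
  by congr fine; have := lebesgue_measure_itv `[a, b]; rewrite /= lte_fin.
by case: ltP => // h; apply/esym/eqP; rewrite subr_eq0 eq_le ab h.
Qed.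

Lemma ci_abs a b f : J a b f -> `|I[a, b] f| <= I[a, b] (fun x => `|f x|).
Proof. exact: (E_abs (mcci a b)). Qed.

Lemma ci_CS a b f : a <= b -> L2 leb `[a, b]%classic f ->
  (I[a, b] f) ^+ 2 <= (b - a) * I[a, b] (fun x => f x ^+ 2).
Proof.
move=> ab Lf; have [J1 e1] := ci_cst 1 ab.
have L1 : L2 leb `[a, b]%classic (fun=> 1 : R).
  split; first exact: measurable_cst.
  by apply: (itg_eq (mcci a b)) J1 => x _; rewrite expr1n.
have h := E_CSabs (mcci a b) L1 Lf.
have i1 := itgM (mcci a b) L1 Lf.
have {}h : `|I[a, b] f| <= nrm leb `[a, b]%classic (fun=> 1) * nrm leb `[a, b]%classic f.
  apply: le_trans h; apply: le_trans (E_abs (mcci a b) i1).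
  by apply: ler_eq; congr (`|_|); apply: E_eq => x _; rewrite mul1r.
rewrite -real_normK ?num_real //.
apply: (@le_trans _ _ ((nrm leb `[a, b]%classic (fun=> 1) * nrm leb `[a, b]%classic f) ^+ 2)).
  by rewrite ler_pXn2r ?nnegrE ?mulr_ge0 ?nrm_ge0.
rewrite exprMn !nrm_sq; apply: ler_wpM2r.
  by apply: E_ge0 => x _; rewrite sqr_ge0.
by under E_eq do rewrite expr1n; rewrite e1 mul1r.
Qed.

(** On a cell of length at most 1/(2C) the inequality absorbs half of its own right-hand side: Y' <=
    A' + (Y + Y')/2, hence Y + Y' <= 2 (Y + A'). Each of the N+1 cells thus costs a factor 2, in
    place of the exponential. The conclusion is about integrals, which are also defined pathwise. *)
Lemma gronwall (t T C : R) (y al : R -> R) N : t <= T -> 0 <= C -> 2 * C * (T - t) <= N.+1%:R ->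
  J t T y -> J t T al -> (forall s, t <= s <= T -> 0 <= y s) -> (forall s, t <= s <= T -> 0 <= al s) ->
  (forall s, t <= s <= T -> y s <= al s + C * I[t, s] y) ->
  I[t, T] y <= 2 ^+ N.+1 * I[t, T] al.
Proof.
move=> tT C0 hN Jy Ja y0 a0 h.
suff key j : (j <= N.+1)%N -> I[t, grid t T N j] y <= 2 ^+ j * I[t, grid t T N j] al.
  by have := key _ (leqnn _); rewrite grid_last.
elim: j => [|j IH] jN; first by rewrite grid0 !ci_same mulr0.
have := IH (ltnW jN).
have /andP[g0 _] := grid_in tT (ltnW jN); have /andP[_ g1] := grid_in tT jN.
have gg := grid_le N tT (leqnSn j); have gs := grid_step t T N j.
set u := grid t T N j in g0 gg gs *; set v := grid t T N j.+1 in g1 gg gs *.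
have tv := le_trans g0 gg.
have Jyv := ci_sub (lexx t) g1 Jy; have Jav := ci_sub (lexx t) g1 Ja.
have Juv := ci_sub g0 (lexx v) Jyv; have Jauv := ci_sub g0 (lexx v) Jav.
rewrite (ci_split g0 gg Jyv) (ci_split g0 gg Jav).
set Y := I[t, u] y; set A := I[t, u] al; set A' := I[u, v] al.
have A'0 : 0 <= A' by apply: ci_ge0 => x /andP[h1 h2]; apply: a0; rewrite (le_trans g0 h1) (le_trans h2).
have Y0 : 0 <= Y by apply: ci_ge0 => x /andP[h1 h2]; apply: y0; rewrite h1 (le_trans h2) // (le_trans gg).
have Y'0 : 0 <= I[u, v] y by apply: ci_ge0 => x /andP[h1 h2]; apply: y0; rewrite (le_trans g0 h1) (le_trans h2).
have [Jc ec] := ci_cst (C * (Y + I[u, v] y)) gg.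
have step : I[u, v] y <= A' + C * (Y + I[u, v] y) * (v - u).
  rewrite -ec -(ED (mcci u v) Jauv Jc); apply: ci_le => //; first exact: (itgD (mcci u v)).
  move=> x /andP[ux xv]; have tx := le_trans g0 ux; have xT := le_trans xv g1.
  apply: le_trans (h x _) _; first by rewrite tx xT.
  rewrite lerD2l ler_wpM2l // -(ci_split g0 gg Jyv) (ci_split tx xv Jyv) lerDl.
  by apply: ci_ge0 => z /andP[h1 h2]; apply: y0; rewrite (le_trans tx h1) (le_trans h2).
have hC : C * (v - u) <= 2^-1.
  by rewrite gs mulrA ler_pdivrMr // -ler_pdivrMl // invrK mulrA.
have step2 : I[u, v] y <= A' + 2^-1 * (Y + I[u, v] y).
  apply: le_trans step _; rewrite lerD2l.
  rewrite mulrAC -mulrA; apply: le_trans (_ : (C * (v - u)) * (Y + I[u, v] y) <= _).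
    by rewrite mulrA.
  by apply: ler_wpM2r => //; exact: addr_ge0.
move=> IHj; have p1 : 1 <= 2 ^+ j :> R by rewrite exprn_ege1 // ler1n.
rewrite exprS; have : Y + I[u, v] y <= 2 * Y + 2 * A' by lra.
move=> hh; apply: le_trans hh _.
have : 0 <= (2 ^+ j - 1) * A' by rewrite mulr_ge0 // subr_ge0.
rewrite -mulrA; nra.
Qed.

(* exponential weight turning an iterated integral inequality into a contraction *)
Lemma exp_weight (t C : R) : 0 < C -> exists om : R -> R, [/\ continuous om,
  forall s, t <= s -> 1 <= om s, forall s s', s <= s' -> om s <= om s' &
  forall s, t <= s -> C * I[t, s] om <= 64^-1 * om s].
Proof.
(* The rate 64 C bounds C times the integral of the exponential by 1/64 of its end value. A ratio
   this small leaves room for the squared threshold of the maximal inequality in the Picard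
   iteration. *)
move=> C0; pose l := 64 * C; have l0 : 0 < l by rewrite mulr_gt0.
pose F (s : R) := expR (l * (s - t)).
have dF x : is_derive x (1:R) F (l * F x).
  apply: is_derive_eq; rewrite /F /GRing.scale /=; ring.
have cF : continuous F.
  by move=> x; apply: differentiable_continuous; apply/derivable1_diffP; have [] := dF x.
exists F; split => // [s ts|s s' ss|s ts].
- by rewrite /F -expR0 ler_expR mulr_ge0 ?(ltW l0) ?subr_ge0.
- by rewrite /F ler_expR ler_pM2l // lerD2r.
have [->|nts] := eqVneq t s; first by rewrite ci_same mulr0 mulr_ge0 // expR_ge0.
have lts : t < s by rewrite lt_neqAle nts.
have cf : continuous (fun x => l * F x) by move=> x; apply: cvgM; [exact: cvg_cst|exact: cF].
have := @continuous_FTC2 R (fun x => l * F x) F t s lts.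
move=> /(_ (continuous_subspaceT cf)) ftc.
have e : I[t, s] (fun x => l * F x) = F s - F t.
  have d1 : derivable_oo_LRcontinuous F t s.
    split; first by move=> x _; have [] := dF x.
      by apply: cvg_at_right_filter; exact: cF.
    by apply: cvg_at_left_filter; exact: cF.
  have d2 : {in `]t, s[, F^`()%classic =1 (fun x => l * F x)}.
    by move=> x _; rewrite derive1E; have [_ ->] := dF x.
  by rewrite /Rintegral ftc.
move: e; rewrite (EZ (mcci t s)); last exact: ci_continuous.
move=> e; have : l * I[t, s] F <= F s by rewrite e gerBl expR_ge0.
rewrite /l -ler_pdivlMl ?mulr_gt0 // => h; rewrite -ler_pdivlMl //.
apply: le_trans h _; rewrite invfM; lra.
Qed.

End IntervalIntegrals.

(** * Fubini on space-time bands *)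

Section BandFubini.
Context (R : realType) (d : nat) (B : stoch_base R d).
Local Notation P := (Pr B).
Local Notation lm := (leb \x P)%E.
Local Notation "'E[' f ]" := (Rintegral P setT f).
Local Notation band := (@band R d B).
Local Notation mbd r s := (@measurable_band R d B r s).

Lemma band_sup r s (f : R * Omega B -> R) K : r <= s -> mband f r s ->
  (forall z, band r s z -> 0 <= f z) ->
  (forall u, r <= u <= s -> itg P setT (fun w => f (u, w)) /\ E[fun w => f (u, w)] <= K) ->
  itg lm (band r s) f /\ Rintegral lm (band r s) f <= K * (s - r).
Proof.
move=> rs mf f0 hK; have [JK eK] := ci_cst K rs.
apply: (itg_leE (mbd r s)) => //; rewrite (band_tonelli mf f0).1 -eK.
rewrite -(EFin_E (mcci r s) JK) -integral_itv_obnd_cbnd; last exact: measurable_cst.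
apply: ge0_le_integral => //.
- by move=> x xrs; apply: integral_ge0 => w _; rewrite lee_fin; apply: f0; split.
- have mg : measurable_fun setT ((EFin \o f) \_ (band r s) : measurableTypeR R * Omega B -> \bar R).
    apply/measurable_restrict => //; first exact: (mbd r s).
    by rewrite setIidr //; exact/measurable_EFinP.
  have g0 z : (0 <= ((EFin \o f) \_ (band r s)) z)%E.
    by rewrite patchE; case: ifPn => // /set_mem/f0; rewrite lee_fin.
  have := @measurable_fun_fubini_tonelli_F _ _ (measurableTypeR R) (Omega B) R P _ mg g0.
  move=> /(measurable_funS mT (@subsetT _ `]r, s]%classic)).
  apply: eq_measurable_fun => x xrs; rewrite /fubini_F.
  by apply: eq_integral => w _; rewrite patchE mem_set //; split => //; exact: set_mem.
- by move=> x /=; rewrite in_itv /= => /andP[/ltW h1 h2]; have [i e] := hK x (introT andP (conj h1 h2)); rewrite (EFin_E mT i) lee_fin.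
Qed.

(** Sections are integrable at every time and on every path, so both iterated integrals are
    real-valued everywhere and can be handled without exceptional sets. *)
Lemma band_swap r s (f : R * Omega B -> R) : r <= s -> itg lm (band r s) f ->
  (forall u w, r <= u <= s -> 0 <= f (u, w)) ->
  (forall u, r <= u <= s -> itg P setT (fun w => f (u, w))) ->
  (forall w, itg leb `[r, s]%classic (fun u => f (u, w))) ->
  [/\ itg P setT (fun w => I[r, s] (fun u => f (u, w))),
      Rintegral lm (band r s) f = E[fun w => I[r, s] (fun u => f (u, w))],
      itg leb `[r, s]%classic (fun u => E[fun w => f (u, w)]) &
      Rintegral lm (band r s) f = I[r, s] (fun u => E[fun w => f (u, w)])].
Proof.
move=> rs If f0 iP iL; have mf := itg_meas If.
have f0' z : band r s z -> 0 <= f z.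
  by case: z => u w [/= + _]; rewrite in_itv /= => /andP[/ltW h1 h2]; apply: f0; rewrite h1.
have mg : measurable_fun setT ((EFin \o f) \_ (band r s) : measurableTypeR R * Omega B -> \bar R).
  apply/measurable_restrict => //; first exact: (mbd r s).
  by rewrite setIidr //; exact/measurable_EFinP.
have g0 z : (0 <= ((EFin \o f) \_ (band r s)) z)%E.
  by rewrite patchE; case: ifPn => // /set_mem/f0'; rewrite lee_fin.
have half w : I[r, s] (fun u => f (u, w)) = Rintegral leb `]r, s]%classic (fun u => f (u, w)).
  rewrite Rintegral_itv_obnd_cbnd //.
  by apply: integrableS (iL w) => //; apply: subset_itv; rewrite bnd_simp.
have iH w : itg leb `]r, s]%classic (fun u => f (u, w)).
  by apply: integrableS (iL w) => //; apply: subset_itv; rewrite bnd_simp.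
have mH : measurable (`]r, s]%classic : set (measurableTypeR R)) by exact: measurable_itv.
have eH w : (\int[leb]_(u in `]r, s]) (f (u, w))%:E = (I[r, s] (fun u => f (u, w)))%:E)%E.
  by rewrite half; exact: (EFin_E mH (iH w)).
have mh : measurable_fun setT (fun w => I[r, s] (fun u => f (u, w))).
  apply/measurable_EFinP.
  have := @measurable_fun_fubini_tonelli_G _ _ (measurableTypeR R) (Omega B) R leb _ mg g0.
  apply: eq_measurable_fun => w _; rewrite /fubini_G /= -eH [RHS]integral_mkcond; apply: eq_integral => x _; rewrite !patchE.
  case: ifPn => [/set_mem [xrs _]|xrs]; first by rewrite mem_set.
  by rewrite memNset // => h; move/negP: xrs; apply; exact: mem_set.
have e1 : (\int[lm]_(z in band r s) (f z)%:E = \int[P]_w (I[r, s] (fun u => f (u, w)))%:E)%E.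
  rewrite (band_tonelli mf f0').2; apply: eq_integral => w _.
  exact: eH.
have h0 w : 0 <= I[r, s] (fun u => f (u, w)) by apply: ci_ge0 => u; exact: f0.
have i1 : itg P setT (fun w => I[r, s] (fun u => f (u, w))).
  by apply: itg_ge0P => //; rewrite -e1 (EFin_E (mbd r s) If) ltry.
have inu u : `]r, s]%classic u -> r <= u <= s by rewrite /= in_itv /= => /andP[/ltW -> ->].
have e2 : (\int[lm]_(z in band r s) (f z)%:E = \int[leb]_(u in `]r, s]) (E[fun w => f (u, w)])%:E)%E.
  rewrite (band_tonelli mf f0').1; apply: eq_integral => u /set_mem/inu urs.
  by rewrite (EFin_E mT (iP u urs)).
have mk : measurable_fun (`]r, s]%classic : set (measurableTypeR R)) (fun u => E[fun w => f (u, w)]).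
  apply/measurable_EFinP.
  have := @measurable_fun_fubini_tonelli_F _ _ (measurableTypeR R) (Omega B) R P _ mg g0.
  move=> /(measurable_funS mT (@subsetT _ `]r, s]%classic)).
  apply: eq_measurable_fun => u urs; rewrite /fubini_F /= -(EFin_E mT (iP u (inu u (set_mem urs)))).
  by apply: eq_integral => w _; rewrite patchE mem_set //; split => //; exact: set_mem.
have i2 : itg leb `]r, s]%classic (fun u => E[fun w => f (u, w)]).
  apply: itg_ge0P => // [u /inu urs|]; first by apply: E_ge0 => w _; exact: f0.
  by rewrite -e2 (EFin_E (mbd r s) If) ltry.
have [i3 e3] : itg leb `[r, s]%classic (fun u => E[fun w => f (u, w)]) /\
    I[r, s] (fun u => E[fun w => f (u, w)]) = Rintegral leb `]r, s]%classic (fun u => E[fun w => f (u, w)]).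
  split; last by rewrite Rintegral_itv_obnd_cbnd.
  have mk2 : measurable_fun (`[r, s]%classic : set (measurableTypeR R)) (fun u => E[fun w => f (u, w)]).
    have -> : `[r, s]%classic = [set r] `|` `]r, s]%classic.
      by rewrite setU1itv // bnd_simp.
    by apply/measurable_funU => //; split => //; exact: measurable_fun_set1.
  apply: itg_ge0P => // [u|]; first by rewrite /= in_itv /= => urs; apply: E_ge0 => w _; exact: f0.
  by rewrite -integral_itv_obnd_cbnd ?(EFin_E mH i2) ?ltry //; exact/measurable_EFinP.
split => //.
- by apply: EFin_inj; rewrite -(EFin_E (mbd r s) If) e1 (EFin_E mT i1).
- by apply: EFin_inj; rewrite -(EFin_E (mbd r s) If) e2 e3 (EFin_E mH i2).
Qed.

End BandFubini.

(** * Uniform continuity and Riemann sums *)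

Section UniformContinuity.
Context (R : realType).

(** Compactness of the diagonal over [r, s]. When [G] ignores its first argument this is uniform
    continuity, and [v] may even leave the segment. *)
Lemma diagonal_modulus (G : R -> R -> R) (r s e : R) :
  continuous (fun z : R * R => G z.1 z.2) -> 0 < e ->
  exists2 del, 0 < del & forall u v, r <= u <= s -> `|u - v| < del -> `|G u v - G u u| < e.
Proof.
move=> cG e0; have := @segment_compact R r s.
move=> /compact_near_coveringP /(_ R 0^'+ (fun del u => forall v, `|u - v| < del -> `|G u v - G u u| < e) _).
have e2 : 0 < e / 2 by rewrite divr_gt0.
case=> [x _|del0 /= d0 hdel].
  have /cvgrPdist_lt /(_ _ e2) := cG (x, x).
  case=> -[A1 A2] /= [[d1 /= d10 hA1] [d2 /= d20 hA2]] hA.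
  pose m := Num.min d1 d2; have m0 : 0 < m by rewrite lt_min d10.
  have hm u v : `|x - u| < m -> `|x - v| < m -> `|G x x - G u v| < e / 2.
    rewrite !lt_min => /andP[h1 h2] /andP[h3 h4].
    by apply: (hA (u, v)); split; [exact: hA1|exact: hA2].
  exists ([set u | `|x - u| < m / 2], [set del : R | del < m / 2]); first split => /=.
  - by exists (m / 2); [rewrite /= divr_gt0|move=> y].
  - by apply: nbhs_right_lt; rewrite divr_gt0.
  - move=> [u del] /= [h1 h2] v h3.
    have h4 : `|x - v| < m.
      have := ler_distD u x v; move: h1 h2 h3; rewrite /=; lra.
    have h5 : `|x - u| < m by lra.
    have a1 := hm _ _ h5 h4; have a2 := hm _ _ h5 h5.
    have := ler_distD (G x x) (G u v) (G u u); rewrite (distrC (G u v) (G x x)); lra.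
exists (del0 / 2); first by rewrite divr_gt0.
move=> u v urs h; apply: (hdel (del0 / 2)) => //=.
- by rewrite sub0r normrN ger0_norm ?(ltW _) ?divr_gt0 //; lra.
- by rewrite divr_gt0.
Qed.

(** Only [F] is frozen at left end points, the integrals of [g] over the cells stay exact. This is
    the form in which the drift enters Ito's formula; g = 1 gives ordinary Riemann sums. *)
Lemma riemann_weighted r s (F g : R -> R) : r <= s -> {within `[r, s], continuous F} -> {within `[r, s], continuous g} ->
  (fun N => \sum_(j < N.+1) F (grid r s N j) * I[grid r s N j, grid r s N j.+1] g) @ \oo --> I[r, s] (fun v => F v * g v).
Proof.
move=> rs cF cg; have cFg : {within `[r, s], continuous (fun v => F v * g v)} by move=> v; apply: cvgM; [exact: cF|exact: cg].
have Jg := ci_cont cg; have JFg := ci_cont cFg.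
have [K K0 hK] : exists2 K : R, 0 <= K & forall v, r <= v <= s -> `|g v| <= K.
  have c1 : {within `[r, s], continuous (fun v => `|g v|)} by move=> v; apply: cvg_norm; exact: cg.
  by have [c _ hc] := EVT_max rs c1; exists `|g c| => // v vI; apply: hc; rewrite in_itv.
have cc : continuous (F \o clp r s) := within_clp rs cF.
apply/cvgrPdist_le => e e0.
pose M := K * (s - r) + 1; have M0 : 0 < M by rewrite ltr_wpDl // mulr_ge0 // subr_ge0.
have e1 : 0 < e / M by rewrite divr_gt0.
have [|dl d0 hd] := @diagonal_modulus (fun _ v => F (clp r s v)) r s _ _ e1.
  by move=> z; apply: (continuous_comp (g := F \o clp r s)); [exact: cvg_snd|exact: cc].
have := cvg0_lt (mesh_cvg r s) d0; apply: filterS => N /= hN.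
have split_sum k : (k <= N.+1)%N -> I[r, grid r s N k] (fun v => F v * g v) =
   \sum_(j < k) I[grid r s N j, grid r s N j.+1] (fun v => F v * g v).
  elim: k => [|k IH] kN; first by rewrite grid0 ci_same big_ord0.
  rewrite big_ord_recr /= -IH; last exact: ltnW.
  have /andP[g1 _] := grid_in rs (ltnW kN); have /andP[_ g2] := grid_in rs kN.
  by rewrite (@ci_split _ _ (grid r s N k)) //; [exact: grid_le|exact: ci_sub JFg].
have -> : I[r, s] (fun v => F v * g v) = \sum_(j < N.+1) I[grid r s N j, grid r s N j.+1] (fun v => F v * g v).
  by rewrite -split_sum // grid_last.
rewrite -sumrB; apply: le_trans (ler_norm_sum _ _ _) _.
apply: (@le_trans _ _ (\sum_(j < N.+1) (e / M * K) * ((s - r) / N.+1%:R))); last first.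
  by rewrite -mulr_sumr mesh_sum mulrAC -mulrA mulrAC ler_pdivrMr // ler_pM2l // [_ * K]mulrC /M lerDl.
apply: ler_sum => j _; have /andP[h4 _] := grid_in rs (ltnW (ltn_ord j)); have /andP[_ h5] := grid_in rs (ltn_ord j).
have h2 := grid_le N rs (leqnSn j).
set a := grid r s N j in h2 h4 *; set b := grid r s N j.+1 in h2 h5 *.
have Ja := ci_sub h4 h5 JFg; have Jb := ci_sub h4 h5 Jg.
have Jc := itgZ (mcci a b) (F a) Jb.
rewrite -(EZ (mcci a b) _ Jb) -(EB (mcci a b) Ja Jc).
have Jd := itgB (mcci a b) Ja Jc; have [Je ee] := ci_cst (e / M * K) h2.
have -> : (s - r) / N.+1%:R = b - a by rewrite grid_step.
rewrite -ee; apply: le_trans (ci_abs Jd) _; apply: (ci_le (itg_abs Jd) Je) => v /andP[v1 v2].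
rewrite -mulrBl normrM; have vI : r <= v <= s by rewrite (le_trans h4 v1) (le_trans v2 h5).
have aI : r <= a <= s by rewrite h4 (le_trans h2 h5).
apply: ler_pM => //; last exact: hK.
have := hd v a vI; rewrite !clp_id // (distrC (F a)) => hh; apply: ltW; apply: hh.
rewrite ger0_norm ?subr_ge0 //; apply: le_lt_trans hN; apply: le_trans (ler_norm _).
by rewrite -(grid_step r s N j) lerD2r.
Qed.

Lemma riemann_cvg r s (f : R -> R) : r <= s -> {within `[r, s], continuous f} ->
  (fun N => \sum_(j < N.+1) f (grid r s N j) * ((s - r) / N.+1%:R)) @ \oo --> I[r, s] f.
Proof.
move=> rs cf; have c1 : {within `[r, s], continuous (fun=> 1 : R)} by move=> v; exact: cvg_cst.
have := riemann_weighted rs cf c1; rewrite (ci_eq (g := f)) => [|v _]; last exact: mulr1.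
apply: cvg_eq => N; apply: eq_bigr => j _.
by have [_ ->] := ci_cst 1 (grid_le N rs (leqnSn j)); rewrite grid_step mul1r.
Qed.

End UniformContinuity.

Section SquaredNorm.
Context (R : realType) (n : nat).
Implicit Types x y : 'cV[R]_n.

Definition nsq x : R := \sum_i x i 0 ^+ 2.

Lemma nsq_ge0 x : 0 <= nsq x.
Proof. by apply: sumr_ge0 => i _; rewrite sqr_ge0. Qed.

Lemma nsq_coord x i : x i 0 ^+ 2 <= nsq x.
Proof. by rewrite /nsq (bigD1 i) //= lerDl sumr_ge0 // => j _; rewrite sqr_ge0. Qed.

Lemma nsq0 : nsq 0 = 0.
Proof. by rewrite /nsq big1 // => i _; rewrite mxE expr0n. Qed.

Lemma nsqB x y : nsq (x - y) <= 2 * nsq x + 2 * nsq y.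
Proof.
rewrite /nsq !mulr_sumr -big_split /=; apply: ler_sum => i _; rewrite !mxE.
have := sqr_ge0 (x i 0 + y i 0); nra.
Qed.

Lemma nsq_eq0 x : nsq x = 0 -> x = 0.
Proof.
move=> h; apply/colP => i; rewrite mxE; apply/eqP; rewrite -sqrf_eq0 eq_le sqr_ge0 andbT.
by rewrite -h nsq_coord.
Qed.

Lemma continuous_coord (i : 'I_n) : continuous (fun z : R * 'cV[R]_n => z.2 i 0).
Proof.
move=> z; apply: (continuous_comp (f := snd) (g := fun M : 'cV[R]_n => M i 0)); first exact: cvg_snd.
exact: coord_continuous.
Qed.

Lemma continuous_nsq : continuous (fun z : R * 'cV[R]_n => nsq z.2).
Proof.
move=> z; rewrite /continuous_at /nsq; apply: cvg_sumF => i; rewrite !expr2.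
by apply: cvgM; exact: continuous_coord.
Qed.

End SquaredNorm.

(** Coordinatewise squared bounds fit mean square estimates directly. The drift has linear growth,
    the diffusion is bounded, and everything holds at all real times, as the coefficients to be
    inserted are clamped in time. *)
Definition coef_ok (R : realType) n d (bt : R -> 'cV[R]_n -> 'cV[R]_n)
    (sg : R -> 'cV[R]_n -> 'M[R]_(n, d)) (L : R) :=
  [/\ 0 <= L,
   (forall i, continuous (fun z : R * 'cV[R]_n => bt z.1 z.2 i 0)) /\
   (forall i j, continuous (fun z : R * 'cV[R]_n => sg z.1 z.2 i j)),
   forall s x y i, (bt s x i 0 - bt s y i 0) ^+ 2 <= L * nsq (x - y),
   forall s x y i j, (sg s x i j - sg s y i j) ^+ 2 <= L * nsq (x - y)
 & (forall s i, bt s 0 i 0 ^+ 2 <= L) /\ (forall s x i j, sg s x i j ^+ 2 <= L)].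

Section Tube.
Context (R : realType) (n : nat).

(** Compactness of the graph of [Y] over [r, s]. The modulus also covers points near the graph but
    off the path, because Taylor's formula evaluates derivatives between two values of the
    process. *)
Lemma tube_modulus (F : R * 'cV[R]_n -> R) (Y : R -> 'cV[R]_n) (r s e : R) :
  continuous F -> continuous Y -> 0 < e ->
  exists2 rho : R, 0 < rho & forall tau tau' (z : 'cV[R]_n), r <= tau <= s -> `|tau - tau'| < rho ->
    (forall i, `|Y tau i 0 - z i 0| < rho) -> `|F (tau', z) - F (tau, Y tau)| < e.
Proof.
move=> cF cY e0; have := @segment_compact R r s.
pose good (rho tau : R) := forall tau' (z : 'cV[R]_n), `|tau - tau'| < rho ->
    (forall i, `|Y tau i 0 - z i 0| < rho) -> `|F (tau', z) - F (tau, Y tau)| < e.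
move=> /compact_near_coveringP /(_ R 0^'+ good _).
have e2 : 0 < e / 2 by rewrite divr_gt0.
case=> [x _|del0 /= d0 hdel].
  have /cvgrPdist_lt /(_ _ e2) := cF (x, Y x).
  case=> -[A1 A2] [[d1 /= d10 hA1] nA2] hA.
  have /nbhs_ballP [d2 /= d20 hA2] : nbhs (Y x) A2 := nA2.
  pose m := Num.min d1 d2; have m0 : 0 < m by rewrite lt_min d10.
  have hm (u : R) (z : 'cV[R]_n) : `|x - u| < m -> (forall i, `|Y x i 0 - z i 0| < m) -> `|F (x, Y x) - F (u, z)| < e / 2.
    rewrite lt_min => /andP[h1 _] h2; apply: (hA (u, z)); split; first exact: hA1.
    apply: hA2; split => // i j; rewrite ord1.
    by have := h2 i; rewrite lt_min => /andP[].
  have m2 : 0 < m / 2 by rewrite divr_gt0.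
  have /cvg_ballP /(_ _ m2) := cY x; rewrite near_simpl => -[d3 /= d30 h3].
  exists ([set u | `|x - u| < Num.min d3 (m / 2)], [set del : R | del < m / 2]); first split => /=.
  - by exists (Num.min d3 (m / 2)); [rewrite /= lt_min d30|move=> y].
  - by apply: nbhs_right_lt.
  - move=> [u del] /= [h1 h2] v z hv hz; move: h1; rewrite lt_min => /andP[h1 h1'].
    have hY i : `|Y x i 0 - Y u i 0| < m / 2 by have [_ h] := h3 u h1; exact: (h i 0).
    have a1 : `|F (x, Y x) - F (v, z)| < e / 2.
      apply: hm => [|i].
        by apply: le_lt_trans (ler_distD u _ _) _; lra.
      by apply: le_lt_trans (ler_distD (Y u i 0) _ _) _; have := hY i; have := hz i; lra.
    have a2 : `|F (x, Y x) - F (u, Y u)| < e / 2.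
      by apply: hm => [|i]; [lra|have := hY i; lra].
    have := ler_distD (F (x, Y x)) (F (v, z)) (F (u, Y u)); rewrite (distrC (F (v, z)) (F (x, Y x))); lra.
exists (del0 / 2); first by rewrite divr_gt0.
move=> u v z urs h1 h2; have hin : `[r, s]%classic u by rewrite /= in_itv.
apply: (hdel (del0 / 2) _ _ u hin) => //=.
- by rewrite sub0r normrN ger0_norm ?(ltW _) ?divr_gt0 //; lra.
- by rewrite divr_gt0.
Qed.

End Tube.

(** * Second-order Taylor expansion along coordinate directions *)

Section Taylor.
Context (R : realType) (n : nat).
Variables (f : 'cV[R]_n -> R) (f1 : 'I_n -> 'cV[R]_n -> R) (f2 : 'I_n -> 'I_n -> 'cV[R]_n -> R).
Local Notation ev k := (delta_mx k 0 : 'cV[R]_n).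
Hypothesis df : forall i x, is_derive x (ev i) f (f1 i x).
Hypothesis df1 : forall i j x, is_derive x (ev j) (f1 i) (f2 i j x).

Lemma is_derive_line (g : 'cV[R]_n -> R) (g' : 'cV[R]_n -> R) k (x : 'cV[R]_n) (c th : R) :
  (forall y, is_derive y (ev k) g (g' y)) ->
  is_derive th (1 : R) (fun th => g (x + (th * c) *: ev k)) (c * g' (x + (th * c) *: ev k)).
Proof.
move=> hg.
have line (a : R) : is_derive a (1 : R) (fun a => g (x + a *: ev k)) (g' (x + a *: ev k)).
  have [h1 h2] := hg (x + a *: ev k).
  have e : (fun h : R => h^-1 *: ((g \o shift (x + a *: ev k)) (h *: ev k) - g (x + a *: ev k))) =
           (fun h : R => h^-1 *: (((fun a => g (x + a *: ev k)) \o shift a) (h *: (1 : R)) - g (x + a *: ev k))).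
    apply/funext => h /=; congr (_ *: (g _ - _)).
    by rewrite scalerDl addrCA; congr (_ + (_ *: _ + _)); rewrite /GRing.scale /= mulr1.
  split; first by rewrite /derivable -e.
  by rewrite -h2 /derive -e.
have lin : is_derive th (1 : R) (fun th : R => th * c) c.
  by apply: is_derive_eq; rewrite /GRing.scale /=; ring.
have := @is_derive1_comp R (fun a => g (x + a *: ev k)) (fun th : R => th * c) th _ _ (line (th * c)) lin.
by rewrite mulrC.
Qed.

Lemma mvt_line (g : 'cV[R]_n -> R) (g' : 'cV[R]_n -> R) k (x : 'cV[R]_n) (c b : R) : 0 <= b ->
  (forall y, is_derive y (ev k) g (g' y)) ->
  exists2 th, 0 <= th <= b & g (x + (b * c) *: ev k) - g x = b * (c * g' (x + (th * c) *: ev k)).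
Proof.
move=> b0 hg; pose p th := g (x + (th * c) *: ev k).
have dp th : is_derive th (1 : R) p (c * g' (x + (th * c) *: ev k)) by exact: is_derive_line.
have cp : continuous p.
  by move=> y; apply: differentiable_continuous; apply/derivable1_diffP; have [] := dp y.
have [th] := @MVT_segment R p (fun th => c * g' (x + (th * c) *: ev k)) 0 b b0 (fun y _ => dp y) (continuous_subspaceT cp).
rewrite in_itv /= => th0 e; exists th => //.
by move: e; rewrite /p mul0r scale0r addr0 subr0 => ->; rewrite mulrC.
Qed.

(** The mean value theorem is applied to the remainder as a function of the step, and then to [f1];
    no integral of second derivatives appears. *)
Lemma taylor_line k (x : 'cV[R]_n) (c e : R) :
  (forall th, 0 <= th <= 1 -> `|f2 k k (x + (th * c) *: ev k) - f2 k k x| <= e) ->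
  `|f (x + c *: ev k) - f x - f1 k x * c - 2^-1 * (f2 k k x * c ^+ 2)| <= e * c ^+ 2.
Proof.
move=> he; pose p th := f (x + (th * c) *: ev k) - (c * f1 k x) * th - (2^-1 * (f2 k k x * c ^+ 2)) * th ^+ 2.
pose p' th := c * f1 k (x + (th * c) *: ev k) - c * f1 k x - (f2 k k x * c ^+ 2) * th.
have dp th : is_derive th (1 : R) p (p' th).
  have d0 := is_derive_line x c th (df k).
  by apply: is_derive_eq; rewrite /p' /GRing.scale /=; field.
have cp : continuous p.
  by move=> y; apply: differentiable_continuous; apply/derivable1_diffP; have [] := dp y.
have [b] := @MVT_segment R p p' 0 1 ler01 (fun y _ => dp y) (continuous_subspaceT cp).
rewrite in_itv /= => /andP[b0 b1] e1.
have [th /andP[t0 tb] e2] := mvt_line x c b0 (df1 k k).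
have {}e1 : f (x + c *: ev k) - f x - f1 k x * c - 2^-1 * (f2 k k x * c ^+ 2) =
    b * ((f2 k k (x + (th * c) *: ev k) - f2 k k x) * c ^+ 2).
  transitivity (p 1 - p 0); first by rewrite /p mul1r mul0r scale0r addr0 expr1n expr0n /=; ring.
  rewrite e1 /p' -mulrBr e2; ring.
rewrite e1 normrM (ger0_norm b0) normrM (ger0_norm (sqr_ge0 c)).
have h := he th; rewrite t0 (le_trans tb b1) in h; have {}h := h isT.
apply: (@le_trans _ _ (1 * (e * c ^+ 2))); last by rewrite mul1r.
by apply: ler_pM => //; [rewrite mulr_ge0 // sqr_ge0|apply: ler_wpM2r => //; exact: sqr_ge0].
Qed.

Variables (x del : 'cV[R]_n) (e : R).
Hypothesis e0 : 0 <= e.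
Hypothesis osc : forall z : 'cV[R]_n, (forall i, exists2 th, 0 <= th <= 1 & z i 0 = x i 0 + th * del i 0) ->
  forall k l, `|f2 k l z - f2 k l x| <= e.

Let mv (s : seq 'I_n) := x + \sum_(k <- s) del k 0 *: ev k.

Let mv_coord s (th : R) k i : uniq (k :: s) -> 0 <= th <= 1 ->
  exists2 th', 0 <= th' <= 1 & (mv s + (th * del k 0) *: ev k) i 0 = x i 0 + th' * del i 0.
Proof.
move=> /= /andP[ks us] th01.
have e1 : (\sum_(l <- s) del l 0 *: ev l) i 0 = (i \in s)%:R * del i 0.
  rewrite summxE; elim: s us {ks} => [|l s IH] /=; first by rewrite big_nil mul0r.
  move=> /andP[ls us]; rewrite big_cons IH // !mxE eqxx andbT in_cons.
  have [->|nil] := eqVneq i l; first by rewrite (negbTE ls) mulr1 mul0r addr0 mul1r.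
  by rewrite mulr0 add0r.
have [ik|ik] := eqVneq i k.
  exists th => //; move: e1; rewrite ik (negbTE ks) mul0r => e1.
  by rewrite 2!mxE e1 !mxE !eqxx /= mulr1 addr0.
exists ((i \in s)%:R); first by case: (i \in s); rewrite ?lexx ?ler01.
by rewrite 2!mxE e1 !mxE (negbTE ik) /= mulr0 addr0.
Qed.

(** The quadratic part produced by moving the coordinates of the list one after another, the tail
    before the head. Each pair of coordinates contributes only one of its two mixed derivatives. *)
Let quad (s : seq 'I_n) :=
  (fix q (s : seq 'I_n) : R := if s is k :: s' then
     q s' + (del k 0 * (\sum_(l <- s') f2 k l x * del l 0) + 2^-1 * (f2 k k x * del k 0 ^+ 2)) else 0) s.

Let osc_mv s k th a b : uniq (k :: s) -> 0 <= th <= 1 ->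
  `|f2 a b (mv s + (th * del k 0) *: ev k) - f2 a b x| <= e.
Proof. by move=> us th01; apply: osc => i; exact: mv_coord. Qed.

Let grad_move k s : uniq s -> `|f1 k (mv s) - f1 k x - \sum_(l <- s) f2 k l x * del l 0| <=
  e * \sum_(l <- s) `|del l 0|.
Proof.
elim: s => [|l s IH] us; first by rewrite /mv !big_nil addr0 subrr subr0 normr0 mulr0.
have us' : uniq s by case/andP: us.
have mvE : mv (l :: s) = mv s + (1 * del l 0) *: ev l by rewrite /mv big_cons mul1r addrAC addrA.
have [th th01 e1] := mvt_line (mv s) (del l 0) ler01 (df1 k l).
rewrite mvE !big_cons.
have -> : f1 k (mv s + (1 * del l 0) *: ev l) - f1 k x - (f2 k l x * del l 0 + \sum_(j <- s) f2 k j x * del j 0) =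
   (f2 k l (mv s + (th * del l 0) *: ev l) - f2 k l x) * del l 0 + (f1 k (mv s) - f1 k x - \sum_(j <- s) f2 k j x * del j 0).
  by move/eqP: e1; rewrite subr_eq => /eqP ->; ring.
apply: le_trans (ler_normD _ _) _; rewrite mulrDr; apply: lerD; last exact: IH.
by rewrite normrM ler_wpM2r // osc_mv.
Qed.

Let taylor_move s : uniq s ->
  `|f (mv s) - f x - \sum_(k <- s) f1 k x * del k 0 - quad s| <= 3 * e * (\sum_(k <- s) `|del k 0|) ^+ 2.
Proof.
elim: s => [|k s IH] us; first by rewrite /mv !big_nil addr0 subrr !subr0 normr0 expr0n mulr0.
have us' : uniq s by case/andP: us.
have mvE : mv (k :: s) = mv s + del k 0 *: ev k by rewrite /mv big_cons addrAC addrA.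
have h1 : `|f (mv s + del k 0 *: ev k) - f (mv s) - f1 k (mv s) * del k 0 - 2^-1 * (f2 k k (mv s) * del k 0 ^+ 2)|
   <= 2 * e * del k 0 ^+ 2.
  apply: taylor_line => th th01.
  have h2 := @osc_mv s k 0 k k us; rewrite mul0r scale0r addr0 lexx ler01 in h2.
  have h4 := osc_mv k k us th01; have h3 := h2 isT.
  apply: le_trans (ler_distD (f2 k k x) _ _) _; rewrite (distrC (f2 k k x)); lra.
have h2 := @osc_mv s k 0 k k us; rewrite mul0r scale0r addr0 lexx ler01 in h2; have {}h2 := h2 isT.
have h3 := grad_move k us'; have h4 := IH us'.
rewrite mvE !big_cons /quad -/quad.
set S1 := \sum_(j <- s) `|_| in h3 h4 *; have S10 : 0 <= S1 by apply: sumr_ge0 => j _.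
set g := \sum_(j <- s) f2 k j x * _ in h3 *; set G := \sum_(j <- s) f1 j x * _ in h4 *.
set D := del k 0 in h1 *; set q := (X in _ - X) in h4.
have -> : f (mv s + D *: ev k) - f x - (f1 k x * D + G) - (q + (D * g + 2^-1 * (f2 k k x * D ^+ 2))) =
  (f (mv s + D *: ev k) - f (mv s) - f1 k (mv s) * D - 2^-1 * (f2 k k (mv s) * D ^+ 2)) +
  (f (mv s) - f x - G - q) + (f1 k (mv s) - f1 k x - g) * D +
  2^-1 * ((f2 k k (mv s) - f2 k k x) * D ^+ 2) by ring.
have b3 : `|(f1 k (mv s) - f1 k x - g) * D| <= e * S1 * `|D| by rewrite normrM ler_wpM2r.
have b4 : `|2^-1 * ((f2 k k (mv s) - f2 k k x) * D ^+ 2)| <= 2^-1 * (e * D ^+ 2).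
  rewrite normrM ger0_norm // ler_wpM2l // normrM (ger0_norm (sqr_ge0 D)).
  by apply: ler_wpM2r => //; exact: sqr_ge0.
apply: le_trans (ler_normD _ _) _; apply: le_trans (lerD (ler_normD _ _) b4) _.
apply: le_trans (lerD (lerD (ler_normD _ _) b3) (lexx _)) _.
apply: le_trans (lerD (lerD (lerD h1 h4) (lexx _)) (lexx _)) _.
have D2 : D ^+ 2 = `|D| ^+ 2 by rewrite real_normK ?num_real.
rewrite D2; have d0 := normr_ge0 D; have p1 := mulr_ge0 e0 (sqr_ge0 `|D|).
have p2 : 0 <= e * S1 * `|D| by rewrite !mulr_ge0.
rewrite sqrrD; lra.
Qed.

Let H k l := f2 k l x * (del k 0 * del l 0).

Let quad_cons k s : quad (k :: s) = quad s + \sum_(l <- s) H k l + 2^-1 * H k k.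
Proof.
rewrite /quad -/quad /H -expr2 -addrA; congr (_ + (_ + _)).
by rewrite mulr_sumr; apply: eq_bigr => l _; ring.
Qed.

Let quad_rcons s k : quad (rcons s k) = quad s + \sum_(l <- s) H l k + 2^-1 * H k k.
Proof.
elim: s => [|m s IH]; first by rewrite quad_cons !big_nil.
by rewrite rcons_cons !quad_cons IH -cats1 big_cat big_seq1 big_cons /=; ring.
Qed.

Let quad_rev s : quad s + quad (rev s) = \sum_(k <- s) \sum_(l <- s) H k l.
Proof.
elim: s => [|k s IH]; first by rewrite big_nil addr0.
rewrite rev_cons quad_cons quad_rcons big_cons big_cons.
rewrite [X in _ = _ + _ + X](eq_bigr (fun a => H a k + \sum_(l <- s) H a l)) => [|a _]; last by rewrite big_cons.
have pr : perm_eq (rev s) s by rewrite perm_rev.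
by rewrite big_split /= -IH (perm_big _ pr) /=; field.
Qed.

(** The coordinates are moved in one order and then in the reverse order, and the two expansions are
    averaged. They use opposite mixed derivatives of every pair, so the average is the full double
    sum with factor 1/2 although [f2] is not assumed symmetric. *)
Lemma taylor2 : `|f (x + del) - f x - \sum_k f1 k x * del k 0 -
    2^-1 * \sum_k \sum_l f2 k l x * (del k 0 * del l 0)| <= 3 * e * (\sum_k `|del k 0|) ^+ 2.
Proof.
have mvE s : perm_eq s (enum 'I_n) -> mv s = x + del.
  move=> ps; rewrite /mv (perm_big _ ps) /= big_enum /=; congr (_ + _).
  apply/colP => i; rewrite summxE (bigD1 i) //= !mxE !eqxx mulr1 big1 ?addr0 // => j ji.
  by rewrite !mxE eq_sym (negbTE ji) mulr0.
have h1 := taylor_move (enum_uniq 'I_n).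
have h2 : `|f (mv (rev (enum 'I_n))) - f x - \sum_(k <- rev (enum 'I_n)) f1 k x * del k 0 - quad (rev (enum 'I_n))|
    <= 3 * e * (\sum_(k <- rev (enum 'I_n)) `|del k 0|) ^+ 2.
  by apply: taylor_move; rewrite rev_uniq enum_uniq.
have pr : perm_eq (rev (enum 'I_n)) (enum 'I_n) by rewrite perm_rev.
rewrite (mvE _ pr) !(perm_big _ pr) /= !big_enum /= in h2.
rewrite (mvE _ (perm_refl _)) !big_enum /= in h1.
have e1 : 2^-1 * \sum_k \sum_l f2 k l x * (del k 0 * del l 0) =
    2^-1 * (quad (enum 'I_n) + quad (rev (enum 'I_n))).
  by rewrite quad_rev big_enum /=; congr (_ * _); apply: eq_bigr => k _; rewrite big_enum.
rewrite e1; set q1 := quad _ in h1 *; set q2 := quad _ in h2 *.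
set F := f (x + del) - f x - _ in h1 h2 *.
have -> : F - 2^-1 * (q1 + q2) = 2^-1 * (F - q1) + 2^-1 * (F - q2) by field.
apply: le_trans (ler_normD _ _) _; rewrite !normrM (ger0_norm (_ : 0 <= 2^-1)) //; lra.
Qed.

End Taylor.

(** Expansion of the double sum of the (a_i - a_j)^2. *)
Lemma sqr_sum_le (R : realFieldType) n (a : 'I_n -> R) : (\sum_i a i) ^+ 2 <= n%:R * \sum_i a i ^+ 2.
Proof.
have : 0 <= \sum_i \sum_j (a i - a j) ^+ 2 by do 2 (apply: sumr_ge0 => ? _); exact: sqr_ge0.
have -> : \sum_i \sum_j (a i - a j) ^+ 2 = 2 * (n%:R * \sum_i a i ^+ 2) - 2 * (\sum_i a i) ^+ 2.
  have -> : 2 * (n%:R * \sum_i a i ^+ 2) = \sum_i \sum_j (a i ^+ 2 + a j ^+ 2).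
    under [RHS]eq_bigr => i _ do rewrite big_split /= sumr_const card_ord.
    rewrite big_split /= sumrMnl sumr_const card_ord.
    set A := \sum_i a i ^+ 2; rewrite -[A *+ n]mulr_natl; ring.
  have -> : 2 * (\sum_i a i) ^+ 2 = \sum_i \sum_j 2 * (a i * a j).
    rewrite expr2 big_distrlr /= mulr_sumr; apply: eq_bigr => i _; by rewrite mulr_sumr.
  rewrite -sumrB; apply: eq_bigr => i _; rewrite -sumrB; apply: eq_bigr => j _; ring.
lra.
Qed.

Section AlmostEverywhere.
Context d (T : measurableType d) (R : realType) (mu : {measure set T -> \bar R}) (D : set T).
Hypothesis mD : measurable D.

(** The maximum of [f] and [g] equals [g] almost everywhere and dominates [f] everywhere, so the
    everywhere versions of the comparison lemmas apply to it. *)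
Let itg_max (f g : T -> R) : measurable_fun D f -> itg mu D g -> {ae mu, forall x, D x -> f x <= g x} ->
  itg mu D (fun x => Num.max (f x) (g x)) /\ Rintegral mu D (fun x => Num.max (f x) (g x)) = Rintegral mu D g.
Proof.
move=> mf ig fg; have [||i e] := itg_ae mD (itg_meas ig) (g := fun x => Num.max (f x) (g x)) _ _ ig.
- exact: measurable_maxr mf (itg_meas ig).
- by apply: filterS fg => x h Dx; apply/esym/max_idPr; exact: h.
- by [].
Qed.

Lemma ae_mono (Q Q' : T -> Prop) : (forall x, Q x -> Q' x) -> {ae mu, forall x, Q x} -> {ae mu, forall x, Q' x}.
Proof. by move=> h; apply: filterS. Qed.

Lemma ae_and (Q Q' : T -> Prop) : {ae mu, forall x, Q x} -> {ae mu, forall x, Q' x} ->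
  {ae mu, forall x, Q x /\ Q' x}.
Proof. by move=> h h'; near=> x; split; near: x. Unshelve. all: by end_near. Qed.

Lemma itg_le_ae (f g : T -> R) : measurable_fun D f -> itg mu D g ->
  {ae mu, forall x, D x -> `|f x| <= g x} -> itg mu D f.
Proof.
move=> mf ig fg; have [i _] := itg_max (measurableT_comp (@normr_measurable R setT) mf) ig fg.
by apply: (itg_le mD mf i) => x Dx; rewrite le_max lexx.
Qed.

Lemma E_le_ae (f g : T -> R) : itg mu D f -> itg mu D g -> {ae mu, forall x, D x -> f x <= g x} ->
  Rintegral mu D f <= Rintegral mu D g.
Proof.
move=> jf ig fg; have [i <-] := itg_max (itg_meas jf) ig fg.
by apply: (E_le mD) => // x Dx; rewrite le_max lexx.
Qed.

End AlmostEverywhere.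

(** * Stochastic integration, stochastic differential equations, the formula of Ito *)

Section StochasticCalculus.
Context (R : realType) (d : nat) (B : stoch_base R d) (t T : R).
Hypotheses (HB : brownian B t T) (tT : t <= T).
Local Notation P := (Pr B).
Local Notation lm := (leb \x P)%E.
Local Notation "'E[' f ]" := (Rintegral P setT f).
Local Notation fmeas := (@fmeas R d B t).
Local Notation L2F := (@L2F R d B t).
Local Notation band := (@band R d B).
Local Notation isint := (@isint R d B t).
Local Notation mbd r s := (@measurable_band R d B r s).
Local Notation elem_wf := (@elem_wf R d B t).

(** Conditional expectation is replaced by orthogonality: an increment is orthogonal to every square
    integrable variable known at its starting time. *)
Definition mart (D : R -> Omega B -> R) :=
  (forall s, t <= s <= T -> L2F s (D s)) /\
  (forall r s xi, t <= r -> r <= s -> s <= T -> L2F r xi ->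
     E[fun w => xi w * (D s w - D r w)] = 0).

Definition cpath (D : R -> Omega B -> R) :=
  forall w, {within `[t, T], continuous (fun s => D s w)}.

Definition adapted (D : R -> Omega B -> R) :=
  forall s, t <= s <= T -> fmeas s (D s).

(** * Kolmogorov's maximal inequality and uniform limits of processes *)

Section FiniteMaximal.
Variables (D : R -> Omega B -> R) (lam : R) (u : nat -> R).
Hypotheses (mD : mart D) (lam0 : 0 < lam).
Hypotheses (uT : forall j, t <= u j <= T) (umono : forall j, u j <= u j.+1).

Definition exceeds s (w : Omega B) : R := if lam < `|D s w| then 1 else 0.

(* indicator of [exists j <= k, lam < |D (u j)|] *)
Fixpoint hit k w : R :=
  if k is k'.+1 then hit k' w + exceeds (u k) w * (1 - hit k' w) else exceeds (u 0%N) w.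

Lemma hit01 k w : hit k w = 0 \/ hit k w = 1.
Proof.
elim: k => [|k IH] /=; rewrite /exceeds; first by case: ltP; [right|left].
by case: IH => ->; case: ltP => _; rewrite ?subr0 ?subrr ?mulr0 ?mulr1 ?addr0 ?add0r; auto.
Qed.

Lemma hitP k w : hit k w = 1 <-> exists2 j, (j <= k)%N & lam < `|D (u j) w|.
Proof.
have n01 : (0 : R) <> 1 by move/eqP; rewrite eq_sym oner_eq0.
elim: k => [|k IH] /=.
  rewrite /exceeds; case: ltP => h; split => //; first by exists 0%N.
  by move=> [j]; rewrite leqn0 => /eqP ->; rewrite ltNge h.
case: (hit01 k w) => hk; rewrite hk ?subr0 ?subrr ?mulr0 ?mulr1 ?addr0 ?add0r.
  rewrite /exceeds; case: ltP => h; split => //; first by exists k.+1.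
  move=> [j]; rewrite leq_eqVlt => /orP[/eqP ->|jk hj]; first by rewrite ltNge h.
  by have /IH : exists2 j, (j <= k)%N & lam < `|D (u j) w|; [exists j|rewrite hk => /n01].
split => // _; have /IH [j jk hj] := hk; by exists j => //; exact: leqW.
Qed.

Lemma exceeds_meas s : t <= s <= T -> fmeas s (exceeds s).
Proof.
move=> st; have [mDs _] := mD.1 s st.
apply: measurable_fun_ifT; [|exact: measurable_cst|exact: measurable_cst].
apply: measurable_fun_ltr; first exact: measurable_cst.
exact: measurableT_comp.
Qed.

Lemma hit_meas k : fmeas (u k) (hit k).
Proof.
elim: k => [|k IH] /=; first exact: exceeds_meas.
have hk : fmeas (u k.+1) (hit k) by exact: fmeas_mono IH.
apply: measurable_funD => //; apply: measurable_funM; first exact: exceeds_meas.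
by apply: measurable_funB => //; exact: measurable_cst.
Qed.

Let bL2F s (x f : Omega B -> R) : t <= s <= T -> fmeas s x -> (forall w, x w = 0 \/ x w = 1) ->
  L2F s f -> L2F s (fun w => x w * f w).
Proof.
move=> st mx x01 [mf lf].
have mxf : fmeas s (fun w => x w * f w) by exact: measurable_funM.
split=> //; apply: (L2_le mT _ lf).
  exact: (fmeas_measurable HB st).
by move=> w _; case: (x01 w) => ->; rewrite ?mul0r ?mul1r ?normr0.
Qed.

(** Induction on the grid. On the event already hit, passing to the next time cannot lower the
    second moment, because the increment is orthogonal to the past; on a new hit the threshold is
    exceeded at that very time. *)
Lemma hit_bound k : lam ^+ 2 * E[hit k] <= E[fun w => hit k w * D (u k) w ^+ 2].
Proof.
have i01 s x : t <= s <= T -> fmeas s x -> (forall w, x w = 0 \/ x w = 1) -> itg P setT x.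
  move=> st mx x01; apply: (itg_le mT (g := fun=> 1)).
  - exact: (fmeas_measurable HB st).
  - exact: finite_measure_integrable_cst.
  - by move=> w _; case: (x01 w) => ->; rewrite ?normr0 ?normr1.
have iD s x f : t <= s <= T -> fmeas s x -> (forall w, x w = 0 \/ x w = 1) -> L2F s f ->
    itg P setT (fun w => x w * f w ^+ 2).
  move=> st mx x01 Lf; have [_ L1] := bL2F st mx x01 Lf.
  by apply: (itg_eq mT) (itgM mT L1 Lf.2) => w _; ring.
have e01 s w : exceeds s w = 0 \/ exceeds s w = 1.
  by rewrite /exceeds; case: ltP; [right|left].
have ex_le s w : lam ^+ 2 * exceeds s w <= exceeds s w * D s w ^+ 2.
  rewrite /exceeds; case: ltP => h; rewrite ?mulr0 ?mul0r // mulr1 mul1r.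
  by rewrite -[leRHS]real_normK ?num_real // ler_pXn2r ?nnegrE ?(ltW lam0) // ltW.
elim: k => [|k IH].
  rewrite -(EZ mT); last exact: i01 (exceeds_meas (uT 0)) _.
  apply: (E_le mT) => [||w _]; last exact: ex_le.
    exact/(itgZ mT)/(i01 _ _ (uT 0) (exceeds_meas (uT 0))).
  exact: iD (uT 0) (exceeds_meas _) _ (mD.1 _ (uT 0)).
have uk := uT k; have uk1 := uT k.+1; have mk := umono k.
have hk1 : fmeas (u k.+1) (hit k) := fmeas_mono mk (@hit_meas k).
pose c w := exceeds (u k.+1) w * (1 - hit k w).
have mc : fmeas (u k.+1) c.
  apply: measurable_funM; first exact: exceeds_meas.
  by apply: measurable_funB => //; exact: measurable_cst.
have c01 w : c w = 0 \/ c w = 1.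
  by rewrite /c; case: (hit01 k w) => ->; case: (e01 (u k.+1) w) => ->; rewrite ?subr0 ?subrr ?mulr0 ?mulr1; auto.
have LD := mD.1 _ uk; have LD1 := mD.1 _ uk1.
have i1 := iD _ _ _ uk (@hit_meas k) (hit01 k) LD.
have i2 := iD _ _ _ uk1 hk1 (hit01 k) LD1.
have i3 := iD _ _ _ uk1 mc c01 LD1.
have ic := i01 _ _ uk1 mc c01; have ih := i01 _ _ uk (@hit_meas k) (hit01 k).
have st1 : E[fun w => hit k w * D (u k) w ^+ 2] <= E[fun w => hit k w * D (u k.+1) w ^+ 2].
  have Lx := bL2F uk (@hit_meas k) (hit01 k) LD.
  have LDD := L2B mT LD1.2 LD.2.
  have /andP[tk _] := uk; have /andP[_ kT] := uk1.
  have z := mD.2 _ _ _ tk mk kT Lx.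
  have iz := itgM mT Lx.2 LDD.
  have h : E[fun w => hit k w * D (u k) w ^+ 2 + 2 * (hit k w * D (u k) w * (D (u k.+1) w - D (u k) w))]
       <= E[fun w => hit k w * D (u k.+1) w ^+ 2].
    apply: (E_le mT) => //; first exact: (itgD mT i1 (itgZ mT 2 iz)).
    move=> w _; rewrite -subr_ge0; set h := hit k w.
    have -> : h * D (u k.+1) w ^+ 2 - (h * D (u k) w ^+ 2 +
       2 * (h * D (u k) w * (D (u k.+1) w - D (u k) w))) = h * (D (u k.+1) w - D (u k) w) ^+ 2 by ring.
    by apply: mulr_ge0; rewrite ?sqr_ge0 // /h; case: (hit01 k w) => ->.
  by move: h; rewrite (ED mT i1 (itgZ mT 2 iz)) (EZ mT _ iz) z mulr0 addr0.
have -> : E[fun w => hit k.+1 w * D (u k.+1) w ^+ 2] =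
   E[fun w => hit k w * D (u k.+1) w ^+ 2] + E[fun w => c w * D (u k.+1) w ^+ 2].
  by rewrite -(ED mT) //; apply: E_eq => w _; rewrite /= -/(c w) mulrDl.
have -> : E[hit k.+1] = E[hit k] + E[c] by rewrite -(ED mT) //; exact: E_eq.
rewrite mulrDr; apply: lerD; first exact: le_trans IH st1.
rewrite -(EZ mT) //; apply: (E_le mT) => //; first exact: (itgZ mT).
move=> w _; rewrite /c; case: (hit01 k w) => ->; rewrite ?subr0 ?subrr ?mulr0 ?mul0r ?mulr1 //.
Qed.

Lemma kolmogorov_finite k :
  measurable [set w | exists2 j, (j <= k)%N & lam < `|D (u j) w|] /\
  (P [set w | exists2 j, (j <= k)%N & (lam < `|D (u j) w|)%R]
    <= (E[fun w => D (u k) w ^+ 2] / lam ^+ 2)%:E)%E.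
Proof.
set A := [set w | _].
have mh : measurable_fun setT (hit k) := fmeas_measurable HB (uT k) (@hit_meas k).
have mA : measurable A.
  rewrite (_ : A = setT `&` hit k @^-1` [set 1]); first exact: mh.
  by rewrite setTI; apply/seteqP; split => w /= /hitP.
split => //.
have hA w : hit k w = \1_A w.
  rewrite indicE; case: (boolP (w \in A)) => [/set_mem/hitP -> //|wA].
  case: (hit01 k w) => // /hitP wA'; by move/negP: wA; case; exact: mem_set.
have PE : (P A = (E[hit k])%:E)%E.
  rewrite /Rintegral; under eq_integral do rewrite hA.
  by rewrite integral_indic // setIT fineK // fin_num_measure.
rewrite PE lee_fin ler_pdivlMr ?exprn_gt0 // mulrC; apply: le_trans (hit_bound k) _.
have [mDk lDk] := mD.1 _ (uT k).
apply: (E_le mT) => [|//|w _]; last first.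
- by case: (hit01 k w) => ->; rewrite ?mul0r ?mul1r ?sqr_ge0.
- by case: lDk.
apply: (itg_le mT (g := fun w => D (u k) w ^+ 2)); last 2 first.
- by case: lDk.
- move=> w _; case: (hit01 k w) => ->; rewrite ?mul0r ?mul1r ?normr0 ?sqr_ge0 //.
  by rewrite ger0_norm ?sqr_ge0.
by apply: measurable_funM => //; apply: measurable_funX; case: lDk.
Qed.

End FiniteMaximal.

(** The grids are nested, so the events of the finite inequality increase with [m]. The minimum
    holds the sequence at [T] beyond its last index, as the finite inequality takes an infinite
    sequence of times. *)
Definition dyad (m j : nat) : R := t + (T - t) * (minn j (2 ^ m)%N)%:R / (2 ^ m)%:R.

Lemma dyad_in m j : t <= dyad m j <= T.
Proof.
have TT : 0 <= T - t by rewrite subr_ge0.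
have h2 : 0 < ((2 ^ m)%:R : R) by rewrite ltr0n expn_gt0.
rewrite /dyad lerDl divr_ge0 ?mulr_ge0 ?(ltW h2) //= -lerBrDl ler_pdivrMr //.
by rewrite ler_wpM2l // ler_nat geq_minr.
Qed.

Lemma dyad_mono m j : dyad m j <= dyad m j.+1.
Proof.
have TT : 0 <= T - t by rewrite subr_ge0.
rewrite /dyad lerD2l ler_wpM2r ?invr_ge0 // ler_wpM2l // ler_nat.
by rewrite leq_min geq_minr (leq_trans (geq_minl _ _)).
Qed.

Lemma dyad_last m : dyad m (2 ^ m) = T.
Proof. by rewrite /dyad minnn mulfK ?pnatr_eq0 ?expn_eq0 // addrC subrK. Qed.

Lemma dyad_refine m j : (j <= 2 ^ m)%N -> dyad m j = dyad m.+1 (2 * j).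
Proof.
move=> jm; rewrite /dyad (minn_idPl jm) (minn_idPl _); last by rewrite expnS leq_mul2l.
by rewrite expnS !natrM; congr (t + _); field; rewrite !pnatr_eq0 expn_eq0.
Qed.

Lemma dyad_dense s : t <= s <= T -> exists j : nat -> nat,
  (forall m, (j m <= 2 ^ m)%N) /\ (fun m => dyad m (j m)) @ \oo --> s.
Proof.
move=> /andP[ts sT]; have [eqT|neT] := eqVneq t T.
  exists (fun=> 0%N); split => //.
  have -> : s = t by apply/eqP; rewrite eq_le ts {1}eqT sT.
  by apply: cvg_near_cst; apply: nearW => m; rewrite /dyad eqT subrr mul0r mul0r addr0.
have T0 : 0 < T - t by rewrite subr_gt0 lt_neqAle neT.
have h2 m : 0 < ((2 ^ m)%:R : R) by rewrite ltr0n expn_gt0.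
pose x m := (s - t) / (T - t) * (2 ^ m)%:R.
have x0 m : 0 <= x m by rewrite mulr_ge0 ?divr_ge0 ?subr_ge0 // ?ltW.
pose j m := Num.truncn (x m).
have jx m : (j m)%:R <= x m by rewrite truncn_le.
have xj m : x m < (j m)%:R + 1 by rewrite natr1; exact: truncnS_gt.
have jm m : (j m <= 2 ^ m)%N.
  rewrite -(ler_nat R); apply: le_trans (jx m) _; rewrite /x ler_piMl ?(ltW (h2 m)) //.
  by rewrite ler_pdivrMr // mul1r lerD2r.
exists j; split => //.
have dE m : dyad m (j m) = t + (T - t) * (j m)%:R / (2 ^ m)%:R by rewrite /dyad (minn_idPl (jm m)).
have sE m : s = t + (T - t) * x m / (2 ^ m)%:R.
  by rewrite /x; field; rewrite !gt_eqF.
have lim : (fun m => s - (T - t) * (2^-1) ^+ m) @ \oo --> s.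
  rewrite -[X in _ --> X]subr0; apply: cvgB; first exact: cvg_cst.
  rewrite -(mulr0 (T - t)); apply: cvgM; first exact: cvg_cst.
  by apply: cvg_expr; rewrite ger0_norm // invf_lt1 // ltr1n.
apply: squeeze_cvgr _ lim (cvg_cst s); apply: nearW => m.
rewrite dE [X in X - _ <= _](sE m) [X in _ <= _ <= X](sE m); apply/andP; split; last first.
  by rewrite lerD2l ler_wpM2r ?invr_ge0 ?(ltW (h2 m)) // ler_wpM2l // ltW.
have -> : (2^-1 : R) ^+ m = ((2 ^ m)%:R)^-1 by rewrite natrX exprVn.
rewrite -addrA lerD2l.
have -> : (T - t) * x m / (2 ^ m)%:R - (T - t) / (2 ^ m)%:R = (T - t) * (x m - 1) / (2 ^ m)%:R by ring.
rewrite ler_wpM2r ?invr_ge0 ?(ltW (h2 m)) // ler_wpM2l ?(ltW T0) // lerBlDr ltW //.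
Qed.

(** The strict inequality is an open condition on a continuous path, so it is already witnessed at a
    dyadic time. The event is therefore an increasing union of events on finite grids, all with the
    same bound. *)
Lemma kolmogorov_maximal (D : R -> Omega B -> R) (lam : R) : mart D -> cpath D -> 0 < lam ->
  measurable [set w | exists2 s, t <= s <= T & lam < `|D s w|] /\
  (P [set w | exists2 s, (t <= s <= T)%R & (lam < `|D s w|)%R]
    <= (E[fun w => D T w ^+ 2] / lam ^+ 2)%:E)%E.
Proof.
move=> mD cD lam0.
pose A m := [set w | exists2 j, (j <= 2 ^ m)%N & lam < `|D (dyad m j) w|].
have hA m := kolmogorov_finite mD lam0 (dyad_in m) (dyad_mono m) (2 ^ m).
have -> : [set w | exists2 s, t <= s <= T & lam < `|D s w|] = \bigcup_m A m.
  apply/seteqP; split => [w /= [s sT hs]|w [m _ [j jm hj]]]; last first.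
    by exists (dyad m j) => //; exact: dyad_in.
  have [j [jm js]] := dyad_dense sT.
  have cDw : continuous ((D ^~ w) \o clp t T) by apply: within_clp => //; exact: cD.
  have h := cvg_comp _ _ js (cDw s).
  have /cvgrPdist_lt /(_ (`|D s w| - lam)) := h.
  rewrite /= (clp_id sT) subr_gt0 => /(_ hs) [N _ /(_ N (leqnn N)) /=].
  rewrite clp_id ?dyad_in // => hN; exists N => //; exists (j N) => //.
  have := le_trans (lerB_dist _ _) (ltW hN) => h2.
  have := le_lt_trans (lerB_dist (D s w) (D (dyad N (j N)) w)) hN.
  by rewrite ltrBlDr -ltrBlDl opprB addrC subrK.
have mA m : measurable (A m) := (hA m).1.
split; first exact: bigcupT_measurable.
have nd : {homo A : n m / (n <= m)%N >-> (n <= m)%O}.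
  apply/nondecreasing_seqP => m; apply/subsetPset => w [j jm hj].
  by exists (2 * j)%N; [rewrite expnS leq_mul2l|rewrite -dyad_refine].
have cv : (P \o A) @ \oo --> P (\bigcup_m A m) := nondecreasing_cvg_mu mA (bigcupT_measurable _ mA) nd.
rewrite -(cvg_lim _ cv) //; apply: lime_le; first by apply/cvg_ex; eexists; exact: cv.
apply: nearW => m /=; have := (hA m).2; by rewrite dyad_last.
Qed.

(** Borel-Cantelli: off the upper limit of the [A k] the increments are eventually geometric. On
    that null set the limit is set to 0, so that all paths are continuous; adaptedness survives
    because the filtration is augmented. *)
Lemma uniform_limit (Dk : nat -> R -> Omega B -> R) (A : nat -> set (Omega B)) (C : R) :
  (forall k, adapted (Dk k)) -> (forall k, cpath (Dk k)) ->
  (forall k, measurable (A k)) -> (forall k, (P (A k) <= (C * 2^-1 ^+ k)%:E)%E) ->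
  (forall k w, ~ A k w -> forall s, t <= s <= T -> `|Dk k.+1 s w - Dk k s w| <= 2^-1 ^+ k) ->
  exists D, [/\ adapted D, cpath D &
    {ae P, forall w, exists m, forall k s, (m <= k)%N -> t <= s <= T ->
       `|Dk k s w - D s w| <= 2 * 2^-1 ^+ k}].
Proof.
move=> aD cD mA PA dA.
pose N := lim_sup_set A.
have N0 : P.-negligible N.
  apply/negligibleP.
    by apply: bigcapT_measurable => i; apply: bigcup_measurable.
  apply: lim_sup_set_cvg0 => //.
  have C0 : 0 <= C.
    have := le_trans (measure_ge0 P (A 0%N)) (PA 0%N).
    by rewrite lee_fin expr0 mulr1.
  apply: (@le_lt_trans _ _ (\sum_(0 <= k <oo) (C * 2^-1 ^+ k)%:E)%E).
    by apply: lee_nneseries => k *; [exact: measure_ge0|exact: PA].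
  rewrite (_ : (\sum_(0 <= k <oo) _)%E = (2 * C)%:E) ?ltry //; apply/cvg_lim => //.
  have := @cvg_geometric_series R C 2^-1.
  rewrite ger0_norm // invf_lt1 // ltr1n => /(_ erefl).
  rewrite (_ : C / (1 - 2^-1) = 2 * C); last by field.
  move/cvge_EFin; apply: cvg_eq => n /=.
  by rewrite /eseries /series /= sumEFin.
have NA : {ae P, forall w, ~ N w} by apply: negligibleS N0 => w /contrapT.
(* The bound is a difference of two geometric tails, a form that is stable under adding one more
   increment. *)
have good w : ~ N w -> exists m, forall j k s, (m <= j)%N -> (j <= k)%N -> t <= s <= T ->
    `|Dk k s w - Dk j s w| <= 2 * 2^-1 ^+ j - 2 * 2^-1 ^+ k.
  rewrite /N /lim_sup_set => /existsNP[m /not_implyP[_ hm]].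
  have nA k : (m <= k)%N -> ~ A k w by move=> mk Ak; apply: hm; exists k.
  exists m => j k s mj /subnK <-; elim: (k - j)%N => [|i IH] sT.
    by rewrite add0n !subrr normr0.
  rewrite addSn; have := dA _ w (nA (i + j)%N _) s sT.
  move=> /(_ (leq_trans mj (leq_addl _ _))) h1; have h2 := IH sT.
  have -> : Dk (i + j).+1 s w - Dk j s w =
     (Dk (i + j).+1 s w - Dk (i + j)%N s w) + (Dk (i + j)%N s w - Dk j s w) by ring.
  apply: le_trans (ler_normD _ _) _.
  have : 2 * 2^-1 ^+ (i + j).+1 = 2^-1 ^+ (i + j) :> R by rewrite exprS mulrA mulfV ?mul1r.
  lra.
have small m e : 0 < e -> exists2 j, (m <= j)%N & 2 * 2^-1 ^+ j < e :> R.
  move=> e0; have h : (fun n => 2 * 2^-1 ^+ n : R) @ \oo --> 0.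
    apply: cvgMl0.
    by apply: cvg_expr; rewrite ger0_norm // invf_lt1 // ltr1n.
  have /cvgrPdist_lt /(_ e e0) [j _ hj] := h.
  exists (maxn m j); first exact: leq_maxl.
  have := hj (maxn m j) (leq_maxr _ _).
  by rewrite /= sub0r normrN ger0_norm // mulr_ge0 // exprn_ge0.
pose D s w := if `[< N w >] then 0 else lim (Dk k s w @[k --> \oo]).
have cvgD w s : ~ N w -> t <= s <= T -> (fun k => Dk k s w) @ \oo --> D s w.
  move=> Nw sT; rewrite /D asboolF //.
  have [m hm] := good w Nw.
  suff : cvgn (fun k => Dk k s w) by [].
  apply/cauchy_cvgP/cauchy_exP => e e0.
  have [j mj je] := small m e e0.
  exists (Dk j s w); exists j => // k /= jk.
  rewrite /ball /= distrC; apply: le_lt_trans (hm j k s mj jk sT) _.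
  by apply: le_lt_trans je; rewrite gerBl mulr_ge0 // exprn_ge0.
have final w : ~ N w -> exists m, forall k s, (m <= k)%N -> t <= s <= T ->
    `|Dk k s w - D s w| <= 2 * 2^-1 ^+ k.
  move=> Nw; have [m hm] := good w Nw; exists m => k s mk sT.
  apply/ler_addgt0Pr => e e0.
  have /cvgrPdist_lt /(_ e e0) [j _ hj] := cvgD w s Nw sT.
  have := hj (maxn j k) (leq_maxl _ _); rewrite /= distrC => h1.
  have h2 := hm k (maxn j k) s mk (leq_maxr _ _) sT.
  have h3 : 0 <= 2 * 2^-1 ^+ maxn j k :> R by rewrite mulr_ge0 // exprn_ge0.
  have := ler_distD (Dk (maxn j k) s w) (Dk k s w) (D s w).
  rewrite (distrC (Dk k s w) (Dk (maxn j k) s w)); lra.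
exists D; split.
- move=> s sT.
  apply: (@measurable_fun_cvg _ (g_sigma_algebraType (@fgen R d B t s)) _ setT
     (fun k (w : g_sigma_algebraType (@fgen R d B t s)) => if `[< N w >] then 0 else Dk k s w)) => [k|w _].
    by apply: (fmeas_ae (aD k s sT)); apply: filterS NA => w Nw; rewrite asboolF.
  rewrite /D; case: (asboolP (N w)) => Nw; first exact: cvg_cst.
  by have := cvgD w s Nw sT; rewrite /D asboolF.
- move=> w; apply: (within_clp_inv tT) => x.
  case: (pselect (N w)) => Nw.
    have -> : (D ^~ w) \o clp t T = fun=> 0 by apply/funext => y; rewrite /D /= asboolT.
    exact: cvg_cst.
  have [m hm] := final w Nw.
  apply/cvgrPdist_lt => e e0.
  have e3 : 0 < e / 3 by rewrite divr_gt0.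
  have [j mj je] := small m (e / 3) e3.
  have cx : continuous ((Dk j ^~ w) \o clp t T) by apply: within_clp => //; exact: cD.
  have /cvgrPdist_lt /(_ _ e3) := cx x.
  apply: filterS => y /= h.
  have h1 := hm j _ mj (clp_in x tT); have h2 := hm j _ mj (clp_in y tT).
  have := ler_distD (Dk j (clp t T x) w) (D (clp t T x) w) (D (clp t T y) w).
  have := ler_distD (Dk j (clp t T y) w) (Dk j (clp t T x) w) (D (clp t T y) w).
  rewrite (distrC (D (clp t T x) w) (Dk j (clp t T x) w)) => h3 h4.
  have : e / 3 + e / 3 + e / 3 = e by field.
  lra.
- by apply: filterS NA => w; exact: final.
Qed.

(** * From simple processes to the Ito integral *)

Lemma ints_fmeas r s l : t <= r -> List.Forall (elem_wf r s) l -> fmeas s (@ints R d B l).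
Proof.
move=> tr; elim: l => [|e l IH] h.
  rewrite (_ : ints _ = fun=> 0); first exact: measurable_cst.
  by apply/funext => w; rewrite /ints big_nil.
have [[ra ab bs [mc lc]] hl] : elem_wf r s e /\ List.Forall (elem_wf r s) l.
  by inversion h.
rewrite (_ : ints _ = fun w => elem_int e w + ints l w); last first.
  by apply/funext => w; rewrite /ints big_cons.
apply: measurable_funD; last exact: IH.
apply: measurable_funM; first exact: fmeas_mono (le_trans ab bs) mc.
have ta := le_trans tr ra.
by apply: fmeas_dW; rewrite ?ta ?(le_trans ab) ?(le_trans ta).
Qed.

(** Restriction of a simple process to [r, s], split into coordinates. A cell starting after [s] is
    clamped to an empty one; its coefficient is replaced by 0, since it need not be known at the
    clamped time [s]. *)
Definition clamped (H : simple_process B) r s : seq (@elem R d B) :=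
  [seq Elem (clp r s (knot H p.1)) (clp r s (knot H p.1.+1)) p.2
         (fun w => if knot H p.1 <= s then coef H p.1 w p.2 0 else 0)
  | p <- [seq (j, i) | j <- index_iota 0 (steps H), i <- enum 'I_d]].

Lemma clamped_wf H r s : simple_wf t T H -> t <= r -> r <= s -> s <= T ->
  List.Forall (elem_wf r s) (clamped H r s).
Proof.
move=> wH tr rs sT.
suff h (l : seq (nat * 'I_d)) : (forall p, p \in l -> (p.1 < steps H)%N) ->
    List.Forall (elem_wf r s) [seq Elem (clp r s (knot H p.1)) (clp r s (knot H p.1.+1)) p.2
         (fun w => if knot H p.1 <= s then coef H p.1 w p.2 0 else 0) | p <- l].
  by apply: h => p /allpairsP[[j i] /= [+ _ ->]]; rewrite mem_index_iota.
elim: l => [|p l IH] hl /=; constructor; last first.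
  by apply: IH => q ql; apply: hl; rewrite in_cons ql orbT.
have [tk kk kT [K hK] mc] := wH _ (hl p (mem_head _ _)).
have /andP[c1 c2] := clp_in (knot H p.1) rs; have /andP[c3 c4] := clp_in (knot H p.1.+1) rs.
split => //=.
  exact: clp_mono.
have mf : fmeas (clp r s (knot H p.1)) (fun w => if knot H p.1 <= s then coef H p.1 w p.2 0 else 0).
  have [ks|_] := leP (knot H p.1) s; last exact: measurable_cst.
  apply: (@fmeas_mono _ _ _ _ (knot H p.1)); first by rewrite /clp (min_l ks) le_max lexx orbT.
  by apply/fmeasP => U mU; exact: mc.
split=> //; apply: (L2_le mT (g := fun=> K)).
- by apply: (fmeas_measurable HB) mf; rewrite (le_trans tr c1) (le_trans c2).
- by split; [exact: measurable_cst|exact: finite_measure_integrable_cst].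
- move=> w _; have K0 : 0 <= K by apply: le_trans (hK w); exact: enorm_ge0.
  rewrite (ger0_norm K0); case: ifP => _; rewrite ?normr0 //.
  exact: le_trans (enorm_coord _ _ _) (hK w).
Qed.

Lemma ints_clamped H r s w : simple_wf t T H -> t <= r -> r <= s -> s <= T ->
  ints (clamped H r s) w = simple_int H s w - simple_int H r w.
Proof.
move=> wH tr rs sT; rewrite /ints /clamped big_map big_allpairs_dep /=.
rewrite /simple_int -sumrB big_mkord.
apply: eq_bigr => j _; have [tk kk kT _ _] := wH j (ltn_ord j).
rewrite -sumrB big_enum /=; apply: eq_bigr => i _; rewrite /elem_int /= /dW !mxE.
have mm k : W (Num.min k s) w i 0 - W (Num.min k r) w i 0 = W (clp r s k) w i 0 - W r w i 0 :> R.
  rewrite /clp; case: (leP k r) => kr.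
    by rewrite (min_l (le_trans kr rs)) (max_l kr) !subrr.
  by rewrite max_r // le_min (ltW kr) rs.
transitivity (coef H j w i 0 * ((W (Num.min (knot H j.+1) s) w i 0 - W (Num.min (knot H j.+1) r) w i 0) -
    (W (Num.min (knot H j) s) w i 0 - W (Num.min (knot H j) r) w i 0))); last by ring.
rewrite !mm; have cE k : s <= k -> clp r s k = s by move=> sk; rewrite /clp (min_r sk) max_r.
have [ks|ks] := leP (knot H j) s; first by ring.
by rewrite !cE ?(ltW (lt_le_trans ks kk)) ?(ltW ks) //; ring.
Qed.

Lemma vals_clamped H r s i z : simple_wf t T H -> r <= s -> band r s z ->
  vals (clamped H r s) i z = simple_val H z.1 z.2 i 0.
Proof.
move=> wH rs [/= + _]; rewrite in_itv /= => /andP[rz zs].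
rewrite /vals /clamped big_map big_allpairs_dep /= /simple_val summxE.
rewrite big_mkord.
apply: eq_bigr => j _; rewrite mxE big_enum (bigD1 i) //= big1 => [|k ki]; last first.
  by rewrite /elem_val /= eq_sym (negbTE ki) mul0r.
rewrite addr0 /elem_val /= eqxx mul1r indicE.
have -> : (z.1 \in `]clp r s (knot H j), clp r s (knot H j.+1)]%classic) = (knot H j < z.1 <= knot H j.+1).
  rewrite (_ : (z.1 \in _) = (clp r s (knot H j) < z.1 <= clp r s (knot H j.+1))); last first.
    by apply/idP/idP => [/set_mem|h]; rewrite /= ?in_itv //; apply: mem_set; rewrite /= in_itv.
  rewrite /clp gt_max rz gt_min le_max le_min zs andbT (leNgt z.1 r) rz /=.
  by rewrite (ltNge s) zs orbF.
by case: (leP (knot H j) s) => // ks; rewrite ltNge (le_trans zs (ltW ks)) /= !mul0r.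
Qed.

Lemma simple_int_start H w : simple_wf t T H -> @simple_int R d B H t w = 0.
Proof.
move=> wH; rewrite /simple_int big1 // => j _; have [tk kk _ _ _] := wH j (ltn_ord j).
rewrite !min_r ?(le_trans tk kk) // subrr /dot big1 // => i _; by rewrite mxE mulr0.
Qed.

Lemma simple_mart H : simple_wf t T H -> mart (simple_int H).
Proof.
move=> wH.
have e r s : t <= r -> r <= s -> s <= T ->
    (fun w => simple_int H s w - simple_int H r w) = ints (clamped H r s).
  by move=> tr rs sT; apply/funext => w; rewrite ints_clamped.
split=> [s /andP[ts sT]|r s xi tr rs sT Lxi]; last first.
  have wl := clamped_wf wH tr rs sT.
  rewrite -(ints_mean HB tr sT wl Lxi); apply: E_eq => w _.
  by rewrite -e.
have wl := clamped_wf wH (lexx t) ts sT.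
have -> : simple_int H s = ints (clamped H t s).
  by rewrite -e //; apply/funext => w; rewrite simple_int_start // subr0.
split; first exact: ints_fmeas wl.
exact: (ints_L2 HB (lexx t) sT wl).
Qed.

Lemma simple_cpath H : simple_wf t T H -> cpath (@simple_int R d B H).
Proof.
move=> wH w; apply: (within_clp_inv tT).
have [_ _ _ cW _] := HB.
have cWc : continuous ((fun s => W s w) \o clp t T) by exact: (within_clp tT (cW w)).
have key k i : t <= k -> k <= T ->
    continuous (fun x : R => W (Num.min k (clp t T x)) w i 0 : R).
  move=> tk kT x.
  have -> : (fun x : R => W (Num.min k (clp t T x)) w i 0) =
      (fun M : 'cV[R]_d => M i 0) \o ((fun s => W s w) \o clp t T) \o (fun x => Num.min k (clp t T x)).
    apply/funext => y /=; rewrite [in RHS]clp_id //.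
    by have /andP[h1 h2] := clp_in y tT; rewrite le_min tk h1 ge_min kT.
  apply: continuous_comp; last first.
    by apply: continuous_comp; [exact: cWc|exact: coord_continuous].
  apply: (@continuous_min _ R (fun=> k) (clp t T) x); [exact: cvg_cst|exact: clp_continuous].
move=> x; rewrite /comp /simple_int.
rewrite /continuous_at; apply: cvg_sumF => j; have [tk kk kT _ _] := wH j (ltn_ord j).
rewrite /dot; apply: cvg_sumF => i.
apply: cvgM; first exact: cvg_cst.
under eq_fun do rewrite !mxE.
rewrite !mxE; apply: cvgB; apply: key => //; by [exact: le_trans tk kk|exact: le_trans kk kT].
Qed.

Lemma simple_val_L2 H i : simple_wf t T H ->
  L2 lm (band t T) (fun z => simple_val H z.1 z.2 i 0).
Proof.
move=> wH; have wl := clamped_wf wH (lexx t) tT (lexx T).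
apply: (L2_eq (@measurable_band R d B t T)) (vals_L2 i wl) => z bz.
exact: vals_clamped wH tT bz.
Qed.

Lemma simple_isometry H H' r s : simple_wf t T H -> simple_wf t T H' ->
  t <= r -> r <= s -> s <= T ->
  E[fun w => (simple_int H s w - simple_int H r w - (simple_int H' s w - simple_int H' r w)) ^+ 2] =
  \sum_i nrm lm (band r s) (fun z => simple_val H z.1 z.2 i 0 - simple_val H' z.1 z.2 i 0) ^+ 2.
Proof.
move=> wH wH' tr rs sT; have mb := @measurable_band R d B r s.
have c1 := clamped_wf wH tr rs sT; have c2 := clamped_wf wH' tr rs sT.
have i1 : isint r s (vals (clamped H r s)) (ints (clamped H r s)).
  exists (fun=> clamped H r s); split => // [i|]; apply: L2cv_cst => //.
    exact: vals_L2 c1.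
  exact: (ints_L2 HB tr sT c1).
have i2 : isint r s (vals (clamped H' r s)) (ints (clamped H' r s)).
  exists (fun=> clamped H' r s); split => // [i|]; apply: L2cv_cst => //.
    exact: vals_L2 c2.
  exact: (ints_L2 HB tr sT c2).
have := isint_norm HB tr sT (isintD i1 (isintN i2)).
under E_eq do rewrite !ints_clamped //.
move=> ->; apply: eq_bigr => i _; rewrite nrm_sq; apply: E_eq => z bz.
by rewrite !(vals_clamped _ _ rs bz).
Qed.

(** Convergence of the extended-real errors to 0 makes some error finite; as simple integrals are
    square integrable, so is [M]. *)
Lemma ito_L2 Z M : ito t T Z M ->
  (forall i, L2 lm (band t T) (fun z => Z z.1 z.2 i 0)) /\ forall s, t <= s <= T -> L2 P setT (M s).
Proof.
move=> [[pZ fZ] pM _ [H [wH HZ HM]]]; split.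
  apply: band_enorm_fin fZ => i; apply: (progressive_measurable HB (pZ i) tT).
    exact: measurable_band.
  by move=> z [/= + _]; rewrite in_itv /= => /andP[/ltW -> ->].
move=> s st; have mM : measurable_fun setT (M s).
  exact: (fmeas_measurable HB st) (progressive_fmeas st pM).
have /fine_cvgP[/= [k _ /(_ k (leqnn k)) fk] _] := HM s st.
have [_ Lk] := (simple_mart (wH k)).1 s st.
have LD : L2 P setT (fun w => simple_int (H k) s w - M s w).
  split; first by apply: measurable_funB => //; exact: L2_meas Lk.
  apply: itg_ge0P => [|*|]; rewrite ?sqr_ge0 //.
    by apply: measurable_funX; apply: measurable_funB => //; exact: L2_meas Lk.
  by rewrite ltey_eq fk.
by apply: (L2_eq mT) (L2B mT Lk LD) => w _; ring.
Qed.

(** The bridge from the integral of the problem statement to [isint]: one approximating sequence,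
    cut to [r, s], serves every subinterval. *)
Lemma ito_isint Z M r s : ito t T Z M -> t <= r -> r <= s -> s <= T ->
  isint r s (fun i z => Z z.1 z.2 i 0) (fun w => M s w - M r w).
Proof.
move=> iZ tr rs sT; have [LZ LM] := ito_L2 iZ.
have [_ _ _ [H [wH HZ HM]]] := iZ; have mb := @measurable_band R d B r s.
have rt : t <= r <= T by rewrite tr (le_trans rs).
have st : t <= s <= T by rewrite sT (le_trans tr).
have LH k i := @simple_val_L2 (H k) i (wH k).
exists (fun k => clamped (H k) r s); split => [k|i|]; first exact: clamped_wf.
- split=> [k||]; first by apply: (vals_L2 (t := t)); exact: clamped_wf.
    exact: (L2_band_sub tr sT (LZ i)).1.
  have Ld k j := L2B (@measurable_band R d B t T) (LH k j) (LZ j).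
  have cv : (fun k => \sum_j nrm lm (band t T) (fun z => simple_val (H k) z.1 z.2 j 0 - Z z.1 z.2 j 0) ^+ 2) @ \oo --> 0.
    have /fine_cvgP[_] := HZ; apply: cvg_eq => k /=.
    rewrite (@band_enorm _ _ _ _ _ _ (fun s w => simple_val (H k) s w - Z s w)) /=.
      by apply: eq_bigr => j _; congr (_ ^+ 2); apply: nrm_eq => z _; rewrite !mxE.
    by move=> j; apply: (L2_eq (@measurable_band R d B t T)) (Ld k j) => z _; rewrite !mxE.
  have cv2 := cvg_sqrt0 cv.
  apply: squeeze_cvgr _ (cvg_cst 0) cv2; apply: nearW => k; rewrite nrm_ge0 /=.
  have -> : nrm lm (band r s) (fun z => vals (clamped (H k) r s) i z - Z z.1 z.2 i 0) =
     nrm lm (band r s) (fun z => simple_val (H k) z.1 z.2 i 0 - Z z.1 z.2 i 0).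
    by apply: nrm_eq => z bz; rewrite (vals_clamped _ _ rs bz).
  apply: le_trans (L2_band_sub tr sT (Ld k i)).2 _.
  rewrite -[leLHS]ger0_norm ?nrm_ge0 // -sqrtr_sqr; apply: ler_wsqrtr.
  by rewrite (bigD1 i) //= lerDl sumr_ge0 // => j _; rewrite sqr_ge0.
- have Lk k s' : t <= s' <= T -> L2 P setT (simple_int (H k) s') by move=> h; exact: ((simple_mart (wH k)).1 s' h).2.
  have cv s' : t <= s' <= T -> L2cv P setT (fun k => simple_int (H k) s') (M s').
    move=> h; split; [by move=> k; exact: Lk|exact: LM|].
    have /fine_cvgP[_ cv] := HM s' h.
    exact: cvg_sqrt0 cv.
  have [c1 c2 c3] := L2cvD mT (cv s st) (L2cvZ mT (-1) (cv r rt)).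
  have e k w : ints (clamped (H k) r s) w = simple_int (H k) s w + -1 * simple_int (H k) r w.
    by rewrite ints_clamped // mulN1r.
  split=> [k||].
  - by apply: (L2_eq mT) (c1 k) => w _; rewrite e.
  - by apply: (L2_eq mT) c2 => w _; rewrite mulN1r.
  - apply: cvg_trans c3; apply: near_eq_cvg; apply: nearW => k; apply: nrm_eq => w _.
    by rewrite e !mulN1r.
Qed.

Lemma martB D D' : mart D -> mart D' -> mart (fun s w => D s w - D' s w).
Proof.
move=> mD mD'; split=> [s st|r s xi tr rs sT Lxi].
  have [m1 l1] := mD.1 s st; have [m2 l2] := mD'.1 s st.
  by split; [exact: measurable_funB|exact: (L2B mT)].
have st : t <= s <= T by rewrite sT (le_trans tr).
have rt : t <= r <= T by rewrite tr (le_trans rs).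
have e1 := mD.2 r s xi tr rs sT Lxi; have e2 := mD'.2 r s xi tr rs sT Lxi.
have l1 := L2B mT (mD.1 s st).2 (mD.1 r rt).2.
have l2 := L2B mT (mD'.1 s st).2 (mD'.1 r rt).2.
have i1 := itgM mT Lxi.2 l1; have i2 := itgM mT Lxi.2 l2.
rewrite -[RHS](subrr 0) -[in X in X - _]e1 -[in X in _ - X]e2 -(EB mT i1 i2).
by apply: E_eq => w _; ring.
Qed.

Lemma cpathB D D' : cpath D -> cpath D' -> cpath (fun s w => D s w - D' s w).
Proof. by move=> cD cD' w; apply: within_continuousB; [exact: cD|exact: cD']. Qed.

Section Limit.
Variables (H : nat -> @simple_process R d B) (Z : R -> Omega B -> 'cV[R]_d).
Hypotheses (wH : forall k, simple_wf t T (H k))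
  (LZ : forall i, L2 lm (band t T) (fun z => Z z.1 z.2 i 0))
  (fast : forall k, \sum_i nrm lm (band t T) (fun z => simple_val (H k) z.1 z.2 i 0 - Z z.1 z.2 i 0) ^+ 2
     <= 64^-1 ^+ k).

Let close j k s : (k <= j)%N -> t <= s <= T ->
  E[fun w => (simple_int (H j) s w - simple_int (H k) s w) ^+ 2] <= 4 * 64^-1 ^+ k.
Proof.
move=> kj /andP[ts sT].
have -> : E[fun w => (simple_int (H j) s w - simple_int (H k) s w) ^+ 2] =
   E[fun w => (simple_int (H j) s w - simple_int (H j) t w - (simple_int (H k) s w - simple_int (H k) t w)) ^+ 2].
  by apply: E_eq => w _; rewrite (simple_int_start _ (@wH j)) (simple_int_start _ (@wH k)) !subr0.
rewrite (simple_isometry (@wH j) (@wH k) (lexx t) ts sT).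
have q1 : (64^-1 : R) ^+ j <= 64^-1 ^+ k by rewrite ler_wiXn2l // invf_le1 // ler1n.
apply: (@le_trans _ _ (2 * (64^-1 ^+ j + 64^-1 ^+ k))); last by lra.
apply: le_trans (ler_wpM2l _ (lerD (fast j) (fast k))) => //.
rewrite -big_split mulr_sumr /=; apply: ler_sum => i _.
have Lj := L2B (mbd t T) (simple_val_L2 i (@wH j)) (LZ i).
have Lk := L2B (mbd t T) (simple_val_L2 i (@wH k)) (LZ i).
have Ljk := L2B (mbd t T) Lj Lk.
have e : nrm lm (band t s) (fun z => simple_val (H j) z.1 z.2 i 0 - simple_val (H k) z.1 z.2 i 0) <=
   nrm lm (band t T) (fun z => simple_val (H j) z.1 z.2 i 0 - Z z.1 z.2 i 0) +
   nrm lm (band t T) (fun z => simple_val (H k) z.1 z.2 i 0 - Z z.1 z.2 i 0).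
  apply: le_trans (nrmB (mbd t T) Lj Lk).
  apply: le_trans (L2_band_sub (lexx t) sT Ljk).2.
  by apply: ler_eq; apply: nrm_eq => z _; ring.
set x := nrm _ _ _ in e *; set y := nrm lm (band t T) _ in e *; set z := nrm lm (band t T) _ in e *.
have x0 : 0 <= x by exact: nrm_ge0.
have y0 : 0 <= y by exact: nrm_ge0.
have z0 : 0 <= z by exact: nrm_ge0.
have : x ^+ 2 <= (y + z) ^+ 2 by rewrite ler_pXn2r // ?nnegrE ?addr_ge0.
have := sqr_ge0 (y - z); nra.
Qed.

(** The rate 64^-k is small compared with the squared threshold (2^-k)^2, so the maximal inequality
    gives summable probabilities and the simple integrals converge uniformly on almost every path.
    Fatou's lemma identifies the same limit in L2. *)
Lemma ito_limit : (forall i, progressive t T (fun s w => Z s w i 0)) ->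
  exists M, [/\ ito t T Z M, cpath M & adapted M].
Proof.
move=> pZ; pose I k := simple_int (H k).
have mI k : mart (I k) by exact: simple_mart.
have cI k : cpath (I k) by exact: simple_cpath.
have aI k : adapted (I k) by move=> s st; exact: ((mI k).1 s st).1.
pose A k := [set w | exists2 s, t <= s <= T & 2^-1 ^+ k < `|I k.+1 s w - I k s w|].
have h2 k : 0 < (2^-1 : R) ^+ k by rewrite exprn_gt0.
have kol k := kolmogorov_maximal (martB (mI k.+1) (mI k)) (cpathB (cI k.+1) (cI k)) (h2 k).
have PA k : (P (A k) <= (4 * 2^-1 ^+ k)%:E)%E.
  apply: le_trans (kol k).2 _; rewrite lee_fin ler_pdivrMr ?exprn_gt0 //.
  apply: le_trans (close (leqnSn k) _) _; first by rewrite tT lexx.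
  rewrite -mulrA ler_wpM2l // -exprM mulnC exprM -exprMn.
  by rewrite lerXn2r ?nnegrE //; lra.
have [|M [aM cM uM]] := uniform_limit aI cI (fun k => (kol k).1) PA.
  move=> k w nA s st; rewrite leNgt; apply/negP => hlt; apply: nA; by exists s.
exists M; split => //; split.
- split => //; rewrite (band_enorm LZ); exact: ltry.
- exact: (continuous_adapted_progressive aM cM).
- by apply/nearW/cM.
exists H; split => // [|s st].
  rewrite (_ : (fun k => _) = (fun k => (\sum_i nrm lm (band t T) (fun z => simple_val (H k) z.1 z.2 i 0 - Z z.1 z.2 i 0) ^+ 2)%:E)); last first.
    apply/funext => k; rewrite (@band_enorm _ _ _ _ _ _ (fun s w => simple_val (H k) s w - Z s w)) /=.
      by congr (_%:E); apply: eq_bigr => i _; congr (_ ^+ 2); apply: nrm_eq => z _; rewrite !mxE.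
    move=> i; have Ld := L2B (mbd t T) (simple_val_L2 i (@wH k)) (LZ i).
    by apply: (L2_eq (mbd t T)) Ld => z _; rewrite !mxE.
  apply: cvge_EFin; apply: (@geo_cvg _ _ _ 1 0%N) => k _; rewrite subr0 mul1r ger0_norm.
    apply: le_trans (fast k) _; rewrite lerXn2r ?nnegrE //; lra.
  by apply: sumr_ge0 => i _; rewrite sqr_ge0.
have LI k : L2 P setT (I k s) := ((mI k).1 s st).2.
have mM : measurable_fun setT (M s) := fmeas_measurable HB st (aM s st).
have fat k : L2 P setT (fun w => M s w - I k s w) /\
    nrm P setT (fun w => M s w - I k s w) <= Num.sqrt (4 * 64^-1 ^+ k).
  apply: (@L2_fatou _ _ _ _ _ mT (fun j w => I j s w - I k s w)).
  - by move=> j; exact: (L2B mT).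
  - by apply: measurable_funB => //; exact: L2_meas (LI k).
  - by exists k => // j /= kj; apply: ler_wsqrtr; exact: close.
  - apply: filterS uM => w [m hm] _; apply: cvgB; last exact: cvg_cst.
    by apply: (@geo_cvg _ _ _ 2 m) => j mj; exact: hm.
rewrite (_ : (fun k => _) = (fun k => (nrm P setT (fun w => M s w - I k s w) ^+ 2)%:E)); last first.
  apply/funext => k; rewrite nrm_sq -(EFin_E mT); last exact: (fat k).1.2.
  by apply: eq_integral => w _; congr (_%:E); rewrite -/(I k); ring.
apply: cvge_EFin; apply: (@geo_cvg _ _ _ 4 0%N) => k _; rewrite subr0 ger0_norm ?sqr_ge0 //.
apply: (@le_trans _ _ (4 * 64^-1 ^+ k)).
  have h0 : 0 <= 4 * 64^-1 ^+ k :> R by rewrite mulr_ge0 // exprn_ge0.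
  by rewrite -[leRHS]sqr_sqrtr // ler_pXn2r ?nnegrE ?nrm_ge0 ?sqrtr_ge0 //; exact: (fat k).2.
by rewrite ler_wpM2l // lerXn2r ?nnegrE //; lra.
Qed.

End Limit.

(** The integrand is frozen at the left ends of grid cells, which keeps it adapted. Continuity of
    paths and the bound [K] give convergence in H^2 by dominated convergence, and a subsequence
    reaches the rate that [ito_limit] asks for. *)
Lemma ito_exists (Z : R -> Omega B -> 'cV[R]_d) (K : R) :
  (forall i, adapted (fun s w => Z s w i 0)) -> (forall i, cpath (fun s w => Z s w i 0)) ->
  (forall s w i, t <= s <= T -> `|Z s w i 0| <= K) ->
  exists M, [/\ ito t T Z M, cpath M & adapted M].
Proof.
move=> aZ cZ bZ.
have pZ i : progressive t T (fun s w => Z s w i 0) by exact: (continuous_adapted_progressive (aZ i) (cZ i)).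
have bt z : band t T z -> t <= z.1 <= T by move=> [/= + _]; rewrite in_itv /= => /andP[/ltW -> ->].
have mZ i : mband (fun z => Z z.1 z.2 i 0) t T.
  exact: (progressive_measurable HB (pZ i) tT (mbd t T) bt).
have icst c : itg lm (band t T) (fun=> c).
  have [+ _] := band_prod (B := B) (lexx t) tT (lexx T) (@finite_measure_integrable_cst _ _ _ P _ c mT).
  apply: (itg_eq (mbd t T)) => z [bz _] /=.
  by rewrite indicE mem_set // mul1r.
have LZ i : L2 lm (band t T) (fun z => Z z.1 z.2 i 0).
  apply: (L2_le (mbd t T) (mZ i)) (_ : L2 lm (band t T) (fun=> K)) _.
    by split; [exact: measurable_cst|exact: icst].
  by move=> z /bt h; exact: le_trans (bZ _ _ _ h) (ler_norm _).
pose H N := SimpleProcess N.+1 (grid t T N) (fun j => Z (grid t T N j)).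
have wH N : simple_wf t T (H N).
  move=> j /= jN; have /andP[g1 _] := grid_in tT (ltnW jN).
  have /andP[_ g2] := grid_in tT jN.
  split=> //=; first exact: grid_le.
    exists (Num.sqrt (\sum_(i < d) K ^+ 2)) => w; apply: ler_wsqrtr; apply: ler_sum => i _.
    rewrite big_ord1 -[leLHS]real_normK ?num_real //.
    have h := bZ (grid t T N j) w i (grid_in tT (ltnW jN)).
    by rewrite ler_pXn2r ?nnegrE // (le_trans _ h).
  by move=> i U mU; have /fmeasP := aZ i _ (grid_in tT (ltnW jN)); apply.
have valE N z i : simple_val (H N) z.1 z.2 i 0 =
    \sum_(j < N.+1) (grid t T N j < z.1 <= grid t T N j.+1)%R%:R * Z (grid t T N j) z.2 i 0.
  by rewrite /simple_val summxE; apply: eq_bigr => j _; rewrite mxE.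
pose F i N z := (simple_val (H N) z.1 z.2 i 0 - Z z.1 z.2 i 0) ^+ 2.
have F0 i : (fun N => nrm lm (band t T) (fun z => simple_val (H N) z.1 z.2 i 0 - Z z.1 z.2 i 0) ^+ 2) @ \oo --> 0.
  have : (fun N => Rintegral lm (band t T) (fun z => `|F i N z|)) @ \oo --> 0.
    apply: (dct0 (mbd t T) (g := fun=> (K + K) ^+ 2)) => [N||N z bz|].
    - apply: measurable_funX; apply: measurable_funB => //.
      exact: L2_meas (simple_val_L2 i (wH N)).
    - exact: icst.
    - have b := bZ _ z.2 i (bt z bz).
      have tz : t < z.1 <= T by move: bz => [/= + _]; rewrite in_itv.
      have : `|simple_val (H N) z.1 z.2 i 0 - Z z.1 z.2 i 0| <= K + K.
        rewrite valE; apply: (grid_avg (a := fun j => Z (grid t T N j) z.2 i 0) tT tz) => j jN _.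
        apply: le_trans (ler_normB _ _) _; apply: lerD => //.
        exact: bZ (grid_in tT (ltnW jN)).
      move=> h; rewrite ger0_norm ?sqr_ge0 // -[leLHS]real_normK ?num_real //.
      by rewrite ler_pXn2r ?nnegrE // (le_trans _ h).
    - apply: nearW => -[x w] bz; have tz : t < x <= T by move: bz => [/= + _]; rewrite in_itv.
      have cf : continuous ((fun s => Z s w i 0) \o clp t T) by exact: (within_clp tT (cZ i w)).
      rewrite -[X in _ --> X](expr0n R 2) /F /=.
      rewrite (_ : (fun N => _) = (fun u : R => u ^+ 2) \o (fun N => simple_val (H N) x w i 0 - Z x w i 0)) //.
      apply: continuous_cvg; first exact: exprn_continuous.
      apply/cvgrPdist_le => e e0.
      have /cvgrPdist_le /(_ e e0) [h /= h0 hh] := cf x.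
      have := cvg0_lt (mesh_cvg t T) h0; apply: filterS => N /= hN.
      rewrite sub0r normrN (valE N (x, w)).
      apply: (grid_avg (a := fun j => Z (grid t T N j) w i 0) tT tz) => j jN /andP[gx xg].
      rewrite distrC; have := hh (grid t T N j); rewrite /= clp_id; last by case/andP: tz => /ltW -> ->.
      rewrite clp_id; last exact: grid_in tT (ltnW jN).
      apply; rewrite ger0_norm ?subr_ge0 ?(ltW gx) //.
      apply: le_lt_trans hN; apply: le_trans (ler_norm _); rewrite -(grid_step t T N j).
      by rewrite lerD2r.
  apply: cvg_eq => N; rewrite nrm_sq; apply: E_eq => z _.
  by rewrite /F ger0_norm ?sqr_ge0.
have S0 : (fun N => \sum_i nrm lm (band t T) (fun z => simple_val (H N) z.1 z.2 i 0 - Z z.1 z.2 i 0) ^+ 2) @ \oo --> 0.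
  by apply: cvg_sum0.
have [|phi hphi] := fast_subsequence S0 (q := 64^-1); first by rewrite invr_gt0.
apply: (@ito_limit (fun k => H (phi k))) => // k.
exact: le_trans (ler_norm _) (hphi k).2.
Qed.

Lemma cpath_sub D r s w : cpath D -> t <= r -> s <= T -> {within `[r, s], continuous (D ^~ w)}.
Proof.
move=> cD tr sT; apply: continuous_subspaceW (cD w).
by apply: subset_itv; rewrite bnd_simp.
Qed.

Lemma cpath_itg D r s w : cpath D -> t <= r -> s <= T -> itg leb `[r, s]%classic (D ^~ w).
Proof. by move=> cD tr sT; apply: ci_cont; exact: cpath_sub. Qed.

Lemma band_meas D r s : adapted D -> cpath D -> t <= r -> s <= T -> mband (fun z => D z.1 z.2) r s.
Proof.
move=> aD cD tr sT; apply: (progressive_measurable HB _ tT (mbd r s)).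
  exact: (continuous_adapted_progressive aD cD).
by move=> z [/= + _]; rewrite in_itv /= => /andP[/ltW h1 h2]; rewrite (le_trans tr h1) (le_trans h2).
Qed.

(** * Composite processes and closure properties of the stochastic integral *)

Section Composite.
Variables (n : nat) (X : R -> Omega B -> 'cV[R]_n) (F : R * 'cV[R]_n -> R).
Hypotheses (aX : forall i, adapted (fun s w => X s w i 0)) (cX : forall i, cpath (fun s w => X s w i 0)).
Hypothesis cF : continuous F.

Lemma cX_clp w : continuous (fun s => X (clp t T s) w).
Proof.
by move=> s; apply: cvg_col => i; have := within_clp tT (@cX i w); move=> /(_ s).
Qed.

Lemma comp_cpath : cpath (fun s w => F (s, X s w)).
Proof.
move=> w; apply: (within_clp_inv tT) => s.
apply: (continuous_comp (f := fun s => (clp t T s, X (clp t T s) w)) (g := F)); last exact: cF.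
apply: (@cvg_pair _ _ _ _ (nbhs (clp t T s)) (nbhs (X (clp t T s) w))).
  exact: clp_continuous.
exact: cX_clp.
Qed.

Lemma comp_adapted : adapted (fun s w => F (s, X s w)).
Proof.
move=> s st; apply: (measurable_continuous_comp mT cF (measurable_cst _)) => i.
exact: aX.
Qed.

End Composite.

Lemma int_cpath D : cpath D -> cpath (fun s w => I[t, s] (D ^~ w)).
Proof. by move=> cD w; apply: parameterized_integral_continuous => //; exact: (@cpath_itg D t T w cD (lexx t) (lexx T)). Qed.

Lemma int_fmeas D r s : adapted D -> cpath D -> t <= r -> r <= s -> s <= T ->
  fmeas s (fun w => I[r, s] (D ^~ w)).
Proof.
move=> aD cD tr rs sT.
apply: (@measurable_fun_cvg _ (g_sigma_algebraType (@fgen R d B t s)) _ setT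
   (fun N (w : g_sigma_algebraType (@fgen R d B t s)) => \sum_(j < N.+1) D (grid r s N j) w * ((s - r) / N.+1%:R))) => [N|w _].
  apply: measurable_sum => j; apply: measurable_funM; last exact: measurable_cst.
  have /andP[g1 g2] := grid_in rs (ltnW (ltn_ord j)).
  apply: (fmeas_mono g2); apply: aD; by rewrite (le_trans tr g1) (le_trans g2).
apply: riemann_cvg => //; exact: cpath_sub.
Qed.

(** A null set of paths times the whole time line is null for the product measure, although time has
    infinite measure. *)
Lemma ae_band (Q : Omega B -> Prop) (Q' : R * Omega B -> Prop) r s : {ae P, forall w, Q w} ->
  (forall u w, r < u <= s -> Q w -> Q' (u, w)) ->
  {ae lm, forall z : R * Omega B, band r s z -> Q' z}.
Proof.
move=> [N [mN N0 hN]] QQ; exists (setT `*` N); split.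
- exact: measurableX.
- by rewrite product_measure1E // [X in (_ * X)%E](_ : _ = 0%E) ?mule0.
- move=> -[u w] /= h; split => //; apply: hN => /= q; apply: h => -[/= + _].
  by rewrite in_itv /= => urs; exact: QQ.
Qed.

(** Countably many dyadic times determine a continuous path. *)
Lemma indistinguishable D : cpath D -> (forall s, t <= s <= T -> {ae P, forall w, D s w = 0}) ->
  {ae P, forall w s, t <= s <= T -> D s w = 0}.
Proof.
move=> cD h.
have /ae_foralln h1 : forall m, {ae P, forall w, forall j, D (dyad m j) w = 0}.
  by move=> m; apply: ae_foralln => j; apply: h; exact: dyad_in.
apply: filterS h1 => w hw s sT.
have [j [_ js]] := dyad_dense sT.
have cDw : continuous ((D ^~ w) \o clp t T) by apply: within_clp => //; exact: cD.
have := cvg_comp _ _ js (cDw s); rewrite /= clp_id // => cv.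
have c0 : (fun m => D (clp t T (dyad m (j m))) w) @ \oo --> 0.
  by apply: cvg_near_cst; apply: nearW => m; rewrite clp_id ?dyad_in.
exact: (cvg_unique _ cv c0).
Qed.

(** Integrands converge in L2 but integrals only along almost every path, which is what pathwise
    arguments deliver. The isometry makes the integrals Cauchy in L2, Fatou's lemma transfers this
    to the pathwise limit, and a diagonal choice of elementary lists, within 2^-k of a fast
    subsequence, represents it. *)
Lemma isint_lim r s (Z : nat -> 'I_d -> R * Omega B -> R) (xi : nat -> Omega B -> R)
    (Zl : 'I_d -> R * Omega B -> R) (xl : Omega B -> R) :
  t <= r -> r <= s -> s <= T -> (forall k, isint r s (Z k) (xi k)) ->
  (forall i, L2cv lm (band r s) (fun k => Z k i) (Zl i)) ->
  measurable_fun setT xl -> {ae P, forall w, xi ^~ w @ \oo --> xl w} ->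
  isint r s Zl xl.
Proof.
move=> tr rs sT iZ cZ mxl cxi; have mb := mbd r s.
have Lxi k : L2 P setT (xi k) by exact: (isint_L2 (iZ k)).1.
have LZ k i : L2 lm (band r s) (Z k i) by exact: (isint_L2 (iZ k)).2.
have LZl i : L2 lm (band r s) (Zl i) by have [] := cZ i.
pose a k := \sum_i nrm lm (band r s) (fun z => Z k i z - Zl i z).
have a0 : a @ \oo --> 0.
  by apply: cvg_sum0 => i; have [] := cZ i.
have iso j k : nrm P setT (fun w => xi j w - xi k w) <= a j + a k.
  have e := isint_norm HB tr sT (isintD (iZ j) (isintN (iZ k))).
  rewrite -[leLHS]ger0_norm ?nrm_ge0 // -sqrtr_sqr nrm_sq e.
  rewrite -[leRHS]ger0_norm; last by apply: addr_ge0; apply: sumr_ge0 => i _; exact: nrm_ge0.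
  rewrite -sqrtr_sqr; apply: ler_wsqrtr; rewrite -big_split /=.
  apply: (@le_trans _ _ (\sum_i (nrm lm (band r s) (fun z => Z j i z - Zl i z) +
       nrm lm (band r s) (fun z => Z k i z - Zl i z)) ^+ 2)).
    apply: ler_sum => i _; rewrite -nrm_sq ler_pXn2r ?nnegrE ?addr_ge0 ?nrm_ge0 //.
    apply: le_trans (nrmB mb (L2B mb (LZ j i) (LZl i)) (L2B mb (LZ k i) (LZl i))).
    by apply: ler_eq; apply: nrm_eq => z _; ring.
  have h (x : 'I_d -> R) : (forall i, 0 <= x i) -> \sum_i x i ^+ 2 <= (\sum_i x i) ^+ 2.
    move=> x0; rewrite expr2 mulr_suml; apply: ler_sum => i _.
    by rewrite expr2 ler_wpM2l // (bigD1 i) //= lerDl sumr_ge0.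
  by apply: h => i; rewrite addr_ge0 ?nrm_ge0.
have [|phi hphi] := fast_subsequence a0 (q := 2^-1); first by rewrite invr_gt0.
have b0 k : 0 <= a k by apply: sumr_ge0 => i _; exact: nrm_ge0.
have hp k : a (phi k) <= 2^-1 ^+ k by exact: le_trans (ler_norm _) (hphi k).2.
have fat k : L2 P setT (fun w => xl w - xi (phi k) w) /\
    nrm P setT (fun w => xl w - xi (phi k) w) <= 2 * 2^-1 ^+ k.
  apply: (@L2_fatou _ _ _ _ _ mT (fun j w => xi j w - xi (phi k) w)).
  - by move=> j; exact: (L2B mT).
  - by apply: measurable_funB => //; exact: L2_meas (Lxi _).
  - have /cvgrPdist_le /(_ (2^-1 ^+ k)) := a0; rewrite exprn_gt0 // => /(_ isT).
    apply: filterS => j; rewrite /= sub0r normrN => hj.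
    apply: le_trans (iso _ _) _; have := hp k; have := ler_norm (a j); lra.
  - by apply: filterS cxi => w hw _; apply: cvgB => //; exact: cvg_cst.
have /choice[l hl] k : exists l : seq (@elem R d B), [/\ List.Forall (elem_wf r s) l,
    (forall i, nrm lm (band r s) (fun z => vals l i z - Z (phi k) i z) <= 2^-1 ^+ k) &
    nrm P setT (fun w => ints l w - xi (phi k) w) <= 2^-1 ^+ k].
  have [l [wl cl [_ _ cxl]]] := iZ (phi k).
  have q0 : 0 < (2^-1 : R) ^+ k by rewrite exprn_gt0.
  have h : \forall m \near \oo, forall i : 'I_d, nrm lm (band r s) (fun z => vals (l m) i z - Z (phi k) i z) <= 2^-1 ^+ k.
    apply: filter_forall => i; have [_ _ /cvgrPdist_le /(_ _ q0)] := cl i.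
    by apply: filterS => m; rewrite /= sub0r normrN => /(le_trans (ler_norm _)).
  have /cvgrPdist_le /(_ _ q0) h2 := cxl.
  have [m [h3 h4]] := @filter_ex _ _ _ _ (filterI h h2).
  exists (l m); split => //.
  by move: h4; rewrite /= sub0r normrN => /(le_trans (ler_norm _)).
have Lv k i : L2 lm (band r s) (vals (l k) i) by apply: (vals_L2 (t := t)); case: (hl k).
have Li k : L2 P setT (ints (l k)) by apply: (ints_L2 HB tr sT); case: (hl k).
exists l; split => [k|i|]; first by case: (hl k).
- split=> //; apply: (@geo_cvg _ _ _ 2 0%N) => k _; rewrite subr0 ger0_norm ?nrm_ge0 //.
  have [_ h1 _] := hl k.
  apply: le_trans (_ : nrm lm (band r s) (fun z => vals (l k) i z - Z (phi k) i z) +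
     nrm lm (band r s) (fun z => Z (phi k) i z - Zl i z) <= _).
    apply: le_trans (nrmD mb (L2B mb (Lv k i) (LZ (phi k) i)) (L2B mb (LZ (phi k) i) (LZl i))).
    by apply: ler_eq; apply: nrm_eq => z _; ring.
  have h2 : nrm lm (band r s) (fun z => Z (phi k) i z - Zl i z) <= a (phi k).
    by rewrite /a (bigD1 i) //= lerDl sumr_ge0 // => j _; exact: nrm_ge0.
  have := h1 i; have := hp k; lra.
- have Lxl : L2 P setT xl.
    by apply: (L2_eq mT) (L2D mT (fat 0%N).1 (Lxi (phi 0%N))) => w _; ring.
  split=> //; apply: (@geo_cvg _ _ _ 3 0%N) => k _; rewrite subr0 ger0_norm ?nrm_ge0 //.
  have [_ _ h1] := hl k; have [f1 f2] := fat k.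
  apply: le_trans (_ : nrm P setT (fun w => ints (l k) w - xi (phi k) w) +
     nrm P setT (fun w => xl w - xi (phi k) w) <= _).
    apply: le_trans (nrmB mT (L2B mT (Li k) (Lxi (phi k))) f1).
    by apply: ler_eq; apply: nrm_eq => z _; ring.
  lra.
Qed.

(** Extension of an integrand by zero to a larger interval, with the left-open convention of
    [band]. *)
Definition cutoff r s (f : R * Omega B -> R) z : R := if r < z.1 <= s then f z else 0.

Lemma cutoff_itg r s r' s' (f : R * Omega B -> R) : r <= r' -> s' <= s ->
  itg lm (band r' s') f ->
  itg lm (band r s) (cutoff r' s' f) /\
  Rintegral lm (band r s) (cutoff r' s' f) = Rintegral lm (band r' s') f.
Proof.
move=> rr ss If; have sub := @band_sub R d B r' s' r s rr ss.
have e : (EFin \o cutoff r' s' f) \_ (band r s) = (EFin \o f) \_ (band r' s').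
  apply/funext => z; rewrite !patchE /=.
  have bE : (z \in band r' s') = (r' < z.1 <= s').
    apply/idP/idP => [/set_mem[/= + _]|h]; first by rewrite in_itv.
    by apply: mem_set; split => //=; rewrite in_itv.
  rewrite /cutoff; case: ifP => h; first by rewrite bE; case: ifP; reflexivity.
  case: ifP => // /set_mem/sub h2; by rewrite mem_set in h.
have i1 : itg lm (band r s) (cutoff r' s' f).
  have := If; rewrite /itg (integrable_mkcond _ (mbd r' s')) (integrable_mkcond _ (mbd r s)).
  by rewrite e.
by split=> //; rewrite /Rintegral integral_mkcond [in RHS]integral_mkcond e.
Qed.

Lemma cutoff_L2 r s r' s' (f : R * Omega B -> R) : r <= r' -> s' <= s ->
  L2 lm (band r' s') f ->
  L2 lm (band r s) (cutoff r' s' f) /\ nrm lm (band r s) (cutoff r' s' f) = nrm lm (band r' s') f.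
Proof.
move=> rr ss [mf lf].
have e z : cutoff r' s' f z ^+ 2 = cutoff r' s' (fun z => f z ^+ 2) z.
  by rewrite /cutoff; case: ifP => // _; rewrite expr0n.
have [i1 e1] := cutoff_itg rr ss lf.
have mg : mband (cutoff r' s' f) r s.
  have -> : cutoff r' s' f = f \_ (band r' s').
    apply/funext => z; rewrite patchE /cutoff.
    have -> : (z \in band r' s') = (r' < z.1 <= s').
      apply/idP/idP => [/set_mem[/= + _]|h]; first by rewrite in_itv.
      by apply: mem_set; split => //=; rewrite in_itv.
    by case: ifP; reflexivity.
  apply: measurable_funTS; apply/measurable_restrict => //; first exact: (mbd r' s').
  by rewrite setIidr.
split; first by split=> //; apply: (itg_eq (mbd r s)) i1 => z _; rewrite e.
by rewrite /nrm -e1; congr Num.sqrt; apply: E_eq => z _; rewrite e.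
Qed.

Lemma isint_extend r s r' s' Z xi : r <= r' -> s' <= s -> isint r' s' Z xi ->
  isint r s (fun i => cutoff r' s' (Z i)) xi.
Proof.
move=> rr ss [l [wl cl cx]].
have wl' k : List.Forall (elem_wf r s) (l k).
  apply: List.Forall_impl (wl k) => e [h1 h2 h3 h4]; split => //; first exact: le_trans h1.
  exact: le_trans ss.
have vc k i z : vals (l k) i z = cutoff r' s' (vals (l k) i) z.
  rewrite /cutoff; case: ifP => // hz; rewrite /vals.
  have : List.Forall (elem_wf r' s') (l k) by exact: wl.
  elim: (l k) => [|e m IH] h; first by rewrite big_nil.
  have [[h1 h2 h3 _] hm] : elem_wf r' s' e /\ List.Forall (elem_wf r' s') m by inversion h.
  rewrite big_cons IH // addr0 /elem_val indicE (_ : _ \in _ = false) ?mul0r ?mulr0 //.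
  apply/negP => /set_mem /=; rewrite in_itv /= => /andP[h4 h5].
  by move: hz; rewrite (le_lt_trans h1 h4) (le_trans h5 h3).
exists l; split=> // i; have [c1 c2 c3] := cl i.
have LV k : L2 lm (band r s) (vals (l k) i) by exact: (vals_L2 i (wl' k)).
split=> //; first exact: (cutoff_L2 rr ss c2).1.
apply: cvg_trans c3; apply: near_eq_cvg; apply: nearW => k.
rewrite -(cutoff_L2 rr ss (L2B (mbd r' s') (c1 k) c2)).2; apply: nrm_eq => z _.
by rewrite [in RHS]vc /cutoff; case: ifP => // _; rewrite subrr.
Qed.

Lemma isint_zero r s : isint r s (fun _ _ => 0) (fun=> 0).
Proof.
exists (fun=> [::]); split => [k|i|]; first exact: List.Forall_nil.
  rewrite (_ : (fun k => _) = (fun=> fun=> 0)); last by apply/funext => k; apply/funext => z; rewrite /vals big_nil.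
  by apply: L2cv_cst; exact: (L2_0 _ (mbd r s)).
rewrite (_ : (fun k => _) = (fun=> fun=> 0)); last by apply/funext => k; apply/funext => z; rewrite /ints big_nil.
by apply: L2cv_cst; exact: (L2_0 _ mT).
Qed.

Lemma isint_sum r s (I : Type) (q : seq I) (Z : I -> 'I_d -> R * Omega B -> R) (xi : I -> Omega B -> R) :
  (forall a, isint r s (Z a) (xi a)) ->
  isint r s (fun i z => \sum_(a <- q) Z a i z) (fun w => \sum_(a <- q) xi a w).
Proof.
move=> h; elim: q => [|a q IH].
  have := isint_zero r s; congr isint; first by apply/funext => i; apply/funext => z; rewrite big_nil.
  by apply/funext => w; rewrite big_nil.
have := isintD (h a) IH; congr isint; first by apply/funext => i; apply/funext => z; rewrite big_cons.
by apply/funext => w; rewrite big_cons.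
Qed.

Lemma L2_mul_bounded d' (Y : measurableType d') (m : {measure set Y -> \bar R}) (D : set Y) (K : R)
    (y f : Y -> R) : measurable D -> 0 <= K -> measurable_fun D y -> (forall w, `|y w| <= K) -> L2 m D f ->
    L2 m D (fun w => y w * f w) /\ nrm m D (fun w => y w * f w) <= K * nrm m D f.
Proof.
move=> mD K0 my yK Lf; have LK := L2Z mD K Lf.
have le1 w : `|y w * f w| <= `|K * f w|.
  by rewrite !normrM ler_wpM2r // (le_trans (yK w)) // ler_norm.
have L1 : L2 m D (fun w => y w * f w).
  apply: (L2_le mD _ LK) => [|w _]; last exact: le1.
  by apply: measurable_funM => //; exact: L2_meas Lf.
split=> //; apply: le_trans (nrm_le mD L1 LK (fun w _ => le1 w)) _.
by rewrite (nrmZ mD) // (ger0_norm K0).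
Qed.

Lemma fmeas_band q (eta : Omega B -> R) a b : t <= q <= T -> fmeas q eta ->
  mband (fun z => eta z.2) a b.
Proof.
move=> rt me; apply: measurable_funTS.
by apply: (measurableT_comp (fmeas_measurable HB rt me)); exact: measurable_snd.
Qed.

Lemma isint_mul_bounded r s Z xi (eta : Omega B -> R) K : t <= r -> r <= s -> s <= T ->
  isint r s Z xi -> fmeas r eta -> 0 <= K -> (forall w, `|eta w| <= K) ->
  isint r s (fun i z => eta z.2 * Z i z) (fun w => eta w * xi w).
Proof.
move=> tr rs sT [l [wl cl cx]] me K0 bK.
have rt : t <= r <= T by rewrite tr (le_trans rs).
have mz := @fmeas_band r _ r s rt me.
pose mul e := Elem (ea e) (eb e) (ei e) (fun w => eta w * ec e w).
have wm k : List.Forall (elem_wf r s) (map mul (l k)).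
  elim: (l k) (wl k) => [|e m IH] h /=; constructor; last by apply: IH; inversion h.
  have [h1 h2 h3 [h4 h5]] : elem_wf r s e by inversion h.
  split => //=; have mea := fmeas_mono h1 me; split; first exact: measurable_funM.
  apply: (L2_mul_bounded mT K0 _ bK h5).1.
  by apply: (fmeas_measurable HB _ mea); rewrite (le_trans tr h1) (le_trans h2) // (le_trans h3).
have vm k i z : vals (map mul (l k)) i z = eta z.2 * vals (l k) i z.
  by rewrite /vals big_map mulr_sumr; apply: eq_bigr => e _; rewrite /elem_val /=; ring.
have im k w : ints (map mul (l k)) w = eta w * ints (l k) w.
  by rewrite /ints big_map mulr_sumr; apply: eq_bigr => e _; rewrite /elem_int /=; ring.
have c0 (u : nat -> R) : u @ \oo --> 0 -> (fun k => K * u k) @ \oo --> 0.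
  by move=> cu; apply: cvgMl0; exact: cu.
exists (fun k => map mul (l k)); split=> // [i|].
  have [c1 c2 c3] := cl i; split=> [k||].
  - exact: vals_L2 (wm k).
  - exact: (L2_mul_bounded (mbd r s) K0 mz (fun z => bK z.2) c2).1.
  apply: squeeze_cvgr _ (cvg_cst 0) (c0 _ c3); apply: nearW => k; rewrite nrm_ge0 /=.
  have [_] := L2_mul_bounded (mbd r s) K0 mz (fun z => bK z.2) (L2B (mbd r s) (c1 k) c2).
  apply: le_trans; apply: ler_eq; apply: nrm_eq => z _.
  by rewrite vm mulrBr.
have [c1 c2 c3] := cx; have me' := fmeas_measurable HB rt me; split=> [k||].
- exact: (ints_L2 HB tr sT (wm k)).
- exact: (L2_mul_bounded mT K0 me' bK c2).1.
apply: squeeze_cvgr _ (cvg_cst 0) (c0 _ c3); apply: nearW => k; rewrite nrm_ge0 /=.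
have [_] := L2_mul_bounded mT K0 me' bK (L2B mT (c1 k) c2).
apply: le_trans; apply: ler_eq; apply: nrm_eq => w _.
by rewrite im mulrBr.
Qed.

(** The factor is truncated at level [k], where the bounded case applies. The bound [C] on the
    integrand keeps the products dominated by the square of [eta], and on each path the truncation
    is eventually inactive. *)
Lemma isint_mul r s Z xi (eta : Omega B -> R) C : t <= r -> r <= s -> s <= T ->
  isint r s Z xi -> L2F r eta -> (forall i z, band r s z -> Z i z ^+ 2 <= C) ->
  isint r s (fun i z => eta z.2 * Z i z) (fun w => eta w * xi w).
Proof.
move=> tr rs sT iZ [me Le] ZC; have rt : t <= r <= T by rewrite tr (le_trans rs).
pose ek (k : nat) w := clp (- k%:R) k%:R (eta w).
have kk (k : nat) : - k%:R <= k%:R :> R by have := ler0n R k; lra.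
have mek k : fmeas r (ek k).
  apply: measurableT_comp; last exact: me.
  by apply: continuous_measurable_fun; exact: clp_continuous.
have bek k w : `|ek k w| <= k%:R by rewrite ler_norml; exact: clp_in (kk k).
have ek_le k w : `|ek k w| <= `|eta w|.
  rewrite /ek /clp; have k0 : 0 <= k%:R :> R by [].
  rewrite ler_norml; case: (ger0P (eta w)) => h; rewrite ?opprK le_max ge_max ge_min le_min; lra.
have ek_eq w : \forall k \near \oo, ek k w = eta w.
  exists (Num.truncn `|eta w|).+1 => // k /= hk; apply: clp_id; rewrite -ler_norml.
  by apply: ltW; apply: lt_le_trans (truncnS_gt _) _; rewrite ler_nat.
have LZ := (isint_L2 iZ).2.
have Leb : itg lm (band r s) (fun z => eta z.2 ^+ 2).
  have mz := @fmeas_band r _ r s rt me.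
  have [|||//] := @band_sup R d B r s (fun z => eta z.2 ^+ 2) (E[fun w => eta w ^+ 2]) rs.
  - exact: measurable_funX.
  - by move=> z _; rewrite sqr_ge0.
  - by move=> u _; split=> //; case: Le.
have mE i : mband (fun z => eta z.2 * Z i z) r s.
  by apply: measurable_funM; [exact: (@fmeas_band r _ r s rt me)|exact: L2_meas (LZ i)].
apply: (isint_lim (Z := fun k i z => ek k z.2 * Z i z) (xi := fun k w => ek k w * xi w) tr rs sT).
- by move=> k; exact: (isint_mul_bounded tr rs sT iZ (mek k) (ler0n R k) (bek k)).
- move=> i.
  have L1 k : L2 lm (band r s) (fun z => ek k z.2 * Z i z).
    by apply: (L2_mul_bounded (mbd r s) (ler0n R k) (@fmeas_band r _ r s rt (mek k)) (fun z => bek k z.2) (LZ i)).1.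
  have ig : itg lm (band r s) (fun z => C * eta z.2 ^+ 2) by exact: (itgZ (mbd r s)).
  have L3 : L2 lm (band r s) (fun z => eta z.2 * Z i z).
    split=> //; apply: (itg_sqr_le (mbd r s) _ ig) => // z bz; rewrite exprMn mulrC ler_wpM2r ?sqr_ge0 //; exact: ZC.
  split=> //.
  have : (fun k => Rintegral lm (band r s) (fun z => `|(ek k z.2 * Z i z - eta z.2 * Z i z) ^+ 2|)) @ \oo --> 0.
    apply: (dct0 (mbd r s) (g := fun z => 4 * (C * eta z.2 ^+ 2))).
    + by move=> k; apply: measurable_funX; apply: measurable_funB => //; exact: L2_meas (L1 k).
    + exact: (itgZ (mbd r s)).
    + move=> k z bz; rewrite ger0_norm ?sqr_ge0 // -mulrBl exprMn.
      have := ZC i z bz; have h1 : (ek k z.2 - eta z.2) ^+ 2 <= 4 * eta z.2 ^+ 2.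
        have := ler_normB (ek k z.2) (eta z.2); have := ek_le k z.2 => h1 h2.
        have h3 : `|ek k z.2 - eta z.2| <= 2 * `|eta z.2| by lra.
        rewrite -[leLHS]real_normK ?num_real // -[eta z.2 ^+ 2]real_normK ?num_real //.
        have := normr_ge0 (ek k z.2 - eta z.2); nra.
      move=> h2; apply: (@le_trans _ _ (4 * eta z.2 ^+ 2 * C)); last by rewrite -mulrA (mulrC C).
      by apply: ler_pM => //; exact: sqr_ge0.
    + apply: aeW => z bz; apply: cvg_near_cst; apply: filterS (ek_eq z.2) => k ->.
      by rewrite subrr expr0n.
  move=> cv; have cv2 := cvg_sqrt0 cv; move: cv2; apply: cvg_eq => k.
  by rewrite /nrm; congr Num.sqrt; apply: E_eq => z _; rewrite ger0_norm ?sqr_ge0.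
- apply: measurable_funM; first exact: (fmeas_measurable HB rt me).
  exact: L2_meas (isint_L2 iZ).1.
- apply: aeW => w; apply: cvgMr_tmp; apply: cvg_near_cst; exact: ek_eq.
Qed.

Lemma isint_step r s (c : 'I_d -> Omega B -> R) : t <= r -> r <= s -> s <= T ->
  (forall l, L2F r (c l)) ->
  isint r s (fun l z => c l z.2) (fun w => \sum_l c l w * dW r s l w).
Proof.
move=> tr rs sT Lc; pose q := [seq Elem r s l (c l) | l <- enum 'I_d].
have wq : List.Forall (elem_wf r s) q.
  rewrite /q; elim: (enum 'I_d) => [|l m IH] /=; first exact: List.Forall_nil.
  by apply: List.Forall_cons; [split => //=; exact: Lc|exact: IH].
have e1 w : ints q w = \sum_l c l w * dW r s l w by rewrite /ints big_map big_enum.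
have e2 l z : band r s z -> vals q l z = c l z.2.
  move=> [bz _]; rewrite /vals big_map big_enum (bigD1 l) //= big1 ?addr0 => [|k kl].
    by rewrite /elem_val /= eqxx mul1r indicE mem_set // mul1r.
  by rewrite /elem_val /= eq_sym (negbTE kl) mul0r.
exists (fun=> q); split => // [l|].
  have Lq := vals_L2 l wq.
  have Lc' : L2 lm (band r s) (fun z => c l z.2) by apply: (L2_eq (mbd r s)) Lq => z; exact: e2.
  have [h1 h2 h3] := L2cv_cst Lc'; split=> //.
  move: h3; apply: cvg_eq => k.
  by apply: nrm_eq => z bz; rewrite e2.
by rewrite (_ : (fun w => _) = ints q); [apply: L2cv_cst; exact: (ints_L2 HB tr sT wq)|apply/funext => w].
Qed.

Lemma E_cst c : E[fun=> c] = c.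
Proof.
transitivity (c * fine (P setT)); first exact: Rintegral_cst.
by rewrite probability_setT mulr1.
Qed.

Lemma itg_cst c : itg P setT (fun=> c).
Proof. exact: (@finite_measure_integrable_cst _ _ _ P _ _ mT). Qed.

Lemma band_proc r s (h : R -> Omega B -> R) K : t <= r -> r <= s -> s <= T ->
  adapted h -> cpath h -> (forall u w, r <= u <= s -> 0 <= h u w) ->
  (forall u, r <= u <= s -> itg P setT (h u) /\ E[h u] <= K) ->
  [/\ itg lm (band r s) (fun z => h z.1 z.2), itg P setT (fun w => I[r, s] (h ^~ w)),
      E[fun w => I[r, s] (h ^~ w)] = I[r, s] (fun u => E[h u]),
      itg leb `[r, s]%classic (fun u => E[h u]) &
      Rintegral lm (band r s) (fun z => h z.1 z.2) = I[r, s] (fun u => E[h u])].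
Proof.
move=> tr rs sT ah ch h0 hK; have mh := band_meas ah ch tr sT.
have [|ih _] := band_sup rs mh _ hK.
  by move=> [u w] [/= + _]; rewrite in_itv /= => /andP[/ltW h1 h2]; apply: h0; rewrite h1.
have [||w|i1 e1 i2 e2] := band_swap rs ih => //.
- by move=> u /hK[].
- exact: (cpath_itg (D := h) w ch tr sT).
by split => //; rewrite -e1 e2.
Qed.

(** One mean square estimate behind increments, stability and the Picard iteration. The 3 comes from
    the square of a sum of three terms, [S] from Cauchy-Schwarz in time for the drift, and [d] from
    the isometry over the Brownian coordinates; [h] dominates the squares of both drift and
    diffusion. *)
Lemma process_estimate n r s (S : R) (h : R -> Omega B -> R) (b : 'I_n -> R -> Omega B -> R)
  (z : 'I_n -> 'I_d -> R * Omega B -> R) (N V : 'I_n -> Omega B -> R) (a : 'I_n -> R) K :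
  t <= r -> r <= s -> s <= T -> s - r <= S ->
  adapted h -> cpath h -> (forall u w, r <= u <= s -> 0 <= h u w) ->
  (forall u, r <= u <= s -> itg P setT (h u) /\ E[h u] <= K) ->
  (forall i, cpath (b i)) -> (forall i u w, r <= u <= s -> b i u w ^+ 2 <= h u w) ->
  (forall i, isint r s (z i) (N i)) -> (forall i j u w, r <= u <= s -> z i j (u, w) ^+ 2 <= h u w) ->
  (forall i, measurable_fun setT (V i)) -> (forall i w, V i w = a i + I[r, s] (b i ^~ w) + N i w) ->
  itg P setT (fun w => \sum_i V i w ^+ 2) /\
  E[fun w => \sum_i V i w ^+ 2] <=
    3 * \sum_i a i ^+ 2 + 3 * n%:R * (S + d%:R) * I[r, s] (fun u => E[h u]).
Proof.
move=> tr rs sT hS ah ch h0 hK cb bh iz zh mV VE.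
have [i1 i2 e2 i3 e3] := band_proc tr rs sT ah ch h0 hK.
have LN i : L2 P setT (N i) by exact: (isint_L2 (iz i)).1.
set J := I[r, s] (fun u => E[h u]).
have EN i : E[fun w => N i w ^+ 2] <= d%:R * J.
  rewrite (isint_norm HB tr sT (iz i)) /J -e3.
  apply: (@le_trans _ _ (\sum_(j < d) Rintegral lm (band r s) (fun z => h z.1 z.2))).
    apply: ler_sum => j _; apply: (E_le (mbd r s)) => //; first exact: ((isint_L2 (iz i)).2 j).2.
    move=> [u w] [/= + _]; rewrite in_itv /= => /andP[/ltW h1 h2]; apply: zh.
    by rewrite h1.
  by rewrite sumr_const card_ord -[leLHS]mulr_natl.
have S0 : 0 <= S by apply: le_trans hS; rewrite subr_ge0.
have Vb i w : V i w ^+ 2 <= 3 * a i ^+ 2 + 3 * S * I[r, s] (h ^~ w) + 3 * N i w ^+ 2.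
  have Jb := cpath_itg (D := b i) w (cb i) tr sT.
  have Jh := cpath_itg (D := h) w ch tr sT.
  have Jb2 : itg leb `[r, s]%classic (fun u => b i u w ^+ 2).
    apply: (itg_le (mcci r s)) Jh _.
      by apply: measurable_funX; exact: itg_meas Jb.
    by move=> u /=; rewrite in_itv /= => urs; rewrite ger0_norm ?sqr_ge0 //; exact: bh.
  have c1 := ci_CS rs (conj (itg_meas Jb) Jb2).
  have c2 : I[r, s] (fun u => b i u w ^+ 2) <= I[r, s] (h ^~ w).
    by apply: ci_le => // u urs; exact: bh.
  have c3 : 0 <= I[r, s] (h ^~ w) by apply: ci_ge0 => u urs; exact: h0.
  have c4 : I[r, s] (b i ^~ w) ^+ 2 <= S * I[r, s] (h ^~ w).
    apply: le_trans c1 _; apply: (@le_trans _ _ ((s - r) * I[r, s] (h ^~ w))).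
      by apply: ler_wpM2l => //; rewrite subr_ge0.
    exact: ler_wpM2r.
  rewrite VE; set p := I[r, s] (b i ^~ w) in c4 *; set q := N i w.
  have := sqr_ge0 (a i - p); have := sqr_ge0 (a i - q); have := sqr_ge0 (p - q); nra.
have iG i : itg P setT (fun w => 3 * a i ^+ 2 + 3 * S * I[r, s] (h ^~ w) + 3 * N i w ^+ 2).
  apply: (itgD mT); last exact: (itgZ mT _ (LN i).2).
  apply: (itgD mT); last exact: (itgZ mT _ i2).
  exact: itg_cst.
have EG i : E[fun w => 3 * a i ^+ 2 + 3 * S * I[r, s] (h ^~ w) + 3 * N i w ^+ 2] <=
    3 * a i ^+ 2 + 3 * (S + d%:R) * J.
  have ic := itg_cst (3 * a i ^+ 2).
  have is2 := itgZ mT (3 * S) i2.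
  rewrite (ED mT (itgD mT ic is2) (itgZ mT 3 (LN i).2)) (ED mT ic is2).
  rewrite (EZ mT _ i2) (EZ mT _ (LN i).2) e2 -/J E_cst.
  have := EN i; lra.
have iV i : itg P setT (fun w => V i w ^+ 2).
  by apply: (itg_sqr_le mT _ (iG i)).
split; first exact: (itg_sum mT).
rewrite (E_sum mT) //; apply: (@le_trans _ _ (\sum_i (3 * a i ^+ 2 + 3 * (S + d%:R) * J))).
  by apply: ler_sum => i _; apply: le_trans (EG i); apply: (E_le mT).
rewrite big_split /= -mulr_sumr lerD2l sumr_const card_ord -mulr_natl.
by apply: ler_eq; ring.
Qed.

(** * Stochastic differential equations: moments, stability, uniqueness *)

Variables (n : nat) (bt : R -> 'cV[R]_n -> 'cV[R]_n) (sg : R -> 'cV[R]_n -> 'M[R]_(n, d)) (L : R).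
Hypothesis coefs : coef_ok bt sg L.

Definition drift_path (X : R -> Omega B -> 'cV[R]_n) i s w := bt s (X s w) i 0.

Definition process (X : R -> Omega B -> 'cV[R]_n) :=
  (forall i, adapted (fun s w => X s w i 0)) /\ (forall i, cpath (fun s w => X s w i 0)).

(* solutions of the equation, all of whose paths are continuous *)
Definition nsol (x : 'cV[R]_n) (X : R -> Omega B -> 'cV[R]_n) :=
  [/\ process X, forall w, X t w = x &
  forall i r s, t <= r -> r <= s -> s <= T ->
    isint r s (fun j z => sg z.1 (X z.1 z.2) i j)
      (fun w => X s w i 0 - X r w i 0 - I[r, s] (drift_path X i ^~ w))].

Lemma L_ge0 : 0 <= L. Proof. by case: coefs. Qed.

Lemma process_comp X (F : R * 'cV[R]_n -> R) : process X -> continuous F ->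
  adapted (fun s w => F (s, X s w)) /\ cpath (fun s w => F (s, X s w)).
Proof. by move=> [aX cX] cF; split; [exact: comp_adapted|exact: comp_cpath]. Qed.

Lemma drift_process X i : process X -> adapted (drift_path X i) /\ cpath (drift_path X i).
Proof.
move=> pX; have [_ [cb _] _ _ _] := coefs.
exact: (process_comp (F := fun z => bt z.1 z.2 i 0) pX).
Qed.

Lemma nsq_process X : process X -> adapted (fun s w => nsq (X s w)) /\ cpath (fun s w => nsq (X s w)).
Proof. by move=> pX; exact: (process_comp (F := fun z => nsq z.2) pX (@continuous_nsq R n)). Qed.

Lemma processB X Y : process X -> process Y -> process (fun s w => X s w - Y s w).
Proof.
move=> [aX cX] [aY cY]; split=> i.
  move=> s st; rewrite (_ : (fun w => _) = fun w => X s w i 0 - Y s w i 0).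
    by apply: measurable_funB; [exact: aX|exact: aY].
  by apply/funext => w; rewrite !mxE.
move=> w; rewrite (_ : (fun s => _) = fun s => X s w i 0 - Y s w i 0).
  by apply: within_continuousB; [exact: cX|exact: cY].
by apply/funext => s; rewrite !mxE.
Qed.

Lemma process_meas X i s : process X -> t <= s <= T -> measurable_fun setT (fun w => X s w i 0).
Proof. by move=> [aX _] st; apply: (fmeas_measurable HB st); exact: aX. Qed.

Lemma bt_growth s x i : bt s x i 0 ^+ 2 <= 2 * L * (1 + nsq x).
Proof.
have [_ _ Hb _ [H0 _]] := coefs; have h1 := Hb s x 0 i; rewrite subr0 in h1; have h2 := H0 s i.
have := sqr_ge0 (bt s x i 0 - 2 * bt s 0 i 0); nra.
Qed.

(** Moments are not part of [nsol], so Gronwall's lemma cannot be applied to expectations that might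
    be infinite. It is applied path by path instead: the drift has linear growth, and the remaining
    forcing [al] involves only the stochastic part [xi], whose second moment is bounded because [sg]
    is. *)
Lemma nsol_moment x X : nsol x X -> exists K, forall s, t <= s <= T ->
  itg P setT (fun w => nsq (X s w)) /\ E[fun w => nsq (X s w)] <= K.
Proof.
move=> [pX X0 iX]; have [aX cX] := pX; have L0 := L_ge0; have [_ _ _ _ [_ sgL]] := coefs.
have [anX cnX] := nsq_process pX.
pose xi (s : R) (w : Omega B) : 'cV[R]_n := \col_i (X s w i 0 - x i 0 - I[t, s] (drift_path X i ^~ w)).
have pxi : process xi.
  split=> i.
    move=> s st; have /andP[ts sT] := st.
    rewrite (_ : (fun w => xi s w i 0) = fun w => X s w i 0 - x i 0 - I[t, s] (drift_path X i ^~ w)); last first.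
      by apply/funext => w; rewrite mxE.
    apply: measurable_funB.
      by apply: measurable_funB; [exact: aX|exact: measurable_cst].
    by have [a1 c1] := drift_process i pX; exact: (int_fmeas a1 c1).
  move=> w; rewrite (_ : (fun s => xi s w i 0) = fun s => X s w i 0 - x i 0 - I[t, s] (drift_path X i ^~ w)); last first.
    by apply/funext => s; rewrite mxE.
  apply: within_continuousB; first apply: within_continuousB.
  - exact: cX.
  - by apply: continuous_subspaceT => u; exact: cvg_cst.
  - by have [a1 c1] := drift_process i pX; exact: (int_cpath c1).
have [ah ch] := nsq_process pxi.
have hK s : t <= s <= T -> itg P setT (fun w => nsq (xi s w)) /\
    E[fun w => nsq (xi s w)] <= n%:R * (d%:R * (L * (T - t))).
  move=> /andP[ts sT].
  have is_ i : isint t s (fun j z => sg z.1 (X z.1 z.2) i j) (fun w => xi s w i 0).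
    rewrite (_ : (fun w => _) = fun w => X s w i 0 - X t w i 0 - I[t, s] (drift_path X i ^~ w)).
      exact: iX.
    by apply/funext => w; rewrite mxE X0.
  have iN i : itg P setT (fun w => xi s w i 0 ^+ 2) by exact: (isint_L2 (is_ i)).1.2.
  split; first exact: (itg_sum mT).
  rewrite (E_sum mT) //.
  apply: (@le_trans _ _ (\sum_(i < n) d%:R * (L * (T - t)))); last first.
    by rewrite sumr_const card_ord -[leLHS]mulr_natl.
  apply: ler_sum => i _; rewrite (isint_norm HB (lexx t) sT (is_ i)).
  apply: (@le_trans _ _ (\sum_(j < d) L * (T - t))); last first.
    by rewrite sumr_const card_ord -[leLHS]mulr_natl.
  apply: ler_sum => j _.
  have ij := ((isint_L2 (is_ i)).2 j).2.
  have [||_ h] := band_sup (f := fun z => sg z.1 (X z.1 z.2) i j ^+ 2) (K := L) ts (itg_meas ij).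
  - by move=> z _; rewrite sqr_ge0.
  - move=> u uts /=.
    have mu_ : measurable_fun setT (fun w => sg u (X u w) i j).
      apply: (fmeas_measurable HB (s := u)).
        by case/andP: uts => -> h; rewrite (le_trans h).
      have [_ [_ cs] _ _ _] := coefs.
      apply: (process_comp (F := fun z => sg z.1 z.2 i j) pX (cs i j)).1.
      by case/andP: uts => -> h; rewrite (le_trans h).
    have ic := itg_cst L.
    have i1 : itg P setT (fun w => sg u (X u w) i j ^+ 2).
      by apply: (itg_sqr_le mT _ ic).
    split=> //; apply: le_trans (E_le mT i1 ic (fun w _ => sgL u (X u w) i j)) _.
    by rewrite E_cst.
  by apply: le_trans h _; rewrite ler_wpM2l // lerD2r.
set K1 := n%:R * (d%:R * (L * (T - t))) in hK.
pose S := T - t; have S0 : 0 <= S by rewrite subr_ge0.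
pose C := 6 * n%:R * S * L; have C0 : 0 <= C by rewrite !mulr_ge0.
pose al s w := 3 * nsq x + C * S + 3 * nsq (xi s w).
have [aal cal] : adapted al /\ cpath al.
  apply: (process_comp (F := fun z => 3 * nsq x + C * S + 3 * nsq z.2) pxi) => z.
  apply: cvgD; first exact: cvg_cst.
  by apply: cvgM; [exact: cvg_cst|exact: continuous_nsq].
have al0 s w : 0 <= al s w by rewrite !addr_ge0 ?mulr_ge0 ?nsq_ge0.
have ic := itg_cst.
pose K2 := 3 * nsq x + C * S + 3 * K1.
have alK s : t <= s <= T -> itg P setT (al s) /\ E[al s] <= K2.
  move=> st; have [i1 e1] := hK s st; have i3 := itgZ mT 3 i1.
  split; first exact: (itgD mT (ic _) i3).
  rewrite (ED mT (ic _) i3) (EZ mT _ i1) E_cst.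
  by rewrite /K2 lerD2l ler_wpM2l.
have [_ ial eal _ _] := band_proc (lexx t) tT (lexx T) aal cal (fun u w _ => al0 u w) alK.
have key s w : t <= s <= T -> nsq (X s w) <= al s w + C * I[t, s] (fun u => nsq (X u w)).
  move=> /andP[ts sT]; have sS : s - t <= S by rewrite lerD2r.
  have Jn := cpath_itg (D := fun s w => nsq (X s w)) w cnX (lexx t) sT.
  set J := I[t, s] (fun u => nsq (X u w)).
  have J0 : 0 <= J by apply: ci_ge0 => u _; exact: nsq_ge0.
  have b i : X s w i 0 ^+ 2 <= 3 * x i 0 ^+ 2 + 3 * xi s w i 0 ^+ 2 + 6 * S * L * (S + J).
    have [_ c1] := drift_process i pX.
    have Jb := cpath_itg (D := drift_path X i) w c1 (lexx t) sT.
    have [J1 e1] := ci_cst 1 ts.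
    have Jg : itg leb `[t, s]%classic (fun u => 2 * L * (1 + nsq (X u w))).
      by apply: (itgZ (mcci t s)); exact: (itgD (mcci t s) J1 Jn).
    have Jb2 : itg leb `[t, s]%classic (fun u => drift_path X i u w ^+ 2).
      by apply: (itg_sqr_le (mcci t s) (itg_meas Jb) Jg) => u _; exact: bt_growth.
    have h1 := ci_CS ts (conj (itg_meas Jb) Jb2).
    have h2 : I[t, s] (fun u => drift_path X i u w ^+ 2) <= 2 * L * ((s - t) + J).
      rewrite -[s - t]mul1r -e1 -(ED (mcci t s) J1 Jn).
      rewrite -(EZ (mcci t s) _ (itgD (mcci t s) J1 Jn)).
      by apply: ci_le => // u _; exact: bt_growth.
    have h3 : I[t, s] (drift_path X i ^~ w) ^+ 2 <= S * (2 * L * (S + J)).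
      apply: le_trans h1 _; apply: ler_pM => //; rewrite ?subr_ge0 //.
        by apply: ci_ge0 => u _; rewrite sqr_ge0.
      by apply: le_trans h2 _; rewrite ler_wpM2l ?mulr_ge0 // lerD2r.
    have -> : X s w i 0 = x i 0 + xi s w i 0 + I[t, s] (drift_path X i ^~ w) by rewrite mxE; ring.
    set p := I[t, s] _ in h3 *; set q := xi s w i 0; set a := x i 0.
    have := sqr_ge0 (a - p); have := sqr_ge0 (a - q); have := sqr_ge0 (p - q); nra.
  apply: le_trans (ler_sum _ (fun i _ => b i)) _.
  rewrite !big_split /= -!mulr_sumr sumr_const card_ord -/(nsq x) -/(nsq (xi s w)) /al /C -mulr_natl.
  by apply: ler_eq; ring.
(* The number of Gronwall cells, minus one; it depends on the constants alone, so the same factor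
   [2 ^+ M.+1] serves all paths. *)
pose M := Num.truncn (2 * C * S).
have hM : 2 * C * S <= M.+1%:R by apply: ltW; exact: truncnS_gt.
have gr w : I[t, T] (fun u => nsq (X u w)) <= 2 ^+ M.+1 * I[t, T] (al ^~ w).
  apply: (gronwall tT C0 hM) => //.
  - exact: (cpath_itg (D := fun s w => nsq (X s w)) w cnX (lexx t) (lexx T)).
  - exact: (cpath_itg (D := al) w cal (lexx t) (lexx T)).
  - by move=> s _; exact: nsq_ge0.
  - by move=> s st; exact: key.
exists (K2 + C * (2 ^+ M.+1 * (K2 * S))) => s st; have /andP[ts sT] := st.
have ib : itg P setT (fun w => al s w + C * (2 ^+ M.+1 * I[t, T] (al ^~ w))).
  apply: (itgD mT); first by case: (alK s st).
  by do 2!apply: (itgZ mT).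
have le1 w : nsq (X s w) <= al s w + C * (2 ^+ M.+1 * I[t, T] (al ^~ w)).
  apply: le_trans (key s w st) _; rewrite lerD2l ler_wpM2l //; apply: le_trans (gr w).
  have Jn := cpath_itg (D := fun s w => nsq (X s w)) w cnX (lexx t) (lexx T).
  by rewrite (ci_split ts sT Jn) lerDl; apply: ci_ge0 => u _; exact: nsq_ge0.
have i1 : itg P setT (fun w => nsq (X s w)).
  apply: (itg_le mT _ ib); first exact: (fmeas_measurable HB st (anX s st)).
  by move=> w _; rewrite ger0_norm ?nsq_ge0.
split=> //; apply: le_trans (E_le mT i1 ib (fun w _ => le1 w)) _.
have [ia ea] := alK s st; have iz := itgZ mT (2 ^+ M.+1) ial.
rewrite (ED mT ia (itgZ mT C iz)) (EZ mT _ iz) (EZ mT _ ial) eal.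
apply: lerD => //; rewrite ler_wpM2l // ler_wpM2l ?exprn_ge0 //.
have [Jc ec] := ci_cst K2 tT; rewrite -ec.
have [_ _ _ i4 _] := band_proc (lexx t) tT (lexx T) aal cal (fun u w _ => al0 u w) alK.
apply: (ci_le i4 Jc) => u ut; by case: (alK u ut).
Qed.

Lemma nsol_increment x X : nsol x X -> exists K, forall r s, t <= r -> r <= s -> s <= T ->
  itg P setT (fun w => nsq (X s w - X r w)) /\
  E[fun w => nsq (X s w - X r w)] <= K * (s - r).
Proof.
move=> sX; have [K hK] := nsol_moment sX; have [pX X0 iX] := sX; have L0 := L_ge0.
have [_ _ _ _ [_ sgL]] := coefs.
pose h s w := 2 * L * (1 + nsq (X s w)).
have [ah ch] : adapted h /\ cpath h.
  apply: (process_comp (F := fun z => 2 * L * (1 + nsq z.2)) pX) => z.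
  apply: cvgM; first exact: cvg_cst.
  by apply: cvgD; [exact: cvg_cst|exact: continuous_nsq].
have hh s : t <= s <= T -> itg P setT (h s) /\ E[h s] <= 2 * L * (1 + K).
  move=> st; have [i1 e1] := hK s st; have i2 := itgD mT (itg_cst 1) i1.
  split; first exact: (itgZ mT).
  by rewrite (EZ mT _ i2) (ED mT (itg_cst 1) i1) E_cst ler_wpM2l ?mulr_ge0 // lerD2l.
exists (3 * n%:R * (T - t + d%:R) * (2 * L * (1 + K))) => r s tr rs sT.
have inT u : r <= u <= s -> t <= u <= T by move=> /andP[h1 h2]; rewrite (le_trans tr h1) (le_trans h2).
have [|||||||||i e] := @process_estimate n r s (T - t) h (drift_path X) (fun i j z => sg z.1 (X z.1 z.2) i j)
  (fun i w => X s w i 0 - X r w i 0 - I[r, s] (drift_path X i ^~ w))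
  (fun i w => (X s w - X r w) i 0) (fun=> 0) (2 * L * (1 + K)) tr rs sT _ ah ch.
- by rewrite lerB.
- by move=> u w _; rewrite /h !mulr_ge0 // addr_ge0 // nsq_ge0.
- by move=> u /inT; exact: hh.
- by move=> i; case: (drift_process i pX).
- by move=> i u w _; exact: bt_growth.
- by move=> i; exact: iX.
- move=> i j u w _; apply: le_trans (sgL u (X u w) i j) _.
  rewrite /h; have := nsq_ge0 (X u w); nra.
- move=> i; rewrite (_ : (fun w => _) = fun w => X s w i 0 - X r w i 0); last first.
    by apply/funext => w; rewrite !mxE.
  by apply: measurable_funB; apply: process_meas => //; rewrite ?tr ?(le_trans tr rs) ?(le_trans rs sT) ?sT.
- by move=> i w; rewrite !mxE; ring.
split=> //; apply: le_trans e _.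
rewrite big1 => [|j _]; last by rewrite expr0n.
rewrite mulr0 add0r -[leRHS]mulrA; apply: ler_wpM2l.
  by rewrite !mulr_ge0 // addr_ge0 // subr_ge0.
have [J1 e1] := ci_cst (2 * L * (1 + K)) rs; rewrite -e1.
have [_ _ _ i4 _] := band_proc tr rs sT ah ch (fun u w _ => mulr_ge0 (mulr_ge0 (ler0n R 2) L0) (addr_ge0 ler01 (nsq_ge0 (X u w)))) (fun u h => hh u (inT u h)).
by apply: (ci_le i4 J1) => u /inT /hh [].
Qed.

(** Written with an upper bound [S] for the length of the interval, so that one constant serves all
    starting times. The power of 2 comes from [gronwall], the exponent being the number of its
    cells. *)
Definition stability_constant (S : R) : R :=
  let C := 3 * n%:R * (S + d%:R) * L in
  3 + C * (S * (2 ^+ (Num.truncn (2 * C * S)).+1 * 3)).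

Lemma nsol_stability S x x' X X' : T - t <= S -> nsol x X -> nsol x' X' ->
  forall s, t <= s <= T -> itg P setT (fun w => nsq (X s w - X' s w)) /\
  E[fun w => nsq (X s w - X' s w)] <= stability_constant S * nsq (x - x').
Proof.
move=> hS sX sX'; have [pX X0 iX] := sX; have [pX' X0' iX'] := sX'; have L0 := L_ge0.
have [K hK] := nsol_moment sX; have [K' hK'] := nsol_moment sX'.
have [_ _ Hb Hs _] := coefs.
have S0 : 0 <= S by apply: le_trans hS; rewrite subr_ge0.
have pD := processB pX pX'; have [aD cD] := nsq_process pD.
have yK s : t <= s <= T -> itg P setT (fun w => nsq (X s w - X' s w)) /\
    E[fun w => nsq (X s w - X' s w)] <= 2 * K + 2 * K'.
  move=> st; have [i1 e1] := hK s st; have [i2 e2] := hK' s st.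
  have i3 := itgD mT (itgZ mT 2 i1) (itgZ mT 2 i2).
  have i4 : itg P setT (fun w => nsq (X s w - X' s w)).
    apply: (itg_le mT _ i3); first exact: (fmeas_measurable HB st (aD s st)).
    by move=> w _; rewrite ger0_norm ?nsq_ge0 ?nsqB.
  split=> //; apply: le_trans (E_le mT i4 i3 (fun w _ => nsqB _ _)) _.
  rewrite (ED mT (itgZ mT 2 i1) (itgZ mT 2 i2)).
  by rewrite (EZ mT _ i1) (EZ mT _ i2) lerD // ler_wpM2l.
pose h s w := L * nsq (X s w - X' s w).
have [ah ch] : adapted h /\ cpath h.
  apply: (process_comp (F := fun z => L * nsq z.2) pD) => z.
  by apply: cvgM; [exact: cvg_cst|exact: continuous_nsq].
have h0 s w : 0 <= h s w by rewrite mulr_ge0 // nsq_ge0.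
have hh s : t <= s <= T -> itg P setT (h s) /\ E[h s] <= L * (2 * K + 2 * K').
  move=> /yK [i1 e1]; split; first exact: (itgZ mT).
  by rewrite (EZ mT _ i1) ler_wpM2l.
pose y s := E[fun w => nsq (X s w - X' s w)].
have y0 s : 0 <= y s by apply: E_ge0 => w _; exact: nsq_ge0.
have Jy a b : t <= a -> a <= b -> b <= T -> itg leb `[a, b]%classic y.
  move=> ta ab bT.
  have inT u : a <= u <= b -> t <= u <= T by move=> /andP[h1 h2]; rewrite (le_trans ta h1) (le_trans h2).
  by have [_ _ _ J _] := band_proc ta ab bT aD cD (fun u w _ => nsq_ge0 _) (fun u h => yK u (inT u h)).
pose C := 3 * n%:R * (S + d%:R) * L.
have C0 : 0 <= C by rewrite !mulr_ge0 // addr_ge0.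
have key s : t <= s <= T -> y s <= 3 * nsq (x - x') + C * I[t, s] y.
  move=> st; have /andP[ts sT] := st.
  have inT u : t <= u <= s -> t <= u <= T by move=> /andP[-> h2]; rewrite (le_trans h2).
  have [|||||||||i e] := @process_estimate n t s S h
    (fun i u w => drift_path X i u w - drift_path X' i u w)
    (fun i j z => sg z.1 (X z.1 z.2) i j + - sg z.1 (X' z.1 z.2) i j)
    (fun i w => (X s w i 0 - X t w i 0 - I[t, s] (drift_path X i ^~ w)) +
              - (X' s w i 0 - X' t w i 0 - I[t, s] (drift_path X' i ^~ w)))
    (fun i w => (X s w - X' s w) i 0) (fun i => (x - x') i 0) (L * (2 * K + 2 * K')) (lexx t) ts sT _ ah ch.
  - by apply: le_trans hS; rewrite lerD2r.
  - by move=> u w _.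
  - by move=> u /inT; exact: hh.
  - by move=> i; apply: cpathB; [case: (drift_process i pX)|case: (drift_process i pX')].
  - by move=> i u w _; exact: Hb.
  - by move=> i; apply: isintD; [exact: iX|apply: isintN; exact: iX'].
  - by move=> i j u w _; exact: Hs.
  - move=> i; exact: (process_meas i pD st).
  - move=> i w; rewrite !mxE !X0 !X0'.
    have [_ c1] := drift_process i pX; have [_ c2] := drift_process i pX'.
    have J1 := cpath_itg (D := drift_path X i) w c1 (lexx t) sT.
    have J2 := cpath_itg (D := drift_path X' i) w c2 (lexx t) sT.
    by rewrite (EB (mcci t s) J1 J2); ring.
  apply: le_trans e _; rewrite -/(nsq (x - x')) lerD2l /C -[leRHS]mulrA.
  rewrite -(EZ (mcci t s) _ (Jy t s (lexx t) ts sT)).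
  apply: ler_wpM2l; first by rewrite !mulr_ge0 // addr_ge0.
  apply: ler_eq; apply: ci_eq => u /inT uT.
  by rewrite /h (EZ mT _ (yK u uT).1).
pose M := Num.truncn (2 * C * S).
have hM : 2 * C * (T - t) <= M.+1%:R.
  by apply: (@le_trans _ _ (2 * C * S)); [rewrite ler_wpM2l // mulr_ge0|apply: ltW; exact: truncnS_gt].
have [J3 e3] := ci_cst (3 * nsq (x - x')) tT.
have gr : I[t, T] y <= 2 ^+ M.+1 * (3 * nsq (x - x') * (T - t)).
  rewrite -e3; apply: (gronwall tT C0 hM) => //; first exact: Jy.
  by move=> s _; rewrite mulr_ge0 // nsq_ge0.
move=> s st; have /andP[ts sT] := st; split; first by case: (yK s st).
apply: le_trans (key s st) _.
have -> : stability_constant S = 3 + C * (S * (2 ^+ M.+1 * 3)) by [].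
rewrite (mulrDl 3); apply: lerD => //; rewrite -(mulrA C) (ler_wpM2l C0) //.
apply: (@le_trans _ _ (I[t, T] y)).
  rewrite (ci_split ts sT (Jy t T (lexx t) tT (lexx T))) lerDl.
  by apply: ci_ge0 => u _; exact: y0.
apply: le_trans gr _.
have -> : 2 ^+ M.+1 * (3 * nsq (x - x') * (T - t)) = (T - t) * (2 ^+ M.+1 * 3) * nsq (x - x') by ring.
by rewrite ler_wpM2r ?nsq_ge0 // ler_wpM2r // mulr_ge0 // exprn_ge0.
Qed.

Lemma nsol_unique x X X' : nsol x X -> nsol x X' ->
  {ae P, forall w s, t <= s <= T -> X s w = X' s w}.
Proof.
move=> sX sX'; have [pX _ _] := sX; have [pX' _ _] := sX'; have pD := processB pX pX'.
have h i : {ae P, forall w s, t <= s <= T -> (X s w - X' s w) i 0 = 0}.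
  apply: (indistinguishable (D := fun s w => (X s w - X' s w) i 0)); first by case: pD.
  move=> s st; have [i1 e1] := nsol_stability (lexx (T - t)) sX sX' st.
  have E0 : E[fun w => nsq (X s w - X' s w)] = 0.
    apply/eqP; rewrite eq_le E_ge0 ?andbT; last by move=> w _; exact: nsq_ge0.
    by move: e1; rewrite subrr nsq0 mulr0.
  have := E_eq0 mT i1 (fun w _ => nsq_ge0 _) E0.
  by apply: filterS => w /(_ I) /nsq_eq0 ->; rewrite mxE.
have hall : {ae P, forall w (i : 'I_n) s, t <= s <= T -> (X s w - X' s w) i 0 = 0} by exact: filter_forall.
apply: filterS hall => w hw s st.
by apply/eqP; rewrite -subr_eq0; apply/eqP/colP => i; rewrite hw // mxE.
Qed.

Lemma chebyshev (U : Omega B -> R) lam : L2 P setT U -> 0 < lam ->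
  measurable [set w | lam < `|U w|] /\
  (P [set w | (lam < `|U w|)%R] <= (E[fun w => U w ^+ 2] / lam ^+ 2)%:E)%E.
Proof.
move=> [mU iU] lam0.
have mA : measurable [set w | lam < `|U w|].
  have := measurable_fun_ltr (measurable_cst lam) (measurableT_comp (@normr_measurable R setT) mU).
  move=> /(_ mT [set true] I); rewrite setTI.
  by rewrite (_ : _ @^-1` _ = [set w | lam < `|U w|]) //; apply/seteqP; split.
split=> //; set A := [set w | _] in mA *.
have i1 : itg P setT (\1_A : Omega B -> R).
  apply: (itg_le mT _ (itg_cst 1)); first exact: measurable_indic.
  by move=> w _; rewrite indicE; case: (w \in A); rewrite ?normr0 ?normr1.
have PE : (P A = (E[\1_A])%:E)%E.
  by rewrite -(EFin_E mT i1) integral_indic // setIT.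
rewrite PE lee_fin ler_pdivlMr ?exprn_gt0 // mulrC -(EZ mT _ i1).
apply: (E_le mT) => // [|w _]; first exact: (itgZ mT).
rewrite indicE; case: (boolP (w \in A)) => [/set_mem h|_]; rewrite ?mulr0 ?sqr_ge0 // mulr1.
by rewrite -[leRHS]real_normK ?num_real // ler_pXn2r ?nnegrE ?(ltW lam0) // ltW.
Qed.

Lemma ito_start (Z : R -> Omega B -> 'cV[R]_d) M : ito t T Z M -> {ae P, forall w, M t w = 0}.
Proof.
move=> iZ; have [_ LM] := ito_L2 iZ; have [_ _ _ [H [wH _ HM]]] := iZ.
have tt : t <= t <= T by rewrite lexx.
have [mM iM] := LM t tt.
have e k : (\int[P]_w ((simple_int (H k) t w - M t w) ^+ 2)%:E = (E[fun w => M t w ^+ 2])%:E)%E.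
  rewrite -(EFin_E mT iM); apply: eq_integral => w _.
  by rewrite (simple_int_start w (wH k)) sub0r sqrrN.
have /fine_cvgP[_ cv2] := HM t tt.
have E0 : E[fun w => M t w ^+ 2] = 0.
  apply: (cvg_unique _ (F := (fun=> E[fun w => M t w ^+ 2]) @ \oo)) => //; first exact: cvg_cst.
  by move: cv2; apply: cvg_eq => k /=; rewrite e.
have := E_eq0 mT iM (fun w _ => sqr_ge0 _) E0.
by apply: filterS => w /(_ I) /eqP; rewrite sqrf_eq0 => /eqP.
Qed.

(** * Picard iteration *)

Local Notation drift := drift_path.

Definition row_path (X : R -> Omega B -> 'cV[R]_n) i s w : 'cV[R]_d := (row i (sg s (X s w)))^T.

Lemma row_pathE X i s w j : row_path X i s w j 0 = sg s (X s w) i j.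
Proof. by rewrite !mxE. Qed.

Lemma sigma_process X i j : process X ->
  adapted (fun s w => sg s (X s w) i j) /\ cpath (fun s w => sg s (X s w) i j).
Proof.
move=> pX; have [_ [_ cs] _ _ _] := coefs.
exact: (process_comp (F := fun z => sg z.1 z.2 i j) pX).
Qed.

Lemma row_ito X i : process X -> exists M, [/\ ito t T (row_path X i) M, cpath M & adapted M].
Proof.
move=> pX; have [_ _ _ _ [_ sgL]] := coefs.
have rE j : (fun s w => row_path X i s w j 0) = fun s w => sg s (X s w) i j.
  by apply/funext => s; apply/funext => w; rewrite row_pathE.
apply: (ito_exists (K := Num.sqrt L)) => [j|j|s w j _].
- by rewrite rE; case: (sigma_process i j pX).
- by rewrite rE; case: (sigma_process i j pX).
- by rewrite row_pathE -sqrtr_sqr; apply: ler_wsqrtr.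
Qed.

Lemma row_isint X i M r s : ito t T (row_path X i) M -> t <= r -> r <= s -> s <= T ->
  isint r s (fun j z => sg z.1 (X z.1 z.2) i j) (fun w => M s w - M r w).
Proof.
move=> iM tr rs sT; have := ito_isint iM tr rs sT.
rewrite (_ : (fun j z => row_path X i z.1 z.2 j 0) = fun j z => sg z.1 (X z.1 z.2) i j) //.
by apply/funext => j; apply/funext => z; rewrite row_pathE.
Qed.

Definition picard_step x (X Y : R -> Omega B -> 'cV[R]_n) :=
  [/\ process Y, forall w, Y t w = x &
  forall i r s, t <= r -> r <= s -> s <= T ->
    isint r s (fun j z => sg z.1 (X z.1 z.2) i j)
      (fun w => Y s w i 0 - Y r w i 0 - I[r, s] (drift X i ^~ w))].

Lemma picard_step_exists x X : process X -> exists Y, picard_step x X Y.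
Proof.
move=> pX; have /choice[M hM] i := row_ito i pX.
exists (fun s w => \col_i (x i 0 + I[t, s] (drift X i ^~ w) + (M i s w - M i t w))).
have tt : t <= t <= T by rewrite lexx.
split.
- split=> i.
    move=> s /[dup] st /andP[ts sT]; have [_ _ aM] := hM i.
    rewrite (_ : (fun w => _) = fun w => x i 0 + I[t, s] (drift X i ^~ w) + (M i s w - M i t w)); last first.
      by apply/funext => w; rewrite mxE.
    apply: measurable_funD; first apply: measurable_funD.
    + exact: measurable_cst.
    + by have [a1 c1] := drift_process i pX; exact: (int_fmeas a1 c1).
    + by apply: measurable_funB; [exact: aM|apply: (fmeas_mono ts); exact: aM].
  move=> w; have [_ cM _] := hM i.
  rewrite (_ : (fun s => _) = fun s => x i 0 + I[t, s] (drift X i ^~ w) + (M i s w - M i t w)); last first.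
    by apply/funext => s; rewrite mxE.
  apply: within_continuousD; first apply: within_continuousD.
  + by apply: continuous_subspaceT => u; exact: cvg_cst.
  + by have [a1 c1] := drift_process i pX; exact: (int_cpath c1).
  + apply: within_continuousB; first exact: cM.
    by apply: continuous_subspaceT => u; exact: cvg_cst.
- by move=> w; apply/colP => i; rewrite mxE ci_same subrr !addr0.
- move=> i r s tr rs sT; have [iM _ _] := hM i.
  have := row_isint iM tr rs sT; congr isint; apply/funext => w; rewrite !mxE.
  have [_ c1] := drift_process i pX.
  have Jt := cpath_itg (D := drift X i) w c1 (lexx t) sT.
  by rewrite (ci_split tr rs Jt); ring.
Qed.

(** What remains after the initial value and the drift: a martingale, to which the maximal
    inequality applies, whereas the drift is estimated path by path. *)
Definition noise (x : 'cV[R]_n) (X Y : R -> Omega B -> 'cV[R]_n) i (s : R) (w : Omega B) : R := Y s w i 0 - x i 0 - I[t, s] (drift X i ^~ w).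

Lemma noise_isint x X Y i s : picard_step x X Y -> t <= s <= T ->
  isint t s (fun j z => sg z.1 (X z.1 z.2) i j) (noise x X Y i s).
Proof.
move=> [_ Y0 iY] /andP[ts sT]; have := iY i t s (lexx t) ts sT.
by congr isint; apply/funext => w; rewrite Y0.
Qed.

Lemma noise_cpath x X Y i : process X -> picard_step x X Y ->
  mart (noise x X Y i) /\ cpath (noise x X Y i).
Proof.
move=> pX sY; have [[aY cY] Y0 iY] := sY.
have [a1 c1] := drift_process i pX.
split; last first.
  move=> w; apply: within_continuousB; first apply: within_continuousB.
  - exact: cY.
  - by apply: continuous_subspaceT => u; exact: cvg_cst.
  - exact: (int_cpath c1).
split=> [s st|r s xi tr rs sT Lxi].
  have /andP[ts sT] := st; split; last exact: (isint_L2 (noise_isint i sY st)).1.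
  apply: measurable_funB; last exact: (int_fmeas a1 c1).
  by apply: measurable_funB; [exact: aY|exact: measurable_cst].
have z := isint_mean HB tr sT (iY i r s tr rs sT) Lxi.
rewrite -[RHS]z; apply: E_eq => w _; rewrite /noise.
have Jt := cpath_itg (D := drift X i) w c1 (lexx t) sT.
by rewrite (ci_split tr rs Jt); ring.
Qed.

Let S := T - t.
Let S0 : 0 <= S. Proof. by rewrite subr_ge0. Qed.

Lemma picard_estimate x X Y X' Y' K s : process X -> process X' ->
  picard_step x X Y -> picard_step x X' Y' ->
  (forall u, t <= u <= T -> itg P setT (fun w => nsq (X u w - X' u w)) /\ E[fun w => nsq (X u w - X' u w)] <= K) ->
  t <= s <= T ->
  itg P setT (fun w => nsq (Y s w - Y' s w)) /\
  E[fun w => nsq (Y s w - Y' s w)] <=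
    3 * n%:R * (S + d%:R) * L * I[t, s] (fun u => E[fun w => nsq (X u w - X' u w)]).
Proof.
move=> pX pX' sY sY' hK st; have /andP[ts sT] := st.
have [L0 _ Hb Hs _] := coefs; have [pY Y0 _] := sY; have [pY' Y0' _] := sY'.
have pD := processB pX pX'.
pose h s w := L * nsq (X s w - X' s w).
have [ah ch] : adapted h /\ cpath h.
  apply: (process_comp (F := fun z => L * nsq z.2) pD) => z.
  by apply: cvgM; [exact: cvg_cst|exact: continuous_nsq].
have h0 u w : 0 <= h u w by rewrite mulr_ge0 // nsq_ge0.
have inT u : t <= u <= s -> t <= u <= T by move=> /andP[-> h2]; rewrite (le_trans h2).
have hh u : t <= u <= s -> itg P setT (h u) /\ E[h u] <= L * K.
  move=> /inT /hK [i1 e1]; split; first exact: (itgZ mT).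
  by rewrite (EZ mT _ i1) ler_wpM2l.
have [|||||||||i e] := @process_estimate n t s S h
    (fun i u w => drift X i u w - drift X' i u w)
    (fun i j z => sg z.1 (X z.1 z.2) i j + - sg z.1 (X' z.1 z.2) i j)
    (fun i w => noise x X Y i s w + - noise x X' Y' i s w)
    (fun i w => (Y s w - Y' s w) i 0) (fun i => 0) (L * K) (lexx t) ts sT _ ah ch.
- by rewrite lerD2r.
- by [].
- exact: hh.
- by move=> i; apply: cpathB; [case: (drift_process i pX)|case: (drift_process i pX')].
- by move=> i u w _; exact: Hb.
- by move=> i; apply: isintD; [exact: noise_isint|apply: isintN; exact: noise_isint].
- by move=> i j u w _; exact: Hs.
- move=> i; exact: (process_meas i (processB pY pY') st).
- move=> i w; rewrite !mxE /noise.
  have [_ c1] := drift_process i pX; have [_ c2] := drift_process i pX'.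
  have J1 := cpath_itg (D := drift X i) w c1 (lexx t) sT.
  have J2 := cpath_itg (D := drift X' i) w c2 (lexx t) sT.
  by rewrite (EB (mcci t s) J1 J2); ring.
split=> //; apply: le_trans e _.
rewrite big1 => [|j _]; last by rewrite expr0n.
have [_ _ _ Jy _] := band_proc (lexx t) ts sT (nsq_process pD).1 (nsq_process pD).2
   (fun u w _ => nsq_ge0 _) (fun u h => hK u (inT u h)).
rewrite mulr0 add0r -[leRHS]mulrA -(EZ (mcci t s) _ Jy).
apply: ler_wpM2l; first by rewrite !mulr_ge0 // addr_ge0.
apply: ler_eq; apply: ci_eq => u /inT uT.
by rewrite /h (EZ mT _ (hK u uT).1).
Qed.

Lemma picard_first x Y s : picard_step x (fun _ _ => x) Y -> t <= s <= T ->
  itg P setT (fun w => nsq (Y s w - x)) /\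
  E[fun w => nsq (Y s w - x)] <= 3 * n%:R * (S + d%:R) * (2 * L * (1 + nsq x)) * S.
Proof.
move=> sY st; have /andP[ts sT] := st; have [pY Y0 _] := sY.
have [L0 _ _ _ [_ sgL]] := coefs.
have cc (c : R) : continuous (fun z : R * 'cV[R]_n => c) by move=> z; exact: cvg_cst.
pose h (s : R) (w : Omega B) := 2 * L * (1 + nsq x).
have [ah ch] : adapted h /\ cpath h := process_comp pY (cc _).
have pC : process (fun _ _ => x).
  split=> i; first by move=> u _; exact: measurable_cst.
  by move=> w; apply: continuous_subspaceT => u; exact: cvg_cst.
have [|||||||||i e] := @process_estimate n t s S h
    (drift (fun _ _ => x)) (fun i j z => sg z.1 x i j) (fun i => noise x (fun _ _ => x) Y i s)
    (fun i w => (Y s w - x) i 0) (fun i => 0) (2 * L * (1 + nsq x)) (lexx t) ts sT _ ah ch.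
- by rewrite lerD2r.
- by move=> u w _; rewrite /h !mulr_ge0 // addr_ge0 // nsq_ge0.
- by move=> u _; split; [exact: itg_cst|rewrite E_cst].
- by move=> i; case: (drift_process i pC).
- by move=> i u w _; exact: bt_growth.
- by move=> i; exact: noise_isint sY st.
- move=> i j u w _; apply: le_trans (sgL u x i j) _.
  by rewrite /h; have := nsq_ge0 x; nra.
- move=> i; exact: (process_meas i (processB pY pC) st).
- by move=> i w; rewrite !mxE /noise; ring.
split=> //; apply: le_trans e _.
rewrite big1 => [|j _]; last by rewrite expr0n.
rewrite mulr0 add0r -[leRHS]mulrA; apply: ler_wpM2l.
  by rewrite !mulr_ge0 // addr_ge0.
have [_ e1] := ci_cst (2 * L * (1 + nsq x)) ts.
rewrite /h; under E_eq do rewrite E_cst.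
rewrite e1; apply: ler_wpM2l; last by rewrite lerD2r.
by have n0 := nsq_ge0 x; rewrite !mulr_ge0 // addr_ge0.
Qed.

Section Sequence.
Variables (x : 'cV[R]_n) (X : nat -> R -> Omega B -> 'cV[R]_n).
Hypotheses (X0 : X 0%N = fun _ _ => x) (pX : forall k, process (X k))
  (sX : forall k, picard_step x (X k) (X k.+1)).

(** Differences are measured against the weight [om], for which the integral operator of
    [picard_estimate] contracts by 1/64 on the whole interval at once rather than on short
    subintervals. *)
Lemma picard_decay : exists K, forall k s, t <= s <= T ->
  itg P setT (fun w => nsq (X k.+1 s w - X k s w)) /\
  E[fun w => nsq (X k.+1 s w - X k s w)] <= K * 64^-1 ^+ k.
Proof.
have [L0 _ _ _ _] := coefs.
pose C := 3 * n%:R * (S + d%:R) * L.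
have C0 : 0 <= C by rewrite !mulr_ge0 // addr_ge0.
(* [exp_weight] asks for a positive constant, and [C] may be 0. *)
have [|om [com om1 omle omC]] := @exp_weight R t (C + 1); first by rewrite ltr_wpDl.
pose K0 := 3 * n%:R * (S + d%:R) * (2 * L * (1 + nsq x)) * S.
have K00 : 0 <= K0.
  have n0 := nsq_ge0 x; have S0' := S0.
  by apply: mulr_ge0 => //; apply: mulr_ge0; [rewrite !mulr_ge0 // addr_ge0|rewrite !mulr_ge0 // addr_ge0].
have key k s : t <= s <= T -> itg P setT (fun w => nsq (X k.+1 s w - X k s w)) /\
  E[fun w => nsq (X k.+1 s w - X k s w)] <= K0 * 64^-1 ^+ k * om s.
  elim: k s => [|k IH] s st; have /andP[ts sT] := st.
    have h := sX 0; rewrite X0 in h; have [i1 e1] := picard_first h st.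
    rewrite X0; split=> //; apply: le_trans e1 _; rewrite -/K0 expr0 mulr1.
    by rewrite ler_peMr // om1.
  have q0 : 0 <= (64^-1 : R) ^+ k by rewrite exprn_ge0.
  have hK u : t <= u <= T -> itg P setT (fun w => nsq (X k.+1 u w - X k u w)) /\
      E[fun w => nsq (X k.+1 u w - X k u w)] <= K0 * 64^-1 ^+ k * om T.
    move=> ut; have [i1 e1] := IH u ut; split=> //; apply: le_trans e1 _.
    by apply: ler_wpM2l; [exact: mulr_ge0|apply: omle; case/andP: ut].
  have [i1 e1] := picard_estimate (pX k.+1) (pX k) (sX k.+1) (sX k) hK st.
  split=> //; apply: le_trans e1 _; rewrite -/C.
  have inT u : t <= u <= s -> t <= u <= T by move=> /andP[-> h2]; rewrite (le_trans h2).
  have pD := processB (pX k.+1) (pX k).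
  have [_ _ _ Jy _] := band_proc (lexx t) ts sT (nsq_process pD).1 (nsq_process pD).2
     (fun u w _ => nsq_ge0 _) (fun u h => hK u (inT u h)).
  have Jo : itg leb `[t, s]%classic om by exact: ci_continuous.
  apply: (@le_trans _ _ (C * (K0 * 64^-1 ^+ k * I[t, s] om))).
    apply: ler_wpM2l => //; rewrite -(EZ (mcci t s) _ Jo).
    apply: (ci_le Jy (itgZ (mcci t s) _ Jo)) => u /inT uT.
    by case: (IH u uT).
  have o0 : 0 <= I[t, s] om.
    by apply: ci_ge0 => u /andP[tu _]; apply: le_trans (om1 u tu).
  have h1 : C * I[t, s] om <= 64^-1 * om s.
    by apply: le_trans (omC s ts); rewrite ler_wpM2r // lerDl.
  have := ler_wpM2l (mulr_ge0 K00 q0) h1; congr (_ <= _); first by ring.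
  by rewrite exprS; ring.
exists (K0 * om T) => k s st; have [i1 e1] := key k s st; split=> //.
apply: le_trans e1 _; rewrite mulrAC; apply: ler_wpM2r; first by rewrite exprn_ge0.
by apply: ler_wpM2l => //; apply: omle; case/andP: st.
Qed.

Lemma lip_drift (Y Z : R -> Omega B -> 'cV[R]_n) s w i : (drift Y i s w - drift Z i s w) ^+ 2 <= L * nsq (Y s w - Z s w).
Proof. by have [_ _ Hb _ _] := coefs; exact: Hb. Qed.

(** A step of the iteration differs from the next by a drift part and a noise part. Each gets half
    of the threshold 2^-k: Chebyshev's inequality for the total variation [U] of the drift part, the
    maximal inequality for the noise. The exceptional sets are summable, so [uniform_limit]
    applies. *)
Lemma picard_limit : exists Y, [/\ process Y, forall w, Y t w = x &
  {ae P, forall w, exists m, forall k s i, (m <= k)%N -> t <= s <= T ->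
     `|(X k.+1 s w - Y s w) i 0| <= 2 * 2^-1 ^+ k}].
Proof.
have [K hK] := picard_decay; have [L0 _ Hb Hs _] := coefs.
have tTT : t <= T <= T by rewrite tT lexx.
have tt : t <= t <= T by rewrite lexx.
have K0 : 0 <= K.
  have [_ h] := hK 0%N t tt; rewrite expr0 mulr1 in h.
  by apply: le_trans h; apply: E_ge0 => w _; exact: nsq_ge0.
pose y k u := E[fun w => nsq (X k.+1 u w - X k u w)].
have pD k := processB (pX k.+1) (pX k).
have hK' k u : t <= u <= T -> itg P setT (fun w => nsq (X k.+1 u w - X k u w)) /\ y k u <= K * 64^-1 ^+ k by exact: hK.
have bp k := band_proc (lexx t) tT (lexx T) (nsq_process (pD k)).1 (nsq_process (pD k)).2
     (fun u w _ => nsq_ge0 _) (hK' k).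
have Iy k : I[t, T] (y k) <= K * 64^-1 ^+ k * S.
  have [Jc ec] := ci_cst (K * 64^-1 ^+ k) tT; rewrite -ec.
  by have [_ _ _ Jy _] := bp k; apply: (ci_le Jy Jc) => u ut; case: (hK' k u ut).
pose Nz k i := noise x (X k) (X k.+1) i.
have mN k i : mart (Nz k i) /\ cpath (Nz k i) := noise_cpath i (pX k) (sX k).
pose U k i w := I[t, T] (fun u => `|drift (X k.+1) i u w - drift (X k) i u w|).
have h2 k : 0 < 2^-1 * 2^-1 ^+ k :> R by rewrite mulr_gt0 // exprn_gt0.
have EN k i : E[fun w => (Nz k.+1 i T w - Nz k i T w) ^+ 2] <= d%:R * (L * (K * 64^-1 ^+ k * S)).
  have i1 : isint t T (fun j z => sg z.1 (X k.+1 z.1 z.2) i j + - sg z.1 (X k z.1 z.2) i j)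
     (fun w => Nz k.+1 i T w + - Nz k i T w).
    apply: isintD; first exact: (noise_isint i (sX k.+1) tTT).
    by apply: isintN; exact: (noise_isint i (sX k) tTT).
  rewrite (isint_norm HB (lexx t) (lexx T) i1).
  apply: (@le_trans _ _ (\sum_(j < d) L * (K * 64^-1 ^+ k * S))); last first.
    by rewrite sumr_const card_ord -[leLHS]mulr_natl.
  apply: ler_sum => j _; have [ib _ _ _ eb] := bp k.
  apply: (@le_trans _ _ (L * I[t, T] (y k))); last by rewrite ler_wpM2l.
  rewrite -eb -(EZ (mbd t T) _ ib); apply: (E_le (mbd t T)).
  - exact: ((isint_L2 i1).2 j).2.
  - exact: (itgZ (mbd t T)).
  - by move=> z _; exact: Hs.
have LU k i : L2 P setT (U k i) /\ E[fun w => U k i w ^+ 2] <= S * (L * (K * 64^-1 ^+ k * S)).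
  have [a1 c1] := drift_process i (pX k.+1); have [a0 c0] := drift_process i (pX k).
  pose De u w := drift (X k.+1) i u w - drift (X k) i u w.
  have cDe : cpath De := cpathB c1 c0.
  have aDe : adapted De by move=> s st; apply: measurable_funB; [exact: a1|exact: a0].
  have cA : cpath (fun u w => `|De u w|).
    move=> w; apply: (within_clp_inv tT) => u.
    apply: (continuous_comp (f := (De ^~ w) \o clp t T) (g := fun y : R => `|y|)); last exact: norm_continuous.
    exact: (within_clp tT (cDe w)).
  have aA : adapted (fun u w => `|De u w|) by move=> s st; apply: measurableT_comp => //; exact: aDe.
  have mU : measurable_fun setT (U k i).
    exact: (fmeas_measurable HB tTT (int_fmeas aA cA (lexx t) tT (lexx T))).
  have [_ iI eI _ _] := bp k.
  have iLI := itgZ mT (S * L) iI.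
  have b w : U k i w ^+ 2 <= S * L * I[t, T] (fun u => nsq (X k.+1 u w - X k u w)).
    have J1 := cpath_itg (D := fun u w => `|De u w|) w cA (lexx t) (lexx T).
    have [_ cn] := nsq_process (pD k).
    have J2 := cpath_itg (D := fun u w => nsq (X k.+1 u w - X k u w)) w cn (lexx t) (lexx T).
    have J3 := itgZ (mcci t T) L J2.
    have le1 u : `|De u w| ^+ 2 <= L * nsq (X k.+1 u w - X k u w).
      by rewrite real_normK ?num_real //; exact: lip_drift.
    have J4 : itg leb `[t, T]%classic (fun u => `|De u w| ^+ 2).
      apply: (itg_le (mcci t T)) J3 _; first by apply: measurable_funX; exact: itg_meas J1.
      by move=> u _; rewrite ger0_norm ?sqr_ge0.
    apply: le_trans (ci_CS tT (conj (itg_meas J1) J4)) _.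
    rewrite -mulrA; apply: ler_wpM2l; first exact: S0.
    rewrite -(EZ (mcci t T) _ J2).
    by apply: (ci_le J4 J3) => u _; exact: le1.
  have iU : itg P setT (fun w => U k i w ^+ 2).
    by apply: (itg_sqr_le mT _ iLI).
  split=> //; apply: le_trans (E_le mT iU iLI (fun w _ => b w)) _.
  rewrite (EZ mT _ iI) eI -mulrA; apply: ler_wpM2l; first exact: S0.
  by apply: ler_wpM2l => //; exact: Iy.
pose A i k := [set w | 2^-1 * 2^-1 ^+ k < `|U k i w|] `|`
   [set w | exists2 s, t <= s <= T & 2^-1 * 2^-1 ^+ k < `|Nz k.+1 i s w - Nz k i s w|].
have ch1 k i := chebyshev (LU k i).1 (h2 k).
have ch2 k i := kolmogorov_maximal (martB (mN k.+1 i).1 (mN k i).1) (cpathB (mN k.+1 i).2 (mN k i).2) (h2 k).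
pose C := 4 * (S * (L * (K * S)) + d%:R * (L * (K * S))).
have mA i k : measurable (A i k) by apply: measurableU; [exact: (ch1 k i).1|exact: (ch2 k i).1].
have PA i k : (P (A i k) <= (C * 2^-1 ^+ k)%:E)%E.
  apply: le_trans (measureU2 _ (ch1 k i).1 (ch2 k i).1) _.
  apply: le_trans (leeD (ch1 k i).2 (ch2 k i).2) _.
  rewrite -EFinD lee_fin -mulrDl ler_pdivrMr ?exprn_gt0 //.
  have := lerD (LU k i).2 (EN k i); move=> /le_trans; apply.
  (* The inequalities divide by the squared threshold, of order (2^-k)^2; a factor 2^-k is left for
     summability. *)
  have q : (64^-1 : R) ^+ k <= 2^-1 ^+ k * (2^-1 ^+ k) ^+ 2.
    rewrite -exprM mulnC exprM -exprMn lerXn2r ?nnegrE //; lra.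
  have c0 : 0 <= S * (L * (K * S)) + d%:R * (L * (K * S)) by have S0' := S0; rewrite addr_ge0 // !mulr_ge0.
  have -> : S * (L * (K * 64^-1 ^+ k * S)) + d%:R * (L * (K * 64^-1 ^+ k * S)) =
     (S * (L * (K * S)) + d%:R * (L * (K * S))) * 64^-1 ^+ k by ring.
  apply: le_trans (ler_wpM2l c0 q) _; rewrite /C exprMn.
  by apply: ler_eq; field.
have dA i k w : ~ A i k w -> forall s, t <= s <= T -> `|X k.+2 s w i 0 - X k.+1 s w i 0| <= 2^-1 ^+ k.
  move=> nA s st; have /andP[ts sT] := st.
  have u1 : `|U k i w| <= 2^-1 * 2^-1 ^+ k by rewrite leNgt; apply/negP => h; apply: nA; left.
  have u2 : `|Nz k.+1 i s w - Nz k i s w| <= 2^-1 * 2^-1 ^+ k.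
    by rewrite leNgt; apply/negP => h; apply: nA; right; exists s.
  have [_ c1] := drift_process i (pX k.+1); have [_ c0] := drift_process i (pX k).
  have J1 := cpath_itg (D := drift (X k.+1) i) w c1 (lexx t) sT.
  have J0 := cpath_itg (D := drift (X k) i) w c0 (lexx t) sT.
  have JT := itgB (mcci t T) (cpath_itg (D := drift (X k.+1) i) w c1 (lexx t) (lexx T))
    (cpath_itg (D := drift (X k) i) w c0 (lexx t) (lexx T)).
  have e : X k.+2 s w i 0 - X k.+1 s w i 0 =
     I[t, s] (fun u => drift (X k.+1) i u w - drift (X k) i u w) + (Nz k.+1 i s w - Nz k i s w).
    by rewrite (EB (mcci t s) J1 J0) /Nz /noise; ring.
  rewrite e; apply: le_trans (ler_normD _ _) _.
  have := ci_abs (itgB (mcci t s) J1 J0).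
  have JA := itg_abs JT.
  have : I[t, s] (fun u => `|drift (X k.+1) i u w - drift (X k) i u w|) <= U k i w.
    rewrite /U (ci_split ts sT JA) lerDl; by apply: ci_ge0 => u _; exact: normr_ge0.
  have := ler_norm (U k i w); lra.
have /choice[D hD] i := uniform_limit (fun k => (pX k.+1).1 i) (fun k => (pX k.+1).2 i) (mA i) (PA i) (dA i).
(* The uniform limit starts at [x] almost surely only. Recentring makes every path start there and
   changes the process on a null set alone. *)
exists (fun s w => \col_i (D i s w - D i t w + x i 0)); split.
- split=> i; have [aD cD _] := hD i.
    move=> s st; rewrite (_ : (fun w => _) = fun w => D i s w - D i t w + x i 0); last first.
      by apply/funext => w; rewrite mxE.
    apply: measurable_funD; last exact: measurable_cst.
    apply: measurable_funB; first exact: aD.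
    by case/andP: st => ts _; apply: (fmeas_mono ts); exact: aD.
  move=> w; rewrite (_ : (fun s => _) = fun s => D i s w - D i t w + x i 0); last first.
    by apply/funext => s; rewrite mxE.
  apply: within_continuousD; first apply: within_continuousB.
  + exact: cD.
  + by apply: continuous_subspaceT => u; exact: cvg_cst.
  + by apply: continuous_subspaceT => u; exact: cvg_cst.
- by move=> w; apply/colP => i; rewrite mxE subrr add0r.
- have hall : {ae P, forall w (i : 'I_n), exists m, forall k s, (m <= k)%N -> t <= s <= T ->
     `|X k.+1 s w i 0 - D i s w| <= 2 * 2^-1 ^+ k}.
    by apply: filter_forall => i; case: (hD i).
  apply: filterS hall => w /choice[m hm].
  exists (\max_i m i)%N => k s i mk st; have mi : (m i <= k)%N.
    by apply: leq_trans mk; exact: leq_bigmax.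
  have D0 : D i t w = x i 0.
    have cv : (fun k => X k.+1 t w i 0) @ \oo --> D i t w.
      by apply: (@geo_cvg _ _ _ 2 (m i)) => j mj; exact: hm.
    have [_ e _] := sX 0%N; apply: (cvg_unique _ cv) => //.
    by apply: cvg_near_cst; apply: nearW => j; have [_ -> _] := sX j.
  by rewrite !mxE D0 subrK; exact: hm.
Qed.

(** [isint_lim] passes to the limit in the equation: integrands converge in L2 because [sg] is
    bounded and Lipschitz, while the integrals converge along almost every path by the uniform
    convergence. *)
Lemma picard_solution : exists Y, nsol x Y.
Proof.
have [Y [pY Y0 uY]] := picard_limit; exists Y; split => // i r s tr rs sT.
have [L0 _ Hb Hs [_ sgL]] := coefs.
have mb := mbd r s.
have nc w m : (forall k s i, (m <= k)%N -> t <= s <= T -> `|(X k.+1 s w - Y s w) i 0| <= 2 * 2^-1 ^+ k) ->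
    forall k u, (m <= k)%N -> t <= u <= T -> nsq (X k.+1 u w - Y u w) <= n%:R * (2 * 2^-1 ^+ k) ^+ 2.
  move=> hm k u mk ut; rewrite /nsq; apply: (@le_trans _ _ (\sum_(j < n) (2 * 2^-1 ^+ k) ^+ 2)).
    apply: ler_sum => j _; rewrite -[leLHS]real_normK ?num_real //.
    by have h := hm k u j mk ut; rewrite ler_pXn2r ?nnegrE // (le_trans _ h).
  by rewrite sumr_const card_ord -[leLHS]mulr_natl.
have inT u : r <= u <= s -> t <= u <= T by move=> /andP[h1 h3]; rewrite (le_trans tr h1) (le_trans h3).
apply: (isint_lim (Z := fun k j z => sg z.1 (X k.+1 z.1 z.2) i j)
   (xi := fun k w => X k.+2 s w i 0 - X k.+2 r w i 0 - I[r, s] (drift (X k.+1) i ^~ w)) tr rs sT).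
- by move=> k; have [_ _] := sX k.+1; apply.
- move=> j.
  have iZ k : L2 lm (band r s) (fun z => sg z.1 (X k.+1 z.1 z.2) i j).
    by have [_ _ h] := sX k.+1; exact: ((isint_L2 (h i r s tr rs sT)).2 j).
  have [aY cY] := sigma_process i j pY.
  have mY := band_meas aY cY tr sT.
  have LY : L2 lm (band r s) (fun z => sg z.1 (Y z.1 z.2) i j).
    split=> //; have [] // := @band_sup R d B r s (fun z => sg z.1 (Y z.1 z.2) i j ^+ 2) L rs.
    - exact: measurable_funX.
    - by move=> z _; rewrite sqr_ge0.
    - move=> u /inT ut /=; have mu_ : measurable_fun setT (fun w => sg u (Y u w) i j).
        exact: (fmeas_measurable HB ut (aY u ut)).
      have i1 : itg P setT (fun w => sg u (Y u w) i j ^+ 2).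
        by apply: (itg_sqr_le mT _ (itg_cst L)).
      by split=> //; rewrite -[leRHS](E_cst); apply: (E_le mT) => //; exact: itg_cst.
  split=> //.
  have : (fun k => Rintegral lm (band r s) (fun z =>
      `|(sg z.1 (X k.+1 z.1 z.2) i j - sg z.1 (Y z.1 z.2) i j) ^+ 2|)) @ \oo --> 0.
    apply: (dct0 mb (g := fun=> 4 * L)).
    + move=> k; apply: measurable_funX; apply: measurable_funB => //; exact: L2_meas (iZ k).
    + have [|||//] := @band_sup R d B r s (fun=> 4 * L) (4 * L) rs; first exact: measurable_cst.
      * by move=> z _; rewrite mulr_ge0.
      * by move=> u _; split; [exact: itg_cst|rewrite E_cst].
    + move=> k z _; rewrite ger0_norm ?sqr_ge0 //.
      have := sgL z.1 (X k.+1 z.1 z.2) i j; have := sgL z.1 (Y z.1 z.2) i j.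
      set a := sg _ _ _ _; set b := sg _ _ _ _; have := sqr_ge0 (a + b); nra.
    + apply: (ae_band uY) => u w /andP[/ltW h1 h3] [m hm].
      have ut : t <= u <= T by apply: inT; rewrite h1.
      apply: (@geo_cvg _ _ _ (L * (n%:R * 4)) m) => k mk; rewrite subr0 ger0_norm ?sqr_ge0 //=.
      apply: le_trans (Hs _ _ _ _ _) _; rewrite -mulrA ler_wpM2l //.
      apply: le_trans (nc w m hm k u mk ut) _; rewrite -mulrA ler_wpM2l // exprMn.
      rewrite (_ : 2 ^+ 2 = 4 :> R); last by rewrite expr2; ring.
      rewrite ler_wpM2l // expr2 -[leRHS]mul1r ler_wpM2r ?exprn_ge0 //.
      by apply: exprn_ile1; lra.
  move=> cv; have cv2 := cvg_sqrt0 cv; move: cv2; apply: cvg_eq => k.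
  by rewrite /nrm; congr Num.sqrt; apply: E_eq => z _; rewrite ger0_norm ?sqr_ge0.
- have [a1 c1] := drift_process i pY.
  have st : t <= s <= T by rewrite sT (le_trans tr).
  have rt : t <= r <= T by rewrite tr (le_trans rs).
  apply: measurable_funB; first apply: measurable_funB.
  + exact: (process_meas i pY st).
  + exact: (process_meas i pY rt).
  + exact: (fmeas_measurable HB st (int_fmeas a1 c1 tr rs sT)).
- apply: filterS uY => w [m hm].
  have st : t <= s <= T by rewrite sT (le_trans tr).
  have rt : t <= r <= T by rewrite tr (le_trans rs).
  apply: cvgB; first apply: cvgB.
  + apply: (@geo_cvg _ _ _ 2 m) => k mk; have h := hm k.+1 s i (leqW mk) st; rewrite !mxE in h.
    apply: le_trans h _; rewrite ler_wpM2l // exprS ler_piMl ?exprn_ge0 //; lra.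
  + apply: (@geo_cvg _ _ _ 2 m) => k mk; have h := hm k.+1 r i (leqW mk) rt; rewrite !mxE in h.
    apply: le_trans h _; rewrite ler_wpM2l // exprS ler_piMl ?exprn_ge0 //; lra.
  + apply: (@geo_cvg _ _ _ (Num.sqrt (L * n%:R) * 2 * (s - r)) m) => k mk.
    have [_ c1] := drift_process i (pX k.+1); have [_ c0] := drift_process i pY.
    have J1 := cpath_itg (D := drift (X k.+1) i) w c1 tr sT.
    have J0 := cpath_itg (D := drift Y i) w c0 tr sT.
    have Jd := itgB (mcci r s) J1 J0.
    rewrite -(EB (mcci r s) J1 J0); apply: le_trans (ci_abs Jd) _.
    have [Jc ec] := ci_cst (Num.sqrt (L * n%:R) * (2 * 2^-1 ^+ k)) rs.
    have -> : Num.sqrt (L * n%:R) * 2 * (s - r) * 2^-1 ^+ k =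
      Num.sqrt (L * n%:R) * (2 * 2^-1 ^+ k) * (s - r) by ring.
    rewrite -ec; apply: (ci_le (itg_abs Jd) Jc) => u urs.
    have q0 : 0 <= 2 * 2^-1 ^+ k :> R by rewrite mulr_ge0 // exprn_ge0.
    have -> : Num.sqrt (L * n%:R) * (2 * 2^-1 ^+ k) = Num.sqrt (L * n%:R * (2 * 2^-1 ^+ k) ^+ 2).
      by rewrite [in RHS]sqrtrM ?mulr_ge0 // sqrtr_sqr ger0_norm.
    rewrite -sqrtr_sqr; apply: ler_wsqrtr; apply: le_trans (lip_drift _ _ _ _ _) _.
    by rewrite -mulrA ler_wpM2l //; exact: (nc w m hm k u mk (inT u urs)).
Qed.

End Sequence.

Lemma nsol_exists x : exists Y, nsol x Y.
Proof.
(* The iteration wants a total map; an argument that is not a process is sent to itself as a dummy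
   value. *)
have /choice[nx hnx] Y : exists Z, process Y -> picard_step x Y Z.
  by case: (pselect (process Y)) => h; [have [Z hZ] := picard_step_exists x h; exists Z|exists Y].
pose X k := iter k nx (fun _ _ => x).
have pX k : process (X k).
  elim: k => [|k IH] /=; last by case: (hnx _ IH).
  split=> i; first by move=> u _; exact: measurable_cst.
  by move=> w; apply: continuous_subspaceT => u; exact: cvg_cst.
exact: (@picard_solution x X erefl pX (fun k => hnx _ (pX k))).
Qed.

(* the equation of [sde_sol], for general coefficients *)
Definition esol (bt' : R -> 'cV[R]_n -> 'cV[R]_n) (sg' : R -> 'cV[R]_n -> 'M[R]_(n, d)) (x : 'cV[R]_n) (X : R -> Omega B -> 'cV[R]_n) :=
  (forall i, progressive t T (fun s w => X s w i 0)) /\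
  exists M : R -> Omega B -> 'cV[R]_n,
    (forall i, ito t T (fun s w => (row i (sg' s (X s w)))^T : 'cV[R]_d) (fun s w => M s w i 0)) /\
    {ae P, forall w i,
       leb.-integrable `[t, T] (EFin \o (fun s => bt' s (X s w) i 0 : R)) /\
       forall s, t <= s <= T ->
         X s w i 0 = x i 0 + \int[leb]_(r in `[t, s]) bt' r (X r w) i 0 + M s w i 0}.

(** The noise of [X] and the constructed Ito integral are stochastic integrals of the same integrand
    on every [t, s], so their difference has second moment 0. Both being continuous, they are
    indistinguishable. *)
Lemma nsol_esol x X : nsol x X -> esol bt sg x X.
Proof.
move=> sX; have [pX X0 iX] := sX; have [aX cX] := pX.
split; first by move=> i; exact: (continuous_adapted_progressive (aX i) (cX i)).
have /choice[M hM] i := row_ito i pX.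
exists (fun s w => \col_i M i s w).
have hME i : (fun s w => (\col_i M i s w) i 0) = M i.
  by apply/funext => s; apply/funext => w; rewrite mxE.
split=> [i|]; first by rewrite hME; case: (hM i).
have sX' : picard_step x X X by [].
have h1 i : {ae P, forall w, forall s, t <= s <= T -> noise x X X i s w - (M i s w - M i t w) = 0}.
  have [iM cM aM] := hM i; have [mN cN] := noise_cpath i pX sX'.
  apply: (indistinguishable (D := fun s w => noise x X X i s w - (M i s w - M i t w))).
    apply: cpathB => // w; apply: within_continuousB; first exact: cM.
    by apply: continuous_subspaceT => u; exact: cvg_cst.
  move=> s st; have /andP[ts sT] := st.
  have i1 := isintD (noise_isint i sX' st) (isintN (row_isint iM (lexx t) ts sT)).
  have e := isint_norm HB (lexx t) sT i1.
  have E0 : E[fun w => (noise x X X i s w + - (M i s w - M i t w)) ^+ 2] = 0.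
    rewrite e big1 // => j _; rewrite -[RHS](E0 lm (band t s)); apply: E_eq => z _.
    by rewrite subrr expr0n.
  have := E_eq0 mT (isint_L2 i1).1.2 (fun w _ => sqr_ge0 _) E0.
  by apply: filterS => w /(_ I) /eqP; rewrite sqrf_eq0 => /eqP.
have h2 i : {ae P, forall w, M i t w = 0} by have [iM _ _] := hM i; exact: (ito_start iM).
have hall : {ae P, forall w (i : 'I_n), (forall s, t <= s <= T -> noise x X X i s w - (M i s w - M i t w) = 0) /\ M i t w = 0}.
  by apply: filter_forall => i; exact: (filterI (h1 i) (h2 i)).
apply: filterS hall => w hw i; have [h3 h4] := hw i.
have [_ c1] := drift_process i pX; split.
  exact: (cpath_itg (D := drift X i) w c1 (lexx t) (lexx T)).
move=> s st; rewrite mxE; have := h3 s st; rewrite h4 subr0 /noise /drift_path.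
by move/eqP; rewrite subr_eq0 => /eqP <-; ring.
Qed.

(** A given solution satisfies the equation with continuous integrals on almost every path only. The
    other paths are replaced by the constant [x]; augmentation keeps the result adapted, and almost
    sure changes leave the stochastic integrals intact. *)
Lemma esol_nsol x X : esol bt sg x X ->
  exists2 X', nsol x X' & {ae P, forall w s, t <= s <= T -> X s w = X' s w}.
Proof.
move=> [pX [M [iM eM]]].
pose Q w := [/\ forall i, M t w i 0 = 0, forall i, {within `[t, T], continuous (fun s => M s w i 0)} &
   forall i, leb.-integrable `[t, T] (EFin \o (fun s => bt s (X s w) i 0 : R)) /\
       forall s, t <= s <= T ->
         X s w i 0 = x i 0 + \int[leb]_(r in `[t, s]) bt r (X r w) i 0 + M s w i 0].
have aQ : {ae P, forall w, Q w}.
  have a1 : {ae P, forall w (i : 'I_n), M t w i 0 = 0}.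
    by apply: filter_forall => i; exact: (ito_start (iM i)).
  have a2 : {ae P, forall w (i : 'I_n), {within `[t, T], continuous (fun s => M s w i 0)}}.
    by apply: filter_forall => i; case: (iM i).
  by apply: filterS (filterI a1 (filterI a2 eM)) => w [h1 [h2 h3]]; split.
pose X' s w := if `[< Q w >] then X s w else x.
have XX : {ae P, forall w s, t <= s <= T -> X s w = X' s w}.
  by apply: filterS aQ => w Qw s _; rewrite /X' asboolT.
exists X' => //.
have tt : t <= t <= T by rewrite lexx.
have pX' : process X'.
  split=> i.
    move=> s st; apply: (fmeas_ae (progressive_fmeas st (pX i))).
    by apply: filterS XX => w ->.
  move=> w; rewrite /X'; case: (asboolP (Q w)) => Qw; last first.
    by apply: continuous_subspaceT => u; exact: cvg_cst.
  have [q1 q2 q3] := Qw; have [q4 q5] := q3 i.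
  apply: (@subspace_eq_continuous _ _ _ (fun s => x i 0 + \int[leb]_(r in `[t, s]) bt r (X r w) i 0 + M s w i 0)).
    by move=> s /set_mem /=; rewrite in_itv /= => st; exact/esym/(q5 s st).
  apply: within_continuousD; last exact: q2.
  apply: within_continuousD; first by apply: continuous_subspaceT => u; exact: cvg_cst.
  exact: parameterized_integral_continuous.
split=> // [w|i r s tr rs sT].
  rewrite /X'; case: (asboolP (Q w)) => // -[q1 q2 q3]; apply/colP => i.
  by have [_ ->] := q3 i; rewrite // q1 ci_same !addr0.
have st : t <= s <= T by rewrite sT (le_trans tr).
have rt : t <= r <= T by rewrite tr (le_trans rs).
apply: (isint_ae (row_isint (iM i) tr rs sT)).
- have [a1 c1] := drift_process i pX'.
  apply: measurable_funB; first apply: measurable_funB.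
  + exact: (process_meas i pX' st).
  + exact: (process_meas i pX' rt).
  + exact: (fmeas_measurable HB st (int_fmeas a1 c1 tr rs sT)).
- apply: filterS aQ => w Qw; have [q1 q2 q3] := Qw; have [q4 q5] := q3 i.
  have X'E u : X' u w = X u w by rewrite /X' asboolT.
  rewrite !X'E (q5 s st) (q5 r rt).
  have -> : I[r, s] (drift X' i ^~ w) = I[r, s] (fun u => bt u (X u w) i 0).
    by apply: ci_eq => u _; rewrite /drift_path X'E.
  have Js : itg leb `[t, s]%classic (fun u => bt u (X u w) i 0) by exact: ci_sub (lexx t) sT q4.
  by rewrite (ci_split tr rs Js); ring.
- by move=> j; have [a1 c1] := sigma_process i j pX'; exact: (band_meas a1 c1 tr sT).
- move=> j; apply: (ae_band XX) => u w /andP[/ltW h1 h3] h /=.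
  by rewrite -h // (le_trans tr h1) (le_trans h3).
Qed.

Lemma E_abs_nrm f : L2 P setT f -> E[fun w => `|f w|] <= nrm P setT f.
Proof.
move=> Lf; have L1 : L2 P setT (fun=> 1 : R).
  by split; [exact: measurable_cst|apply: (itg_eq mT) (itg_cst 1) => w _; rewrite expr1n].
have := E_CSabs mT Lf L1.
have -> : nrm P setT (fun=> 1 : R) = 1.
  by rewrite /nrm; under E_eq do rewrite expr1n; rewrite E_cst sqrtr1.
by rewrite mulr1; congr (_ <= _); apply: E_eq => w _; rewrite mulr1.
Qed.

Lemma L2_itgP f : L2 P setT f -> itg P setT f.
Proof.
move=> Lf; have L1 : L2 P setT (fun=> 1 : R).
  by split; [exact: measurable_cst|apply: (itg_eq mT) (itg_cst 1) => w _; rewrite expr1n].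
by apply: (itg_eq mT) (itgM mT Lf L1) => w _; rewrite mulr1.
Qed.

(** * The formula of Ito *)

Section ItoFormula.
Variables (x : 'cV[R]_n) (X : R -> Omega B -> 'cV[R]_n).
Hypothesis sX : nsol x X.
Variables (r s : R).
Hypotheses (tr : t <= r) (rs : r <= s) (sT : s <= T).
Local Notation tau N j := (grid r s N j).
Local Notation h N := ((s - r) / N.+1%:R).

Lemma pX : process X. Proof. by case: sX. Qed.

Lemma step_T N j : (j < N.+1)%N -> [/\ t <= tau N j, tau N j <= tau N j.+1, tau N j.+1 <= T, r <= tau N j & tau N j.+1 <= s].
Proof.
move=> jN; have /andP[h1 h2] := grid_in rs (ltnW jN); have /andP[h3 h4] := grid_in rs jN.
by split => //; [exact: le_trans h1|exact: grid_le|exact: le_trans sT].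
Qed.

(** Freezing [F] at the left end of each cell. The change is split at the value F(tau_j, X_u): the
    change in time has no rate, only continuity, and goes to 0 by dominated convergence; the change
    in space is Lipschitz, costs O(h) in mean square by [nsol_increment], and integrates to O(h) in
    total. *)
Lemma step_L2 (F : R * 'cV[R]_n -> R) (C : R) : continuous F -> 0 <= C ->
  (forall u y z, (F (u, y) - F (u, z)) ^+ 2 <= C * nsq (y - z)) ->
  (forall u y, F (u, y) ^+ 2 <= C * (1 + nsq y)) ->
  (forall N j, (j < N.+1)%N -> itg lm (band (tau N j) (tau N j.+1))
      (fun z => (F (z.1, X z.1 z.2) - F (tau N j, X (tau N j) z.2)) ^+ 2)) /\
  (fun N => \sum_(j < N.+1) Rintegral lm (band (tau N j) (tau N j.+1))
      (fun z => (F (z.1, X z.1 z.2) - F (tau N j, X (tau N j) z.2)) ^+ 2)) @ \oo --> 0.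
Proof.
move=> cF C0 FL Fb; have [K1 hK1] := nsol_moment sX.
have [K2 hK2] := nsol_increment sX.
have pX := pX; have [aX cX] := pX.
have inT u : r <= u <= s -> t <= u <= T by move=> /andP[h1 h2]; rewrite (le_trans tr h1) (le_trans h2).
have [aF cpF] := process_comp pX cF.
have fz q : adapted (fun u w => F (q, X u w)) /\ cpath (fun u w => F (q, X u w)).
  apply: (process_comp (F := fun z => F (q, z.2)) pX) => z.
  apply: (continuous_comp (f := fun z : R * 'cV[R]_n => (q, z.2)) (g := F)); last exact: cF.
  by apply: (@cvg_pair _ _ _ _ (nbhs q) (nbhs z.2)); [exact: cvg_cst|exact: cvg_snd].
have mF a b : t <= a -> b <= T -> mband (fun z => F (z.1, X z.1 z.2)) a b by move=> ta bT; exact: (band_meas aF cpF).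
have mq q a b : t <= a -> b <= T -> mband (fun z => F (q, X z.1 z.2)) a b.
  by move=> ta bT; have [h1 h2] := fz q; exact: (band_meas h1 h2).
have m0 q a b : t <= q <= T -> mband (fun z => F (q, X q z.2)) a b by move=> qT; exact: (@fmeas_band q (fun w => F (q, X q w)) a b qT (aF q qT)).
have [ian can] := nsq_process pX.
have dom a b : t <= a -> a <= b -> b <= T -> itg lm (band a b) (fun z => 4 * (C * (1 + nsq (X z.1 z.2)))).
  move=> ta ab bT; apply: (itgZ (mbd a b)); apply: (itgZ (mbd a b)).
  have uT u : a <= u <= b -> t <= u <= T by move=> /andP[h1 h2]; rewrite (le_trans ta h1) (le_trans h2).
  have [h1 _ _ _ _] := band_proc ta ab bT ian can (fun u w _ => nsq_ge0 _) (fun u h => hK1 u (uT u h)).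
  apply: (itgD (mbd a b)) => //.
  have [|||//] := @band_sup R d B a b (fun=> 1) 1 ab; first exact: measurable_cst.
  - by [].
  - by move=> u _; split; [exact: itg_cst|rewrite E_cst].
pose D N j (z : R * Omega B) := (F (z.1, X z.1 z.2) - F (tau N j, X z.1 z.2)) ^+ 2.
pose D' N j (z : R * Omega B) := (F (tau N j, X z.1 z.2) - F (tau N j, X (tau N j) z.2)) ^+ 2.
have sq4 (a b c : R) : a ^+ 2 <= c -> b ^+ 2 <= c -> (a - b) ^+ 2 <= 4 * c by have := sqr_ge0 (a + b); nra.
have iD N j : (j < N.+1)%N -> itg lm (band (tau N j) (tau N j.+1)) (D N j).
  move=> jN; have [h1 h2 h3 _ _] := step_T jN.
  apply: (itg_le (mbd _ _) _ (dom _ _ h1 h2 h3)).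
    by apply: measurable_funX; apply: measurable_funB; [exact: mF|exact: mq].
  by move=> z _; rewrite ger0_norm ?sqr_ge0 //; apply: sq4.
have iD' N j : (j < N.+1)%N -> itg lm (band (tau N j) (tau N j.+1)) (D' N j) /\
    Rintegral lm (band (tau N j) (tau N j.+1)) (D' N j) <= C * (`|K2| * h N) * h N.
  move=> jN; have [h1 h2 h3 _ _] := step_T jN; rewrite -{2}(grid_step r s N j).
  apply: (band_sup h2).
  - apply: measurable_funX; apply: measurable_funB; first exact: mq.
    by apply: m0; rewrite h1 (le_trans h2).
  - by move=> z _; rewrite sqr_ge0.
  - move=> u /andP[u1 u2] /=.
    have uT' : t <= u <= T by rewrite (le_trans h1 u1) (le_trans u2).
    have qT' : t <= tau N j <= T by rewrite h1 (le_trans h2).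
    have [i1 e1] := hK2 _ _ h1 u1 (le_trans u2 h3).
    have i2 := itgZ mT C i1.
    have i3 : itg P setT (fun w => D' N j (u, w)).
      apply: (itg_le mT _ i2) => [|w _]; last by rewrite ger0_norm ?sqr_ge0 //; exact: FL.
      apply: measurable_funX; apply: measurable_funB.
        by apply: (fmeas_measurable HB uT'); exact: (fz _).1.
      by apply: (fmeas_measurable HB qT'); exact: (fz _).1.
    split=> //; apply: le_trans (E_le mT i3 i2 (fun w _ => FL _ _ _)) _.
    rewrite (EZ mT _ i1) ler_wpM2l //; apply: le_trans e1 _.
    rewrite -(grid_step r s N j); apply: (@le_trans _ _ (`|K2| * (u - tau N j))).
      by apply: ler_wpM2r; rewrite ?subr_ge0 // ler_norm.
    by apply: ler_wpM2l => //; rewrite lerD2r.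
have split2 N j (z : R * Omega B) : (F (z.1, X z.1 z.2) - F (tau N j, X (tau N j) z.2)) ^+ 2 <= 2 * D N j z + 2 * D' N j z.
  rewrite /D /D'; set a := F (z.1, _); set b := F (_, X z.1 _); set c := F (_, X _ _).
  have := sqr_ge0 (a - b - (b - c)); nra.
have iS N j : (j < N.+1)%N -> itg lm (band (tau N j) (tau N j.+1)) (fun z => 2 * D N j z + 2 * D' N j z).
  by move=> jN; apply: (itgD (mbd _ _)); apply: (itgZ (mbd _ _)); [exact: iD|exact: (iD' N j jN).1].
have iT N j : (j < N.+1)%N -> itg lm (band (tau N j) (tau N j.+1))
      (fun z => (F (z.1, X z.1 z.2) - F (tau N j, X (tau N j) z.2)) ^+ 2).
  move=> jN; have [h1 h2 h3 _ _] := step_T jN.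
  apply: (itg_le (mbd _ _) _ (iS N j jN)).
    apply: measurable_funX; apply: measurable_funB; first exact: mF.
    by apply: m0; rewrite h1 (le_trans h2).
  by move=> z _; rewrite ger0_norm ?sqr_ge0.
split; first exact: iT.
(* the time increments, by dominated convergence on the whole band *)
pose G N z := \sum_(j < N.+1) cutoff (tau N j) (tau N j.+1) (D N j) z.
have GE N : itg lm (band r s) (G N) /\
    Rintegral lm (band r s) (G N) = \sum_(j < N.+1) Rintegral lm (band (tau N j) (tau N j.+1)) (D N j).
  have hc (j : 'I_N.+1) : itg lm (band r s) (cutoff (tau N j) (tau N j.+1) (D N j)) /\
     Rintegral lm (band r s) (cutoff (tau N j) (tau N j.+1) (D N j)) = Rintegral lm (band (tau N j) (tau N j.+1)) (D N j).
    have [h1 h2 h3 h4 h5] := step_T (ltn_ord j).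
    by apply: cutoff_itg => //; exact: iD.
  split; first by apply: (itg_sum (mbd r s)) => j; exact: (hc j).1.
  rewrite (E_sum (mbd r s)) => [|j]; last exact: (hc j).1.
  by apply: eq_bigr => j _; exact: (hc j).2.
have Gavg N z (e : R) : band r s z -> (forall j, (j < N.+1)%N -> tau N j < z.1 <= tau N j.+1 -> D N j z <= e) ->
    `|G N z| <= e.
  move=> [/= + _]; rewrite in_itv /= => zrs hD.
  have := @grid_avg R r s N z.1 (fun j => D N j z) 0 e rs zrs; rewrite subr0.
  rewrite (eq_bigr (fun j : 'I_N.+1 => cutoff (tau N j) (tau N j.+1) (D N j) z)) => [|j _].
    by apply => j jN hj; rewrite subr0 ger0_norm ?sqr_ge0 //; exact: hD.
  by rewrite /cutoff; case: ifP; rewrite ?mul1r ?mul0r.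
have G0 : (fun N => Rintegral lm (band r s) (fun z => `|G N z|)) @ \oo --> 0.
  apply: (dct0 (mbd r s) _ (dom r s tr rs sT)).
  - by move=> N; exact: itg_meas (GE N).1.
  - by move=> N z bz; apply: Gavg => // j jN _; apply: sq4.
  - apply: aeW => -[u w] bz.
    have ut : r < u <= s by move: bz => [/= + _]; rewrite in_itv.
    have cf : continuous (fun q : R => F (q, X u w)).
      move=> q; apply: (continuous_comp (f := fun q : R => (q, X u w)) (g := F)); last exact: cF.
      by apply: (@cvg_pair _ _ _ _ (nbhs q) (nbhs (X u w))); [exact: cvg_id|exact: cvg_cst].
    apply/cvgrPdist_le => e e0.
    have e1 : 0 < Num.sqrt e by rewrite sqrtr_gt0.
    have /cvgrPdist_le /(_ _ e1) [rho /= rho0 hrho] := cf u.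
    have := cvg0_lt (mesh_cvg r s) rho0; apply: filterS => N /=; rewrite sub0r normrN => hN.
    apply: Gavg => // j jN /andP[/= h1 h2]; rewrite /D /=.
    have : `|F (u, X u w) - F (tau N j, X u w)| <= Num.sqrt e.
      apply: hrho => /=; rewrite ger0_norm ?subr_ge0 ?(ltW h1) //.
      apply: le_lt_trans hN; apply: le_trans (ler_norm _); rewrite -(grid_step r s N j).
      by rewrite lerD2r.
    move=> h3; rewrite -[leLHS]real_normK ?num_real // -[leRHS](sqr_sqrtr (ltW e0)).
    by rewrite ler_pXn2r ?nnegrE ?sqrtr_ge0.
have G0' : (fun N => \sum_(j < N.+1) Rintegral lm (band (tau N j) (tau N j.+1)) (D N j)) @ \oo --> 0.
  move: G0; apply: cvg_eq => N; rewrite -(GE N).2; apply: E_eq => z _.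
  rewrite ger0_norm //; apply: sumr_ge0 => j _; rewrite /cutoff; case: ifP => // _; exact: sqr_ge0.
have hc0 : (fun N : nat => 2 * (C * `|K2| * (s - r) * h N)) @ \oo --> 0.
  apply: cvgMl0.
  apply: cvgMl0.
  exact: cvgMl0 (cvg_harmonic).
have bound : (fun N => 2 * (\sum_(j < N.+1) Rintegral lm (band (tau N j) (tau N j.+1)) (D N j)) +
    2 * (C * `|K2| * (s - r) * h N)) @ \oo --> 0.
  rewrite -[X in _ --> X](addr0 0); apply: cvgD => //.
  by apply: cvgMl0; exact: G0'.
apply: squeeze_cvgr _ (cvg_cst 0) bound; apply: nearW => N; apply/andP; split.
  by apply: sumr_ge0 => j _; apply: E_ge0 => z _; exact: sqr_ge0.
have -> : 2 * (C * `|K2| * (s - r) * h N) = \sum_(j < N.+1) 2 * (C * (`|K2| * h N) * h N).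
  rewrite sumr_const card_ord -[RHS]mulr_natl.
  have M0 : N.+1%:R != 0 :> R by rewrite pnatr_eq0.
  by move: (N.+1%:R) M0 => M M0; field.
rewrite mulr_sumr -big_split /=; apply: ler_sum => j _.
have jN := ltn_ord j; have [i2 e2] := iD' N j jN; have i1 := iD N j jN.
apply: le_trans (E_le (mbd _ _) (iT N j jN) (iS N j jN) (fun z _ => split2 N j z)) _.
rewrite (ED (mbd _ _) (itgZ (mbd _ _) 2 i1) (itgZ (mbd _ _) 2 i2)) (EZ (mbd _ _) _ i1) (EZ (mbd _ _) _ i2).
by rewrite lerD2l ler_wpM2l.
Qed.

Local Notation del N j i w := (X (tau N j.+1) w i 0 - X (tau N j) w i 0).
Local Notation sgj N j i l w := (sg (tau N j) (X (tau N j) w) i l).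

(** The leading part of the increment of [X] over a cell: diffusion frozen at the left end, drift
    dropped. *)
Definition rho N j i w := \sum_l sgj N j i l w * dW (tau N j) (tau N j.+1) l w.

Let h_ge0 N : 0 <= h N. Proof. by rewrite divr_ge0 // subr_ge0. Qed.

Lemma sgj_L2F N j i l : (j < N.+1)%N -> L2F (tau N j) (fun w => sgj N j i l w).
Proof.
move=> jN; have [h1 h2 h3 _ _] := step_T jN; have [pX _ _] := sX; have [_ _ _ _ [_ sgL]] := coefs.
have jT : t <= tau N j <= T by rewrite h1 (le_trans h2).
have [aS _] := sigma_process i l pX; have m1 := aS _ jT.
split=> //; have m2 := fmeas_measurable HB jT m1; split=> //.
apply: (itg_sqr_le mT _ (itg_cst L)) => // w _; exact: sgL.
Qed.

Lemma rho_isint N j i : (j < N.+1)%N -> isint (tau N j) (tau N j.+1) (fun l z => sgj N j i l z.2) (rho N j i).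
Proof.
move=> jN; have [h1 h2 h3 _ _] := step_T jN.
by apply: (isint_step h1 h2 h3) => l; exact: sgj_L2F.
Qed.

Lemma rho_L2 N j i : (j < N.+1)%N -> L2 P setT (rho N j i) /\ E[fun w => rho N j i w ^+ 2] <= d%:R * L * h N.
Proof.
move=> jN; have [h1 h2 h3 _ _] := step_T jN; have [_ _ _ _ [_ sgL]] := coefs.
have ir := rho_isint i jN; split; first exact: (isint_L2 ir).1.
rewrite (isint_norm HB h1 h3 ir); apply: (@le_trans _ _ (\sum_(l < d) L * h N)); last first.
  by rewrite sumr_const card_ord -[leLHS]mulr_natl mulrA.
apply: ler_sum => l _; rewrite -(grid_step r s N j).
have [|||_ e] := band_sup (f := fun z => sgj N j i l z.2 ^+ 2) (K := L) h2 _ _ _ => //.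
- exact: itg_meas ((isint_L2 ir).2 l).2.
- by move=> z _; rewrite sqr_ge0.
- move=> u _ /=; have [_ [_ i1]] := sgj_L2F i l jN; split=> //.
  by rewrite -[leRHS](E_cst); apply: (E_le mT) => //; exact: itg_cst.
Qed.

Lemma del_L2 : exists K, 0 <= K /\ forall N j i, (j < N.+1)%N ->
  L2 P setT (fun w => del N j i w) /\ E[fun w => del N j i w ^+ 2] <= K * h N.
Proof.
have [K hK] := nsol_increment sX; have [pX _ _] := sX.
exists `|K|; split=> // N j i jN; have [h1 h2 h3 _ _] := step_T jN.
have [i1 e1] := hK _ _ h1 h2 h3.
have md : measurable_fun setT (fun w => del N j i w).
  apply: measurable_funB; apply: (process_meas i pX); by rewrite ?h1 ?h3 ?(le_trans h1 h2) ?(le_trans h2 h3).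
have le1 w : del N j i w ^+ 2 <= nsq (X (tau N j.+1) w - X (tau N j) w).
  by apply: le_trans (nsq_coord _ i); rewrite !mxE.
have i2 : itg P setT (fun w => del N j i w ^+ 2).
  by apply: (itg_sqr_le mT _ i1).
split; first by split.
apply: le_trans (E_le mT i2 i1 (fun w _ => le1 w)) _; apply: le_trans e1 _.
by rewrite grid_step ler_wpM2r // ler_norm.
Qed.

Lemma drift_int_sq : exists K, 0 <= K /\ forall a b i, t <= a -> a <= b -> b <= T ->
  L2 P setT (fun w => I[a, b] (drift X i ^~ w)) /\
  E[fun w => I[a, b] (drift X i ^~ w) ^+ 2] <= K * (b - a) ^+ 2.
Proof.
have [K hK] := nsol_moment sX; have [pX _ _] := sX; have [L0 _ _ _ _] := coefs.
exists `|2 * L * (1 + K)|; split=> // a b i ta ab bT.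
have [a1 c1] := drift_process i pX.
have aT : t <= b <= T by rewrite bT (le_trans ta).
have inT u : a <= u <= b -> t <= u <= T by move=> /andP[h1 h2]; rewrite (le_trans ta h1) (le_trans h2).
pose hh u w := 2 * L * (1 + nsq (X u w)).
have [ah ch] : adapted hh /\ cpath hh.
  apply: (process_comp (F := fun z => 2 * L * (1 + nsq z.2)) pX) => z.
  apply: cvgM; first exact: cvg_cst.
  by apply: cvgD; [exact: cvg_cst|exact: continuous_nsq].
have hh0 u w : 0 <= hh u w by rewrite !mulr_ge0 // addr_ge0 // nsq_ge0.
have hE u : a <= u <= b -> itg P setT (hh u) /\ E[hh u] <= 2 * L * (1 + K).
  move=> /inT /hK [i1 e1]; have i2 := itgD mT (itg_cst 1) i1.
  split; first exact: (itgZ mT).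
  by rewrite (EZ mT _ i2) (ED mT (itg_cst 1) i1) E_cst ler_wpM2l ?mulr_ge0 // lerD2l.
have [_ iI eI Jh _] := band_proc ta ab bT ah ch (fun u w _ => hh0 u w) hE.
have mI : measurable_fun setT (fun w => I[a, b] (drift X i ^~ w)).
  exact: (fmeas_measurable HB aT (int_fmeas a1 c1 ta ab bT)).
have iB := itgZ mT (b - a) iI.
have le1 w : I[a, b] (drift X i ^~ w) ^+ 2 <= (b - a) * I[a, b] (hh ^~ w).
  have J1 := cpath_itg (D := drift X i) w c1 ta bT; have J2 := cpath_itg (D := hh) w ch ta bT.
  have J3 : itg leb `[a, b]%classic (fun u => drift X i u w ^+ 2).
    by apply: (itg_sqr_le (mcci a b) (itg_meas J1) J2) => u _; exact: bt_growth.
  apply: le_trans (ci_CS ab (conj (itg_meas J1) J3)) _; apply: ler_wpM2l; first by rewrite subr_ge0.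
  by apply: (ci_le J3 J2) => u _; exact: bt_growth.
have i2 : itg P setT (fun w => I[a, b] (drift X i ^~ w) ^+ 2).
  by apply: (itg_sqr_le mT _ iB).
split; first by split.
apply: le_trans (E_le mT i2 iB (fun w _ => le1 w)) _.
rewrite (EZ mT _ iI) eI expr2 mulrCA; apply: ler_wpM2l; first by rewrite subr_ge0.
have [Jc ec] := ci_cst `|2 * L * (1 + K)| ab; rewrite -ec.
by apply: (ci_le Jh Jc) => u /hE [_ e]; apply: le_trans e (ler_norm _).
Qed.

Local Notation dev N j i := E[fun w => (del N j i w - rho N j i w) ^+ 2].
Local Notation gap N j i k w := (del N j i w * del N j k w - rho N j i w * rho N j k w).

(** The drift contributes O(h^2) in mean square per cell, hence O(h) in total; the error of freezing
    the diffusion is the one of [step_L2], through the isometry. *)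
Lemma deviation_cvg i : (forall N j, (j < N.+1)%N -> itg P setT (fun w => (del N j i w - rho N j i w) ^+ 2)) /\
  (fun N => \sum_(j < N.+1) dev N j i) @ \oo --> 0.
Proof.
have [Kd [Kd0 hKd]] := del_L2; have [Ki [Ki0 hKi]] := drift_int_sq.
have [L0 [_ cs] _ Hs [_ sgL]] := coefs; have [_ _ iX] := sX.
have bF l (u : R) (y : 'cV[R]_n) : sg u y i l ^+ 2 <= L * (1 + nsq y).
  by apply: le_trans (sgL u y i l) _; rewrite ler_peMr // lerDl; exact: nsq_ge0.
have {}hF l : (fun N => \sum_(j < N.+1) Rintegral lm (band (tau N j) (tau N j.+1))
      (fun z => (sg z.1 (X z.1 z.2) i l - sgj N j i l z.2) ^+ 2)) @ \oo --> 0.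
  by have [_ e] := step_L2 (F := fun z => sg z.1 z.2 i l) (C := L) (cs i l) L0 (fun u y z => Hs u y z i l) (bF l); exact: e.
pose nz N j w := del N j i w - I[tau N j, tau N j.+1] (drift X i ^~ w).
have inz N j : (j < N.+1)%N -> isint (tau N j) (tau N j.+1) (fun l z => sg z.1 (X z.1 z.2) i l + - sgj N j i l z.2)
    (fun w => nz N j w + - rho N j i w).
  move=> jN; have [h1 h2 h3 _ _] := step_T jN.
  by apply: isintD; [exact: iX|apply: isintN; exact: rho_isint].
have iL N j (jN : (j < N.+1)%N) := L2B mT (hKd N j i jN).1 (rho_L2 i jN).1.
split; first by move=> N j jN; exact: (iL N j jN).2.
have lim : (fun N => 2 * (Ki * (s - r) * h N) + 2 * \sum_l (\sum_(j < N.+1) Rintegral lm (band (tau N j) (tau N j.+1))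
      (fun z => (sg z.1 (X z.1 z.2) i l - sgj N j i l z.2) ^+ 2))) @ \oo --> 0.
  rewrite -[X in _ --> X](addr0 0); apply: cvgD.
    apply: cvgMl0.
    apply: cvgMl0; exact: (mesh_cvg r s).
  apply: cvgMl0.
  by apply: cvg_sum0 => l; exact: hF.
apply: squeeze_cvgr _ (cvg_cst 0) lim; apply: nearW => N; apply/andP; split.
  by apply: sumr_ge0 => j _; apply: E_ge0 => w _; exact: sqr_ge0.
have -> : 2 * (Ki * (s - r) * h N) = \sum_(j < N.+1) 2 * (Ki * h N ^+ 2).
  by rewrite sumr_const card_ord -[RHS]mulr_natl; field; rewrite nat1r pnatr_eq0.
rewrite exchange_big mulr_sumr -big_split /=; apply: ler_sum => j _; have jN := ltn_ord j.
have [h1 h2 h3 _ _] := step_T jN; have [L1 e1] := hKi _ _ i h1 h2 h3.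
have [L3 _] := isint_L2 (inz N j jN).
have e3 := isint_norm HB h1 h3 (inz N j jN).
rewrite -e3; have ib := itgD mT (itgZ mT 2 L1.2) (itgZ mT 2 L3.2).
apply: (@le_trans _ _ (E[fun w => 2 * I[tau N j, tau N j.+1] (drift X i ^~ w) ^+ 2 + 2 * (nz N j w + - rho N j i w) ^+ 2])).
  apply: (E_le mT (iL N j jN).2 ib) => w _; rewrite /nz.
  set a := X _ w i 0; set b := X _ w i 0; set c := I[_, _] _; set e := rho N j i w.
  have := sqr_ge0 (c - (a - b - c - e)); nra.
rewrite (ED mT (itgZ mT 2 L1.2) (itgZ mT 2 L3.2)) (EZ mT _ L1.2) (EZ mT _ L3.2).
by rewrite lerD2r ler_wpM2l // -(grid_step r s N j).
Qed.

(** a b - a' b' = (a - a') b + a' (b - b'), and Young's inequality with a parameter c splits each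
    product: the deviations carry 1/c and sum to 0, the other squares carry c and have a bounded sum
    [M]. Letting the mesh go to 0 first, c can then be as small as desired. *)
Lemma product_cvg i k : (forall N j, (j < N.+1)%N ->
    itg P setT (fun w => `|gap N j i k w|)) /\
  (fun N => \sum_(j < N.+1) E[fun w => `|gap N j i k w|]) @ \oo --> 0.
Proof.
have [Kd [Kd0 hKd]] := del_L2; have [di ci] := deviation_cvg i; have [dk ck] := deviation_cvg k.
have L0 := L_ge0.
have iP N j (jN : (j < N.+1)%N) : itg P setT (fun w => `|gap N j i k w|).
  apply: itg_abs; apply: (itgB mT); apply: (itgM mT).
  - exact: (hKd N j i jN).1.
  - exact: (hKd N j k jN).1.
  - exact: (rho_L2 i jN).1.
  - exact: (rho_L2 k jN).1.
split; first exact: iP.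
pose M := (Kd + d%:R * L) * (s - r).
have M0 : 0 <= M by rewrite mulr_ge0 ?subr_ge0 // addr_ge0 // mulr_ge0.
have key N c : 0 < c -> \sum_(j < N.+1) E[fun w => `|gap N j i k w|] <=
   c^-1 * (\sum_(j < N.+1) dev N j i +
           \sum_(j < N.+1) dev N j k) + c * M.
  move=> c0; rewrite /M -(mesh_sum r s N) -big_split /= !mulr_sumr -big_split /=; apply: ler_sum => j _.
  have jN := ltn_ord j; have [Ld ed] := hKd N j k jN; have [Lr er] := rho_L2 i jN.
  have i1 := itgZ mT c^-1 (itgD mT (di N j jN) (dk N j jN)).
  have i2 := itgZ mT c (itgD mT Ld.2 Lr.2).
  apply: (@le_trans _ _ E[fun w => c^-1 * ((del N j i w - rho N j i w) ^+ 2 + (del N j k w - rho N j k w) ^+ 2) +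
      c * (del N j k w ^+ 2 + rho N j i w ^+ 2)]).
    apply: (E_le mT (iP N j jN) (itgD mT i1 i2)) => w _.
    set a := X _ w i 0 - _; set b := X _ w k 0 - _; set a' := rho N j i w; set b' := rho N j k w.
    have -> : a * b - a' * b' = (a - a') * b + a' * (b - b') by ring.
    apply: le_trans (ler_normD _ _) _; rewrite !normrM.
    have am (p q : R) : `|p| * `|q| <= c^-1 * p ^+ 2 + c * q ^+ 2.
      rewrite -[p ^+ 2]real_normK ?num_real // -[q ^+ 2]real_normK ?num_real //.
      set u := `|p|; set v := `|q|; have u0 : 0 <= u := normr_ge0 p; have v0 : 0 <= v := normr_ge0 q.
      have ci0 : 0 < c^-1 by rewrite invr_gt0.
      have := mulr_ge0 (ltW ci0) (sqr_ge0 (u - c * v)).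
      have -> : c^-1 * (u - c * v) ^+ 2 = c^-1 * u ^+ 2 + c * v ^+ 2 - 2 * (u * v) by field; rewrite gt_eqF.
      have := mulr_ge0 u0 v0; have := mulr_ge0 (ltW ci0) (sqr_ge0 u); have := mulr_ge0 (ltW c0) (sqr_ge0 v); lra.
    have h1 := am (a - a') b; have h2 := am (b - b') a'; rewrite [`|a'| * _]mulrC; lra.
  rewrite (ED mT i1 i2) (EZ mT _ (itgD mT (di N j jN) (dk N j jN))) (EZ mT _ (itgD mT Ld.2 Lr.2)).
  rewrite (ED mT (di N j jN) (dk N j jN)) (ED mT Ld.2 Lr.2) lerD2l; apply: ler_wpM2l; first exact: ltW.
  by rewrite mulrDl; exact: lerD.
apply/cvgrPdist_le => e e0.
(* Makes the part that does not vanish with the mesh at most e/2. *)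
pose c := e / 2 / (M + 1).
have c0 : 0 < c by rewrite !divr_gt0 // ltr_wpDl.
have cM : c * M <= e / 2.
  by rewrite /c -mulrA ler_piMr ?divr_ge0 ?(ltW e0) // mulrC ler_pdivrMr ?ltr_wpDl // mul1r lerDl.
have lim : (fun N => c^-1 * (\sum_(j < N.+1) dev N j i +
           \sum_(j < N.+1) dev N j k)) @ \oo --> 0.
  apply: cvgMl0.
  by rewrite -[X in _ --> X](addr0 0); apply: cvgD.
have e2 : 0 < e / 2 by rewrite divr_gt0.
have := cvg0_le lim e2; apply: filterS => N /=; rewrite sub0r normrN => hN.
rewrite ger0_norm; last by apply: sumr_ge0 => j _; apply: E_ge0.
apply: le_trans (key N c c0) _; have := ler_norm (c^-1 * (\sum_(j < N.+1) dev N j i +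
           \sum_(j < N.+1) dev N j k)); lra.
Qed.

(* orthogonality of the centred products of Brownian increments *)
Lemma centred_sum_L2 N l m (xi : nat -> Omega B -> R) K J : (J <= N.+1)%N -> 0 <= K ->
  (forall j, (j < N.+1)%N -> fmeas (tau N j) (xi j)) -> (forall j w, `|xi j w| <= K) ->
  let V j w := dW (tau N j) (tau N j.+1) l w * dW (tau N j) (tau N j.+1) m w - (l == m)%:R * h N in
  L2F (tau N J) (fun w => \sum_(j < J) xi j w * V j w) /\
  E[fun w => (\sum_(j < J) xi j w * V j w) ^+ 2] <= J%:R * (2 * h N ^+ 2 * K ^+ 2).
Proof.
move=> JN K0 mxi bxi V; elim: J JN => [|J IH] JN.
  split; last by under E_eq do rewrite big_ord0 expr0n; rewrite E_cst mul0r.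
  rewrite (_ : (fun w => _) = fun=> 0); last by apply/funext => w; rewrite big_ord0.
  by split; [exact: measurable_cst|exact: (L2_0 _ mT)].
have [[mS LS] eS] := IH (ltnW JN); have [h1 h2 h3 _ _] := step_T JN.
have JT : t <= tau N J <= T by rewrite h1 (le_trans h2).
have xi2 w : xi J w ^+ 2 <= K ^+ 2.
  by rewrite -[leLHS]real_normK ?num_real // ler_pXn2r ?nnegrE.
have mx2 : fmeas (tau N J) (fun w => xi J w ^+ 2) by apply: measurable_funX; exact: mxi.
have ix2 : itg P setT (fun w => xi J w ^+ 2).
  apply: (itg_le mT _ (itg_cst (K ^+ 2))); first exact: (fmeas_measurable HB JT mx2).
  by move=> w _; rewrite ger0_norm ?sqr_ge0.
have [iq eq] := dW_quartic HB h1 h2 h3 mx2 ix2 l m; rewrite !(grid_step r s N J) in iq eq.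
have mV : fmeas (tau N J.+1) (V J).
  apply: measurable_funB; last exact: measurable_cst.
  by apply: measurable_funM; apply: fmeas_dW; rewrite ?h1 ?h2 ?lexx ?(le_trans h1 h2).
have mxV : fmeas (tau N J.+1) (fun w => xi J w * V J w).
  by apply: measurable_funM => //; exact: fmeas_mono h2 (mxi J JN).
have J1T : t <= tau N J.+1 <= T by rewrite h3 (le_trans h1).
have LxV : L2 P setT (fun w => xi J w * V J w).
  split; first exact: (fmeas_measurable HB J1T mxV).
  by apply: (itg_eq mT) iq => w _; rewrite exprMn.
have EV : E[fun w => (xi J w * V J w) ^+ 2] <= 2 * h N ^+ 2 * K ^+ 2.
  have -> : E[fun w => (xi J w * V J w) ^+ 2] = (1 + (l == m)%:R) * h N ^+ 2 * E[fun w => xi J w ^+ 2].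
    by rewrite -eq; apply: E_eq => w _; rewrite exprMn.
  apply: ler_pM.
  - by rewrite mulr_ge0 ?sqr_ge0 // addr_ge0 // ler0n.
  - by apply: E_ge0 => w _; exact: sqr_ge0.
  - by rewrite ler_wpM2r ?sqr_ge0 //; case: (l == m); rewrite ?addr0 // ler1n.
  - by rewrite -[leRHS](E_cst); apply: (E_le mT) => //; exact: itg_cst.
have SE w : \sum_(j < J.+1) xi j w * V j w = \sum_(j < J) xi j w * V j w + xi J w * V J w by rewrite big_ord_recr.
have cross : E[fun w => (\sum_(j < J) xi j w * V j w) * (xi J w * V J w)] = 0.
  have me : fmeas (tau N J) (fun w => (\sum_(j < J) xi j w * V j w) * xi J w).
    by apply: measurable_funM => //; exact: mxi.
  have Lxi : L2 P setT (xi J) by split => //; exact: (fmeas_measurable HB JT (mxi J JN)).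
  have ie := itgM mT LS Lxi.
  have [i1 e1] := dW_cov HB h1 h2 h3 me ie l m; rewrite (grid_step r s N J) in e1.
  have i2 := itgZ mT ((l == m)%:R * h N) ie.
  transitivity (E[fun w => (\sum_(j < J) xi j w * V j w) * xi J w * (dW (tau N J) (tau N J.+1) l w * dW (tau N J) (tau N J.+1) m w)
     - (l == m)%:R * h N * ((\sum_(j < J) xi j w * V j w) * xi J w)]).
    by apply: E_eq => w _; rewrite {2}/V; ring.
  by rewrite (EB mT i1 i2) (EZ mT _ ie) e1 subrr.
have fS : (fun w => \sum_(j < J.+1) xi j w * V j w) = fun w => \sum_(j < J) xi j w * V j w + xi J w * V J w.
  by apply/funext => w; rewrite SE.
split.
  rewrite fS; split; last exact: (L2D mT).
  by apply: measurable_funD => //; exact: fmeas_mono h2 mS.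
have ic := itgM mT LS LxV; have ic2 := itgZ mT 2 ic.
have iS := LS.2.
have -> : E[fun w => (\sum_(j < J.+1) xi j w * V j w) ^+ 2] =
   E[fun w => (\sum_(j < J) xi j w * V j w) ^+ 2 + 2 * ((\sum_(j < J) xi j w * V j w) * (xi J w * V J w)) + (xi J w * V J w) ^+ 2].
  by apply: E_eq => w _; rewrite SE sqrrD -mulr_natl.
rewrite (ED mT (itgD mT iS ic2) LxV.2) (ED mT iS ic2) (EZ mT _ ic) cross mulr0 addr0.
by rewrite -natr1 mulrDl mul1r; exact: lerD.
Qed.

Local Notation bra N j i k w := (\sum_l sgj N j i l w * sgj N j k l w).

(** Expanding [rho] over pairs of Brownian coordinates gives d^2 sums of centred products, each with
    second moment O(h) by [centred_sum_L2]; on a probability space the L1 norm is at most the L2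
    norm. *)
Lemma bracket_sum (N : nat) i k (H : nat -> Omega B -> R) K : 0 <= K ->
  (forall j, (j < N.+1)%N -> fmeas (tau N j) (H j)) -> (forall j w, `|H j w| <= K) ->
  let Sum w := \sum_(j < N.+1) H j w * (rho N j i w * rho N j k w - bra N j i k w * h N) in
  itg P setT (fun w => `|Sum w|) /\
  E[fun w => `|Sum w|] <= d%:R ^+ 2 * Num.sqrt (2 * (s - r) * (K * L) ^+ 2 * h N).
Proof.
move=> K0 mH bH Sum; have L0 := L_ge0; have [_ _ _ _ [_ sgL]] := coefs.
pose xi l m j w := if (j < N.+1)%N then H j w * (sgj N j i l w * sgj N j k m w) else 0.
have bxi l m j w : `|xi l m j w| <= K * L.
  rewrite /xi; case: ifP => _; last by rewrite normr0 mulr_ge0.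
  rewrite normrM; apply: ler_pM => //; rewrite normrM.
  have := sgL (tau N j) (X (tau N j) w) i l; have := sgL (tau N j) (X (tau N j) w) k m.
  set a := sg _ _ i l; set b := sg _ _ k m.
  have := sqr_ge0 (`|a| - `|b|); rewrite -[a ^+ 2]real_normK ?num_real // -[b ^+ 2]real_normK ?num_real //; nra.
have mxi l m j : (j < N.+1)%N -> fmeas (tau N j) (xi l m j).
  move=> jN; rewrite /xi jN; apply: measurable_funM; first exact: mH.
  by apply: measurable_funM; [have [] := sgj_L2F i l jN|have [] := sgj_L2F k m jN].
pose V l m w := \sum_(j < N.+1) xi l m j w *
  (dW (tau N j) (tau N j.+1) l w * dW (tau N j) (tau N j.+1) m w - (l == m)%:R * h N).
have SE w : Sum w = \sum_(l < d) \sum_(m < d) V l m w.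
  rewrite /Sum /V.
  under [RHS]eq_bigr => l _ do rewrite exchange_big /=.
  rewrite [RHS]exchange_big /=; apply: eq_bigr => j _.
  rewrite /rho big_distrlr /= mulr_suml -sumrB mulr_sumr; apply: eq_bigr => l _.
  rewrite (_ : sgj N j i l w * sgj N j k l w * h N = \sum_m (l == m)%:R * (sgj N j i l w * sgj N j k m w * h N)).
    by rewrite -sumrB mulr_sumr; apply: eq_bigr => m _; rewrite /xi ltn_ord; ring.
  by rewrite (bigD1 l) //= eqxx mul1r big1 ?addr0 // => m ml; rewrite eq_sym (negbTE ml) mul0r.
have c l m := centred_sum_L2 l m (leqnn N.+1) (mulr_ge0 K0 L0) (mxi l m) (bxi l m).
have L2V l m : L2 P setT (V l m).
  have [[_ L1] _] := c l m; exact: L1.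
have iS : itg P setT Sum.
  rewrite (_ : Sum = fun w => \sum_(l < d) \sum_(m < d) V l m w); last by apply/funext.
  do 2 (apply: (itg_sum mT) => ?); exact: L2_itgP.
split; first exact: itg_abs.
have iV l m : itg P setT (fun w => `|V l m w|) by apply: itg_abs; exact: L2_itgP.
have iVV l : itg P setT (fun w => \sum_(m < d) `|V l m w|) by apply: (itg_sum mT).
apply: (@le_trans _ _ E[fun w => \sum_(l < d) \sum_(m < d) `|V l m w|]).
  apply: (E_le mT); [exact: itg_abs|exact: (itg_sum mT)|].
  move=> w _; rewrite SE; apply: le_trans (ler_norm_sum _ _ _) _; apply: ler_sum => l _.
  exact: ler_norm_sum.
rewrite (E_sum mT) //; under eq_bigr => l _ do rewrite (E_sum mT) //.
rewrite (_ : d%:R ^+ 2 * _ = \sum_(l < d) \sum_(m < d) Num.sqrt (2 * (s - r) * (K * L) ^+ 2 * h N)); last first.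
  under eq_bigr => l _ do rewrite sumr_const card_ord.
  by rewrite sumr_const card_ord -mulrnA -[RHS]mulr_natl natrM expr2.
apply: ler_sum => l _; apply: ler_sum => m _; apply: le_trans (E_abs_nrm (L2V l m)) _.
rewrite /nrm ler_wsqrtr //; have [_ e] := c l m; apply: le_trans e _.
by apply: ler_eq; field; rewrite nat1r pnatr_eq0.
Qed.

(** The weights [H] are continuous but not bounded, so they are truncated at a level that grows
    along the subsequence. A single error [F] collects all weights and coordinates, so one
    subsequence and one null set serve for every [a], [i], [k]. *)
Lemma quadratic_variation (A : finType) (H : A -> R -> Omega B -> R) :
  (forall a, adapted (H a)) -> (forall a, cpath (H a)) ->
  exists phi : nat -> nat, (forall q, (q <= phi q)%N) /\
    {ae P, forall w a i k,
      (fun q => \sum_(j < (phi q).+1) H a (tau (phi q) j) w * (del (phi q) j i w * del (phi q) j k w)) @ \oo -->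
      I[r, s] (fun u => H a u w * \sum_l sg u (X u w) i l * sg u (X u w) k l)}.
Proof.
move=> aH cH; have [pX _ _] := sX; have L0 := L_ge0.
pose D N i k w := \sum_(j < N.+1) `|gap N j i k w|.
pose Hc (K : nat) a u w := clp (- K%:R) K%:R (H a u w).
pose M N K a i k w := \sum_(j < N.+1) Hc K a (tau N j) w * (rho N j i w * rho N j k w - bra N j i k w * h N).
have jT N j : (j < N.+1)%N -> t <= tau N j <= T.
  by move=> /step_T [h1 h2 h3 _ _]; rewrite h1 (le_trans h2).
have bHc K a u w : `|Hc K a u w| <= K%:R by rewrite ler_norml; apply: clp_in; rewrite -subr_ge0 opprK addr_ge0.
have hM N K a i k : itg P setT (fun w => `|M N K a i k w|) /\
    E[fun w => `|M N K a i k w|] <= d%:R ^+ 2 * Num.sqrt (2 * (s - r) * (K%:R * L) ^+ 2 * h N).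
  apply: (bracket_sum i k (H := fun j => Hc K a (tau N j))) => // j jN.
  have := aH a _ (jT N j jN) => m1.
  apply: measurableT_comp m1; apply: continuous_measurable_fun; exact: clp_continuous.
have iD N i k : itg P setT (D N i k).
  by apply: (itg_sum mT) => j; exact: (product_cvg i k).1.
pose F K N w := \sum_(i < n) \sum_(k < n) (D N i k w + \sum_(a : A) `|M N K a i k w|).
have iF K N : itg P setT (F K N).
  do 2 (apply: (itg_sum mT) => ?); apply: (itgD mT) => //.
  by apply: (itg_sum mT) => a; exact: (hM _ _ _ _ _).1.
have F0 K N w : 0 <= F K N w.
  apply: sumr_ge0 => i _; apply: sumr_ge0 => k _; apply: addr_ge0; apply: sumr_ge0 => //.
have EF K : (fun N => E[F K N]) @ \oo --> 0.
  have lim : (fun N => \sum_(i < n) \sum_(k < n)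
     (\sum_(j < N.+1) E[fun w => `|gap N j i k w|] +
      \sum_(a : A) d%:R ^+ 2 * Num.sqrt (2 * (s - r) * (K%:R * L) ^+ 2 * h N))) @ \oo --> 0.
    have e0 : \sum_(i < n) \sum_(k < n) (0 + \sum_(a : A) 0) = 0 :> R.
      by rewrite big1 // => i _; rewrite big1 // => k _; rewrite big1 ?addr0.
    rewrite -[X in _ --> X]e0; apply: cvg_sumF => i; apply: cvg_sumF => k; apply: cvgD.
      exact: (product_cvg i k).2.
    apply: cvg_sumF => a; apply: cvgMl0.
    apply: cvg_sqrt0; rewrite -[X in _ --> X](mulr0 (2 * (s - r) * (K%:R * L) ^+ 2)).
    by apply: cvgM; [exact: cvg_cst|exact: (mesh_cvg r s)].
  apply: squeeze_cvgr _ (cvg_cst 0) lim; apply: nearW => N; apply/andP; split.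
    by apply: E_ge0 => w _; exact: F0.
  have iA i k : itg P setT (fun w => \sum_(a : A) `|M N K a i k w|).
    by apply: (itg_sum mT) => a; exact: (hM _ _ _ _ _).1.
  have i1 i k : itg P setT (fun w => D N i k w + \sum_(a : A) `|M N K a i k w|).
    exact: (itgD mT).
  have i2 i : itg P setT (fun w => \sum_(k < n) (D N i k w + \sum_(a : A) `|M N K a i k w|)).
    exact: (itg_sum mT).
  rewrite (E_sum mT) //; apply: ler_sum => i _; rewrite (E_sum mT) //; apply: ler_sum => k _.
  rewrite (ED mT) // lerD //.
    by rewrite (E_sum mT) // => j; exact: (product_cvg i k).1.
  rewrite (E_sum mT); last by move=> a; exact: (hM _ _ _ _ _).1.
  by apply: ler_sum => a _; exact: (hM _ _ _ _ _).2.
(* Truncation level and mesh are tied together: the mesh is chosen so fine that the error at level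
   [q] is below 2^-q, as [fast_ae] wants. *)
have ph q : {N : nat | (q <= N)%N /\ E[F q N] <= 2^-1 ^+ q}.
  apply: cid; have e0 : 0 < 2^-1 ^+ q :> R by rewrite exprn_gt0 ?invr_gt0.
  have /cvgrPdist_le /(_ _ e0) [N0 _ hN] := EF q.
  exists (maxn q N0); split; first exact: leq_maxl.
  have := hN (maxn q N0) (leq_maxr _ _); rewrite /= sub0r normrN; exact: le_trans (ler_norm _).
pose phi q := sval (ph q).
have phiq q : (q <= phi q)%N := (svalP (ph q)).1.
exists phi; split => //.
have := fast_ae mT (fun q => iF q (phi q)) (fun q w _ => F0 q (phi q) w) (fun q => (svalP (ph q)).2).
apply: filterS => w /(_ Logic.I) Fw a i k.
(* A continuous path of [H a] is bounded on [r, s], so on each path the truncation is inactive for q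
   >= Kw. *)
have [Kw Kw0 hKw] : exists2 Kw : R, 0 <= Kw & forall u, r <= u <= s -> `|H a u w| <= Kw.
  have c1 : {within `[r, s], continuous (fun u => `|H a u w|)}.
    move=> u; apply: cvg_norm; exact: (cpath_sub (cH a) tr sT).
  have [c _ hc] := EVT_max rs c1; exists `|H a c w| => // u uI; apply: hc; by rewrite in_itv.
have jI N j : (j < N.+1)%N -> r <= tau N j <= s.
  by move=> /step_T [_ h2 _ h4 h5]; rewrite h4 (le_trans h2).
pose G u := H a u w * \sum_l sg u (X u w) i l * sg u (X u w) k l.
have cG : {within `[r, s], continuous G}.
  move=> u; apply: cvgM; first exact: (cpath_sub (cH a) tr sT).
  apply: cvg_sumF => l; have [_ c1] := sigma_process i l pX; have [_ c2] := sigma_process k l pX.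
  by apply: cvgM; [exact: (cpath_sub c1 tr sT)|exact: (cpath_sub c2 tr sT)].
have phioo := cvg_subseq phiq.
have rc := cvg_comp _ _ phioo (riemann_cvg rs cG).
apply/cvgrPdist_le => e e0.
have e2 : 0 < e / 2 by rewrite divr_gt0.
have e3 : 0 < e / 2 / (Kw + 1) by rewrite divr_gt0 // ltr_wpDl.
move/cvgrPdist_le: rc => /(_ _ e2) rc; move/cvgrPdist_le: Fw => /(_ _ e3) Fw.
have Kq : \forall q \near \oo, Kw <= q%:R.
  exists (Num.truncn Kw).+1 => // q /= hq; apply: ltW; apply: lt_le_trans (truncnS_gt _) _; by rewrite ler_nat.
near=> q.
have Kq' : Kw <= q%:R by near: q.
have rq : `|I[r, s] G - \sum_(j < (phi q).+1) G (tau (phi q) j) * h (phi q)| <= e / 2 by near: q; exact: rc.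
have Fq : F q (phi q) w <= e / 2 / (Kw + 1).
  by have : `|0 - F q (phi q) w| <= e / 2 / (Kw + 1); [near: q; exact: Fw|rewrite sub0r normrN ger0_norm].
set N := phi q in rq Fq *.
have DM : D N i k w + `|M N q a i k w| <= F q N w.
  rewrite /F (bigD1 i) //= (bigD1 k) //= (bigD1 a) //= -!addrA [X in _ <= X]addrA lerDl.
  repeat (apply: addr_ge0 || (apply: sumr_ge0 => ? _)) => //.
have HE j : (j < N.+1)%N -> Hc q a (tau N j) w = H a (tau N j) w.
  move=> /jI ji; apply: clp_id; rewrite -ler_norml; exact: le_trans (hKw _ ji) Kq'.
have eq1 : \sum_(j < N.+1) H a (tau N j) w * (del N j i w * del N j k w) =
   \sum_(j < N.+1) H a (tau N j) w * (gap N j i k w) + M N q a i k w +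
   \sum_(j < N.+1) G (tau N j) * h N.
  rewrite /M -!big_split /=; apply: eq_bigr => j _; rewrite HE // /G; ring.
rewrite eq1.
have b1 : `|\sum_(j < N.+1) H a (tau N j) w * (gap N j i k w)| <= Kw * D N i k w.
  apply: le_trans (ler_norm_sum _ _ _) _; rewrite mulr_sumr; apply: ler_sum => j _; rewrite normrM.
  by apply: ler_wpM2r => //; exact: hKw (jI _ _ (ltn_ord j)).
have D0 : 0 <= D N i k w by apply: sumr_ge0.
have : (Kw + 1) * F q N w <= e / 2 by rewrite mulrC -ler_pdivlMr // ltr_wpDl.
have : Kw * D N i k w + `|M N q a i k w| <= (Kw + 1) * F q N w.
  have m0 : 0 <= `|M N q a i k w| := normr_ge0 _.
  have : (Kw + 1) * (D N i k w + `|M N q a i k w|) <= (Kw + 1) * F q N w by rewrite ler_wpM2l // addr_ge0.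
  have := mulr_ge0 Kw0 m0; lra.
move: rq b1; set X1 := \sum_(j < N.+1) _; set X2 := \sum_(j < N.+1) _; set X3 := M _ _ _ _ _ _; set X4 := I[r, s] _.
move=> h1 h2 h3 h4; have -> : X4 - (X2 + X3 + X1) = (X4 - X1) + (- X2 + - X3) by ring.
apply: le_trans (ler_normD _ _) _; have := ler_normD (- X2) (- X3); rewrite !normrN; lra.
Unshelve. all: by end_near.
Qed.

Variables (u ut : R -> 'cV[R]_n -> R) (ux : 'I_n -> R -> 'cV[R]_n -> R) (uxx : 'I_n -> 'I_n -> R -> 'cV[R]_n -> R) (C : R).

Definition smooth_data :=
  [/\ [/\ continuous (fun z : R * 'cV[R]_n => u z.1 z.2), continuous (fun z : R * 'cV[R]_n => ut z.1 z.2),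
          forall i, continuous (fun z : R * 'cV[R]_n => ux i z.1 z.2)
        & forall i j, continuous (fun z : R * 'cV[R]_n => uxx i j z.1 z.2)],
      forall v i y, is_derive y (delta_mx i 0 : 'cV[R]_n) (u v) (ux i v y),
      forall v i j y, is_derive y (delta_mx j 0 : 'cV[R]_n) (ux i v) (uxx i j v y),
      forall y a b, t <= a -> a <= b -> b <= T -> exists2 c, a <= c <= b & u b y - u a y = ut c y * (b - a)
    & [/\ 0 <= C, forall i v y z, (ux i v y - ux i v z) ^+ 2 <= C * nsq (y - z)
        & forall i v y, ux i v y ^+ 2 <= C * (1 + nsq y)]].

Hypothesis smooth : smooth_data.

Local Notation uxj N j i w := (ux i (tau N j) (X (tau N j) w)).

Let incr N j i w := del N j i w - I[tau N j, tau N j.+1] (drift X i ^~ w).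

(** First-order Ito sums: gradients frozen at left ends, against increments freed from their drift.
    [Sum N] is exactly the stochastic integral of [step N], so no error arises in identifying it. *)
Let Sum N w := \sum_(j < N.+1) \sum_i uxj N j i w * incr N j i w.

Let step N l z := \sum_(j < N.+1) \sum_i
  cutoff (tau N j) (tau N j.+1) (fun z => uxj N j i z.2 * sg z.1 (X z.1 z.2) i l) z.

Let uxj_L2F N j i : (j < N.+1)%N -> L2F (tau N j) (fun w => uxj N j i w).
Proof.
move=> jN; have [h1 h2 h3 _ _] := step_T jN; have [pX _ _] := sX.
have [[_ _ cux _] _ _ _ [C0 _ gr]] := smooth.
have jT : t <= tau N j <= T by rewrite h1 (le_trans h2).
have [aF _] := process_comp pX (cux i); have m1 := aF _ jT.
have [K hK] := nsol_moment sX; have [i1 _] := hK _ jT.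
split=> //; have m2 := fmeas_measurable HB jT m1; split=> //.
apply: (itg_sqr_le mT _ (itgZ mT C (itgD mT (itg_cst 1) i1))) => // w _; exact: gr.
Qed.

Let S_isint N : isint r s (step N) (Sum N).
Proof.
apply: isint_sum => j; apply: isint_sum => i; have jN := ltn_ord j; have [h1 h2 h3 h4 h5] := step_T jN.
have [_ _ _ _ [_ sgL]] := coefs; have [_ _ iX] := sX.
apply: (isint_extend h4 h5).
by apply: (isint_mul h1 h2 h3 (iX i _ _ h1 h2 h3) (uxj_L2F i jN)) => l z _; exact: sgL.
Qed.

Let zeta l (z : R * Omega B) := \sum_i ux i z.1 (X z.1 z.2) * sg z.1 (X z.1 z.2) i l.

Let zeta_meas l : mband (zeta l) r s.
Proof.
have [pX _ _] := sX; have [[_ _ cux _] _ _ _ _] := smooth; have [_ [_ cs] _ _ _] := coefs.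
have [a c] : adapted (fun v w => zeta l (v, w)) /\ cpath (fun v w => zeta l (v, w)).
  apply: (process_comp (F := fun z => \sum_i ux i z.1 z.2 * sg z.1 z.2 i l) pX) => z.
  by apply: cvg_sumF => i; apply: cvgM; [exact: cux|exact: cs].
have := band_meas a c tr sT; congr (measurable_fun _ _); by apply/funext => -[].
Qed.

Let step_cvg l : L2cv lm (band r s) (fun N => step N l) (zeta l).
Proof.
have [[_ _ cux _] _ _ _ [C0 lip gr]] := smooth; have [L0 _ _ _ [_ sgL]] := coefs.
have hF i := step_L2 (F := fun z => ux i z.1 z.2) (C := C) (cux i) C0 (lip i) (gr i).
pose D i N j (z : R * Omega B) := (ux i z.1 (X z.1 z.2) - uxj N j i z.2) ^+ 2.
have iD i N j : (j < N.+1)%N -> itg lm (band (tau N j) (tau N j.+1)) (D i N j).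
  by move=> jN; exact: ((hF i).1 N j jN).
have cD i : (fun N => \sum_(j < N.+1) Rintegral lm (band (tau N j) (tau N j.+1)) (D i N j)) @ \oo --> 0.
  exact: (hF i).2.
pose V i N z := \sum_(j < N.+1) cutoff (tau N j) (tau N j.+1) (D i N j) z.
have hc i N (j : 'I_N.+1) : itg lm (band r s) (cutoff (tau N j) (tau N j.+1) (D i N j)) /\
    Rintegral lm (band r s) (cutoff (tau N j) (tau N j.+1) (D i N j)) = Rintegral lm (band (tau N j) (tau N j.+1)) (D i N j).
  by have [h1 h2 h3 h4 h5] := step_T (ltn_ord j); apply: cutoff_itg => //; exact: iD.
have iV i N : itg lm (band r s) (V i N) by apply: (itg_sum (mbd r s)) => j; exact: (hc i N j).1.
have eV i N : Rintegral lm (band r s) (V i N) = \sum_(j < N.+1) Rintegral lm (band (tau N j) (tau N j.+1)) (D i N j).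
  rewrite (E_sum (mbd r s)) => [|j]; last exact: (hc i N j).1.
  by apply: eq_bigr => j _; exact: (hc i N j).2.
have D0 i N j z : 0 <= cutoff (tau N j) (tau N j.+1) (D i N j) z.
  by rewrite /cutoff; case: ifP => // _; exact: sqr_ge0.
have le1 N z : band r s z -> (step N l z - zeta l z) ^+ 2 <= n%:R * L * \sum_i V i N z.
  move=> [/= + _]; rewrite in_itv /= => zrs.
  pose a j := \sum_i uxj N j i z.2 * sg z.1 (X z.1 z.2) i l.
  have V0 : 0 <= n%:R * L * \sum_i V i N z.
    by rewrite mulr_ge0 ?mulr_ge0 //; do 2 (apply: sumr_ge0 => ? _).
  have -> : step N l z = \sum_(j < N.+1) (tau N j < z.1 <= tau N j.+1)%R%:R * a j.
    apply: eq_bigr => j _; rewrite mulr_sumr; apply: eq_bigr => i _.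
    by rewrite /cutoff; case: ifP; rewrite ?mul1r ?mul0r.
  have := @grid_avg R r s N z.1 a (zeta l z) (Num.sqrt (n%:R * L * \sum_i V i N z)) rs zrs _.
  move=> /(_ _) hh; rewrite -[leLHS]real_normK ?num_real // -[leRHS](sqr_sqrtr V0).
  rewrite ler_pXn2r ?nnegrE ?sqrtr_ge0 //; apply: hh => j jN hj.
  rewrite -sqrtr_sqr ler_wsqrtr // /a /zeta -sumrB; apply: le_trans (sqr_sum_le _) _.
  rewrite -mulrA ler_wpM2l // mulr_sumr; apply: ler_sum => i _; rewrite -mulrBl exprMn mulrC.
  apply: ler_pM; rewrite ?sqr_ge0 //.
  rewrite /V (bigD1 (Ordinal jN)) //= {1}/cutoff hj /D -[leLHS]addr0 -sqrrN opprB lerD2l.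
  by apply: sumr_ge0 => k _; exact: D0.
have mS N : mband (fun z => step N l z - zeta l z) r s.
  by apply: measurable_funB; [exact: ((isint_L2 (S_isint N)).2 l).1|exact: zeta_meas].
have iB N : itg lm (band r s) (fun z => n%:R * L * \sum_i V i N z).
  by apply: (itgZ (mbd r s)); exact: (itg_sum (mbd r s)).
have iS N : itg lm (band r s) (fun z => (step N l z - zeta l z) ^+ 2).
  apply: (itg_sqr_le (mbd r s) _ (iB N)) => // z bz; exact: le1.
have LS N : L2 lm (band r s) (step N l) := (isint_L2 (S_isint N)).2 l.
split => //.
  have e z : step 0 l z - (step 0 l z - zeta l z) = zeta l z by ring.
  by apply: (L2_eq (mbd r s)) (L2B (mbd r s) (LS 0%N) (conj (mS 0%N) (iS 0%N))) => z _.
apply: cvg_sqrt0.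
have bound : (fun N => n%:R * L * \sum_i \sum_(j < N.+1) Rintegral lm (band (tau N j) (tau N j.+1)) (D i N j)) @ \oo --> 0.
  apply: cvgMl0.
  by apply: cvg_sum0 => i; exact: cD.
apply: squeeze_cvgr _ (cvg_cst 0) bound; apply: nearW => N; apply/andP; split.
  by apply: E_ge0 => z _; exact: sqr_ge0.
apply: le_trans (E_le (mbd r s) (iS N) (iB N) (le1 N)) _.
rewrite (EZ (mbd r s)); last exact: (itg_sum (mbd r s)).
by rewrite (E_sum (mbd r s)) // (eq_bigr _ (fun i _ => eV i N)).
Qed.

Let ito_integrand v w := ut v (X v w) + \sum_i ux i v (X v w) * drift X i v w +
  2^-1 * \sum_i \sum_k uxx i k v (X v w) * \sum_l sg v (X v w) i l * sg v (X v w) k l.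

(** The box condition, with a separate [th] for each coordinate, covers the intermediate points of
    [taylor2], whose coordinates are moved one at a time. *)
Definition tube N w (F : R -> 'cV[R]_n -> R) e := forall j, (j < N.+1)%N -> forall (v : R) (z : 'cV[R]_n), tau N j <= v <= tau N j.+1 ->
  (forall i, exists2 th, 0 <= th <= 1 & z i 0 = X (tau N j) w i 0 + th * del N j i w) ->
  `|F v z - F (tau N j) (X (tau N j) w)| <= e.

Lemma grid_tube w (F : R * 'cV[R]_n -> R) e : continuous F -> 0 < e ->
  \forall N \near \oo, tube N w (fun v z => F (v, z)) e.
Proof.
move=> cF e0; have [[_ cX] _ _] := sX.
pose Y v := X (clp t T v) w.
have cY i : continuous (fun v => Y v i 0) := within_clp tT (cX i w).
have cYv : continuous Y by move=> v; apply: cvg_col => i; exact: cY.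
have YE v : t <= v <= T -> Y v = X v w by move=> vT; rewrite /Y clp_id.
have [rho r0 hr] := @tube_modulus R n F Y r s e cF cYv e0.
have hY i : {dl : R | 0 < dl & forall a b, r <= a <= s -> `|a - b| < dl -> `|Y b i 0 - Y a i 0| < rho}.
  apply: cid2; have [|dl d0 hd] := @diagonal_modulus R (fun _ v => Y v i 0) r s rho _ r0.
    by move=> z; apply: (continuous_comp (g := fun v => Y v i 0)); [exact: cvg_snd|exact: cY].
  by exists dl.
have nd : \forall N \near \oo, forall i : 'I_n, h N < s2val (hY i).
  apply: filter_forall => i; have d0 := s2valP (hY i); set dl := s2val _ in d0 *.
  by have := cvg0_lt (mesh_cvg r s) d0; apply: filterS => N /=; exact: le_lt_trans (ler_norm _).
have nr : \forall N \near \oo, h N < rho.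
  by have := cvg0_lt (mesh_cvg r s) r0; apply: filterS => N /=; exact: le_lt_trans (ler_norm _).
near=> N => j jN v z /andP[v1 v2] hz; have [h1 h2 h3 h4 h5] := step_T jN.
have hN : h N < rho by near: N.
have hd i : h N < s2val (hY i) by move: i; near: N.
have aI : r <= tau N j <= s by rewrite h4 (le_trans h2 h5).
have ja : t <= tau N j <= T by rewrite h1 (le_trans h2 h3).
have jb : t <= tau N j.+1 <= T by rewrite h3 (le_trans h1 h2).
have hj : tau N j.+1 - tau N j = h N by rewrite grid_step.
rewrite -(YE _ ja); apply: ltW; apply: hr => //.
  by rewrite distrC ger0_norm ?subr_ge0 //; apply: le_lt_trans hN; rewrite -hj lerD2r.
move=> i; have [th /andP[t0 t1] ->] := hz i.
have := s2valP' (hY i) (tau N j) (tau N j.+1) aI.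
rewrite distrC ger0_norm ?subr_ge0 // hj => /(_ (hd i)).
rewrite !YE // opprD addNKr normrN normrM (ger0_norm t0); apply: le_lt_trans.
by rewrite ler_piMl.
Unshelve. all: by end_near.
Qed.

(** A deterministic statement about one path. The index [Some (i, k)] supplies the second-order
    sums; [None], with weight 1, supplies sums of squared increments, whose convergence keeps them
    bounded and makes the Taylor remainder negligible. *)
Lemma ito_pathwise w (phi : nat -> nat) : (forall q, (q <= phi q)%N) ->
  (forall (a : option ('I_n * 'I_n)) i k,
    (fun q => \sum_(j < (phi q).+1) (if a is Some p then uxx p.1 p.2 (tau (phi q) j) (X (tau (phi q) j) w) else 1) *
      (del (phi q) j i w * del (phi q) j k w)) @ \oo -->
      I[r, s] (fun v => (if a is Some p then uxx p.1 p.2 v (X v w) else 1) * \sum_l sg v (X v w) i l * sg v (X v w) k l)) ->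
  (fun q => Sum (phi q) w) @ \oo --> u s (X s w) - u r (X r w) - I[r, s] (ito_integrand ^~ w).
Proof.
move=> phiq qv; have [[cu cut cux cuxx] du dux dtm _] := smooth; have [pX _ _] := sX; have [_ cX] := pX.
have phioo := cvg_subseq phiq.
have wc (F : R * 'cV[R]_n -> R) : continuous F -> {within `[r, s], continuous (fun v => F (v, X v w))}.
  by move=> cF; have [_ c] := process_comp pX cF; exact: (cpath_sub c tr sT).
have cdr i : {within `[r, s], continuous (drift X i ^~ w)}.
  by have [_ c] := drift_process i pX; exact: (cpath_sub c tr sT).
have csg i k : {within `[r, s], continuous (fun v => \sum_l sg v (X v w) i l * sg v (X v w) k l)}.
  have [_ [_ cs] _ _ _] := coefs.
  apply: (wc (fun z => \sum_l sg z.1 z.2 i l * sg z.1 z.2 k l)) => z.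
  by apply: cvg_sumF => l; apply: cvgM; exact: cs.
pose A N := \sum_(j < N.+1) ut (tau N j) (X (tau N j) w) * h N.
pose Bi i N := \sum_(j < N.+1) uxj N j i w * I[tau N j, tau N j.+1] (drift X i ^~ w).
pose Q i k N := \sum_(j < N.+1) uxx i k (tau N j) (X (tau N j) w) * (del N j i w * del N j k w).
pose V N := \sum_i \sum_(j < N.+1) 1 * (del N j i w * del N j i w).
have cA : (fun q => A (phi q)) @ \oo --> I[r, s] (fun v => ut v (X v w)).
  exact: cvg_comp _ _ phioo (riemann_cvg rs (wc _ cut)).
have cB i : (fun q => Bi i (phi q)) @ \oo --> I[r, s] (fun v => ux i v (X v w) * drift X i v w).
  exact: cvg_comp _ _ phioo (riemann_weighted rs (wc _ (cux i)) (cdr i)).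
have cQ i k := qv (Some (i, k)) i k.
pose Vl := \sum_i I[r, s] (fun v => 1 * \sum_l sg v (X v w) i l * sg v (X v w) i l).
have cV : (fun q => V (phi q)) @ \oo --> Vl by apply: cvg_sumF => i; exact: (qv None i i).
have limE : I[r, s] (ito_integrand ^~ w) = I[r, s] (fun v => ut v (X v w)) +
   \sum_i I[r, s] (fun v => ux i v (X v w) * drift X i v w) +
   2^-1 * \sum_i \sum_k I[r, s] (fun v => uxx i k v (X v w) * \sum_l sg v (X v w) i l * sg v (X v w) k l).
  have J1 := ci_cont (wc _ cut).
  have J2 i : itg leb `[r, s]%classic (fun v => ux i v (X v w) * drift X i v w).
    by apply: ci_cont => v; apply: cvgM; [exact: (wc _ (cux i))|exact: cdr].
  have J3 i k : itg leb `[r, s]%classic (fun v => uxx i k v (X v w) * \sum_l sg v (X v w) i l * sg v (X v w) k l).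
    by apply: ci_cont => v; apply: cvgM; [exact: (wc _ (cuxx i k))|exact: csg].
  have m := mcci r s.
  have J3' i := itg_sum m (index_enum 'I_n) (J3 i).
  have J3'' := itg_sum m (index_enum 'I_n) J3'; have J2' := itg_sum m (index_enum 'I_n) J2.
  rewrite /ito_integrand (ED m (itgD m J1 J2') (itgZ m _ J3'')) (ED m J1 J2') (EZ m _ J3'') (E_sum m) // (E_sum m) //.
  by congr (_ + _ * _); apply: eq_bigr => i _; rewrite (E_sum m).
pose rem N := u s (X s w) - u r (X r w) - (A N + \sum_i Bi i N + 2^-1 * \sum_i \sum_k Q i k N) - Sum N w.
have near_rem e : 0 < e -> \forall N \near \oo, `|rem N| <= e * (s - r) + 3 * e * n%:R * V N.
  move=> e0; have n1 := grid_tube w cut e0.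
  have n2 : \forall N \near \oo, forall k l, tube N w (uxx k l) e.
    by do 2 (apply: filter_forall => ?); exact: (grid_tube w (cuxx _ _) e0).
  near=> N.
  have h1 : tube N w ut e by near: N.
  have h2 : forall k l, tube N w (uxx k l) e by near: N.
  have remE : rem N = \sum_(j < N.+1) (u (tau N j.+1) (X (tau N j.+1) w) - u (tau N j) (X (tau N j) w)
      - ut (tau N j) (X (tau N j) w) * h N - \sum_i uxj N j i w * del N j i w
      - 2^-1 * \sum_i \sum_k uxx i k (tau N j) (X (tau N j) w) * (del N j i w * del N j k w)).
    rewrite !sumrB /rem -/(A N).
    have -> : \sum_(j < N.+1) (u (tau N j.+1) (X (tau N j.+1) w)) - \sum_(j < N.+1) u (tau N j) (X (tau N j) w) =
       u s (X s w) - u r (X r w).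
      rewrite -sumrB -(big_mkord xpredT (fun j => u (tau N j.+1) (X (tau N j.+1) w) - u (tau N j) (X (tau N j) w))).
      by rewrite (@telescope_sumr _ 0 N.+1 (fun j => u (tau N j) (X (tau N j) w))) // grid_last grid0.
    have -> : 2^-1 * \sum_i \sum_k Q i k N = \sum_(j < N.+1) 2^-1 * \sum_i \sum_k uxx i k (tau N j) (X (tau N j) w) * (del N j i w * del N j k w).
      rewrite -mulr_sumr [in RHS]exchange_big /=; congr (_ * _); apply: eq_bigr => i _.
      by rewrite [in RHS]exchange_big.
    have -> : \sum_(j < N.+1) \sum_i uxj N j i w * del N j i w = Sum N w + \sum_i Bi i N.
      rewrite /Sum /Bi [\sum_i \sum_(j < N.+1) _]exchange_big /= -big_split /=; apply: eq_bigr => j _.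
      by rewrite -big_split /=; apply: eq_bigr => i _; rewrite /incr; ring.
    ring.
  rewrite remE; apply: le_trans (ler_norm_sum _ _ _) _.
  have -> : e * (s - r) + 3 * e * n%:R * V N = \sum_(j < N.+1) (e * h N + 3 * e * (n%:R * \sum_i del N j i w ^+ 2)).
    rewrite big_split /= -mulr_sumr mesh_sum -mulr_sumr -mulr_sumr /V exchange_big /= -!mulrA; congr (_ + 3 * (e * (_ * _))).
    by apply: eq_bigr => j _; apply: eq_bigr => i _; rewrite mul1r expr2.
  apply: ler_sum => j _; have jN := ltn_ord j; have [g1 g2 g3 _ _] := step_T jN.
  set X0 := X (tau N j) w; set X1 := X (tau N j.+1) w.
  (* The step in time is taken at the new state and the step in space at the old time, so that
     Taylor's formula is applied at grid times and the derivatives are those of the Riemann sums. *)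
  have [c cI dE] := dtm X1 _ _ g1 g2 g3.
  have tl := @taylor2 R n (u (tau N j)) (fun i => ux i (tau N j)) (fun i k => uxx i k (tau N j))
     (fun i y => du _ i y) (fun i k y => dux _ i k y) X0 (X1 - X0) e (ltW e0).
  have hbox : `|u (tau N j) (X0 + (X1 - X0)) - u (tau N j) X0 - \sum_k ux k (tau N j) X0 * (X1 - X0) k 0 -
      2^-1 * \sum_k \sum_l uxx k l (tau N j) X0 * ((X1 - X0) k 0 * (X1 - X0) l 0)| <= 3 * e * (\sum_k `|(X1 - X0) k 0|) ^+ 2.
    apply: tl => z hz k l; apply: h2 => //; first by rewrite lexx g2.
    by move=> i; have [th th01 e1] := hz i; exists th => //; rewrite e1 !mxE.
  have dl i : (X1 - X0) i 0 = del N j i w by rewrite !mxE.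
  rewrite [X0 + (X1 - X0)]addrC subrK in hbox.
  have tb : `|ut c X1 - ut (tau N j) X0| <= e.
    by apply: h1 => // i; exists 1; rewrite ?ler01 ?lexx // mul1r addrC subrK.
  have -> : u (tau N j.+1) X1 - u (tau N j) X0 - ut (tau N j) X0 * h N - \sum_i ux i (tau N j) X0 * del N j i w
      - 2^-1 * \sum_i \sum_k uxx i k (tau N j) X0 * (del N j i w * del N j k w) =
      (ut c X1 - ut (tau N j) X0) * h N + (u (tau N j) X1 - u (tau N j) X0 - \sum_k ux k (tau N j) X0 * (X1 - X0) k 0 -
      2^-1 * \sum_k \sum_l uxx k l (tau N j) X0 * ((X1 - X0) k 0 * (X1 - X0) l 0)).
    have -> : u (tau N j.+1) X1 = u (tau N j) X1 + ut c X1 * h N.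
      by rewrite -(grid_step r s N j) -dE addrC subrK.
    have -> : \sum_k ux k (tau N j) X0 * (X1 - X0) k 0 = \sum_i ux i (tau N j) X0 * del N j i w.
      by apply: eq_bigr => k _; rewrite dl.
    have -> : \sum_k \sum_l uxx k l (tau N j) X0 * ((X1 - X0) k 0 * (X1 - X0) l 0) =
        \sum_i \sum_k uxx i k (tau N j) X0 * (del N j i w * del N j k w).
      by apply: eq_bigr => k _; apply: eq_bigr => l _; rewrite !dl.
    ring.
  apply: le_trans (ler_normD _ _) _; apply: lerD.
    by rewrite normrM (ger0_norm (h_ge0 N)) ler_wpM2r.
  apply: le_trans hbox _; apply: ler_wpM2l; first by rewrite mulr_ge0 // ltW.
  apply: le_trans (sqr_sum_le _) _; apply: ler_wpM2l => //; apply: ler_sum => k _.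
  by rewrite real_normK ?num_real // dl.
have cR : (fun q => rem (phi q)) @ \oo --> 0.
  have Vl1 : 0 < `|Vl| + 1 by rewrite ltr_wpDl.
  apply/cvgrPdist_le => e e0.
  pose M := (s - r) + 3 * n%:R * (`|Vl| + 1) + 1.
  have M0 : 0 < M by rewrite /M ltr_wpDl // addr_ge0 ?subr_ge0 // !mulr_ge0 // ltW.
  have e1 : 0 < e / M by rewrite divr_gt0.
  have n1 := phioo _ (near_rem _ e1).
  have /cvgrPdist_le /(_ 1 ltr01) n2 := cV.
  near=> q.
  have m1 : `|rem (phi q)| <= e / M * (s - r) + 3 * (e / M) * n%:R * V (phi q) by near: q; exact: n1.
  have m2 : `|Vl - V (phi q)| <= 1 by near: q; exact: n2.
  rewrite sub0r normrN; apply: le_trans m1 _.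
  have VV : V (phi q) <= `|Vl| + 1.
    by have := ler_normB Vl (Vl - V (phi q)); rewrite opprB addrC subrK; have := ler_norm (V (phi q)); lra.
  have eE : e = e / M * M by rewrite divfK // gt_eqF.
  rewrite [leRHS]eE.
  have k0 : 0 <= 3 * (e / M) * n%:R by rewrite mulr_ge0 // mulr_ge0 // ltW.
  have := ler_wpM2l k0 VV; have := ltW e1; rewrite /M.
  move: (e / _) => a; set b := V _; set c := `|Vl| + 1 => a0 hb.
  have -> : a * (s - r + 3 * n%:R * c + 1) = a * (s - r) + 3 * a * n%:R * c + a by ring.
  lra.
rewrite limE.
have -> : (fun q => Sum (phi q) w) = fun q => u s (X s w) - u r (X r w) -
    (A (phi q) + \sum_i Bi i (phi q) + 2^-1 * \sum_i \sum_k Q i k (phi q)) - rem (phi q).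
  by apply/funext => q; rewrite /rem; ring.
rewrite -[X in _ --> X]subr0; apply: cvgB => //; apply: cvgB; first exact: cvg_cst.
apply: cvgD; first by apply: cvgD => //; exact: cvg_sumF.
by apply: cvgM; [exact: cvg_cst|apply: cvg_sumF => i; apply: cvg_sumF => k; exact: (cQ i k)].
Unshelve. all: by end_near.
Qed.

(** Along the subsequence of [quadratic_variation] the Ito sums converge almost surely, while their
    integrands converge in L2 by [step_cvg]; [isint_lim] combines the two modes of convergence. *)
Lemma ito_formula : isint r s (fun l z => \sum_i ux i z.1 (X z.1 z.2) * sg z.1 (X z.1 z.2) i l)
  (fun w => u s (X s w) - u r (X r w) - I[r, s] (fun v => ito_integrand v w)).
Proof.
have [[cu cut cux cuxx] _ _ _ _] := smooth; have [pX _ _] := sX; have [_ cX] := pX.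
have [L0 [cb cs] _ _ _] := coefs.
pose H (a : option ('I_n * 'I_n)) v w := if a is Some p then uxx p.1 p.2 v (X v w) else 1.
have hH a : adapted (H a) /\ cpath (H a).
  case: a => [[i k]|] /=; first exact: (process_comp pX (cuxx i k)).
  exact: (process_comp (F := fun=> 1) pX (fun z => cvg_cst _)).
have [phi [phiq qv]] := quadratic_variation (fun a => (hH a).1) (fun a => (hH a).2).
have [aI cI] : adapted ito_integrand /\ cpath ito_integrand.
  apply: (process_comp (F := fun z => ut z.1 z.2 + \sum_i ux i z.1 z.2 * bt z.1 z.2 i 0 +
    2^-1 * \sum_i \sum_k uxx i k z.1 z.2 * \sum_l sg z.1 z.2 i l * sg z.1 z.2 k l) pX) => z.
  apply: cvgD; first by apply: cvgD; [exact: cut|apply: cvg_sumF => i; apply: cvgM; [exact: cux|exact: cb]].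
  apply: cvgM; first exact: cvg_cst.
  do 2 (apply: cvg_sumF => ?); apply: cvgM; first exact: cuxx.
  by apply: cvg_sumF => l; apply: cvgM; exact: cs.
have mu v : t <= v <= T -> measurable_fun setT (fun w => u v (X v w)).
  by move=> vT; have [a _] := process_comp pX cu; exact: (fmeas_measurable HB vT (a v vT)).
have sI : t <= s <= T by rewrite sT (le_trans tr rs).
have rI : t <= r <= T by rewrite tr (le_trans rs sT).
have mG : measurable_fun setT (fun w => u s (X s w) - u r (X r w) - I[r, s] (ito_integrand ^~ w)).
  apply: measurable_funB; first by apply: measurable_funB; exact: mu.
  exact: (fmeas_measurable HB sI (int_fmeas aI cI tr rs sT)).
apply: (isint_lim tr rs sT (fun q => S_isint (phi q)) _ mG).
  move=> l; have [c1 c2 c3] := step_cvg l; split => //.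
  have phioo := cvg_subseq phiq.
  exact: cvg_comp _ _ phioo c3.
apply: filterS qv => w qv; exact: ito_pathwise.
Qed.

End ItoFormula.

(** * Energy estimate for linear backward equations *)

Section Energy.
(** For a function integrable on the product only, time sections are integrable on almost every
    path; [q] is a real version of the section integral. Drivers containing a general element of H^2
    have no better regularity. *)
Lemma band_slices r s (f : R * Omega B -> R) : r <= s -> itg lm (band r s) f -> (forall z, 0 <= f z) ->
  exists q : Omega B -> R, [/\ itg P setT q, E[q] = Rintegral lm (band r s) f &
    {ae P, forall w, itg leb `[r, s]%classic (fun u => f (u, w)) /\ I[r, s] (fun u => f (u, w)) = q w}].
Proof.
move=> rs If f0; have mf := itg_meas If.
have mg : measurable_fun setT ((EFin \o f) \_ (band r s) : measurableTypeR R * Omega B -> \bar R).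
  apply/measurable_restrict => //; first exact: (mbd r s).
  by rewrite setIidr //; exact/measurable_EFinP.
have g0 z : (0 <= ((EFin \o f) \_ (band r s)) z)%E.
  by rewrite patchE; case: ifPn => //; rewrite lee_fin.
pose h w := (\int[leb]_(u in `]r, s]) (f (u, w))%:E)%E.
have h0 w : (0 <= h w)%E by apply: integral_ge0 => u _; rewrite lee_fin.
have mh : measurable_fun setT h.
  have := @measurable_fun_fubini_tonelli_G _ _ (measurableTypeR R) (Omega B) R leb _ mg g0.
  apply: eq_measurable_fun => w _; rewrite /fubini_G /= [RHS]integral_mkcond; apply: eq_integral => x _; rewrite !patchE.
  case: ifPn => [/set_mem [xrs _]|xrs]; first by rewrite mem_set.
  by rewrite memNset // => hx; move/negP: xrs; apply; exact: mem_set.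
have eh : (\int[P]_w h w = (Rintegral lm (band r s) f)%:E)%E.
  by rewrite -(band_tonelli mf (fun z _ => f0 z)).2 (EFin_E (mbd r s) If).
have ih : P.-integrable setT h.
  apply/integrableP; split => //; under eq_integral => w _ do rewrite gee0_abs //.
  by rewrite eh ltry.
have fh := integrable_ae mT ih.
have iq : itg P setT (fine \o h).
  apply: itg_ge0P => [|//|]; first by apply: measurableT_comp mh; exact: fine_measurable.
    by move=> w _; exact: fine_ge0.
  apply: le_lt_trans (_ : (_ <= \int[P]_w h w)%E) _; last by rewrite eh ltry.
  apply: ge0_le_integral => //.
  - by move=> w _; rewrite lee_fin fine_ge0.
  - by apply/measurable_EFinP; apply: measurableT_comp mh; exact: fine_measurable.
  - by move=> w _; rewrite /=; case: (h w) (h0 w) => [x| |] //=; rewrite leey.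
exists (fine \o h); split => //.
  apply/EFin_inj; rewrite -eh -(EFin_E mT iq); apply: ae_eq_integral => //.
    exact/measurable_int/iq.
  by apply: filterS fh => w fw _ /=; rewrite fineK //; exact: fw.
apply: filterS fh => w /(_ Logic.I) fw.
have ms : measurable_fun (`]r, s]%classic : set (measurableTypeR R)) (fun x => f (x, w)) by exact: band_slice.
have mc : measurable_fun (`[r, s]%classic : set (measurableTypeR R)) (fun x => f (x, w)).
  exact/measurable_fun_itv_obnd_cbndP.
have e : (\int[leb]_(u in `[r, s]) (f (u, w))%:E = h w)%E.
  by rewrite -integral_itv_obnd_cbnd //; exact/measurable_EFinP.
have J : itg leb `[r, s]%classic (fun u => f (u, w)).
  by apply: itg_ge0P => //; rewrite e ltey_eq fw.
by split => //; rewrite /= -e (EFin_E (mcci r s) J).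
Qed.

Lemma band_integral r s (J : R * Omega B -> R) : r <= s -> L2 lm (band r s) J ->
  exists q : Omega B -> R, [/\ itg P setT q, E[q] = Rintegral lm (band r s) (fun z => J z ^+ 2) &
    {ae P, forall w, itg leb `[r, s]%classic (fun u => J (u, w)) /\
      I[r, s] (fun u => J (u, w)) ^+ 2 <= (s - r) * q w}].
Proof.
move=> rs [mJ iJ]; have [q [iq eq hq]] := band_slices rs iJ (fun z => sqr_ge0 (J z)).
exists q; split => //; apply: filterS hq => w [J2 e].
have ms : measurable_fun (`]r, s]%classic : set (measurableTypeR R)) (fun x => J (x, w)) by exact: band_slice.
have mc : measurable_fun (`[r, s]%classic : set (measurableTypeR R)) (fun x => J (x, w)).
  exact/measurable_fun_itv_obnd_cbndP.
rewrite -e; split; last by apply: ci_CS.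
have [J1 _] := ci_cst 1 rs.
apply: (itg_le (mcci r s) mc (itgD (mcci r s) J1 J2)) => u _.
by rewrite -[J _ ^+ 2]real_normK ?num_real //; have := sqr_ge0 (`|J (u, w)| - 1); have := normr_ge0 (J (u, w)); nra.
Qed.

Variables (D : R -> Omega B -> R) (del : 'I_d -> R * Omega B -> R) (J psi : R * Omega B -> R) (K : R).
Local Notation del2 := (fun z => \sum_l del l z ^+ 2).
Hypotheses (mD : forall s, t <= s <= T -> fmeas s (D s)) (DT : {ae P, forall w, D T w = 0}).
Hypotheses (LJ : L2 lm (band t T) J) (ipsi : itg lm (band t T) psi) (psi0 : forall z, 0 <= psi z) (K0 : 0 <= K).
Hypothesis JK : {ae lm, forall z, band t T z -> J z ^+ 2 <= K * (\sum_l del l z ^+ 2 + psi z)}.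
Hypothesis eqD : forall r s, t <= r -> r <= s -> s <= T -> exists2 xi, isint r s del xi &
  {ae P, forall w, xi w = D s w - D r w - I[r, s] (fun u => J (u, w))}.

(** [D] is given as adapted only; square integrability is read off the equation on [s, T], where the
    terminal value vanishes. *)
Lemma energy_L2 s : t <= s <= T -> L2 P setT (D s).
Proof.
move=> st; have /andP[ts sT] := st; have [xi ix ex] := eqD ts sT (lexx T).
have [q [iq _ hq]] := band_integral sT (L2_band_sub ts (lexx T) LJ).1.
have [[mx Lx] _] := isint_L2 ix; have mDs := fmeas_measurable HB st (mD st).
split=> //; apply: (itg_le_ae mT _ (itgD mT (itgZ mT 2 Lx) (itgZ mT (2 * (T - s)) iq))).
  exact: measurable_funX.
near=> w => _; rewrite ger0_norm ?sqr_ge0 //.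
have e1 : xi w = D T w - D s w - I[s, T] (fun u => J (u, w)) by near: w.
have e2 : D T w = 0 by near: w.
have [_ e3] : itg leb `[s, T]%classic (fun u => J (u, w)) /\ I[s, T] (fun u => J (u, w)) ^+ 2 <= (T - s) * q w by near: w.
move: e1 e3; rewrite e2 sub0r; set a := D s w; set b := I[_, _] _ => e1 e3.
have -> : a = - (xi w + b) by rewrite e1; ring.
rewrite sqrrN; have := sqr_ge0 (xi w - b); nra.
Unshelve. all: by end_near.
Qed.

Let step_arith (a Sg k h : R) : a <= k * Sg -> 0 <= Sg -> 0 <= h -> 16 * k * h <= 1 -> 2 * h * a <= 8^-1 * Sg.
Proof. by move=> b1 Sg0 h0 hk; have := ler_wpM2l h0 b1; have := ler_wpM2r Sg0 hk; lra. Qed.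

(** With xi the stochastic integral, D_r + xi = D_s - int J. The left side has orthogonal terms; the
    square of the right side costs the factor 2. Cauchy-Schwarz in time brings s - r, and 16 K (s -
    r) <= 1 leaves the coefficient 1/8. *)
Lemma energy_step r s : t <= r -> r <= s -> s <= T -> 16 * K * (s - r) <= 1 ->
  E[fun w => D r w ^+ 2] + Rintegral lm (band r s) del2 <=
  2 * E[fun w => D s w ^+ 2] + 8^-1 * (Rintegral lm (band r s) del2 + Rintegral lm (band r s) psi).
Proof.
move=> tr rs sT hK; have [xi ix ex] := eqD tr rs sT.
have rT : t <= r <= T by rewrite tr (le_trans rs). have sI : t <= s <= T by rewrite sT (le_trans tr).
have Lr := energy_L2 rT; have Ls := energy_L2 sI; have [Lx Ld] := isint_L2 ix.
have LJ' := (L2_band_sub tr sT LJ).1; have [q [iq eq hq]] := band_integral rs LJ'.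
have id : itg lm (band r s) del2 by apply: (itg_sum (mbd r s)) => l; exact: (Ld l).2.
have ip : itg lm (band r s) psi.
  by apply: integrableS ipsi; [exact: (mbd t T)|exact: (mbd r s)|exact: band_sub].
have cross := isint_mean HB tr sT ix (conj (mD rT) Lr).
have irx := itgM mT Lr Lx.
have lhs : E[fun w => (D r w + xi w) ^+ 2] = E[fun w => D r w ^+ 2] + Rintegral lm (band r s) del2.
  transitivity (E[fun w => D r w ^+ 2 + 2 * (D r w * xi w) + xi w ^+ 2]); first by apply: E_eq => w _; ring.
  rewrite (ED mT (itgD mT Lr.2 (itgZ mT 2 irx)) Lx.2) (ED mT Lr.2 (itgZ mT 2 irx)).
  by rewrite (EZ mT _ irx) cross mulr0 addr0 (isint_norm HB tr sT ix) (E_sum (mbd r s)) // => l; exact: (Ld l).2.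
have i1 := itgZ mT 2 Ls.2; have i2 := itgZ mT (2 * (s - r)) iq.
rewrite -lhs; apply: le_trans (E_le_ae mT (L2D mT Lr Lx).2 (itgD mT i1 i2) _) _.
  near=> w => _.
  have e1 : xi w = D s w - D r w - I[r, s] (fun u => J (u, w)) by near: w.
  have [_ e3] : itg leb `[r, s]%classic (fun u => J (u, w)) /\ I[r, s] (fun u => J (u, w)) ^+ 2 <= (s - r) * q w by near: w.
  move: e1 e3; set a := D r w; set b := I[_, _] _; set c := D s w => e1 e3.
  have -> : a + xi w = c - b by rewrite e1; ring.
  have := sqr_ge0 (c + b); nra.
rewrite (ED mT i1 i2) (EZ mT _ Ls.2) (EZ mT _ iq) lerD2l eq.
have b1 : Rintegral lm (band r s) (fun z => J z ^+ 2) <= K * (Rintegral lm (band r s) del2 + Rintegral lm (band r s) psi).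
  rewrite -(ED (mbd r s) id ip) -(EZ (mbd r s) _ (itgD (mbd r s) id ip)).
  apply: (E_le_ae (mbd r s) LJ'.2 (itgZ (mbd r s) K (itgD (mbd r s) id ip))).
  by apply: ae_mono JK => z h bz; apply: h; exact: band_sub bz.
have J0 : 0 <= Rintegral lm (band r s) (fun z => J z ^+ 2) by apply: E_ge0 => z _; exact: sqr_ge0.
have sr : 0 <= s - r by rewrite subr_ge0.
move: b1 J0; set a := (X in X <= _ -> _); set Sg := (X in _ <= K * X -> _) => b1 J0.
have Sg0 : 0 <= Sg by apply: addr_ge0; apply: E_ge0 => z _ //; apply: sumr_ge0 => l _; exact: sqr_ge0.
exact: (step_arith b1 Sg0 sr hK).
Unshelve. all: by end_near.
Qed.

Section Weighted.
Variable N : nat.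
Hypothesis hN : 16 * K * (T - t) <= N.+1%:R.
Local Notation tau j := (grid t T N j).

Definition weighted (f : R * Omega B -> R) := \sum_(j < N.+1) 2 ^+ j * Rintegral lm (band (tau j) (tau j.+1)) f.

Let step j : (j < N.+1)%N -> [/\ t <= tau j, tau j <= tau j.+1, tau j.+1 <= T, t <= tau j & tau j.+1 <= T].
Proof. exact: (step_T (lexx t) tT (lexx T)). Qed.

(** The steps are chained from [t] to [T]. Weight 2^j on piece [j] makes the second moments of [D]
    at inner grid points cancel, and the last one vanishes by the terminal condition. *)
Lemma energy : E[fun w => D t w ^+ 2] + 7 / 8 * weighted del2 <= 8^-1 * weighted psi.
Proof.
have hs j : (j < N.+1)%N -> 16 * K * (tau j.+1 - tau j) <= 1.
  by move=> jN; rewrite grid_step mulrA ler_pdivrMr ?ltr0n // mul1r.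
have key k : (k <= N.+1)%N -> E[fun w => D t w ^+ 2] + 7 / 8 * (\sum_(j < k) 2 ^+ j * Rintegral lm (band (tau j) (tau j.+1)) del2) <=
    8^-1 * (\sum_(j < k) 2 ^+ j * Rintegral lm (band (tau j) (tau j.+1)) psi) + 2 ^+ k * E[fun w => D (tau k) w ^+ 2].
  elim: k => [|k IH] kN; first by rewrite !big_ord0 !mulr0 grid0 mul1r add0r addr0.
  have [h1 h2 h3 _ _] := step kN; have es := energy_step h1 h2 h3 (hs k kN).
  have {}IH := IH (ltnW kN); have p0 : 0 <= 2 ^+ k :> R by rewrite exprn_ge0.
  have := ler_wpM2l p0 es; rewrite !big_ord_recr /= exprS; move: IH; lra.
have := key N.+1 (leqnn _); rewrite grid_last; have e : E[fun w => D T w ^+ 2] <= 0.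
  have TT : t <= T <= T by rewrite tT lexx.
  have h := @E_le_ae _ _ _ P setT mT (fun w => D T w ^+ 2) (fun=> 0) (energy_L2 TT).2 (itg0 P setT).
  by rewrite E0 in h; apply: h; apply: filterS DT => w -> _; rewrite expr0n.
have p0 : 0 <= 2 ^+ N.+1 :> R by rewrite exprn_ge0.
have := ler_wpM2l p0 e; rewrite /weighted; lra.
Qed.

Lemma weighted_ge0 f : (forall z, 0 <= f z) -> 0 <= weighted f.
Proof. by move=> f0; apply: sumr_ge0 => j _; rewrite mulr_ge0 ?exprn_ge0 //; apply: E_ge0. Qed.

Let sub j : (j < N.+1)%N -> band (tau j) (tau j.+1) `<=` band t T.
Proof. by move=> /step [h1 _ h3 _ _]; exact: band_sub. Qed.

Lemma weighted_eq0 f : itg lm (band t T) f -> (forall z, 0 <= f z) -> weighted f <= 0 ->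
  {ae lm, forall z, band t T z -> f z = 0}.
Proof.
move=> jf f0 wf.
have e j : (j < N.+1)%N -> {ae lm, forall z, band (tau j) (tau j.+1) z -> f z = 0}.
  move=> jN; have s := sub jN; have i1 := integrableS (mbd t T) (mbd (tau j) (tau j.+1)) s jf.
  apply: (E_eq0 (mbd (tau j) (tau j.+1))) => //; apply/eqP; rewrite eq_le E_ge0 // andbT.
  have p0 : 0 < 2 ^+ j :> R by rewrite exprn_gt0.
  rewrite -(pmulr_rle0 _ p0); apply: le_trans wf; rewrite /weighted (bigD1 (Ordinal jN)) //= lerDl.
  by apply: sumr_ge0 => k _; rewrite mulr_ge0 ?exprn_ge0 //; apply: E_ge0.
have {}e k : (k <= N.+1)%N -> {ae lm, forall z, forall j, (j < k)%N -> band (tau j) (tau j.+1) z -> f z = 0}.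
  elim: k => [|k IH] kN; first by apply: ae_mono (e 0%N isT) => z.
  apply: ae_mono (ae_and (e k kN) (IH (ltnW kN))) => z [h1 h2] j; rewrite ltnS leq_eqVlt => /orP[/eqP ->|] //; exact: h2.
apply: ae_mono (e N.+1 (leqnn _)) => z h [/= + _]; rewrite in_itv /= => zT.
have [//|f1] := eqVneq (f z) 0.
have := @grid_sum1 R t T N z.1 tT zT; rewrite big1 => [/esym/eqP|j _]; first by rewrite oner_eq0.
case: (boolP (tau j < z.1 <= tau j.+1)) => // jz; case/negP: f1.
by rewrite (h j (ltn_ord j)) //; split => //=; rewrite in_itv.
Qed.

End Weighted.

End Energy.

End StochasticCalculus.

(** * The control problem *)

Section LipschitzFunctions.
Context (R : realType) (n : nat).
Implicit Types f g : R -> 'cV[R]_n -> R.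

Definition lip f := exists K, [/\ 0 <= K, continuous (fun z : R * 'cV[R]_n => f z.1 z.2) &
  forall s x y, `|f s x - f s y| <= K * enorm (x - y)].

Definition bnd f := exists2 K, 0 <= K & forall s x, `|f s x| <= K.

Lemma enorm_nsq (x : 'cV[R]_n) : enorm x ^+ 2 = nsq x.
Proof. exact: enorm_sqr. Qed.

Lemma lip_sqr f : lip f -> exists2 K, 0 <= K & forall s x y, (f s x - f s y) ^+ 2 <= K * nsq (x - y).
Proof.
move=> [K [K0 _ h]]; exists (K ^+ 2); first exact: sqr_ge0.
move=> s x y; rewrite -enorm_nsq -exprMn -[leLHS]real_normK ?num_real //.
by rewrite ler_pXn2r ?nnegrE // mulr_ge0 // enorm_ge0.
Qed.

Lemma bnd_sqr f : bnd f -> exists2 K, 0 <= K & forall s x, f s x ^+ 2 <= K.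
Proof.
move=> [K K0 h]; exists (K ^+ 2) => [|s x]; first exact: sqr_ge0.
by rewrite -[leLHS]real_normK ?num_real // ler_pXn2r ?nnegrE.
Qed.

Lemma lipD f g : lip f -> lip g -> lip (fun s x => f s x + g s x).
Proof.
move=> [K [K0 cf h]] [K' [K0' cg h']]; exists (K + K'); split => [|z|s x y]; first exact: addr_ge0.
  by apply: cvgD; [exact: cf|exact: cg].
have -> : f s x + g s x - (f s y + g s y) = f s x - f s y + (g s x - g s y) by ring.
by apply: le_trans (ler_normD _ _) _; rewrite mulrDl lerD.
Qed.

Lemma lipM f g : lip f -> bnd f -> lip g -> bnd g -> lip (fun s x => f s x * g s x).
Proof.
move=> [K [K0 cf h]] [M M0 b] [K' [K0' cg h']] [M' M0' b'].
exists (M * K' + M' * K); split => [|z|s x y]; first by rewrite addr_ge0 // mulr_ge0.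
  by apply: cvgM; [exact: cf|exact: cg].
have -> : f s x * g s x - f s y * g s y = f s x * (g s x - g s y) + g s y * (f s x - f s y) by ring.
apply: le_trans (ler_normD _ _) _; rewrite !normrM mulrDl -!mulrA.
by apply: lerD; apply: ler_pM.
Qed.

Lemma lip_cst c : lip (fun _ _ => c).
Proof. by exists 0; split => // [z|s x y]; [exact: cvg_cst|rewrite subrr normr0 mul0r]. Qed.

Lemma lip_sum I (s : seq I) (F : I -> R -> 'cV[R]_n -> R) : (forall i, lip (F i)) ->
  lip (fun u x => \sum_(i <- s) F i u x).
Proof.
move=> h; elim: s => [|i s IH].
  by have := lip_cst 0; congr lip; apply/funext => u; apply/funext => x; rewrite big_nil.
by have := lipD (h i) IH; congr lip; apply/funext => u; apply/funext => x; rewrite big_cons.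
Qed.

Lemma bndM f g : bnd f -> bnd g -> bnd (fun s x => f s x * g s x).
Proof. by move=> [K K0 h] [M M0 b]; exists (K * M); [exact: mulr_ge0|move=> s x; rewrite normrM ler_pM]. Qed.

Lemma bnd_sum I (s : seq I) (F : I -> R -> 'cV[R]_n -> R) : (forall i, bnd (F i)) ->
  bnd (fun u x => \sum_(i <- s) F i u x).
Proof.
move=> h; elim: s => [|i s [K K0 hK]]; first by exists 0 => // u x; rewrite big_nil normr0.
have [M M0 hM] := h i; exists (M + K); first exact: addr_ge0.
by move=> u x; rewrite big_cons; apply: le_trans (ler_normD _ _) _; rewrite lerD.
Qed.

Lemma enorm_le_sum p q (M : 'M[R]_(p, q)) : enorm M <= \sum_i \sum_j `|M i j|.
Proof.
have S0 : 0 <= \sum_i \sum_j `|M i j| by do 2 (apply: sumr_ge0 => ? _).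
rewrite -[leRHS](ger0_norm S0) -sqrtr_sqr ler_wsqrtr // expr2 big_distrlr /=.
apply: ler_sum => i _; rewrite (bigD1 i) //= -[leLHS]addr0; apply: lerD.
  rewrite big_distrlr /=; apply: ler_sum => j _; rewrite (bigD1 j) //= -expr2 real_normK ?num_real // lerDl.
  by apply: sumr_ge0 => k _; rewrite mulr_ge0.
by apply: sumr_ge0 => k _; rewrite mulr_ge0 //; apply: sumr_ge0.
Qed.

End LipschitzFunctions.

Lemma continuous_entry (R : realType) (U : topologicalType) p q (F : U -> 'M[R]_(p, q)) i j :
  continuous F -> continuous (fun z => F z i j).
Proof. by move=> cF z; exact: (continuous_comp (cF z) (@coord_continuous R p q i j (F z))). Qed.

(** * Clamping time onto the horizon *)

Section Clamping.
Context (R : realType) (n : nat) (T : R).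
Hypothesis T0 : 0 <= T.
Local Notation I := [set t : R | 0 <= t <= T].
Local Notation c := (clp 0 T).

Lemma cI s : 0 <= c s <= T. Proof. exact: clp_in. Qed.

Lemma clamp_continuous (V : topologicalType) (phi : R -> 'cV[R]_n -> V) :
  {within [set w : R * 'cV[R]_n | 0 <= w.1 <= T], continuous (fun w => phi w.1 w.2)} ->
  continuous (fun z : R * 'cV[R]_n => phi (c z.1) z.2).
Proof.
move=> cp; apply: (within_continuous_comp (rho := fun z => (c z.1, z.2)) cp) => [z|z]; last exact: cI.
apply: (@cvg_pair _ _ _ _ (nbhs (c z.1)) (nbhs z.2)); last exact: cvg_snd.
by apply: (continuous_comp (f := fst)); [exact: cvg_fst|exact: clp_continuous].
Qed.

(** Turns the class, which speaks of norms and of times in [0, T], into conditions on total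
    functions and single coordinates; the dummy variable of the trivial extension is set to 0. *)
Lemma CbUniLipP k (phi : R -> 'cV[R]_n -> 'cV[R]_k) : UniLipb2 I setT phi <->
  (forall i, lip (fun s x => phi (c s) x i 0)) /\ forall i, @bnd R n (fun s _ => phi (c s) 0 i 0).
Proof.
split=> [[cphi [L [Lip bL]]]|[h b]].
  have cc : continuous (fun z : R * 'cV[R]_n => phi (c z.1) z.2).
    apply: (within_continuous_comp (F := fun w : R * 'cV[R]_n * 'cV[R]_1 => phi w.1.1 w.1.2) (rho := fun z : R * 'cV[R]_n => (c z.1, z.2, 0 : 'cV[R]_1)) cphi).
      move=> z; apply: (@cvg_pair _ _ _ _ (nbhs (c z.1, z.2)) (nbhs (0 : 'cV[R]_1))); last exact: cvg_cst.
      apply: (@cvg_pair _ _ _ _ (nbhs (c z.1)) (nbhs z.2)); last exact: cvg_snd.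
      by apply: (continuous_comp (f := fst)); [exact: cvg_fst|exact: clp_continuous].
    by move=> z; split => //; exact: cI.
  split=> i.
    exists `|L|; split => // [z|s x y].
      exact: (continuous_entry (i := i) (j := 0) cc).
    have := Lip (c s) x y 0 0 (cI s) Logic.I Logic.I Logic.I Logic.I.
    have -> : enorm (0 - 0 : 'cV[R]_1) = 0.
      by apply/eqP; rewrite subrr -sqrf_eq0 enorm_sqr big1 // => j _; rewrite mxE expr0n.
    rewrite mulr0 addr0 => h; apply: (@le_trans _ _ (L * enorm (x - y))); last by rewrite ler_wpM2r ?enorm_ge0 // ler_norm.
    by apply: le_trans h; have := enorm_coord (phi (c s) x - phi (c s) y) i 0; rewrite !mxE.
  exists `|L| => // s _; apply: le_trans (enorm_coord _ i 0) _; apply: le_trans (ler_norm L); exact: bL (cI s).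
have cc : continuous (fun z : R * 'cV[R]_n => phi (c z.1) z.2).
  by move=> z; apply: cvg_col => i; have [K [_ cf _]] := h i; exact: cf.
have {h} /choice[K hK] : forall i, exists K, 0 <= K /\ forall s x y, `|phi (c s) x i 0 - phi (c s) y i 0| <= K * enorm (x - y).
  by move=> i; have [K [K0 _ hK]] := h i; exists K.
have {b} /choice[M hM] : forall i, exists M, 0 <= M /\ forall s, `|phi (c s) 0 i 0| <= M.
  by move=> i; have [M M0 hM] := b i; exists M; split => // s; exact: hM s 0.
have SK : 0 <= \sum_i K i by apply: sumr_ge0 => i _; exact: (hK i).1.
have SM : 0 <= \sum_i M i by apply: sumr_ge0 => i _; exact: (hM i).1.
split.
  apply: (@subspace_eq_continuous _ _ _ (fun z : R * 'cV[R]_n * 'cV[R]_1 => phi (c z.1.1) z.1.2)).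
    by move=> z /set_mem [/= zI _ _]; rewrite clp_id.
  apply: continuous_subspaceT => z.
  exact: (@continuous_comp _ _ _ fst (fun z : R * 'cV[R]_n => phi (c z.1) z.2) z cvg_fst (cc z.1)).
exists (\sum_i K i + \sum_i M i); split => [s x x' y y' sI _ _ _ _|s sI].
  rewrite -[s](clp_id sI); apply: (@le_trans _ _ ((\sum_i K i) * enorm (x - x'))).
    apply: le_trans (enorm_le_sum _) _; rewrite mulr_suml; apply: ler_sum => i _.
    by rewrite big_ord1 !mxE; exact: (hK i).2.
  rewrite -[leLHS]addr0; apply: lerD; last by rewrite mulr_ge0 ?addr_ge0 ?enorm_ge0.
  by rewrite ler_wpM2r ?enorm_ge0 // lerDl.
rewrite -[s](clp_id sI); apply: le_trans (enorm_le_sum _) _; apply: (@le_trans _ _ (\sum_i M i)); last by rewrite lerDr.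
by apply: ler_sum => i _; rewrite big_ord1; exact: (hM i).2.
Qed.

Lemma comp_cont k p q (E : set 'cV[R]_k) (phi : R -> 'cV[R]_n -> 'cV[R]_k -> 'M[R]_(p, q)) (a : R -> 'cV[R]_n -> 'cV[R]_k) :
  continuous3 I setT E phi -> continuous (fun z : R * 'cV[R]_n => a z.1 z.2) -> (forall s x, E (a s x)) ->
  forall i j, continuous (fun z : R * 'cV[R]_n => phi (c z.1) z.2 (a z.1 z.2) i j).
Proof.
move=> cphi ca Ea i j; apply: continuous_entry.
apply: (within_continuous_comp (rho := fun z : R * 'cV[R]_n => (c z.1, z.2, a z.1 z.2)) cphi).
  move=> z; apply: (@cvg_pair _ _ _ _ (nbhs (c z.1, z.2)) (nbhs (a z.1 z.2))); last exact: ca.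
  apply: (@cvg_pair _ _ _ _ (nbhs (c z.1)) (nbhs z.2)); last exact: cvg_snd.
  by apply: (continuous_comp (f := fst)); [exact: cvg_fst|exact: clp_continuous].
by move=> z; split; [exact: cI|by []|exact: Ea].
Qed.

Lemma comp_lip k p q (E : set 'cV[R]_k) (phi : R -> 'cV[R]_n -> 'cV[R]_k -> 'M[R]_(p, q)) (a : R -> 'cV[R]_n -> 'cV[R]_k) :
  UniLip I setT E phi -> (forall i, lip (fun s x => a s x i 0)) -> (forall s x, E (a s x)) ->
  forall i j, lip (fun s x => phi (c s) x (a s x) i j).
Proof.
move=> [cphi [L Lip]] ha Ea i j.
have ca : continuous (fun z : R * 'cV[R]_n => a z.1 z.2).
  by move=> z; apply: cvg_col => l; have [K [_ cf _]] := ha l; exact: cf.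
have /choice[K hK] : forall l, exists K, 0 <= K /\ forall s x y, `|a s x l 0 - a s y l 0| <= K * enorm (x - y).
  by move=> l; have [K [K0 _ hK]] := ha l; exists K.
have SK : 0 <= \sum_l K l by apply: sumr_ge0 => l _; exact: (hK l).1.
exists (`|L| * (1 + \sum_l K l)); split => [|z|s x y]; first by rewrite mulr_ge0 // addr_ge0.
  exact: (comp_cont cphi ca Ea).
have := Lip (c s) x y (a s x) (a s y) (cI s) Logic.I Logic.I (Ea _ _) (Ea _ _) => h.
have {h} h := le_trans (enorm_coord _ i j) h; rewrite !mxE in h; apply: le_trans h _.
rewrite -mulrDr; apply: (@le_trans _ _ (`|L| * (enorm (x - y) + enorm (a s x - a s y)))).
  by rewrite ler_wpM2r ?addr_ge0 ?enorm_ge0 // ler_norm.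
rewrite -mulrA ler_wpM2l // mulrDl mul1r lerD2l; apply: le_trans (enorm_le_sum _) _.
by rewrite mulr_suml; apply: ler_sum => l _; rewrite big_ord1 !mxE; exact: (hK l).2.
Qed.

(* the one-sided derivatives at the end points are only needed for the mean value theorem *)
Lemma C12_smooth (t : R) (w wt : R -> 'cV[R]_n -> R) (wx : R -> 'cV[R]_n -> 'cV[R]_n) (wxx : R -> 'cV[R]_n -> 'M[R]_n) :
  0 <= t -> C12 T w wt wx wxx -> UniLipb2 I setT wx ->
  exists C, smooth_data t T (fun s x => w (c s) x) (fun s x => wt (c s) x) (fun i s x => wx (c s) x i 0)
    (fun i j s x => wxx (c s) x i j) C.
Proof.
move=> t0 [[cw cwt] [cwx cwxx] dt dx dxx] /CbUniLipP[lx bx].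
have /choice[K hK] i : exists K, 0 <= K /\ forall s x y, (wx (c s) x i 0 - wx (c s) y i 0) ^+ 2 <= K * nsq (x - y).
  by have [K K0 hK] := lip_sqr (lx i); exists K.
have /choice[M hM] i : exists M, 0 <= M /\ forall s, wx (c s) 0 i 0 ^+ 2 <= M.
  by have [M M0 hM] := bnd_sqr (bx i); exists M; split => // s; exact: hM s 0.
have SK : 0 <= \sum_i K i by apply: sumr_ge0 => i _; exact: (hK i).1.
have SM : 0 <= \sum_i M i by apply: sumr_ge0 => i _; exact: (hM i).1.
have Ki i : K i <= \sum_i K i.
  by rewrite (bigD1 i) //= lerDl; apply: sumr_ge0 => j _; exact: (hK j).1.
have Mi i : M i <= \sum_i M i.
  by rewrite (bigD1 i) //= lerDl; apply: sumr_ge0 => j _; exact: (hM j).1.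
exists (2 * (\sum_i K i + \sum_i M i)); split.
- split; [exact: (clamp_continuous cw)|exact: (clamp_continuous cwt)| |] => i.
    exact: (continuous_entry (i := i) (j := 0) (clamp_continuous cwx)).
  by move=> j; exact: (continuous_entry (i := i) (j := j) (clamp_continuous cwxx)).
- by move=> v i y; exact: dx (cI v).
- by move=> v i j y; exact: dxx (cI v).
- move=> y a b ta ab bT.
  have aT : 0 <= a <= T by rewrite (le_trans t0 ta) (le_trans ab bT).
  have bI : 0 <= b <= T by rewrite (le_trans _ ab) ?(le_trans t0 ta).
  have [<-|anb] := eqVneq a b; first by exists a; rewrite ?lexx // !subrr mulr0.
  have ab' : a < b by rewrite lt_neqAle anb.
  pose fw s := w (c s) y.
  have cfw : continuous fw.
    move=> s; apply: (continuous_comp (f := fun s : R => (s, y)) (g := fun z : R * 'cV[R]_n => w (c z.1) z.2)).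
      by apply: (@cvg_pair _ _ _ _ (nbhs s) (nbhs y)); [exact: cvg_id|exact: cvg_cst].
    exact: clamp_continuous.
  have dfw s : s \in `]a, b[ -> is_derive s (1 : R) fw (wt s y).
    rewrite in_itv /= => /andP[as_ sb].
    have s0 : 0 < s by case/andP: aT => a0 _; exact: le_lt_trans as_.
    have sT : s < T by apply: lt_le_trans bT.
    have sI : 0 <= s <= T by rewrite (ltW s0) (ltW sT).
    have := dt s y sI => lim.
    have key : (fun h : R => h^-1 *: (fw (h + s) - fw s)) @ 0^' --> wt s y.
      apply/cvgrPdist_le => e e0; move/cvgrPdist_le: lim => /(_ e e0).
      rewrite near_withinE => -[rho /= rho0 hrho].
      have m0 : 0 < Num.min rho (Num.min s (T - s)) by rewrite !lt_min rho0 s0 subr_gt0.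
      exists (Num.min rho (Num.min s (T - s))) => // h /=; rewrite sub0r normrN !lt_min => /and3P[h1 h2 h3] hn0.
      have := ler_norm h; have := ler_norm (- h); rewrite normrN => h4 h5.
      have hs : 0 <= h + s <= T by apply/andP; split; lra.
      rewrite /fw (clp_id hs) (clp_id sI).
      have := hrho (h + s); rewrite /= opprD addrCA subrr addr0 normrN => /(_ h1).
      rewrite addrK /GRing.scale /=; apply; split => //.
      by apply: contra_neq hn0 => e1; apply: (addIr s); rewrite add0r.
    have eqf : (fun h : R => h^-1 *: ((fw \o shift s) (h *: (1 : R)) - fw s)) = fun h : R => h^-1 *: (fw (h + s) - fw s).
      by apply/funext => h /=; rewrite /GRing.scale /= mulr1.
    apply: DeriveDef; rewrite ?/derivable ?/derive eqf; last by apply/cvg_lim.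
    by apply/cvg_ex; exists (wt s y).
  have [s sab e1] := MVT ab' dfw (continuous_subspaceT cfw).
  exists s; first by move: sab; rewrite in_itv /= => /andP[/ltW -> /ltW ->].
  rewrite -/(fw b) -/(fw a) e1 clp_id //.
  by move: sab; rewrite in_itv /= => /andP[/ltW h1 /ltW h2]; case/andP: aT => a0 _; rewrite (le_trans a0) ?(le_trans h2).
split; first by rewrite mulr_ge0 // addr_ge0.
- move=> i v y z; apply: le_trans ((hK i).2 _ _ _) _; rewrite ler_wpM2r ?nsq_ge0 //.
  by apply: le_trans (Ki i) _; lra.
- move=> i v y; have h1 := (hK i).2 v y 0; have h2 := (hM i).2 v.
  rewrite subr0 in h1; have n0 := nsq_ge0 y.
  have k1 : K i * nsq y <= (\sum_i K i) * nsq y by rewrite ler_wpM2r.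
  have m1 := Mi i; have m2 : 0 <= (\sum_i M i) * nsq y by rewrite mulr_ge0.
  have := sqr_ge0 (wx (c v) y i 0 - 2 * wx (c v) 0 i 0); nra.
Qed.

End Clamping.

Lemma finite_bound (R : realType) (I : finType) (Q : I -> R -> Prop) :
  (forall i K K', K <= K' -> Q i K -> Q i K') -> (forall i, exists2 K, 0 <= K & Q i K) ->
  exists2 K, 0 <= K & forall i, Q i K.
Proof.
move=> mono h; have /choice[K hK] : forall i, exists K, 0 <= K /\ Q i K.
  by move=> i; have [K K0 QK] := h i; exists K.
exists (\sum_i K i) => [|i]; first by apply: sumr_ge0 => i _; exact: (hK i).1.
apply: mono (hK i).2; rewrite (bigD1 i) //= lerDl; apply: sumr_ge0 => j _; exact: (hK j).1.
Qed.

Lemma sqrD_le (R : realFieldType) (a b : R) : (a + b) ^+ 2 <= 2 * a ^+ 2 + 2 * b ^+ 2.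
Proof. by have := sqr_ge0 (a - b); nra. Qed.

Section Control.
Context (R : realType) (n m d : nat) (p : problem R n m d).
Local Notation A := (actions p).
Local Notation T := (horizon p).
Local Notation I := [set t : R | 0 <= t <= T].
Local Notation c := (clp 0 T).
Variable L0 : R.

(** The regularity of the data with a fixed bound [L0], separated from the solvability of the
    partial differential equations, which is passed where it is used. *)
Definition regular :=
  [/\ standing p, UniLip I setT A (fun t x _ => bb p t x), UniLip I setT A (bh p),
      UniLip I setT A (fun t x _ => sigma p t x) & UniLip I setT setT (Defs.mu p)] /\
  [/\ UniLip I setT A (fun t x a => (f p t x a)%:M : 'M[R]_1),
      UniLip I setT A (fun _ x _ => (g p x)%:M : 'M[R]_1)
    & forall t, 0 <= t <= T ->
        enorm (bb p t 0) + enorm (Defs.mu p t 0 0) + `|f p t 0 0| <= L0 /\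
        forall x a, A a -> enorm (bh p t x a) + enorm (sigma p t x) <= L0].

Hypothesis reg : regular.
Let Hp := let: conj (And5 h _ _ _ _) _ := reg in h.
Let Hbb := let: conj (And5 _ h _ _ _) _ := reg in h.
Let Hbh := let: conj (And5 _ _ h _ _) _ := reg in h.
Let Hsg := let: conj (And5 _ _ _ h _) _ := reg in h.
Let Hf := let: conj _ (And3 h _ _) := reg in h.
Let Hg := let: conj _ (And3 _ h _) := reg in h.
Let HL := let: conj _ (And3 _ _ h) := reg in h.
Implicit Types (alpha : policy R n m) (wx : R -> 'cV[R]_n -> 'cV[R]_n).

Lemma T_gt0 : 0 < T. Proof. by case: Hp. Qed.
Let T0 : 0 <= T := ltW T_gt0.
Let A0 : A 0. Proof. by case: Hp => _ []. Qed.

Let bP t x a : 0 <= t <= T -> A a -> b p t x a = bb p t x + sigma p t x *m bh p t x a.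
Proof. by case: Hp => _ [_ [_ [h _]]]; exact: h. Qed.

(* [ctl] is all that is known of the optimal policy, whose gradient is not bounded a priori *)
Definition Adm alpha := CbUniLip p alpha /\ A_valued p alpha.
Definition ctl alpha := A_valued p alpha /\ continuous (fun z : R * 'cV[R]_n => alpha (c z.1) z.2).

Lemma Adm_ctl alpha : Adm alpha -> ctl alpha.
Proof.
move=> [/(CbUniLipP T0)[h _] Aa]; split => // z; apply: cvg_col => i.
by have [K [_ cf _]] := h i; exact: cf.
Qed.

Let Ac alpha s x : A_valued p alpha -> A (alpha (c s) x). Proof. by apply; exact: cI. Qed.

(** Coefficients under a fixed policy at clamped times: they agree with the data on [0, T] and
    satisfy [coef_ok] at all real times. *)
Definition b_clp alpha s y := b p (c s) y (alpha (c s) y).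
Definition sigma_clp s y := sigma p (c s) y.
Definition f_clp alpha s y := f p (c s) y (alpha (c s) y).
Definition bh_clp alpha l s y := bh p (c s) y (alpha (c s) y) l 0.

Lemma bc_coord alpha s y i : A_valued p alpha ->
  b_clp alpha s y i 0 = bb p (c s) y i 0 + \sum_l sigma_clp s y i l * bh_clp alpha l s y.
Proof. by move=> Aa; rewrite /b_clp (bP _ (cI T0 s) (Ac s y Aa)) !mxE. Qed.

Let bb_lip i : lip (fun s y => bb p (c s) y i 0).
Proof. exact: (comp_lip T0 Hbb (a := fun _ _ => 0) (fun i => lip_cst _ _) (fun _ _ => A0)). Qed.

Lemma sg_lip i j : lip (fun s y => sigma_clp s y i j).
Proof. exact: (comp_lip T0 Hsg (a := fun _ _ => 0) (fun i => lip_cst _ _) (fun _ _ => A0)). Qed.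

Let L0_ge0 : 0 <= L0.
Proof.
have [h _] := HL (cI T0 0); apply: le_trans h; by rewrite !addr_ge0 ?enorm_ge0.
Qed.

Lemma sg_bnd i j : bnd (fun s y => sigma_clp s y i j).
Proof.
exists L0 => // s y; apply: le_trans (enorm_coord _ i j) _.
by apply: le_trans ((HL (cI T0 s)).2 y 0 A0); rewrite lerDr enorm_ge0.
Qed.

Lemma bhc_le alpha l s y : A_valued p alpha -> `|bh_clp alpha l s y| <= L0.
Proof.
move=> Aa; apply: le_trans (enorm_coord _ l 0) _.
by apply: le_trans ((HL (cI T0 s)).2 y _ (Ac s y Aa)); rewrite lerDl enorm_ge0.
Qed.

Let acl alpha i : CbUniLip p alpha -> lip (fun s y => alpha (c s) y i 0).
Proof. by move=> /(CbUniLipP T0)[h _]; exact: h. Qed.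

Lemma bhc_lip alpha l : Adm alpha -> lip (bh_clp alpha l).
Proof. by move=> [ca Aa]; exact: (comp_lip T0 Hbh (fun i => acl i ca) (fun s y => Ac s y Aa)). Qed.

Lemma bhc_cont alpha l : ctl alpha -> continuous (fun z : R * 'cV[R]_n => bh_clp alpha l z.1 z.2).
Proof. by move=> [Aa ca]; exact: (comp_cont T0 Hbh.1 ca (fun s y => Ac s y Aa)). Qed.

Lemma fc_lip alpha : Adm alpha -> lip (f_clp alpha).
Proof.
move=> [ca Aa]; have := comp_lip T0 Hf (fun i => acl i ca) (fun s y => Ac s y Aa) 0 0.
by congr lip; apply/funext => s; apply/funext => y; rewrite mxE eqxx mulr1n.
Qed.

Lemma fc_cont alpha : ctl alpha -> continuous (fun z : R * 'cV[R]_n => f_clp alpha z.1 z.2).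
Proof.
move=> [Aa ca].
have -> : (fun z : R * 'cV[R]_n => f_clp alpha z.1 z.2) = fun z => ((f p (c z.1) z.2 (alpha (c z.1) z.2))%:M : 'M[R]_1) 0 0.
  by apply/funext => z; rewrite mxE eqxx mulr1n.
exact: (comp_cont T0 Hf.1 ca (fun s y => Ac s y Aa)).
Qed.

Lemma g_lip : lip (fun _ => g p).
Proof.
have := comp_lip T0 Hg (a := fun _ _ => 0) (fun i => lip_cst _ _) (fun _ _ => A0) 0 0.
by congr lip; apply/funext => s; apply/funext => y; rewrite mxE eqxx mulr1n.
Qed.

(** The drift contains the product of [sigma] and [bh], which is Lipschitz because both factors are
    Lipschitz and bounded; [bb] is merely Lipschitz, which linear growth allows. *)
Lemma coefs alpha : Adm alpha -> exists L, coef_ok (b_clp alpha) sigma_clp L.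
Proof.
move=> Aa; have bE i : (fun s y => b_clp alpha s y i 0) = fun s y => bb p (c s) y i 0 + \sum_l sigma_clp s y i l * bh_clp alpha l s y.
  by apply/funext => s; apply/funext => y; rewrite (bc_coord _ _ _ Aa.2).
have bhb l : bnd (bh_clp alpha l) by exists L0 => // s y; exact: bhc_le Aa.2.
have bl i : lip (fun s y => b_clp alpha s y i 0).
  rewrite bE; apply: (lipD (bb_lip i)); apply: lip_sum => l.
  by apply: lipM (sg_lip i l) (sg_bnd i l) (bhc_lip l Aa) (bhb l).
have b0 i : @bnd R n (fun s _ => b_clp alpha s 0 i 0).
  have [M M0 hM] : bnd (fun s y => \sum_l sigma_clp s y i l * bh_clp alpha l s y).
    by apply: bnd_sum => l; exact: bndM (sg_bnd i l) (bhb l).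
  exists (L0 + M) => [|s _]; first exact: addr_ge0.
  rewrite (bc_coord _ _ _ Aa.2); apply: le_trans (ler_normD _ _) _; apply: lerD; last exact: hM.
  apply: le_trans (enorm_coord _ i 0) _; apply: le_trans (HL (cI T0 s)).1; by rewrite -addrA lerDl addr_ge0 // enorm_ge0.
have mono (K K' : R) (y : 'cV[R]_n) : K <= K' -> K * nsq y <= K' * nsq y by move=> h; rewrite ler_wpM2r ?nsq_ge0.
have [K1 p1 h1] := finite_bound (Q := fun i K => forall s x y, (b_clp alpha s x i 0 - b_clp alpha s y i 0) ^+ 2 <= K * nsq (x - y))
  (fun i K K' le h s x y => le_trans (h s x y) (mono _ _ _ le)) (fun i => lip_sqr (bl i)).
have [K2 p2 h2] := finite_bound (Q := fun ij K => forall s x y, (sigma_clp s x ij.1 ij.2 - sigma_clp s y ij.1 ij.2) ^+ 2 <= K * nsq (x - y))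
  (fun i K K' le h s x y => le_trans (h s x y) (mono _ _ _ le)) (fun ij : 'I_n * 'I_d => lip_sqr (sg_lip ij.1 ij.2)).
have [K3 p3 h3] := finite_bound (Q := fun i K => forall s (y : 'cV[R]_n), b_clp alpha s 0 i 0 ^+ 2 <= K)
  (fun i K K' le h s y => le_trans (h s y) le) (fun i => bnd_sqr (b0 i)).
have [K4 p4 h4] := finite_bound (Q := fun ij K => forall s y, sigma_clp s y ij.1 ij.2 ^+ 2 <= K)
  (fun i K K' le h s y => le_trans (h s y) le) (fun ij : 'I_n * 'I_d => bnd_sqr (sg_bnd ij.1 ij.2)).
exists (K1 + K2 + K3 + K4); split.
- by rewrite !addr_ge0.
- by split=> [i|i j]; [have [K [_ cf _]] := bl i|have [K [_ cf _]] := sg_lip i j]; exact: cf.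
- by move=> s x y i; apply: le_trans (h1 i s x y) (mono _ _ _ _); rewrite -!addrA lerDl !addr_ge0.
- move=> s x y i j; apply: le_trans (h2 (i, j) s x y) (mono _ _ _ _); lra.
- split=> [s i|s x i j]; first by apply: le_trans (h3 i s 0) _; lra.
  by apply: le_trans (h4 (i, j) s x) _; lra.
Qed.

(** * Well-posedness of the controlled equation *)

Section Base.
Variables (B : stoch_base R d) (t : R).
Hypotheses (HB : brownian B t T) (tI : 0 <= t <= T).
Local Notation P := (Pr B).
Local Notation "'E[' f ]" := (Rintegral P setT f).
Local Notation nsol := (@nsol R d B t T n).

Let tT : t <= T. Proof. by case/andP: tI. Qed.
Let inI s : t <= s <= T -> 0 <= s <= T.
Proof. by case/andP: tI => t0 _ /andP[ts ->]; rewrite (le_trans t0 ts). Qed.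

Lemma ito_eq (Z Z' : R -> Omega B -> 'cV[R]_d) M : (forall s w, t <= s <= T -> Z s w = Z' s w) ->
  ito t T Z M -> ito t T Z' M.
Proof.
move=> ZZ [[pZ fZ] pM cM [H [wH lH iH]]]; split; [split| exact: pM | exact: cM |].
- move=> i s U st mU; have e : [set z : R * Omega B | t <= z.1 <= s /\ U (Z z.1 z.2 i 0)] = [set z | t <= z.1 <= s /\ U (Z' z.1 z.2 i 0)].
    apply/seteqP; split=> z /= [h1 h2]; (split; first exact: h1);
      move: h2; rewrite ZZ //; case/andP: h1 => -> h3; rewrite (le_trans h3) //; by case/andP: st.
  by rewrite -e; exact: pZ.
- apply: le_lt_trans fZ; apply: ler_eq; apply/esym; apply: eq_integral => w _; apply: eq_integral => s /set_mem /=.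
  by rewrite in_itv /= => /ZZ ->.
exists H; split; [exact: wH| |exact: iH].
apply: cvg_trans lH; apply: near_eq_cvg; apply: nearW => k; apply: eq_integral => w _; apply: eq_integral => s /set_mem /=.
by rewrite in_itv /= => /ZZ ->.
Qed.

Lemma esol_eq bt bt' sg sg' x X : (forall s y, t <= s <= T -> bt s y = bt' s y /\ sg s y = sg' s y) ->
  @esol R d B t T n bt sg x X -> esol t T bt' sg' x X.
Proof.
move=> h [pX [M [iM eM]]]; split => //; exists M; split.
  by move=> i; apply: ito_eq (iM i) => s w st; rewrite (h _ _ st).2.
have bE w i s : `[t, T]%classic s -> bt s (X s w) i 0 = bt' s (X s w) i 0.
  by rewrite /= in_itv /= => st; rewrite (h _ _ st).1.
apply: filterS eM => w hw i; have [h1 h2] := hw i; split.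
  by apply: eq_integrable h1 => // s /set_mem st /=; rewrite bE.
move=> s st; rewrite h2 //; congr (_ + _ + _); apply: eq_Rintegral => r /set_mem rt; apply: bE.
move: rt; rewrite /= !in_itv /= => /andP[-> h3]; rewrite (le_trans h3) //; by case/andP: st.
Qed.

Lemma sde_esol alpha x X : sde_sol (B := B) p alpha t x X <-> esol t T (b_clp alpha) sigma_clp x X.
Proof.
have e s y : t <= s <= T -> b p s y (alpha s y) = b_clp alpha s y /\ sigma p s y = sigma_clp s y.
  by move=> /inI st; rewrite /b_clp /sigma_clp clp_id.
split=> h; first exact: (esol_eq e h).
have e' s y : t <= s <= T -> b_clp alpha s y = b p s y (alpha s y) /\ sigma_clp s y = sigma p s y by move=> st; have [-> ->] := e s y st.
exact: (esol_eq e' h).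
Qed.

Lemma sde_exists alpha x : Adm alpha -> exists X, sde_sol (B := B) p alpha t x X.
Proof.
move=> Aa; have [L cf] := coefs Aa; have [X sX] := nsol_exists HB tT cf x.
by exists X; apply/sde_esol; exact: (nsol_esol HB tT cf sX).
Qed.

Lemma sde_unique alpha x X X' : Adm alpha -> sde_sol (B := B) p alpha t x X -> nsol (b_clp alpha) sigma_clp x X' ->
  {ae P, forall w s, t <= s <= T -> X s w = X' s w}.
Proof.
move=> Aa /sde_esol eX sX'; have [L cf] := coefs Aa; have [Y sY XY] := esol_nsol HB tT cf eX.
have YX := nsol_unique HB tT cf sY sX'.
by apply: filterS2 XY YX => w h1 h2 s st; rewrite h1 // h2.
Qed.

Lemma state_ae alpha x X : Adm alpha -> nsol (b_clp alpha) sigma_clp x X ->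
  {ae P, forall w s, t <= s <= T -> state p alpha t x s w = X s w}.
Proof.
by move=> Aa sX; apply: (sde_unique Aa) sX; exact: (xgetPex _ (sde_exists x Aa)).
Qed.

End Base.

(** * Value functions along a behaviour process *)

Local Notation bc := b_clp.
Local Notation sgc := sigma_clp.
Local Notation fc := f_clp.
Local Notation bhc := bh_clp.

Lemma Adm_admissible (Bf : R -> 'cV[R]_n -> stoch_base R d) alpha :
  (forall t x, 0 <= t <= T -> brownian (Bf t x) t T) -> Adm alpha -> admissible p Bf alpha.
Proof.
move=> HB Aa; have [Av ca] := Adm_ctl Aa; split => //.
  move=> O oO; pose G := [set V : set (R * 'cV[R]_n) | open V].
  pose D := [set z : R * 'cV[R]_n | 0 <= z.1 <= T].
  (* On [D] the policy agrees with its clamped version, which is continuous, and [D] is Borel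
     because it is closed. *)
  have e : D `&` (fun z => alpha z.1 z.2) @^-1` O = D `&` (fun z => alpha (c z.1) z.2) @^-1` O.
    by apply/seteqP; split => z /= [zI]; rewrite clp_id.
  have cD : closed D.
    rewrite (_ : D = fst @^-1` `[0, T]%classic); last by apply/seteqP; split => z /=; rewrite in_itv.
    by apply: closed_comp => [z _|]; [exact: cvg_fst|exact: interval_closed].
  rewrite e; apply: (@measurableI _ (g_sigma_algebraType G)).
    rewrite -(setCK D); apply: (@measurableC _ (g_sigma_algebraType G)).
    by apply: sub_gen_smallest; rewrite /G /= openC.
  by apply: sub_gen_smallest; move/continuousP: ca; exact.
move=> t x tI; split; first exact: (sde_exists (HB t x tI)).
move=> X X' sX sX'; have [L cf] := coefs Aa; have tT : t <= T by case/andP: tI.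
have [Y sY] := nsol_exists (HB t x tI) tT cf x.
have XY := sde_unique (HB t x tI) tI Aa sX sY; have XY' := sde_unique (HB t x tI) tI Aa sX' sY.
by apply: filterS2 XY XY' => w h h' s st; rewrite h // h'.
Qed.

(** The Cauchy problem with its gradient exposed. Nothing is asked of the policy, so that v* with
    its greedy policy fits the same definition as the costs of admissible policies. *)
Definition hsol alpha (w : R -> 'cV[R]_n -> R) wx := exists wt wxx,
  [/\ C12 T w wt wx wxx, CbUniLip p wx,
      forall t x, 0 <= t < T -> 0 = generator p wt wx wxx (alpha t x) t x + f p t x (alpha t x)
    & forall x, w T x = g p x].

Definition sgrad wx l s y := \sum_i wx (c s) y i 0 * sgc s y i l.

(** The driver of the subroutine's backward equation at Z = sigma^T dw, when states follow [alphab].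
    For [alphab] equal to [alpha] only the running cost remains. *)
Definition driver alpha alphab wx s y := fc alpha s y + \sum_l (bhc alpha l s y - bhc alphab l s y) * sgrad wx l s y.

Let cont_lip h : lip h -> continuous (fun z : R * 'cV[R]_n => h z.1 z.2).
Proof. by move=> [K [_ cf _]]. Qed.

Let wx_cont wx i : CbUniLip p wx -> continuous (fun z : R * 'cV[R]_n => wx (c z.1) z.2 i 0).
Proof. by move=> /(CbUniLipP T0)[h _]; exact: cont_lip (h i). Qed.

Lemma zeta_cont wx l : CbUniLip p wx -> continuous (fun z : R * 'cV[R]_n => sgrad wx l z.1 z.2).
Proof. by move=> cw z; apply: cvg_sumF => i; apply: cvgM; [exact: wx_cont|exact: (cont_lip (sg_lip i l))]. Qed.

Lemma drv_cont alpha alphab wx : ctl alpha -> ctl alphab -> CbUniLip p wx ->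
  continuous (fun z : R * 'cV[R]_n => driver alpha alphab wx z.1 z.2).
Proof.
move=> ca cb cw z; apply: cvgD; first exact: (fc_cont ca).
apply: cvg_sumF => l; apply: cvgM; last exact: zeta_cont.
by apply: cvgB; [exact: (bhc_cont ca)|exact: (bhc_cont cb)].
Qed.

(* the equation, extended to the terminal time by continuity *)
Lemma pde alpha w wt wx wxx : ctl alpha -> C12 T w wt wx wxx -> CbUniLip p wx ->
  (forall t x, 0 <= t < T -> 0 = generator p wt wx wxx (alpha t x) t x + f p t x (alpha t x)) ->
  forall s y, wt (c s) y + \sum_i wx (c s) y i 0 * bc alpha s y i 0 +
    2^-1 * (\sum_i \sum_k wxx (c s) y i k * \sum_l sgc s y i l * sgc s y k l) = - fc alpha s y.
Proof.
move=> [Aa ca] [[_ cwt] [_ cwxx] _ _ _] cwx eq s y; apply/eqP; rewrite -addr_eq0; apply/eqP.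
pose G s := wt (c s) y + \sum_i wx (c s) y i 0 * bc alpha s y i 0 +
    2^-1 * (\sum_i \sum_k wxx (c s) y i k * \sum_l sgc s y i l * sgc s y k l) + fc alpha s y.
have G0 r : 0 <= r < T -> G r = 0.
  move=> rT; have rI : 0 <= r <= T by case/andP: rT => -> /ltW.
  apply: etrans (esym (eq r y rT)); rewrite /generator /G /f_clp /sigma_clp /b_clp (clp_id rI); congr (_ + _ + _ * _ + _).
    by apply: eq_bigr => i _; rewrite mulrC.
  rewrite /mxtrace exchange_big /=; apply: eq_bigr => k _; rewrite mxE; apply: eq_bigr => i _.
  rewrite mxE mulrC; congr (_ * _); apply: eq_bigr => l _; rewrite mxE mulrC //.
have cG : continuous G.
  pose F (z : R * 'cV[R]_n) := wt (c z.1) z.2 + \sum_i wx (c z.1) z.2 i 0 * (bb p (c z.1) z.2 i 0 + \sum_l sgc z.1 z.2 i l * bhc alpha l z.1 z.2) +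
    2^-1 * (\sum_i \sum_k wxx (c z.1) z.2 i k * \sum_l sgc z.1 z.2 i l * sgc z.1 z.2 k l) + fc alpha z.1 z.2.
  have cF : continuous F.
    have csg i l := cont_lip (sg_lip i l).
    have cbb i : continuous (fun z : R * 'cV[R]_n => bb p (c z.1) z.2 i 0).
      exact: cont_lip (comp_lip T0 Hbb (a := fun _ _ => 0) (fun i => lip_cst _ _) (fun _ _ => A0) i 0).
    move=> z; apply: cvgD; last exact: (fc_cont (conj Aa ca)).
    apply: cvgD; last first.
      apply: cvgM; first exact: cvg_cst.
      apply: cvg_sumF => i; apply: cvg_sumF => k; apply: cvgM; first exact: (continuous_entry (clamp_continuous T0 cwxx)).
      by apply: cvg_sumF => l; apply: cvgM; exact: csg.
    apply: cvgD; first exact: (clamp_continuous T0 cwt).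
    apply: cvg_sumF => i; apply: cvgM; first exact: wx_cont.
    apply: cvgD; first exact: cbb.
    by apply: cvg_sumF => l; apply: cvgM; [exact: csg|exact: (bhc_cont (conj Aa ca))].
  have -> : G = F \o (fun s => (s, y)).
    apply/funext => r; rewrite /F /G /=; congr (_ + _ + _ + _); apply: eq_bigr => i _.
    by rewrite (bc_coord _ _ _ Aa).
  move=> r; apply: continuous_comp; last exact: cF.
  by apply: (@cvg_pair _ _ _ _ (nbhs r) (nbhs y)); [exact: cvg_id|exact: cvg_cst].
have GT : G T = 0.
  have cv : (fun k : nat => T - T * k.+1%:R^-1) @ \oo --> T.
    rewrite -[X in _ --> X]subr0; apply: cvgB; first exact: cvg_cst.
    by apply: cvgMl0; exact: cvg_harmonic.
  have c1 := cvg_comp _ _ cv (cG T); apply: (cvg_unique _ c1); first exact: norm_hausdorff.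
  apply: cvg_near_cst; apply: nearW => k; apply: G0; have Tp := T_gt0.
  rewrite subr_ge0 ger_pMr // invf_le1 ?ltr0n // ler1n /= ltrBlDr ltrDl mulr_gt0 // invr_gt0 ltr0n //.
have -> : wt (c s) y + \sum_i wx (c s) y i 0 * bc alpha s y i 0 +
    2^-1 * (\sum_i \sum_k wxx (c s) y i k * \sum_l sgc s y i l * sgc s y k l) + fc alpha s y = G (c s).
  by rewrite /G /fc /sgc /bc (clp_id (cI T0 s)).
have /andP[c0 cT] := cI T0 s; have [ct|tc] := ltP (c s) T; first by apply: G0; rewrite c0.
by have -> : c s = T by apply/eqP; rewrite eq_le cT.
Qed.

Section Base.
Variables (B : stoch_base R d) (t : R).
Hypotheses (HB : brownian B t T) (tI : 0 <= t <= T).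
Local Notation P := (Pr B).
Local Notation lm := (leb \x P)%E.
Local Notation "'E[' f ]" := (Rintegral P setT f).
Local Notation band := (@band R d B).
Local Notation isint := (@isint R d B t).
Local Notation nsol := (@nsol R d B t T n).
Local Notation mbd r s := (@measurable_band R d B r s).
Let tT : t <= T. Proof. by case/andP: tI. Qed.

Variables (alphab : policy R n m) (x : 'cV[R]_n) (X : R -> Omega B -> 'cV[R]_n).
Hypotheses (Ab : Adm alphab) (sX : nsol (bc alphab) sgc x X).
Let pX : process t T X. Proof. by case: sX. Qed.

(** Ito's formula produces the generator of [alphab], while [w] solves the equation of [alpha]. In
    the difference of drifts [bb] cancels and [sigma] factors out, leaving the pairing of the [bh]
    difference with sigma^T dw, that is, the correction in [driver]. *)
Lemma representation alpha w wx : ctl alpha -> hsol alpha w wx -> forall r s, t <= r -> r <= s -> s <= T ->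
  isint r s (fun l z => sgrad wx l z.1 (X z.1 z.2))
    (fun o => w (c s) (X s o) - w (c r) (X r o) - I[r, s] (fun v => - driver alpha alphab wx v (X v o))).
Proof.
move=> ca [wt [wxx [C cw eq _]]] r s tr rs sT; have [L cf] := coefs Ab.
have [K sm] : exists K, smooth_data t T (fun s x => w (c s) x) (fun s x => wt (c s) x) (fun i s x => wx (c s) x i 0)
    (fun i j s x => wxx (c s) x i j) K.
  by apply: C12_smooth => //; case/andP: tI.
have := ito_formula HB tT cf sX tr rs sT sm; congr isint; apply/funext => o; congr (_ - _).
apply: ci_eq => v _; have := pde ca C cw eq v (X v o) => e.
have -> : driver alpha alphab wx v (X v o) = fc alpha v (X v o) +
   (\sum_i wx (c v) (X v o) i 0 * bc alpha v (X v o) i 0 - \sum_i wx (c v) (X v o) i 0 * bc alphab v (X v o) i 0).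
  congr (_ + _); rewrite -sumrB /sgrad.
  under eq_bigr => l _ do rewrite mulr_sumr.
  rewrite exchange_big /=; apply: eq_bigr => i _.
  rewrite (bc_coord v (X v o) i (proj1 ca)) (bc_coord v (X v o) i (proj2 Ab)) -mulrBr opprD addrACA subrr add0r -sumrB mulr_sumr.
  by apply: eq_bigr => l _; ring.
rewrite -[fc _ _ _]opprK -e /drift_path; ring.
Qed.

Lemma X_start o : X t o = x. Proof. by case: sX. Qed.

Lemma zeta_L2 alpha w wx l : ctl alpha -> hsol alpha w wx -> L2 lm (band t T) (fun z => sgrad wx l z.1 (X z.1 z.2)).
Proof. by move=> ca hw; have [_ h] := isint_L2 (representation ca hw (lexx t) tT (lexx T)); exact: h. Qed.

Let cont_band (F : R * 'cV[R]_n -> R) : continuous F ->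
  mband (fun z => F (z.1, X z.1 z.2)) t T.
Proof. by move=> cF; have [a h] := process_comp tT pX cF; exact: (band_meas HB tT a h (lexx t) (lexx T)). Qed.

Lemma delta_itg alpha1 alpha2 w1 w2 wx1 wx2 : ctl alpha1 -> ctl alpha2 -> hsol alpha1 w1 wx1 -> hsol alpha2 w2 wx2 ->
  itg lm (band t T) (fun z => \sum_l (sgrad wx1 l z.1 (X z.1 z.2) - sgrad wx2 l z.1 (X z.1 z.2)) ^+ 2).
Proof.
move=> c1 c2 h1 h2; apply: (itg_sum (mbd t T)) => l.
exact: (L2B (mbd t T) (zeta_L2 l c1 h1) (zeta_L2 l c2 h2)).2.
Qed.

(** Along the common behaviour process the difference of the two solutions satisfies a linear
    backward equation with zero terminal value, to which [energy] applies. [psi] is the part of the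
    driver bound that the gradient difference does not account for. *)
Lemma compare alpha1 alpha2 w1 w2 wx1 wx2 psi K N :
  ctl alpha1 -> ctl alpha2 -> hsol alpha1 w1 wx1 -> hsol alpha2 w2 wx2 ->
  itg lm (band t T) psi -> (forall z, 0 <= psi z) ->
  {ae lm, forall z, band t T z -> (driver alpha1 alphab wx1 z.1 (X z.1 z.2) - driver alpha2 alphab wx2 z.1 (X z.1 z.2)) ^+ 2 <=
    K * (\sum_l (sgrad wx1 l z.1 (X z.1 z.2) - sgrad wx2 l z.1 (X z.1 z.2)) ^+ 2 + psi z)} ->
  16 * K * (T - t) <= N.+1%:R ->
  (w1 t x - w2 t x) ^+ 2 +
  7 / 8 * weighted t T N (fun z => \sum_l (sgrad wx1 l z.1 (X z.1 z.2) - sgrad wx2 l z.1 (X z.1 z.2)) ^+ 2) <=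
  8^-1 * weighted t T N psi.
Proof.
move=> c1 c2 hs1 hs2 ipsi psi0 hK hN.
have [wt1 [wxx1 [[[cw1 _] _ _ _ _] cb1 _ e1]]] := hs1; have [wt2 [wxx2 [[[cw2 _] _ _ _ _] cb2 _ e2]]] := hs2.
pose J (z : R * Omega B) := - driver alpha1 alphab wx1 z.1 (X z.1 z.2) + driver alpha2 alphab wx2 z.1 (X z.1 z.2).
pose D s o := w1 (c s) (X s o) - w2 (c s) (X s o).
have cJ : continuous (fun z : R * 'cV[R]_n => - driver alpha1 alphab wx1 z.1 z.2 + driver alpha2 alphab wx2 z.1 z.2).
  by move=> z; apply: cvgD; [apply: cvgN|]; apply: drv_cont => //; exact: (Adm_ctl Ab).
have [_ cdJ] := process_comp tT pX cJ.
have cD : continuous (fun z : R * 'cV[R]_n => w1 (c z.1) z.2 - w2 (c z.1) z.2).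
  by move=> z; apply: cvgB; [exact: (clamp_continuous T0 cw1)|exact: (clamp_continuous T0 cw2)].
have [aD _] := process_comp tT pX cD.
have iB : itg lm (band t T) (fun z => K * (\sum_l (sgrad wx1 l z.1 (X z.1 z.2) - sgrad wx2 l z.1 (X z.1 z.2)) ^+ 2 + psi z)).
  by apply: (itgZ (mbd t T)); apply: (itgD (mbd t T)) => //; exact: delta_itg c1 c2 hs1 hs2.
have hJ : {ae lm, forall z, band t T z -> J z ^+ 2 <=
    K * (\sum_l (sgrad wx1 l z.1 (X z.1 z.2) - sgrad wx2 l z.1 (X z.1 z.2)) ^+ 2 + psi z)}.
  by apply: ae_mono hK => z h bz; rewrite /J -sqrrN opprD opprK; exact: h.
have LJ : L2 lm (band t T) J.
  have mJ : measurable_fun (band t T : set (measurableTypeR R * Omega B)) J by exact: cont_band cJ.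
  split => //; apply: (itg_le_ae (mbd t T) _ iB); first exact: measurable_funX.
  by apply: ae_mono hJ => z h bz; rewrite ger0_norm ?sqr_ge0 //; exact: h.
have := @energy R d B t T HB tT D (fun l z => sgrad wx1 l z.1 (X z.1 z.2) - sgrad wx2 l z.1 (X z.1 z.2)) J psi K aD _ LJ ipsi psi0 hJ _ N hN.
have -> : E[fun o => D t o ^+ 2] = (w1 t x - w2 t x) ^+ 2.
  rewrite -[RHS](E_cst B); apply: E_eq => o _; rewrite /D X_start clp_id //.
apply; first by apply: aeW => o; rewrite /D clp_id ?lexx ?T0 // e1 e2 subrr.
move=> r s tr rs sT; exists (fun o => (w1 (c s) (X s o) - w1 (c r) (X r o) - I[r, s] (fun v => - driver alpha1 alphab wx1 v (X v o))) +
    - (w2 (c s) (X s o) - w2 (c r) (X r o) - I[r, s] (fun v => - driver alpha2 alphab wx2 v (X v o)))).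
  by apply: isintD; [exact: representation c1 hs1 _ _ tr rs sT|apply: isintN; exact: representation c2 hs2 _ _ tr rs sT].
apply: aeW => o.
have cc alpha wx : ctl alpha -> CbUniLip p wx -> itg leb `[r, s]%classic (fun v => - driver alpha alphab wx v (X v o)).
  move=> ca cw; apply: itgN.
  have [_ h] := process_comp tT pX (drv_cont ca (Adm_ctl Ab) cw).
  exact: (cpath_itg (D := fun s o => driver alpha alphab wx s (X s o)) o h tr sT).
have -> : I[r, s] (fun u => J (u, o)) = I[r, s] (fun v => - driver alpha1 alphab wx1 v (X v o)) - I[r, s] (fun v => - driver alpha2 alphab wx2 v (X v o)).
  by rewrite -(EB (mcci r s) (cc _ _ c1 cb1) (cc _ _ c2 cb2)); apply: ci_eq => v _; rewrite opprK.
rewrite /D; ring.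
Qed.

(** The initial value is deterministic and the stochastic integral centred. The behaviour policy is
    free: taking [alpha] itself gives the expected cost, another one gives the form in which two
    policies can be compared pointwise. *)
Lemma feynman_kac alpha w wx : ctl alpha -> hsol alpha w wx ->
  itg P setT (fun o => g p (X T o) + I[t, T] (fun v => driver alpha alphab wx v (X v o))) /\
  w t x = E[fun o => g p (X T o) + I[t, T] (fun v => driver alpha alphab wx v (X v o))].
Proof.
move=> ca hw; have is_ := representation ca hw (lexx t) tT (lexx T).
have [wt [wxx [_ cw _ e]]] := hw.
have i1 := L2_itgP (isint_L2 is_).1.
have L1 : @L2F R d B t t (fun=> 1 : R).
  split; first exact: measurable_cst.
  by split; [exact: measurable_cst|apply: (itg_eq mT) (itg_cst B 1) => o _; rewrite expr1n].
have := isint_mean HB (lexx t) (lexx T) is_ L1.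
have E1 o : w (c T) (X T o) - w (c t) (X t o) - I[t, T] (fun v => - driver alpha alphab wx v (X v o)) =
   g p (X T o) + I[t, T] (fun v => driver alpha alphab wx v (X v o)) - w t x.
  have [_ h] := process_comp tT pX (drv_cont ca (Adm_ctl Ab) cw).
  rewrite (EN (mcci t T)); last exact: (cpath_itg (D := fun s o => driver alpha alphab wx s (X s o)) o h (lexx t) (lexx T)).
  by rewrite X_start !clp_id ?lexx ?T0 // e; ring.
have i2 : itg P setT (fun o => g p (X T o) + I[t, T] (fun v => driver alpha alphab wx v (X v o)) - w t x).
  by apply: (itg_eq mT) i1 => o _; rewrite E1.
have i3 : itg P setT (fun o => g p (X T o) + I[t, T] (fun v => driver alpha alphab wx v (X v o))).
  by apply: (itg_eq mT) (itgD mT i2 (itg_cst B (w t x))) => o _; ring.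
move=> e0; split => //; apply/eqP; rewrite eq_sym -subr_eq0; apply/eqP.
rewrite -[X in _ - X](E_cst B) -(EB mT i3 (itg_cst B _)) -[RHS]e0.
by apply: E_eq => o _; rewrite mul1r E1.
Qed.

End Base.

Lemma complete_measurable (B : stoch_base R d) (h h' : Omega B -> \bar R) : measure_is_complete (Pr B) ->
  measurable_fun setT h' -> {ae Pr B, forall o, h o = h' o} -> measurable_fun setT h.
Proof.
move=> cP mh' e _ U mU; rewrite setTI; pose N := [set o | h o <> h' o].
have nN : (Pr B).-negligible N by apply: negligibleS e => o /= h1 h2; exact: h1.
have -> : h @^-1` U = (h' @^-1` U `\` N) `|` (N `&` h @^-1` U).
  apply/seteqP; split=> [w /= gU|w /=].
    have [E|E] := pselect (N w); [by right|left; split => //].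
    by have <- : h w = h' w by apply: contrapT.
  by case=> [[fU nN']|[_ gU]] //; have -> : h w = h' w by apply: contrapT.
apply: measurableU; last by apply: cP; apply: negligibleS nN => o [].
by apply: measurableD; [rewrite -[X in measurable X]setTI; exact: mh'|exact: cP].
Qed.

(** [value] uses an arbitrarily chosen solution and an extended-real integral. The chosen solution
    agrees almost surely with one having continuous paths, and completeness of the base makes the
    original integrand measurable. *)
Lemma value_eq (B : stoch_base R d) t x alpha w wx : brownian B t T -> 0 <= t <= T -> Adm alpha -> hsol alpha w wx ->
  value p B alpha t x = (w t x)%:E.
Proof.
move=> HB tI Aa hw; have [L cf] := coefs Aa; have tT : t <= T by case/andP: tI.
have [X sX] := nsol_exists HB tT cf x; have [i e] := feynman_kac HB tI Aa sX (Adm_ctl Aa) hw.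
have [_ [wxx [_ cw _ _]]] := hw; have [pX _ _] := sX.
rewrite e -(EFin_E mT i) /value; have sa := state_ae HB tI Aa sX.
have ae : {ae Pr B, forall o, (\int[leb]_(s in `[t, T]) (f p s (state p alpha t x s o) (alpha s (state p alpha t x s o)))%:E
    + (g p (state p alpha t x T o))%:E)%E = (g p (X T o) + I[t, T] (fun v => driver alpha alpha wx v (X v o)))%:E}.
  apply: filterS sa => o h; have TT : t <= T <= T by rewrite tT lexx.
  rewrite h // addrC EFinD; congr (_ + _)%E.
  have [_ hh] := process_comp tT pX (drv_cont (Adm_ctl Aa) (Adm_ctl Aa) cw).
  have J := cpath_itg (D := fun s o => driver alpha alpha wx s (X s o)) o hh (lexx t) (lexx T).
  rewrite -(EFin_E (mcci t T) J); apply: eq_integral => s /set_mem /=; rewrite in_itv /= => sI.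
  rewrite h // /driver big1 ?addr0 => [|l _]; last by rewrite subrr mul0r.
  by rewrite /fc clp_id //; case/andP: sI => ts ->; case/andP: tI => t0 _; rewrite (le_trans t0 ts).
have mi := itg_meas i; apply: ae_eq_integral => //; last by apply: filterS ae => o h _.
- by apply: (complete_measurable _ _ ae); [case: HB|exact/measurable_EFinP].
- exact/measurable_EFinP.
Qed.

Implicit Types (z : R -> 'cV[R]_n -> 'cV[R]_d).
Local Notation zeta := sgrad.
Local Notation drv := driver.

Let Hmu : UniLip [set t : R | 0 <= t <= T] setT setT (Defs.mu p). Proof. by case: reg => -[]. Qed.
Let HL1 t : 0 <= t <= T -> enorm (bb p t 0) + enorm (Defs.mu p t 0 0) + `|f p t 0 0| <= L0.
Proof. by case: reg => _ [_ _ h] tI; exact: (h t tI).1. Qed.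

Lemma drv_own alpha wx s y : drv alpha alpha wx s y = fc alpha s y.
Proof. by rewrite /driver big1 ?addr0 // => l _; rewrite subrr mul0r. Qed.

(** * A priori bound on the gradient of a cost *)

Section Bounds.
Variable Bf : R -> 'cV[R]_n -> stoch_base R d.
Hypothesis HB : forall t x, 0 <= t <= T -> brownian (Bf t x) t T.

(* both initial points are started on the same base, and w is the expected cost *)
Lemma w_lip alpha w wx : Adm alpha -> hsol alpha w wx ->
  exists2 K, 0 <= K & forall s x y, `|w (c s) x - w (c s) y| <= K * enorm (x - y).
Proof.
move=> Aa hw; have [L cf] := coefs Aa; have ca := Adm_ctl Aa.
have [Kf [Kf0 _ hf]] := fc_lip Aa; have [Kg [Kg0 _ hg]] := g_lip.
(* The stability constant is taken at length [T], which bounds every T - t, so the result is uniform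
   in time. In [C] the first term is the terminal cost; in the second, one factor T comes from
   Cauchy-Schwarz in time and the other from integrating the stability estimate. *)
pose S := `|stability_constant d n L T|; pose C := 2 * (Kg ^+ 2 * S) + 2 * T * (Kf ^+ 2 * (S * T)).
have S0 : 0 <= S := normr_ge0 _.
have C0 : 0 <= C.
  have k1 : 0 <= Kg ^+ 2 * S by rewrite mulr_ge0 ?sqr_ge0.
  have k2 : 0 <= T * (Kf ^+ 2 * (S * T)) by rewrite mulr_ge0 // mulr_ge0 ?sqr_ge0 // mulr_ge0.
  rewrite /C; lra.
exists (Num.sqrt C); first exact: sqrtr_ge0.
move=> s x y; have tI := cI T0 s; have tT : c s <= T by case/andP: tI.
have hB := HB x tI; set t := c s in tI tT hB *.
have [X sX] := nsol_exists hB tT cf x; have [Y sY] := nsol_exists hB tT cf y.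
have [iX eX] := feynman_kac hB tI Aa sX ca hw; have [iY eY] := feynman_kac hB tI Aa sY ca hw.
have [pX _ _] := sX; have [pY _ _] := sY; have TT : t <= T <= T by rewrite tT lexx.
have [ah ch] := nsq_process tT (processB pX pY).
have st u : t <= u <= T -> itg (Pr (Bf t x)) setT (fun o => nsq (X u o - Y u o)) /\
    Rintegral (Pr (Bf t x)) setT (fun o => nsq (X u o - Y u o)) <= S * nsq (x - y).
  move=> uI; have tT' : T - t <= T by rewrite lerBlDr lerDl; case/andP: tI.
  have [i e] := nsol_stability hB tT cf tT' sX sY uI; split => //; apply: le_trans e _.
  by rewrite ler_wpM2r ?nsq_ge0 // ler_norm.
have [_ iI eI Jh _] := band_proc hB tT (lexx t) tT (lexx T) ah ch (fun u w _ => nsq_ge0 _) st.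
have [iT eT] := st _ TT.
pose a o := g p (X T o) - g p (Y T o) + (I[t, T] (fun v => fc alpha v (X v o)) - I[t, T] (fun v => fc alpha v (Y v o))).
have aE o : (g p (X T o) + I[t, T] (fun v => drv alpha alpha wx v (X v o))) - (g p (Y T o) + I[t, T] (fun v => drv alpha alpha wx v (Y v o))) = a o.
  rewrite /a opprD addrACA; congr (_ + (_ - _)); apply: ci_eq => v _; exact: drv_own.
have ia : itg (Pr (Bf t x)) setT a by apply: (itg_eq mT) (itgB mT iX iY) => o _; rewrite aE.
pose r o := 2 * (Kg ^+ 2 * nsq (X T o - Y T o)) + 2 * T * (Kf ^+ 2 * I[t, T] (fun v => nsq (X v o - Y v o))).
have i1 := itgZ mT 2 (itgZ mT (Kg ^+ 2) iT).
have i2 := itgZ mT (2 * T) (itgZ mT (Kf ^+ 2) iI).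
have ar o : a o ^+ 2 <= r o.
  have [_ cX] := process_comp tT pX (fc_cont ca); have [_ cY] := process_comp tT pY (fc_cont ca).
  have JX := cpath_itg (D := fun s o => fc alpha s (X s o)) o cX (lexx t) (lexx T).
  have JY := cpath_itg (D := fun s o => fc alpha s (Y s o)) o cY (lexx t) (lexx T).
  have Jn := cpath_itg (D := fun s o => nsq (X s o - Y s o)) o ch (lexx t) (lexx T).
  have mI := mcci t T; have J1 := itgB mI JX JY.
  have sq (K h : R) (u v : 'cV[R]_n) : 0 <= K -> `|h| <= K * enorm (u - v) -> h ^+ 2 <= K ^+ 2 * nsq (u - v).
    move=> K0 hh; rewrite -enorm_nsq -exprMn -[leLHS]real_normK ?num_real //.
    by rewrite ler_pXn2r ?nnegrE // mulr_ge0 ?enorm_ge0.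
  have J2 : itg leb `[t, T]%classic (fun v => (fc alpha v (X v o) - fc alpha v (Y v o)) ^+ 2).
    apply: (itg_le mI _ (itgZ mI (Kf ^+ 2) Jn)); first by apply: measurable_funX; exact: itg_meas J1.
    by move=> v _; rewrite ger0_norm ?sqr_ge0 //; apply: sq => //; exact: hf.
  have b1 : I[t, T] (fun v => fc alpha v (X v o) - fc alpha v (Y v o)) ^+ 2 <= T * (Kf ^+ 2 * I[t, T] (fun v => nsq (X v o - Y v o))).
    apply: le_trans (ci_CS tT (conj (itg_meas J1) J2)) _; rewrite -(EZ mI _ Jn); apply: ler_pM.
    - by rewrite subr_ge0.
    - by apply: ci_ge0 => v _; exact: sqr_ge0.
    - by rewrite lerBlDr lerDl; case/andP: tI.
    - by apply: (ci_le J2 (itgZ mI _ Jn)) => v _; apply: sq => //; exact: hf.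
  have b2 : (g p (X T o) - g p (Y T o)) ^+ 2 <= Kg ^+ 2 * nsq (X T o - Y T o) by apply: sq => //; exact: (hg 0).
  rewrite /a /r -(EB mI JX JY); apply: le_trans (sqrD_le _ _) _; rewrite -mulrA.
  by apply: lerD; rewrite ler_wpM2l.
have La : L2 (Pr (Bf t x)) setT a.
  split; first exact: itg_meas ia.
  apply: (itg_le mT _ (itgD mT i1 i2)); first by apply: measurable_funX; exact: itg_meas ia.
  by move=> o _; rewrite ger0_norm ?sqr_ge0.
have -> : w t x - w t y = Rintegral (Pr (Bf t x)) setT a.
  by rewrite eX eY -(EB mT iX iY); apply: E_eq => o _; exact: aE.
have ne := le_trans (E_abs mT ia) (E_abs_nrm La); apply: le_trans ne _.
have -> : enorm (x - y) = Num.sqrt (nsq (x - y)) by rewrite -enorm_nsq sqrtr_sqr ger0_norm ?enorm_ge0.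
rewrite -sqrtrM // /nrm ler_wsqrtr //.
apply: le_trans (E_le mT La.2 (itgD mT i1 i2) (fun o _ => ar o)) _.
rewrite (ED mT i1 i2) !(EZ mT) //; [|exact: itgZ|exact: itgZ].
rewrite /C [leRHS]mulrDl; apply: lerD.
  rewrite -[leRHS]mulrA; apply: ler_wpM2l => //; rewrite -[leRHS]mulrA.
  by apply: ler_wpM2l; [exact: sqr_ge0|exact: eT].
rewrite -[leRHS]mulrA; apply: ler_wpM2l; first by rewrite mulr_ge0.
rewrite -[leRHS]mulrA; apply: ler_wpM2l; first exact: sqr_ge0.
rewrite eI.
have [Jc ec] := ci_cst (S * nsq (x - y)) tT.
apply: le_trans (ci_le Jh Jc (fun u uI => (st u uI).2)) _.
rewrite ec [leRHS]mulrAC; apply: ler_wpM2l; first by rewrite mulr_ge0 ?nsq_ge0.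
by rewrite lerBlDr lerDl; case/andP: tI.
Qed.

(** Difference quotients along a unit vector are bounded by the Lipschitz constant of [w]. This
    improves on the class of the gradient, which bounds it at the origin only. *)
Lemma wx_bnd alpha w wx i : Adm alpha -> hsol alpha w wx -> bnd (fun s y => wx (c s) y i 0).
Proof.
move=> Aa hw; have [K K0 hK] := w_lip Aa hw; have [wt [wxx [[_ _ _ dx _] _ _ _]]] := hw.
exists K => // s y; have [] := dx _ y i (cI T0 s); set ei : 'cV[R]_n := delta_mx i 0.
move=> dv <-; apply/ler_addgt0Pr => e e0.
have /cvgrPdist_le /(_ e e0) nh := dv.
have [h [h0 hh]] : exists h : R, h != 0 /\ `|derive (w (c s)) y ei - h^-1 *: (w (c s) (h *: ei + y) - w (c s) y)| <= e.
  have nh0 : \forall h \near (0 : R)^', h != 0 by exact: nbhs_dnbhs_neq.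
  by have [h [h1 h2]] := filter_ex (filterI nh0 nh); exists h.
have b : `|h^-1 *: (w (c s) (h *: ei + y) - w (c s) y)| <= K.
  rewrite normrM normfV ler_pdivrMl ?normr_gt0 //; apply: le_trans (hK _ _ _) _.
  rewrite addrK mulrC ler_wpM2r //.
  have -> : enorm (h *: ei) = Num.sqrt (nsq (h *: ei)) by rewrite -enorm_nsq sqrtr_sqr ger0_norm ?enorm_ge0.
  rewrite -sqrtr_sqr ler_wsqrtr // /nsq (bigD1 i) //= big1 => [|j ji]; last by rewrite !mxE (negbTE ji) mulr0 expr0n.
  by rewrite !mxE !eqxx mulr1 addr0.
have := ler_normD (derive (w (c s)) y ei - h^-1 *: (w (c s) (h *: ei + y) - w (c s) y)) (h^-1 *: (w (c s) (h *: ei + y) - w (c s) y)).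
by rewrite subrK; lra.
Qed.

End Bounds.

(** * Greedy policies, the HJB equation and bounds on drivers *)

Definition zf wx s y : 'cV[R]_d := \col_l zeta wx l s y.

Lemma clpc s : c (c s) = c s. Proof. by rewrite clp_id // cI. Qed.

(** A product of Lipschitz functions is Lipschitz when both are bounded; the bound on the gradient
    is supplied by [wx_bnd]. This makes the exact gradient a competitor in the regression. *)
Lemma zf_CbUniLip wx : CbUniLip p wx -> (forall i, bnd (fun s y => wx (c s) y i 0)) -> CbUniLip p (zf wx).
Proof.
move=> /(CbUniLipP T0)[lw _] bw.
have zE l : (fun s y => zf wx (c s) y l 0) = fun s y => \sum_i wx (c s) y i 0 * sgc s y i l.
  by apply/funext => s; apply/funext => y; rewrite mxE /sgrad /sigma_clp clpc.
apply/(CbUniLipP T0); split=> l.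
  by rewrite zE; apply: lip_sum => i; exact: lipM (lw i) (bw i) (sg_lip i l) (sg_bnd i l).
have [K K0 hK] : bnd (fun s y => zf wx (c s) y l 0).
  by rewrite zE; apply: bnd_sum => i; exact: bndM (bw i) (sg_bnd i l).
by exists K => // s _; exact: hK.
Qed.

Definition greedy z alpha := forall s y, 0 <= s <= T -> alpha s y = Defs.mu p s y (z s y).

Lemma greedy_A z alpha : greedy z alpha -> A_valued p alpha.
Proof. by move=> gz s y sI; rewrite gz //; case: Hp => _ [_ [_ [_ h]]]; case: (h s y (z s y) sI). Qed.

Lemma Adm_greedy z alpha : CbUniLip p z -> greedy z alpha -> Adm alpha.
Proof.
move=> cz gz; split; last exact: greedy_A gz.
have [lz bz] := (CbUniLipP T0 _).1 cz.
have aE i : (fun s y => alpha (c s) y i 0) = fun s y => Defs.mu p (c s) y (z (c s) y) i 0.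
  by apply/funext => s; apply/funext => y; rewrite gz // cI.
apply/(CbUniLipP T0); split=> i; first by rewrite aE; exact: (comp_lip T0 Hmu lz (fun _ _ => Logic.I) i 0).
have [_ [K Lip]] := Hmu.
have [M M0 hM] := finite_bound (Q := fun l M => forall s, `|z (c s) 0 l 0| <= M) (fun l K K' le h s => le_trans (h s) le)
  (fun l => let: ex_intro2 M M0 hM := bz l in ex_intro2 _ _ M M0 (fun s => hM s 0)).
exists (`|L0| + `|K| * (\sum_(l < d) M)) => [|s _]; first by rewrite addr_ge0 // mulr_ge0 // sumr_ge0.
rewrite (_ : alpha (c s) 0 i 0 = Defs.mu p (c s) 0 (z (c s) 0) i 0); last by rewrite gz // cI.
have := Lip (c s) 0 0 (z (c s) 0) 0 (cI T0 s) Logic.I Logic.I Logic.I Logic.I.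
rewrite subrr (_ : enorm 0 = 0) ?mulr0 ?add0r ?subr0 => [h1|]; last first.
  by apply/eqP; rewrite -sqrf_eq0 enorm_sqr big1 // => l _; rewrite mxE expr0n.
have h2 := le_trans (enorm_coord _ i 0) h1; rewrite !mxE in h2.
have h3 : `|Defs.mu p (c s) 0 0 i 0| <= `|L0|.
  apply: le_trans (enorm_coord _ i 0) _; apply: le_trans (ler_norm L0); apply: le_trans (HL1 (cI T0 s)).
  by rewrite addrAC lerDr addr_ge0 // enorm_ge0.
have h4 : K * enorm (z (c s) 0) <= `|K| * \sum_(l < d) M.
  apply: le_trans (ler_wpM2r (enorm_ge0 _) (ler_norm K)) _; rewrite ler_wpM2l //.
  by apply: le_trans (enorm_le_sum _) _; apply: ler_sum => l _; rewrite big_ord1.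
have := ler_normD (Defs.mu p (c s) 0 (z (c s) 0) i 0 - Defs.mu p (c s) 0 0 i 0) (Defs.mu p (c s) 0 0 i 0).
by rewrite subrK; lra.
Qed.

Lemma greedy_min z alpha alpha' s y : greedy z alpha -> A_valued p alpha' ->
  \sum_l bhc alpha l s y * z (c s) y l 0 + fc alpha s y <= \sum_l bhc alpha' l s y * z (c s) y l 0 + fc alpha' s y.
Proof.
move=> gz Aa; case: Hp => _ [_ [_ [_ h]]]; have [_ h'] := h (c s) y (z (c s) y) (cI T0 s).
by rewrite /bh_clp /f_clp gz ?cI //; exact: h' (Aa _ _ (cI T0 s)).
Qed.

(** The infimum in the HJB equation is attained at the policy greedy for sigma^T dv*, so v* solves
    the linear equation of that policy. The policy is obtained as continuous only, [vx] being
    Lipschitz without a known bound. *)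
Lemma hjb_hsol v : smooth_hjb_sol p v -> exists vx, let astar s y := Defs.mu p s y (zf vx s y) in
  [/\ ctl astar, hsol astar v vx & CbUniLip p vx].
Proof.
move=> [vt [vx [vxx [C cv eq e]]]]; exists vx => astar.
have ga : greedy (zf vx) astar by [].
have Aa := greedy_A ga.
have ca : ctl astar.
  split => //; have cz : continuous (fun z : R * 'cV[R]_n => zf vx (c z.1) z.2).
    move=> z; apply: cvg_col => l; have := zeta_cont (l := l) cv (x := z).
    rewrite (_ : (fun k : R * 'cV[R]_n => zeta vx l k.1 k.2) = fun k => zf vx (c k.1) k.2 l 0).
      by rewrite /continuous_at /=.
    by apply/funext => k; rewrite mxE /sgrad /sigma_clp clpc.
  have cc := comp_cont T0 Hmu.1 (a := fun s y => zf vx (c s) y) cz (fun _ _ => Logic.I).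
  by move=> z; apply: cvg_col => i; exact: (cc i 0 z).
split => //; exists vt, vxx; split => // s y sT.
have sI : 0 <= s <= T by case/andP: sT => -> /ltW.
have {}eq := eq s y sT; pose G a := generator p vt vx vxx a s y + f p s y a.
(* On admissible actions the control appears only in the quantity that [mu] minimises. *)
have dE a : actions p a -> G a = vt s y + dot (bb p s y) (vx s y) + 2^-1 * \tr (sigma p s y *m (sigma p s y)^T *m vxx s y) +
    (dot (bh p s y a) (zf vx s y) + f p s y a).
  move=> Aa'; rewrite /G /generator; case: Hp => _ [_ [_ [-> // _]]].
  have -> : dot (bb p s y + sigma p s y *m bh p s y a) (vx s y) = dot (bb p s y) (vx s y) + dot (bh p s y a) (zf vx s y).
    rewrite /dot -[RHS]/(_ + _); under eq_bigr => i _ do rewrite !mxE mulrDl mulr_suml.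
    rewrite big_split /= exchange_big /=; congr (_ + _); apply: eq_bigr => l _; rewrite mxE /sgrad /sigma_clp clp_id // mulr_sumr.
    by apply: eq_bigr => i _; ring.
  ring.
have Gmin a : actions p a -> G (astar s y) <= G a.
  move=> Aa'; rewrite !dE //; last exact: Aa.
  by rewrite lerD2l; case: Hp => _ [_ [_ [_ h]]]; have [_] := h s y (zf vx s y) sI; apply.
have h1 : (G (astar s y))%:E = 0%E.
  apply/eqP; rewrite eq_le; apply/andP; split.
    by rewrite eq; apply: le_ereal_inf_tmp => _ [a Aa' <-]; rewrite lee_fin; exact: Gmin.
  by rewrite {1}eq; apply: ereal_inf_lbound; exists (astar s y) => //; exact: Aa.
by case: h1 => <-.
Qed.

(** Differences of [bh] are at most 2 L0 in each coordinate, so Cauchy-Schwarz gives d (2 L0)^2; the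
    remaining 2 is that of (a + b)^2 <= 2 a^2 + 2 b^2. *)
Local Notation K0 := (8 * d%:R * L0 ^+ 2).

Lemma sum_mul_sq (u v : 'I_d -> R) M : (forall l, `|u l| <= M) ->
  (\sum_l u l * v l) ^+ 2 <= d%:R * (M ^+ 2 * \sum_l v l ^+ 2).
Proof.
move=> uM; apply: le_trans (sqr_sum_le _) _; apply: ler_wpM2l => //.
rewrite mulr_sumr; apply: ler_sum => l _; rewrite exprMn; apply: ler_wpM2r; first exact: sqr_ge0.
have M0 := le_trans (normr_ge0 _) (uM l).
by rewrite -[leLHS]real_normK ?num_real // ler_pXn2r ?nnegrE.
Qed.

Lemma bhc_sub_le alpha alpha' l s y : A_valued p alpha -> A_valued p alpha' ->
  `|bhc alpha l s y - bhc alpha' l s y| <= 2 * L0.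
Proof.
move=> A1 A2; have h1 := bhc_le l s y A1; have h2 := bhc_le l s y A2.
by apply: le_trans (ler_normB _ _) _; lra.
Qed.

Let sum2 (u v : 'I_d -> R) : (forall l, `|u l| <= 2 * L0) ->
  2 * (\sum_l u l * v l) ^+ 2 <= K0 * \sum_l v l ^+ 2.
Proof.
move=> h; have := sum_mul_sq v h; rewrite exprMn; lra.
Qed.

Let psi_ge0 (v : 'I_d -> R) : 0 <= \sum_l v l ^+ 2.
Proof. by apply: sumr_ge0 => l _; exact: sqr_ge0. Qed.

(** With equal actions the running costs cancel and the drivers differ only through the gradients,
    so no inhomogeneity is left in [compare]. *)
Lemma agree_bound alpha alpha' alphab wx wx' s y : A_valued p alpha -> A_valued p alphab -> alpha (c s) y = alpha' (c s) y ->
  (drv alpha alphab wx s y - drv alpha' alphab wx' s y) ^+ 2 <= K0 * (\sum_l (zeta wx l s y - zeta wx' l s y) ^+ 2 + 0).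
Proof.
move=> Aa Ab e; have e1 l : bhc alpha' l s y = bhc alpha l s y by rewrite /bh_clp e.
have -> : drv alpha alphab wx s y - drv alpha' alphab wx' s y =
    \sum_l (bhc alpha l s y - bhc alphab l s y) * (zeta wx l s y - zeta wx' l s y).
  rewrite /driver /f_clp e opprD addrACA subrr add0r -sumrB; apply: eq_bigr => l _; rewrite e1; ring.
have := sum2 (fun l => zeta wx l s y - zeta wx' l s y) (fun l => bhc_sub_le l s y Aa Ab).
rewrite addr0; apply: le_trans; set S := _ ^+ 2; have : 0 <= S by exact: sqr_ge0.
by move: S => S; lra.
Qed.

Lemma zfE wx s y l : zf wx (c s) y l 0 = zeta wx l s y.
Proof. by rewrite mxE /sgrad /sigma_clp clpc. Qed.

(* the two minimality properties trap the difference of the Hamiltonians at the optimal gradient *)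
Lemma contraction_bound z alpha astar vx wx alphab s y : greedy z alpha -> greedy (zf vx) astar -> A_valued p alphab ->
  (drv alpha alphab wx s y - drv astar alphab vx s y) ^+ 2 <=
  K0 * (\sum_l (zeta wx l s y - zeta vx l s y) ^+ 2 + \sum_l (zeta vx l s y - z (c s) y l 0) ^+ 2).
Proof.
move=> gz gs Ab; have Aa := greedy_A gz; have As := greedy_A gs.
have m1 := greedy_min s y gs Aa; have m2 := greedy_min s y gz As.
rewrite (eq_bigr (fun l => bhc astar l s y * zeta vx l s y)) in m1; last by move=> l _; rewrite zfE.
rewrite [X in _ <= X + _](eq_bigr (fun l => bhc alpha l s y * zeta vx l s y)) in m1; last by move=> l _; rewrite zfE.
pose br := fc alpha s y + \sum_l bhc alpha l s y * zeta vx l s y - (fc astar s y + \sum_l bhc astar l s y * zeta vx l s y).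
pose S1 := \sum_l (bhc alpha l s y - bhc alphab l s y) * (zeta wx l s y - zeta vx l s y).
pose S2 := \sum_l (bhc alpha l s y - bhc astar l s y) * (zeta vx l s y - z (c s) y l 0).
have br0 : 0 <= br by rewrite /br; lra.
have br1 : br <= S2.
  have -> : S2 = \sum_l bhc alpha l s y * zeta vx l s y - \sum_l bhc astar l s y * zeta vx l s y
     - (\sum_l bhc alpha l s y * z (c s) y l 0 - \sum_l bhc astar l s y * z (c s) y l 0).
    by rewrite -!sumrB; apply: eq_bigr => l _; ring.
  rewrite /br; lra.
have -> : drv alpha alphab wx s y - drv astar alphab vx s y = br + S1.
  have -> : S1 = \sum_l (bhc alpha l s y - bhc alphab l s y) * zeta wx l s y - \sum_l (bhc astar l s y - bhc alphab l s y) * zeta vx l s y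
     - (\sum_l bhc alpha l s y * zeta vx l s y - \sum_l bhc astar l s y * zeta vx l s y).
    by rewrite -!sumrB; apply: eq_bigr => l _; ring.
  rewrite /br /driver; ring.
apply: le_trans (sqrD_le _ _) _.
have h1 := sum2 (fun l => zeta wx l s y - zeta vx l s y) (fun l => bhc_sub_le l s y Aa Ab).
have h2 := sum2 (fun l => zeta vx l s y - z (c s) y l 0) (fun l => bhc_sub_le l s y Aa As).
have h3 : br ^+ 2 <= S2 ^+ 2 by rewrite ler_pXn2r ?nnegrE // (le_trans br0).
by rewrite mulrDr addrC; apply: lerD; [exact: h1|apply: le_trans h2; rewrite ler_wpM2l].
Qed.

(** * One step of the subroutine: regression, contraction, improvement *)

Section Base.
Variables (B : stoch_base R d) (t : R).
Hypotheses (HB : brownian B t T) (tI : 0 <= t <= T).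
Local Notation P := (Pr B).
Local Notation lm := (leb \x P)%E.
Local Notation band := (@band R d B).
Local Notation isint := (@isint R d B t).
Local Notation nsol := (@nsol R d B t T n).
Local Notation mbd r s := (@measurable_band R d B r s).
Let tT : t <= T. Proof. by case/andP: tI. Qed.
Let inI s : t <= s <= T -> 0 <= s <= T.
Proof. by case/andP: tI => t0 _ /andP[ts ->]; rewrite (le_trans t0 ts). Qed.

Variables (alphab : policy R n m) (x : 'cV[R]_n) (X : R -> Omega B -> 'cV[R]_n).
Hypotheses (Ab : Adm alphab) (sX : nsol (bc alphab) sgc x X).
Let pX : process t T X. Proof. by case: sX. Qed.
Local Notation delta wx wx' := (fun q : R * Omega B => \sum_l (zeta wx l q.1 (X q.1 q.2) - zeta wx' l q.1 (X q.1 q.2)) ^+ 2).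
Local Notation St := (state (B := B) p alphab t x).

Let bandI q : band t T q -> t <= q.1 <= T.
Proof. by move=> [/= + _]; rewrite in_itv /= => /andP[/ltW -> ->]. Qed.

Let weighted0 k : @weighted R d B t T k (fun=> 0) = 0.
Proof. by rewrite /weighted big1 // => j _; rewrite E0 mulr0. Qed.

(** Uniqueness for the backward equation by the estimate that also yields the contraction: the given
    solution minus the one built from [w] has zero terminal value and a driver linear in the
    difference of the integrands, so [energy] without inhomogeneity makes that difference vanish. *)
Lemma bsde_Z alpha w wx (Y : R -> Omega B -> R) (Z : R -> Omega B -> 'cV[R]_d) : Adm alpha -> hsol alpha w wx -> offpolicy_bsde p alpha alphab t x Y Z ->
  {ae lm, forall q, band t T q -> forall l, Z q.1 q.2 l 0 = zeta wx l q.1 (X q.1 q.2)}.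
Proof.
move=> Aa hw [[pY _] _ [M [iM eqY]]]; have ca := Adm_ctl Aa; have cb := Adm_ctl Ab.
have [wt [wxx [[[cw _] _ _ _ _] cwx _ e]]] := hw.
have sa := state_ae HB tI Ab sX.
pose Q l u y := bhc alpha l u y - bhc alphab l u y.
pose del l (q : R * Omega B) := Z q.1 q.2 l 0 + - zeta wx l q.1 (X q.1 q.2).
pose J (q : R * Omega B) := - \sum_l Q l q.1 (X q.1 q.2) * del l q.
pose D s o := Y s o - w (c s) (X s o).
have rep := representation HB tI Ab sX ca hw.
have isd r s : t <= r -> r <= s -> s <= T -> isint r s del (fun o => (M s o - M r o) +
    - (w (c s) (X s o) - w (c r) (X r o) - I[r, s] (fun v => - drv alpha alphab wx v (X v o)))).
  by move=> tr rs sT; apply: isintD; [exact: (ito_isint HB tT iM tr rs sT)|apply: isintN; exact: rep].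
have Ld l : L2 lm (band t T) (del l) := (isint_L2 (isd t T (lexx t) tT (lexx T))).2 l.
have id : itg lm (band t T) (fun q => \sum_l del l q ^+ 2) by apply: (itg_sum (mbd t T)) => l; exact: (Ld l).2.
have JQ q : J q ^+ 2 <= K0 * (\sum_l del l q ^+ 2 + 0).
  rewrite /J sqrrN addr0; have := sum2 (fun l => del l q) (fun l => bhc_sub_le l q.1 (X q.1 q.2) Aa.2 Ab.2).
  apply: le_trans; set S := _ ^+ 2; have : 0 <= S by exact: sqr_ge0.
  by move: S => S; lra.
have mQ l : mband (fun q => Q l q.1 (X q.1 q.2)) t T.
  have cQ : continuous (fun z : R * 'cV[R]_n => Q l z.1 z.2).
    by move=> z; apply: cvgB; [exact: (bhc_cont ca)|exact: (bhc_cont cb)].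
  by have [a h] := process_comp tT pX cQ; exact: (band_meas HB tT a h (lexx t) (lexx T)).
have LJ : L2 lm (band t T) J.
  have mJ : measurable_fun (band t T : set (measurableTypeR R * Omega B)) J.
    apply: measurableT_comp => //; apply: measurable_sum => l; apply: measurable_funM; [exact: mQ|exact: (Ld l).1].
  split => //; apply: (itg_sqr_le (mbd t T) _ (itgZ (mbd t T) K0 id)) => // q _; apply: le_trans (JQ q) _; by rewrite addr0.
have mD s : t <= s <= T -> @fmeas R d B t s (D s).
  move=> sI; apply: measurable_funB; first exact: (progressive_fmeas sI pY).
  by have [a _] := process_comp tT pX (clamp_continuous T0 cw); exact: a.
have DT : {ae P, forall o, D T o = 0}.
  apply: filterS2 eqY sa => o [_ _ h] hs; have TT : t <= T <= T by rewrite tT lexx.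
  by rewrite /D h // hs // !ci_same clp_id ?T0 ?lexx // e; ring.
have eqD r s : t <= r -> r <= s -> s <= T -> exists2 xi, isint r s del xi &
    {ae P, forall o, xi o = D s o - D r o - I[r, s] (fun u => J (u, o))}.
  move=> tr rs sT; eexists; first exact: isd tr rs sT.
  apply: filterS2 eqY sa => o [Jc Jr h] hs.
  have sI : t <= s <= T by rewrite sT (le_trans tr). have rI : t <= r <= T by rewrite tr (le_trans rs).
  move: Jc Jr h; set cst := fun v => f p v _ _; set cor := fun v => dot _ _ => Jc Jr h.
  have mI := mcci r s.
  have J1 := ci_sub tr sT Jc; have J2 := ci_sub tr sT Jr.
  have J1' := ci_sub tr (lexx T) Jc; have J2' := ci_sub tr (lexx T) Jr.
  pose zz v := \sum_l Q l v (X v o) * zeta wx l v (X v o).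
  have stE v : r <= v <= s -> St v o = X v o /\ c v = v.
    move=> /andP[rv vs]; have vI : t <= v <= T by rewrite (le_trans tr rv) (le_trans vs sT).
    by rewrite hs // clp_id // inI.
  have corE v : r <= v <= s -> cor v = \sum_l Q l v (X v o) * Z v o l 0.
    move=> /stE [e1 e2]; rewrite /cor /dot e1; apply: eq_bigr => l _.
    by rewrite !mxE /Q /bh_clp e2.
  have Jd : itg leb `[r, s]%classic (fun v => drv alpha alphab wx v (X v o)).
    have [_ hd] := process_comp tT pX (drv_cont ca cb cwx).
    exact: (cpath_itg (D := fun s o => drv alpha alphab wx s (X s o)) o hd tr sT).
  have zE v : r <= v <= s -> zz v = drv alpha alphab wx v (X v o) - cst v.
    by move=> /stE [e1 e2]; rewrite /cst e1 /driver /f_clp e2 addrC addKr.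
  have Jz : itg leb `[r, s]%classic zz.
    by apply: (itg_eq mI) (itgB mI Jd J1) => v /=; rewrite in_itv /= => vI; rewrite zE.
  have E1 : I[r, s] (fun v => - drv alpha alphab wx v (X v o)) = - I[r, s] cst - I[r, s] zz.
    rewrite (EN mI Jd) -opprD -(ED mI J1 Jz); congr (- _); apply: ci_eq => v vI; rewrite zE //; ring.
  have E2 : I[r, s] (fun u => J (u, o)) = - I[r, s] cor + I[r, s] zz.
    rewrite addrC -(EB mI Jz J2); apply: ci_eq => v vI; rewrite corE // /J /zz /del -sumrB -sumrN.
    by apply: eq_bigr => l _ /=; ring.
  rewrite /D (h s sI) (h r rI) E1 E2 (ci_split rs sT J1') (ci_split rs sT J2'); ring.
pose N := Num.truncn (16 * K0 * (T - t)).
have hN : 16 * K0 * (T - t) <= N.+1%:R by apply: ltW; exact: truncnS_gt.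
have hJ : {ae lm, forall q, band t T q -> J q ^+ 2 <= K0 * (\sum_l del l q ^+ 2 + 0)} by apply: aeW => q _; exact: JQ.
have en := energy HB tT mD DT LJ (itg0 lm (band t T)) (fun=> lexx 0) hJ eqD hN.
have {}en : weighted t T N (fun q => \sum_l del l q ^+ 2) <= 0.
  have a0 : 0 <= Rintegral P setT (fun o => D t o ^+ 2) by apply: E_ge0 => o _; exact: sqr_ge0.
  by move: en; rewrite weighted0 mulr0; move: a0; lra.
apply: ae_mono (weighted_eq0 tT id (fun q => psi_ge0 (del^~ q)) en) => q h bq l.
have /eqP := h bq; rewrite psumr_eq0 => [/allP /(_ l (mem_index_enum l))|k _]; last exact: sqr_ge0.
by rewrite sqrf_eq0 subr_eq0 => /eqP.
Qed.

(** The exact gradient [zf wx] is a competitor of error 0, so the minimal error is 0. The minimiser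
    is thereby identified almost everywhere along the behaviour process, and later estimates
    evaluate it only there. *)
Lemma regression alpha w wx (Y : R -> Omega B -> R) (Z : R -> Omega B -> 'cV[R]_d) z : Adm alpha -> hsol alpha w wx -> CbUniLip p (zf wx) ->
  offpolicy_bsde p alpha alphab t x Y Z -> CbUniLip p z ->
  (forall z', CbUniLip p z' -> (sq_error p alphab t x Z z <= sq_error p alphab t x Z z')%E) ->
  {ae lm, forall q, band t T q -> forall l, z (c q.1) (X q.1 q.2) l 0 = zeta wx l q.1 (X q.1 q.2)}.
Proof.
move=> Aa hw cz bs czz mn; have hZ := bsde_Z Aa hw bs.
have [_ _ [M [iM _]]] := bs.
have LZ l : L2 lm (band t T) (fun q => Z q.1 q.2 l 0) := (isint_L2 (ito_isint HB tT iM (lexx t) tT (lexx T))).2 l.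
have sS : sde_sol (B := B) p alphab t x St by exact: (xgetPex _ (sde_exists HB tI x Ab)).
have pS : forall i, progressive t T (fun s o => St s o i 0) by case: sS.
(* [sq_error] is formulated with the chosen solution [St], the representation of the gradient with
   the continuous one [X]. *)
have sab : {ae lm, forall q, band t T q -> St q.1 q.2 = X q.1 q.2}.
  apply: (ae_band (state_ae HB tI Ab sX)) => u o /andP[tu uT] h; apply: h; by rewrite ltW.
have sq z' : CbUniLip p z' -> sq_error p alphab t x Z z' =
   (\int[P]_o \int[leb]_(s in `[t, T]) (enorm (z' (c s) (St s o) - Z s o) ^+ 2)%:E)%E.
  move=> _; apply: eq_integral => o _; apply: eq_integral => s /set_mem /=; rewrite in_itv /= => sI.
  by rewrite clp_id // inI.
have mz z' l : CbUniLip p z' -> mband (fun q => (z' (c q.1) (St q.1 q.2) - Z q.1 q.2) l 0) t T.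
  move=> /(CbUniLipP T0)[lz _]; have [K [_ cf _]] := lz l.
  have e : (fun q : R * Omega B => (z' (c q.1) (St q.1 q.2) - Z q.1 q.2) l 0) = fun q => z' (c q.1) (St q.1 q.2) l 0 - Z q.1 q.2 l 0.
    by apply/funext => q; rewrite !mxE.
  rewrite e; apply: measurable_funB; last exact: (LZ l).1.
  apply: (measurable_continuous_comp (mbd t T) (F := fun z : R * 'cV[R]_n => z' (c z.1) z.2 l 0) cf).
    by apply: measurable_funTS; exact: measurable_fst.
  by move=> i; exact: (progressive_measurable HB (pS i) tT (mbd t T) bandI).
have zero z' : CbUniLip p z' -> (forall l, {ae lm, forall q, band t T q -> (z' (c q.1) (St q.1 q.2) - Z q.1 q.2) l 0 = 0}) ->
    sq_error p alphab t x Z z' = 0%E.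
  move=> cz' h0; rewrite sq //.
  have L0' l : L2 lm (band t T) (fun q => (z' (c q.1) (St q.1 q.2) - Z q.1 q.2) l 0) /\
      nrm lm (band t T) (fun=> 0) = nrm lm (band t T) (fun q => (z' (c q.1) (St q.1 q.2) - Z q.1 q.2) l 0).
    apply: (L2_ae (mbd t T) (mz z' l cz')); last exact: L2_0 (mbd t T).
    by apply: ae_mono (h0 l) => q h bq; rewrite h.
  rewrite (band_enorm (f := fun s o => z' (c s) (St s o) - Z s o)) => [|l]; last exact: (L0' l).1.
  rewrite big1 // => l _; rewrite -(L0' l).2 nrm_sq -[RHS](E0 lm (band t T)); apply: E_eq => q _; exact: expr0n.
have z0 : sq_error p alphab t x Z (zf wx) = 0%E.
  apply: zero => // l; apply: ae_mono (ae_and hZ sab) => q [h1 h2] bq.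
  by have := zfE wx q.1 (X q.1 q.2) l; rewrite !mxE (h2 bq) (h1 bq) => ->; rewrite subrr.
have := mn _ cz; rewrite z0 sq // => le0.
have Lz := band_enorm_fin (f := fun s o => z (c s) (St s o) - Z s o) (mz z ^~ czz) (le_lt_trans le0 (ltry 0)).
rewrite (band_enorm Lz) lee_fin in le0.
have nz l : {ae lm, forall q, band t T q -> (z (c q.1) (St q.1 q.2) - Z q.1 q.2) l 0 = 0}.
  apply: (nrm_eq0 (mbd t T) (Lz l)); apply/eqP; rewrite -sqrf_eq0 eq_le sqr_ge0 andbT.
  apply: le_trans le0; rewrite (bigD1 l) //= lerDl; apply: sumr_ge0 => k _; exact: sqr_ge0.
have {}nz : {ae lm, forall q, forall l, band t T q -> (z (c q.1) (St q.1 q.2) - Z q.1 q.2) l 0 = 0}.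
  have key (r : seq 'I_d) : {ae lm, forall q, forall l, l \in r -> band t T q -> (z (c q.1) (St q.1 q.2) - Z q.1 q.2) l 0 = 0}.
    elim: r => [|k r IH]; first by apply: ae_mono hZ.
    apply: ae_mono (ae_and (nz k) IH) => q [h1 h2] l; rewrite in_cons => /orP[/eqP ->|] //; exact: h2.
  by apply: ae_mono (key (enum 'I_d)) => q h l; apply: h; rewrite mem_enum.
apply: ae_mono (ae_and (ae_and hZ sab) nz) => q [[h1 h2] h3] bq l.
have := h3 l bq; rewrite !mxE (h2 bq) (h1 bq l) => /eqP; by rewrite subr_eq0 => /eqP.
Qed.

Variable N : nat.
Hypothesis hN : 16 * K0 * (T - t) <= N.+1%:R.

(** [compare] for the new policy and the optimal one, with the previous gradient error as
    inhomogeneity: along [X] the regressed function equals the previous gradient, so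
    [contraction_bound] speaks of that error. *)
Lemma contraction alpha w wx alpha' w' wx' z astar v vx : Adm alpha -> hsol alpha w wx ->
  greedy z alpha' -> CbUniLip p z -> hsol alpha' w' wx' ->
  {ae lm, forall q, band t T q -> forall l, z (c q.1) (X q.1 q.2) l 0 = zeta wx l q.1 (X q.1 q.2)} ->
  ctl astar -> greedy (zf vx) astar -> hsol astar v vx ->
  (w' t x - v t x) ^+ 2 + 7 / 8 * weighted t T N (delta wx' vx) <= 8^-1 * weighted t T N (delta wx vx).
Proof.
move=> Aa hw gz cz hw' az cs gs hv; have A' := Adm_greedy cz gz.
have ca := Adm_ctl Aa; have ca' := Adm_ctl A'.
have := compare HB tI Ab sX ca' cs hw' hv (delta_itg HB tI Ab sX ca cs hw hv) (fun q => psi_ge0 _) _ hN.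
apply; apply: ae_mono az => q h bq; have := contraction_bound wx' q.1 (X q.1 q.2) gz gs Ab.2.
congr (_ <= _ * (_ + _)); apply: eq_bigr => l _; rewrite h //; ring.
Qed.

(* the improved policy has the same cost as the one that is greedy for the exact gradient, and the latter decreases the cost pointwise *)
Lemma improvement alpha w wx alpha' w' wx' z : Adm alpha -> hsol alpha w wx -> CbUniLip p (zf wx) ->
  (forall beta, Adm beta -> exists u ux, hsol beta u ux) ->
  greedy z alpha' -> CbUniLip p z -> hsol alpha' w' wx' ->
  {ae lm, forall q, band t T q -> forall l, z (c q.1) (X q.1 q.2) l 0 = zeta wx l q.1 (X q.1 q.2)} ->
  w' t x <= w t x.
Proof.
move=> Aa hw cze ex gz cz hw' az; have A' := Adm_greedy cz gz.
have ca := Adm_ctl Aa; have ca' := Adm_ctl A'.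
pose beta s y := Defs.mu p s y (zf wx s y).
have gb : greedy (zf wx) beta by [].
have Abeta := Adm_greedy cze gb; have cbeta := Adm_ctl Abeta.
have [u [ux hu]] := ex _ Abeta.
have same : w' t x = u t x.
  have := compare HB tI Ab sX ca' cbeta hw' hu (itg0 lm (band t T)) (fun=> lexx 0) _ hN.
  rewrite weighted0 mulr0; have w0 := @weighted_ge0 R d B t T N (delta wx' ux) (fun q => psi_ge0 _).
  move=> hh; apply/eqP; rewrite -subr_eq0 -sqrf_eq0 eq_le sqr_ge0 andbT.
  suff : (w' t x - u t x) ^+ 2 + 7 / 8 * weighted t T N (delta wx' ux) <= 0 by move: w0; lra.
  (* Along [X] the policies [alpha'] and [beta] choose the same action almost everywhere, since
     their arguments of [mu] agree there; hence their costs agree at the starting point. *)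
  apply: hh; apply: ae_mono az => q h bq; apply: agree_bound; [exact: A'.2|exact: Ab.2|].
  rewrite gz ?cI // /beta; congr (Defs.mu _ _ _ _); apply/colP => l; by rewrite h // zfE.
rewrite same; have [L cf] := coefs Abeta.
(* Both costs are now written along the process driven by [beta]; their drivers compare pointwise,
   because [beta] minimises the Hamiltonian at the gradient of [w]. *)
have [X' sX'] := nsol_exists HB tT cf x; have [pX' _ _] := sX'.
have [i1 e1] := feynman_kac HB tI Abeta sX' ca hw; have [i2 e2] := feynman_kac HB tI Abeta sX' cbeta hu.
rewrite e1 e2; apply: (E_le mT i2 i1) => o _; rewrite lerD2l.
have cwx : CbUniLip p wx by have [? [? []]] := hw. have cux : CbUniLip p ux by have [? [? []]] := hu.
have [_ h1] := process_comp tT pX' (drv_cont ca cbeta cwx); have [_ h2] := process_comp tT pX' (drv_cont cbeta cbeta cux).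
apply: (ci_le (cpath_itg (D := fun s o => drv beta beta ux s (X' s o)) o h2 (lexx t) (lexx T))
  (cpath_itg (D := fun s o => drv alpha beta wx s (X' s o)) o h1 (lexx t) (lexx T))) => s _.
rewrite drv_own; have := greedy_min s (X' s o) gb Aa.2; rewrite /driver.
under eq_bigr => l _ do rewrite zfE; under [X in _ <= X + _]eq_bigr => l _ do rewrite zfE.
under [X in _ -> _ <= _ + X]eq_bigr => l _ do rewrite mulrBl.
rewrite sumrB; lra.
Qed.

End Base.

End Control.

(** The minimiser in the subroutine is not unique as a function, so the sequence of policies is not
    determined by its start. Fixing [C] before the sequence makes the bound uniform over all
    choices. *)
Theorem corollary2 (R : realType) (n m d : nat)
  (n_gt0 : (0 < n)%N) (m_gt0 : (0 < m)%N) (d_gt0 : (0 < d)%N)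
  (p : problem R n m d) (B : R -> 'cV[R]_n -> stoch_base R d)
  (Hp : standing p)
  (HB : forall t x, 0 <= t <= horizon p -> brownian (B t x) t (horizon p))
  (H1 : assumption1 p (vstar p B)) :
  exists q : R, 0 < q < 1 /\
  forall (t : R) (x : 'cV[R]_n), 0 <= t <= horizon p ->
  forall alphab alpha0 : policy R n m,
    CbUniLip p alphab -> A_valued p alphab ->
    CbUniLip p alpha0 -> A_valued p alpha0 ->
  exists C : R, forall alpha : nat -> policy R n m,
    alpha 0%N = alpha0 ->
    (forall k, offpolicy_output p (B t x) (alpha k) alphab t x (alpha k.+1)) ->
    [/\ forall k, admissible p B (alpha k),
        forall k, (value p (B t x) (alpha k.+1) t x <= value p (B t x) (alpha k) t x)%E,
        (fun k => value p (B t x) (alpha k) t x) @ \oo --> vstar p B t x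
      & forall k, (`|value p (B t x) (alpha k) t x - vstar p B t x|
                   <= (C * q ^+ k)%:E)%E].
Proof.
case: H1 => [[[Hbb Hbh Hsg Hmu] [Hf Hg]] [L0 HL] Hc [v [hv ev]]].
have reg : regular p L0 by [].
have ex beta : Adm p beta -> exists u ux, hsol p beta u ux.
  by move=> [cb Ab]; have [w [wt [wx [wxx hw]]]] := Hc _ cb Ab; exists w, wx, wt, wxx.
exists 2^-1; split; first lra.
move=> t x tI alphab alpha0 cb Ab c0 A0; have tT : t <= horizon p by case/andP: tI.
have Adb : Adm p alphab by []. have Ad0 : Adm p alpha0 by [].
have hB := HB t x tI; have [L cf] := coefs reg Adb; have [X sX] := nsol_exists hB tT cf x.
have [vx [cs hs cvx]] := hjb_hsol reg hv; have [w0 [wx0 hw0]] := ex _ Ad0.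
pose N := Num.truncn (16 * (8 * d%:R * L0 ^+ 2) * (horizon p - t)).
have hN : 16 * (8 * d%:R * L0 ^+ 2) * (horizon p - t) <= N.+1%:R by apply: ltW; exact: truncnS_gt.
pose S (wx : R -> 'cV[R]_n -> 'cV[R]_n) := @weighted R d (B t x) t (horizon p) N
  (fun q => \sum_l (sgrad p wx l q.1 (X q.1 q.2) - sgrad p vx l q.1 (X q.1 q.2)) ^+ 2).
have S_ge0 wx : 0 <= S wx.
  by apply: weighted_ge0 => q; apply: sumr_ge0 => l _; exact: sqr_ge0.
(* The first term is the initial error. The 2 comes from an index shift: the error at step k + 1 is
   bounded by the square root of the gradient error at step k, of order 2^-k = 2 * 2^-(k+1). *)
pose C := `|w0 t x - v t x| + 2 * Num.sqrt (S wx0).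
exists C => alpha a0 hstep.
have step k w wx : Adm p (alpha k) -> hsol p (alpha k) w wx -> exists z, [/\ greedy p z (alpha k.+1), CbUniLip p z,
    CbUniLip p (zf p wx) & {ae (lebesgue_measure \x Pr (B t x))%E, forall q, band t (horizon p) q ->
      forall l, z (clp 0 (horizon p) q.1) (X q.1 q.2) l 0 = sgrad p wx l q.1 (X q.1 q.2)}].
  move=> Ak hw; have [Y [Z [z [bs cz mn gz]]]] := hstep k; exists z.
  have czf : CbUniLip p (zf p wx).
    have [_ [_ [_ cwx _ _]]] := hw; apply: (zf_CbUniLip reg cwx) => i; exact: (wx_bnd reg HB i Ak hw).
  by split => //; exact: (regression reg hB tI Adb sX Ak hw czf bs cz mn).
have Ad k : Adm p (alpha k).
  elim: k => [|k IH]; first by rewrite a0.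
  by have [w [wx hw]] := ex _ IH; have [z [gz cz _ _]] := step k w wx IH hw; exact: (Adm_greedy reg cz gz).
(* The induction runs on the gradient error, which decays by 1/4 at each step; the value error is a
   by-product and does not feed back. *)
have rate k : exists w wx, [/\ hsol p (alpha k) w wx, S wx <= S wx0 * 4^-1 ^+ k & `|w t x - v t x| <= C * 2^-1 ^+ k].
  elim: k => [|k [w [wx [hw Sk _]]]].
    exists w0, wx0; rewrite a0 !expr0 !mulr1; split => //.
    by rewrite /C lerDl mulr_ge0 // sqrtr_ge0.
  have [z [gz cz _ az]] := step k w wx (Ad k) hw; have [w' [wx' hw']] := ex _ (Ad k.+1).
  have ct := contraction reg hB tI Adb sX hN (Ad k) hw gz cz hw' az cs (fun s y _ => erefl) hs.
  have s0 := S_ge0 wx0; have s1 := S_ge0 wx'.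
  have p0 : 0 <= 4^-1 ^+ k :> R by rewrite exprn_ge0 // invr_ge0.
  have {}ct : (w' t x - v t x) ^+ 2 + 7 / 8 * S wx' <= 8^-1 * (S wx0 * 4^-1 ^+ k).
    by apply: le_trans ct _; rewrite ler_wpM2l ?invr_ge0.
  have q0 := sqr_ge0 (w' t x - v t x); have sp := mulr_ge0 s0 p0.
  (* 7/8 S' <= 1/8 S gives S' <= S/7, relaxed to S/4 so that its square root has ratio 1/2. *)
  exists w', wx'; split => //; first by rewrite exprSr mulrA; lra.
  apply: (@le_trans _ _ (Num.sqrt (S wx0 * 4^-1 ^+ k))).
    by rewrite -sqrtr_sqr ler_wsqrtr //; lra.
  have -> : 4^-1 ^+ k = (2^-1 ^+ k) ^+ 2 :> R.
    by rewrite exprAC; congr (_ ^+ _); rewrite expr2; lra.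
  have h0 : 0 <= 2^-1 ^+ k :> R by rewrite exprn_ge0 // invr_ge0.
  rewrite sqrtrM // sqrtr_sqr (ger0_norm h0) exprS mulrA; apply: ler_wpM2r => //.
  by have := normr_ge0 (w0 t x - v t x); rewrite /C; lra.
have val k w wx : hsol p (alpha k) w wx -> value p (B t x) (alpha k) t x = (w t x)%:E.
  by move=> hw; exact: (value_eq reg x hB tI (Ad k) hw).
have err k : `|fine (value p (B t x) (alpha k) t x) - v t x| <= C * 2^-1 ^+ k.
  by have [w [wx [hw _ e]]] := rate k; rewrite (val _ _ _ hw).
have valE k : value p (B t x) (alpha k) t x = (fine (value p (B t x) (alpha k) t x))%:E.
  by have [w [wx hw]] := ex _ (Ad k); rewrite (val _ _ _ hw).
split.
- by move=> k; exact: (Adm_admissible reg HB (Ad k)).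
- move=> k; have [w [wx hw]] := ex _ (Ad k); have [w' [wx' hw']] := ex _ (Ad k.+1).
  have [z [gz cz czf az]] := step k w wx (Ad k) hw.
  rewrite (val _ _ _ hw) (val _ _ _ hw') lee_fin.
  exact: (improvement reg hB tI Adb sX hN (Ad k) hw czf ex gz cz hw' az).
(* The identification of [v] with the optimal value function also makes the latter finite, so
   convergence can be checked in the reals. *)
- rewrite -(ev t x tI) (_ : (fun k => _) = fun k => (fine (value p (B t x) (alpha k) t x))%:E); last exact/funext.
  apply: cvg_EFin; first exact: nearW; apply/cvgrPdistC_le => e e0 /=.
  have g : (fun k => C * 2^-1 ^+ k) @ \oo --> 0.
    apply: cvgMl0.
    by apply: cvg_expr; rewrite ger0_norm ?invr_ge0 //; lra.
  have := cvg0_le g e0; apply: filterS => k /= h.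
  by apply: le_trans (err k) _; exact: le_trans (ler_norm _) h.
- by move=> k; rewrite -(ev t x tI) valE -EFinB abse_EFin lee_fin.
Qed.
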